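(* Let $\Omega\subset\mathbb{R}^2$ be a bounded domain with $C^\infty$-smooth boundary that is strictly star-shaped and centrally symmetric (both with respect to the origin). Let $\mathcal{B}\subset\mathbb{R}^2$ be a disk of radius $R>0$ centred at the origin with $\Omega\supset\mathcal{B}$. Then: (i) $\lambda_2^\alpha(\Omega^{\rm c})\le\lambda_2^\alpha(\mathcal{B}^{\rm c})$ for every $\alpha\in\mathbb{R}$; (ii) $\alpha_\star(\Omega^{\rm c})\ge-\frac{1}{R}$.
   Context: For a bounded smooth planar domain $\Omega$, write $\Omega^{\rm c}:=\mathbb{R}^2\setminus\overline{\Omega}$ for its exterior (and likewise $\mathcal{B}^{\rm c}:=\mathbb{R}^2\setminus\overline{\mathcal{B}}$). For $\alpha\in\mathbb{R}$ define $$\lambda_2^\alpha(\Omega^{\rm c}):=\inf_{\substack{\mathcal{L}\subset H^1(\Omega^{\rm c})\\ \dim\mathcal{L}=2}}\ \sup_{u\in\mathcal{L}\setminus\{0\}}\frac{\int_{\Omega^{\rm c}}|\nabla u|^2\,dx+\alpha\int_{\partial\Omega}|u|^2\,d\sigma}{\int_{\Omega^{\rm c}}|u|^2\,dx},$$ where the infimum is over two-dimensional linear subspaces, $u$ on $\partial\Omega$ is understood in the sense of traces and $d\sigma$ is the one-dimensional Hausdorff measure on $\partial\Omega$. If this number is negative it is the second eigenvalue (counted with multiplicity) of the Robin Laplacian on $\Omega^{\rm c}$, whose essential spectrum is $[0,\infty)$; otherwise it equals $0$. The critical coupling constant is $$\alpha_\star(\Omega^{\rm c}):=\sup\{\alpha\in\mathbb{R}:\lambda_2^\alpha(\Omega^{\rm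 c})<0\}.$$ A bounded $C^\infty$-smooth domain $\Omega$ is strictly star-shaped if its boundary can be parametrised by $\theta\mapsto\rho(\theta)(\cos\theta,\sin\theta)^\top$, $\theta\in[0,2\pi]$, where $\rho\in C^\infty([0,2\pi])$ is a positive function with $\rho^{(k)}(0)=\rho^{(k)}(2\pi)$ for all integers $k\ge0$. The domain $\Omega$ is centrally symmetric if $\{-x:x\in\Omega\}=\Omega$. *)

(* Defs.v *)
From HB Require Import structures.
From mathcomp Require Import all_boot all_order all_algebra.
From mathcomp Require Import all_classical all_reals all_analysis.
Set Implicit Arguments.
Unset Strict Implicit.
Unset Printing Implicit Defensive.
Import Order.TTheory GRing.Theory Num.Theory.
Import numFieldNormedType.Exports.
Local Open Scope classical_set_scope.
Local Open Scope ring_scope.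

(* The plane is [R * R]. Its library norm is the sup norm, so Euclidean
   lengths are written with [sqn] below; the topology and the notion of
   bounded set are the same. *)
Section plane.
Variable R : realType.
Implicit Types (x y v p : R * R) (A U Omega : set (R * R)).

Definition sqn x : R := x.1 ^+ 2 + x.2 ^+ 2.

Definition disk (r : R) : set (R * R) := [set x | sqn x < r ^+ 2].

Definition boundary A : set (R * R) := closure A `\` interior A.

Definition exterior Omega : set (R * R) := ~` closure Omega.

Definition leb2 := (@lebesgue_measure R \x @lebesgue_measure R)%E.

(* The [maxe 0] only serves to give the empty set diameter 0. *)
Definition ediam A : \bar R :=
  maxe 0%E (ereal_sup [set (Num.sqrt (sqn (p.1 - p.2)))%:E | p in A `*` A]).

Definition hausdorff1_delta (delta : R) A : \bar R :=
  ereal_inf [set (\sum_(0 <= i <oo) ediam (F i))%E | F in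
    [set F : nat -> set (R * R) |
      A `<=` \bigcup_i F i /\ forall i, (ediam (F i) <= delta%:E)%E]].

Definition hausdorff1 A : \bar R :=
  ereal_sup [set hausdorff1_delta delta A | delta in [set d : R | 0 < d]].

Definition grad (f : R * R -> R) (x : R * R) : R * R :=
  ('D_((1, 0) : R * R) f x, 'D_((0, 1) : R * R) f x).

Fixpoint Ck (k : nat) (f : R * R -> R) : Prop :=
  if k is k'.+1 then
    [/\ continuous f,
        forall x, derivable f x (1, 0) /\ derivable f x (0, 1),
        Ck k' (fun x => (grad f x).1) & Ck k' (fun x => (grad f x).2)]
  else continuous f.

Definition smooth (f : R * R -> R) : Prop := forall k, Ck k f.

Definition tsupport (f : R * R -> R) : set (R * R) :=
  closure [set x | f x != 0].

Definition test_fun U (phi : R * R -> R) : Prop :=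
  [/\ smooth phi, compact (tsupport phi) & tsupport phi `<=` U].

Definition L2 U (u : R * R -> R) : Prop :=
  measurable_fun U u /\ (\int[leb2]_(x in U) ((u x) ^+ 2)%:E < +oo)%E.

Definition weak_grad U (u : R * R -> R) (g : R * R -> R * R) : Prop :=
  [/\ L2 U (fun x => (g x).1), L2 U (fun x => (g x).2) &
    forall phi, test_fun U phi ->
      \int[leb2]_(x in U) (u x * (grad phi x).1)
        = - (\int[leb2]_(x in U) ((g x).1 * phi x)) /\
      \int[leb2]_(x in U) (u x * (grad phi x).2)
        = - (\int[leb2]_(x in U) ((g x).2 * phi x))].

Definition H1 U (u : R * R -> R) : Prop := L2 U u /\ exists g, weak_grad U u g.

(* [t] is the trace on the boundary of [Omega] of the H^1 function [u] on the
   exterior: the extension by density of the restriction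
   [phi |-> phi |_(boundary Omega)], for [phi] smooth and compactly supported in
   the whole plane. *)
Definition is_trace Omega (u t : R * R -> R) : Prop :=
  measurable_fun (boundary Omega) t /\
  exists g (phi : nat -> R * R -> R),
    [/\ weak_grad (exterior Omega) u g,
        forall n, test_fun setT (phi n),
        (\int[leb2]_(x in exterior Omega)
           ((phi n x - u x) ^+ 2 + sqn (grad (phi n) x - g x))%:E)%E
          @[n --> \oo] --> 0%E &
        (\int[hausdorff1]_(x in boundary Omega) ((phi n x - t x) ^+ 2)%:E)%E
          @[n --> \oo] --> 0%E].

(* Elements of H^1 are functions up to almost everywhere equality on [U]; a
   two-dimensional subspace is given by the combinations of two representatives
   that are linearly independent modulo this equality. *)
Definition ae_zero U (u : R * R -> R) : Prop :=
  {ae leb2, forall x, U x -> u x = 0}.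

Definition two_dim_subspace U (L : set (R * R -> R)) : Prop :=
  exists u v : R * R -> R,
    [/\ H1 U u, H1 U v,
        forall a b : R,
          ae_zero U (fun x => a * u x + b * v x) -> a = 0 /\ b = 0 &
        L = [set w | exists a b : R, w = fun x => a * u x + b * v x]].

Definition rayleigh Omega (alpha : R) (u : R * R -> R) (g : R * R -> R * R)
    (t : R * R -> R) : R :=
  (\int[leb2]_(x in exterior Omega) sqn (g x)
   + alpha * fine (\int[hausdorff1]_(x in boundary Omega) ((t x) ^+ 2)%:E)%E)
  / \int[leb2]_(x in exterior Omega) ((u x) ^+ 2).

(* The weak gradient and the trace enter through their defining relations; each
   is unique up to almost everywhere equality, so every nonzero [u] contributes
   a single quotient to the supremum. *)
Definition rayleigh_sup Omega (alpha : R) (L : set (R * R -> R)) : \bar R :=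
  ereal_sup [set q | exists u g t,
    [/\ L u, ~ ae_zero (exterior Omega) u, weak_grad (exterior Omega) u g,
        is_trace Omega u t & q = (rayleigh Omega alpha u g t)%:E]].

Definition lambda2 Omega (alpha : R) : \bar R :=
  ereal_inf [set rayleigh_sup Omega alpha L |
             L in two_dim_subspace (exterior Omega)].

Definition alpha_star Omega : \bar R :=
  ereal_sup [set alpha%:E | alpha in [set a : R | (lambda2 Omega a < 0)%E]].

Definition bounded_domain Omega : Prop :=
  [/\ Omega !=set0, open Omega, connected Omega & bounded_set Omega].

Definition smooth_boundary Omega : Prop :=
  forall p, boundary Omega p -> exists f : R * R -> R,
    [/\ smooth f, grad f p != 0 & \forall x \near p, Omega x <-> f x < 0].

(* [C^oo([0, 2 pi])] is the space of restrictions to [0, 2 pi] of smooth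
   functions on the line. *)
Definition strictly_star_shaped Omega : Prop :=
  exists rho : R -> R,
    [/\ forall k s, derivable (derive1n k rho) s 1,
        forall s, 0 <= s <= 2 * pi -> 0 < rho s,
        forall k, derive1n k rho 0 = derive1n k rho (2 * pi) &
        boundary Omega =
          [set (rho s * cos s, rho s * sin s) | s in `[0, 2 * pi]]].

Definition centrally_symmetric Omega : Prop := [set - x | x in Omega] = Omega.

End plane.

(* Main.v *)
(** Write [h s = K_1 (k s)], the decaying positive solution of
    [s h'' + h' = h / s + k^2 s h], and [q = h' r / h r].

    Outside the disk of radius [r]: Picone's inequality for [h] in the radial direction and
    Wirtinger's inequality on circles give
    [\int |grad u|^2 + k^2 \int u^2 >= - q \int_circle u^2] whenever the trace of [u] has zero mean
    on the circle. Every two-dimensional subspace contains such a [u <> 0], hence a negative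
    Rayleigh bound [- k^2] for a subspace forces [alpha <= q].

    Outside [Omega]: when [alpha <= q], every function in the span of [h (|x|)] and
    [h (|x|) * cos (theta - theta0)] has a Rayleigh quotient at most [- k^2]. Integrating along
    rays leaves a quadratic form on the unit circle; its mixed term vanishes because central
    symmetry makes the integrand antiperiodic, one of the two choices [theta0 = 0, pi / 2] gives
    the angular part the right sign, and log-convexity of [h] together with [rho >= r] bounds the
    boundary term, of length element at least [rho]. Comparing the two statements gives (i), and
    (ii) follows from [- q <= 1 / r + k] as [k] tends to 0. *)
Require Import Defs.
From HB Require Import structures.
From mathcomp Require Import all_boot all_order all_algebra.
From mathcomp Require Import all_classical all_reals all_analysis.
From mathcomp Require Import measurable_realfun borel_hierarchy ring lra.
Import Order.TTheory GRing.Theory Num.Theory.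
Import numFieldNormedType.Exports.
Set Implicit Arguments.
Unset Strict Implicit.
Unset Printing Implicit Defensive.
Local Open Scope classical_set_scope.
Local Open Scope ring_scope.

(** Neither eigenvalue is computed. Each two-dimensional subspace outside the disk supplies one
    Rayleigh quotient, that of a zero-mean function, and when it is negative its value [- k^2]
    selects the profile [h] used outside [Omega]. A nonnegative quotient selects no [k]; there a
    second family, built on [exp (- k |x|)] with [k] tending to 0, shows that [lambda2 Omega] is
    never positive. The boundary terms shape most of the proof. Traces are limits of test functions
    of the whole plane, so the disk side rests on density of these in H^1 up to the circle and on an
    explicit trace. [hausdorff1] enters as a set function vanishing on the empty set, so integrals
    against it are compared with integrals in the angle: from below with density [rho], which is the
    useful direction around [Omega] because the coupling constant is negative there, and from above
    with a constant that is exact on circles. Zero mean is handled through differences of values on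
    pairs of rays: Picone's inequality applies to each pair, and the mean reappears only after
    integration over all pairs. *)

Section density.
Context d1 d2 (X : measurableType d1) (Y : measurableType d2) (R : realType).
Variables (mu : {measure set X -> \bar R}) (D : set X) (g : X -> R) (G : X -> Y).
Hypotheses (mD : measurable D) (mG : measurable_fun D G) (mg : measurable_fun D g).
Hypothesis g0 : forall x, D x -> 0 <= g x.
Local Open Scope ereal_scope.
Import HBNNSimple.

Let dens (A : set Y) : \bar R := \int[mu]_(x in D `&` G @^-1` A) (g x)%:E.

(** The push-forward under [G] of the measure with density [g] on [D]. A change of variables then
    amounts to recognising this measure on intervals. *)
Lemma density_measure : exists m : {measure set Y -> \bar R},
  forall A, m A = \int[mu]_(x in D `&` G @^-1` A) (g x)%:E.
Proof.
have dens0 : dens set0 = 0 by rewrite /dens preimage_set0 setI0 integral_set0.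
have dens_ge0 A : 0 <= dens A.
  by apply: integral_ge0 => x [Dx _]; rewrite lee_fin g0.
have densU : semi_sigma_additive dens.
  move=> F mF tF mUF.
  have -> : dens (\bigcup_n F n) = \sum_(0 <= n <oo) dens (F n).
    rewrite /dens preimage_bigcup setI_bigcupr ge0_integral_bigcup//.
    - by move=> k; apply: mG.
    - apply/measurable_EFinP; apply: measurable_funS mg => //.
      by move=> x [k _ []].
    - by move=> x [k _ [Dx _]]; rewrite lee_fin g0.
    - apply/trivIsetP => i j _ _ ij; rewrite setIACA setIid -preimage_setI.
      by move/trivIsetP : tF => /(_ i j I I ij) ->; rewrite preimage_set0 setI0.
  by apply: is_cvg_nneseries => n _ _; exact: dens_ge0.
pose C := isMeasure.Build _ _ _ dens dens0 dens_ge0 densU.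
pose m : {measure set Y -> \bar R} := HB.pack dens C.
by exists m.
Qed.

Variable m : {measure set Y -> \bar R}.
Hypothesis mE : forall A, measurable A -> m A = \int[mu]_(x in D `&` G @^-1` A) (g x)%:E.

(** Extension from indicators to simple functions and then by monotone convergence. [mE] is asked on
    measurable sets only, so that [m] may be Lebesgue measure itself, identified with the
    push-forward by uniqueness. *)
Lemma density_change (F : Y -> \bar R) : (forall y, 0 <= F y) -> measurable_fun setT F ->
  \int[m]_y F y = \int[mu]_(x in D) (F (G x) * (g x)%:E).
Proof.
move=> F0 mF.
have ind A : measurable A ->
    \int[m]_y (\1_A y)%:E = \int[mu]_(x in D) ((\1_A (G x))%:E * (g x)%:E).
  move=> mA; rewrite integral_indic// setIT mE// integral_mkcondr.
  apply: eq_integral => x xD; rewrite /patch /= indicE.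
  have -> : (x \in G @^-1` A) = (G x \in A) by apply/idP/idP; rewrite !inE.
  by case: ifP => _ /=; rewrite ?mul1e ?mul0e.
have mindic A : measurable A -> measurable_fun D (fun x => (\1_A (G x) : R)%:E * (g x)%:E).
  move=> mA; apply: emeasurable_funM; apply/measurable_EFinP => //.
  by apply: (@measurableT_comp _ _ _ _ _ _ (\1_A : Y -> R)) => //; exact: measurable_indic.
have simple (h : {nnsfun Y >-> R}) :
    \int[m]_y (h y)%:E = \int[mu]_(x in D) ((h (G x))%:E * (g x)%:E).
  under eq_integral do rewrite fimfunE -fsumEFin//.
  rewrite ge0_integral_fsum//; last 2 first.
    - by move=> n; apply/measurable_EFinP/measurable_funM => //.
    - by move=> n y _; rewrite EFinM nnfun_muleindic_ge0.
  under [RHS]eq_integral => x _.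
    rewrite fimfunE -fsumEFin// ge0_mule_fsuml => [|r]; last first.
      by rewrite EFinM nnfun_muleindic_ge0.
    over.
  rewrite ge0_integral_fsum//; last 2 first.
    - move=> r; rewrite [X in measurable_fun _ X](_ : _ = fun x =>
        r%:E * ((\1_(h @^-1` [set r]) (G x))%:E * (g x)%:E)); last first.
        by apply/funext => x; rewrite /= EFinM muleA.
      by apply: measurable_funeM; exact: mindic.
    - by move=> r x Dx; apply: mule_ge0; [rewrite EFinM nnfun_muleindic_ge0|rewrite lee_fin g0].
  apply: eq_fsbigr => r rh.
  have [r0|r0] := leP 0%R r; last first.
    rewrite preimage_nnfun0//; under eq_integral do rewrite indic0 mulr0.
    under [RHS]eq_integral do rewrite indic0 mulr0 mul0e.
    by rewrite !integral0.
  under eq_integral do rewrite EFinM.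
  under [RHS]eq_integral do rewrite EFinM -muleA.
  rewrite !ge0_integralZl_EFin//; first by rewrite ind.
  - by move=> x Dx; rewrite mule_ge0// lee_fin ?g0.
  - exact: mindic.
  - exact/measurable_EFinP.
pose h := nnsfun_approx measurableT mF.
have hnd : nondecreasing_seq (h : (Y -> R)^nat) by exact: nd_nnsfun_approx.
have hcv y : EFin \o h^~ y @ \oo --> F y.
  by apply: cvg_nnsfun_approx => // ? _; exact: F0.
have hle y : nondecreasing_seq (fun n => (h n y)%:E).
  by move=> a b ab; rewrite lee_fin; exact/lefP/hnd.
transitivity (\int[m]_y limn (fun n => (h n y)%:E)).
  by apply: eq_integral => y _; apply/esym/cvg_lim => //; exact: hcv.
rewrite monotone_convergence//; last 2 first.
- by move=> n; exact/measurable_EFinP.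
- by move=> n y _; rewrite lee_fin.
transitivity (\int[mu]_(x in D) limn (fun n => (h n (G x))%:E * (g x)%:E)); last first.
  apply: eq_integral => x; rewrite inE => Dx; apply/cvg_lim => //.
  by apply: cvgeZr => //; exact: hcv.
rewrite monotone_convergence//.
- by under eq_fun do rewrite simple.
- move=> n; apply: emeasurable_funM; apply/measurable_EFinP => //.
  by apply: (@measurableT_comp _ _ _ _ _ _ (h n : Y -> R)).
- by move=> n x Dx; rewrite mule_ge0// lee_fin// g0.
- by move=> x Dx a b ab; rewrite lee_wpmul2r// ?lee_fin ?g0//; exact/lefP/hnd.
Qed.
End density.

(** * Borel sets of the plane and measurability of continuous functions *)

Section plane_measurability.
Variable R : realType.

(** An open set is the countable union of the rectangles with rational corners that it contains. *)
Lemma open_measurable2 (U : set (R * R)) : open U -> measurable U.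
Proof.
move=> oU.
pose I (q : rat * rat) : set R := [set` `]ratr q.1, ratr q.2[].
pose P (p : (rat * rat) * (rat * rat)) := I p.1 `*` I p.2 `<=` U.
(* Rectangles that leave [U] are replaced by the empty set, so that the union can run over all codes
   of rational quadruples. *)
pose B p : set (R * R) := if `[<P p>] then I p.1 `*` I p.2 else set0.
have -> : U = \bigcup_n (oapp B set0 (unpickle n)).
  apply/seteqP; split => [[x y] Uxy|x [n _]]; last first.
    by case: unpickle => //= p; rewrite /B; case: asboolP => // + Ix; apply.
  have /nbhs_ballP[e /= e0 sub] : nbhs (x, y) U by exact: open_nbhs_nbhs.
  have rat2 (z : R) : exists q : rat * rat, I q z /\ forall w, I q w -> ball z e w.
    have [|q1] := @rat_in_itvoo R (z - e) z; first by rewrite ltrBlDr ltrDl.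
    rewrite in_itv /= => /andP[q1l q1r].
    have [|q2] := @rat_in_itvoo R z (z + e); first by rewrite ltrDl.
    rewrite in_itv /= => /andP[q2l q2r].
    exists (q1, q2); split; first by rewrite /I /= in_itv /= q1r.
    move=> w; rewrite /I /= in_itv /= => /andP[w1 w2].
    by rewrite /ball /= distrC ltr_distlC; apply/andP; split; lra.
  have [qx [Ix bx]] := rat2 x; have [qy [Iy b_y]] := rat2 y.
  have PB : P (qx, qy) by move=> [v w] [/= /bx ? /b_y ?]; apply: sub.
  exists (pickle (qx, qy)); first exact: Logic.I.
  by rewrite pickleK; change (B (qx, qy) (x, y)); rewrite /B asboolT.
apply: bigcup_measurable => n _; case: unpickle => //= p; rewrite /B.
by case: asboolP => // _; apply: measurableX; exact: measurable_itv.
Qed.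

Lemma closed_measurable2 (U : set (R * R)) : closed U -> measurable U.
Proof.
by move=> cU; rewrite -(setCK U); apply: measurableC; apply: open_measurable2; exact: closed_openC.
Qed.

Lemma continuous_measurable2 (f : R * R -> R) : continuous f -> measurable_fun setT f.
Proof.
move=> /continuousP cf; apply: (measurability _ (RGenOInfty.measurableE R)) => _ [_ [a ->] <-].
by rewrite setTI; apply: open_measurable2; apply: cf; exact: interval_open.
Qed.

Lemma open_continuous_measurable2 (U : set (R * R)) (f : R * R -> R) :
  open U -> (forall x, U x -> {for x, continuous f}) -> measurable_fun U f.
Proof.
move=> oU cf; apply: (measurability _ (RGenOInfty.measurableE R)) => _ [_ [a ->] <-].
apply: open_measurable2; rewrite openE => x [Ux ax].
apply: filterI; first exact: open_nbhs_nbhs.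
by apply: (cf x Ux); apply: open_nbhs_nbhs; split => //; exact: interval_open.
Qed.
End plane_measurability.

(** * Derivation rules with explicit values *)

Section real_derivatives.
Variable R : realType.
Implicit Types (f g : R -> R) (x a b : R).

(** Separates the computation of a derivative by the rules below from the algebra that puts its
    value in the wanted form. *)
Lemma der_eq f x a b : is_derive x 1 f a -> a = b -> is_derive x 1 f b.
Proof. by move=> h <-. Qed.
Lemma der_id x : is_derive x 1 (fun y : R => y) 1. Proof. exact: is_derive_id. Qed.
Lemma der_cst (c x : R) : is_derive x 1 (fun _ : R => c) 0. Proof. exact: is_derive_cst. Qed.
Lemma derD f g x a b : is_derive x 1 f a -> is_derive x 1 g b ->
  is_derive x 1 (fun y => f y + g y) (a + b).
Proof. by move=> ? ?; exact: is_deriveD. Qed.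
Lemma derN f x a : is_derive x 1 f a -> is_derive x 1 (fun y => - f y) (- a).
Proof. by move=> ?; exact: is_deriveN. Qed.
Lemma derB f g x a b : is_derive x 1 f a -> is_derive x 1 g b ->
  is_derive x 1 (fun y => f y - g y) (a - b).
Proof. by move=> ? ?; exact: is_deriveB. Qed.
Lemma derM f g x a b : is_derive x 1 f a -> is_derive x 1 g b ->
  is_derive x 1 (fun y => f y * g y) (a * g x + f x * b).
Proof.
by move=> ? ?; apply: (der_eq (is_deriveM _ _)); rewrite addrC /GRing.scale /= (mulrC a).
Qed.
Lemma derZ (c : R) f x a : is_derive x 1 f a -> is_derive x 1 (fun y => c * f y) (c * a).
Proof. by move=> ?; exact: is_deriveZ. Qed.
Lemma der2 f x a : is_derive x 1 f a -> is_derive x 1 (fun y => f y ^+ 2) (2 * f x * a).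
Proof. by move=> h; apply: (der_eq (derM h h)); ring. Qed.
Lemma der_comp f g x a b : is_derive (g x) 1 f a -> is_derive x 1 g b ->
  is_derive x 1 (fun y => f (g y)) (a * b).
Proof. exact: is_derive1_comp. Qed.
Lemma derV f x a : f x != 0 -> is_derive x 1 f a ->
  is_derive x 1 (fun y => (f y)^-1) (- a / f x ^+ 2).
Proof.
move=> fx0 h; apply: (@der_eq (fun y => (f y)^-1) _ (- (f x ^- 2) *: a)).
by rewrite /GRing.scale /= mulrC mulrN mulNr.
Qed.
Lemma der_exp f x a : is_derive x 1 f a -> is_derive x 1 (fun y => expR (f y)) (a * expR (f x)).
Proof. by move=> h; apply: (der_eq (@is_derive1_comp _ expR f x _ _ _ _)); rewrite mulrC. Qed.

Lemma der_continuous f x a : is_derive x 1 f a -> {for x, continuous f}.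
Proof. by move=> [+ _] => /derivable1_diffP/differentiable_continuous. Qed.

Lemma der_within f (D : set R) : (forall x, D x -> exists a, is_derive x 1 f a) ->
  {within D, continuous f}.
Proof.
move=> h; apply: continuous_in_subspaceT => x; rewrite inE => /h[a]; exact: der_continuous.
Qed.

Lemma der_derive1 f x a : is_derive x 1 f a -> derive1 f x = a.
Proof. by move=> [_ <-]; rewrite derive1E. Qed.
End real_derivatives.

(** * The fundamental theorem and two changes of variable on the line *)

Section calculus.
Variable R : realType.
Notation mu := (@lebesgue_measure R).
Implicit Types f F : R -> R.

Lemma integral_is_derive F f (a b : R) : a <= b ->
  (forall x, a <= x <= b -> is_derive x 1 F (f x)) -> {within `[a, b], continuous f} ->
  (\int[mu]_(x in `[a, b]) (f x)%:E = (F b - F a)%:E)%E.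
Proof.
rewrite le_eqVlt => /predU1P[<- _ _|ab dF cf].
  by rewrite set_itv1 integral_set1 subrr.
have cF : {within `[a, b], continuous F}.
  by apply: der_within => x /=; rewrite in_itv /= => /dF ?; exists (f x).
have /(continuous_within_itvP _ ab)[_ cFa cFb] := cF.
rewrite (continuous_FTC2 ab cf (F := F)) ?EFinB//.
- split => //= x; rewrite in_itv /= => /andP[/ltW ? /ltW ?].
  by have [] := dF x _; first exact/andP.
- move=> x; rewrite in_itv /= => /andP[/ltW ? /ltW ?].
  by apply: der_derive1; apply: dF; exact/andP.
Qed.

(** The density [|c|] transported by the affine map has the Lebesgue measure on half-open intervals,
    hence is Lebesgue measure by uniqueness. *)
Lemma integral_affine (c d : R) (F : R -> \bar R) : c != 0 ->
  (forall x, 0 <= F x)%E -> measurable_fun setT F ->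
  (\int[mu]_x F x = \int[mu]_x (F (c * x + d)%R * `|c|%:E))%E.
Proof.
move=> c0 F0 mF.
have mG : measurable_fun setT (fun x : R => c * x + d).
  by apply: measurable_funD => //; exact: measurable_funM.
have mc : measurable_fun setT (cst `|c| : R -> R) by [].
have c0' (x : R) : setT x -> 0 <= (cst `|c| : R -> R) x by move=> _ /=.
have [m mE] := @density_measure _ _ _ (measurableTypeR R) _ mu _ _ _ measurableT mG mc c0'.
have ocE X : ocitv X -> mu X = m X.
  move=> /ocitvP[->|[[a b] /= ab ->]]; first by rewrite !measure0.
  rewrite mE setTI.
  have itv (i : interval R) : (\int[mu]_(x in [set` i]) (cst `|c| x)%:E = `|c|%:E * mu [set` i])%E.
    by rewrite -integral_cst//; exact: measurable_itv.
  have abd : a - d < b - d by rewrite ltrD2r.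
  (* The preimage of []a, b]] is closed on the right or on the left according to the sign of [c]. *)
  move: c0; rewrite neq_lt => /orP[c0|c0].
  - have -> : (fun x : R => c * x + d) @^-1` `]a, b] = [set` `[(b - d) / c, (a - d) / c[].
      apply/seteqP; split => x /=; rewrite !in_itv /= => /andP[h1 h2]; apply/andP; split.
      + by rewrite ler_ndivrMr// mulrC lerBrDr.
      + by rewrite ltr_ndivlMr// mulrC ltrBlDr.
      + by move: h2; rewrite ltr_ndivlMr// mulrC ltrBlDr.
      + by move: h1; rewrite ler_ndivrMr// mulrC lerBrDr.
    rewrite itv !lebesgue_measure_itv /= !lte_fin ab ltr_nM2r ?invr_lt0// abd.
    by rewrite -!EFinB -EFinM ltr0_norm//; congr EFin; field; rewrite lt_eqF.
  - have -> : (fun x : R => c * x + d) @^-1` `]a, b] = [set` `](a - d) / c, (b - d) / c]].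
      apply/seteqP; split => x /=; rewrite !in_itv /= => /andP[h1 h2]; apply/andP; split.
      + by rewrite ltr_pdivrMr// mulrC ltrBlDr.
      + by rewrite ler_pdivlMr// mulrC lerBrDr.
      + by move: h1; rewrite ltr_pdivrMr// mulrC ltrBlDr.
      + by move: h2; rewrite ler_pdivlMr// mulrC lerBrDr.
    rewrite itv !lebesgue_measure_itv /= !lte_fin ab ltr_pM2r ?invr_gt0// abd.
    by rewrite -!EFinB -EFinM gtr0_norm//; congr EFin; field; rewrite gt_eqF.
have E := @lebesgue_measure_unique R m ocE.
exact: (@density_change _ _ _ (measurableTypeR R) _ mu _ _ _ measurableT mG mc c0' mu (fun A mA => etrans (E A mA) (mE A)) F F0 mF).
Qed.

(** On a horizontal line of the plane the polar angle is related to the abscissa by a tangent; the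
    shift by [pi / 2] makes [t] run over []0, pi[], the angles of the upper half-plane. *)
Lemma integral_tan (F : R -> \bar R) : (forall x, 0 <= F x)%E -> measurable_fun setT F ->
  (\int[mu]_x F x =
   \int[mu]_(t in `]0%R, pi[) (F (tan (t - pi / 2)%R) * (1 + tan (t - pi / 2) ^+ 2)%:E))%E.
Proof.
move=> F0 mF.
pose D : set R := [set` `]0, pi[].
have mD : measurable D by exact: measurable_itv.
have cosD (t : R) : 0 < t < pi -> cos (t - pi / 2) != 0.
  move=> t0; rewrite gt_eqF// cos_gt0_pihalf//.
  by move: t0; have := pi_gt0 R; lra.
have dtan (t : R) : 0 < t < pi -> is_derive t 1 (fun t => tan (t - pi / 2)) (1 + tan (t - pi / 2) ^+ 2).
  move=> /cosD c0; apply: (@der_eq _ (fun t => tan (t - pi / 2)) _ (cos (t - pi / 2) ^- 2 * (1 - 0))).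
  by rewrite subr0 mulr1 -cos2_tan2.
have ctan (t : R) : 0 < t < pi -> {for t, continuous (fun t => tan (t - pi / 2))}.
  by move/dtan/der_continuous.
have mG : measurable_fun D (fun t => tan (t - pi / 2)).
  apply: open_continuous_measurable_fun; first exact: interval_open.
  by move=> t; rewrite inE /D /= in_itv /=; exact: ctan.
have mg : measurable_fun D (fun t => 1 + tan (t - pi / 2) ^+ 2).
  by apply: measurable_funD => //; exact: measurable_funX.
have g0 (t : R) : D t -> 0 <= 1 + tan (t - pi / 2) ^+ 2 by move=> _; rewrite addr_ge0 ?sqr_ge0.
have [m mE] := @density_measure _ _ _ (measurableTypeR R) _ mu _ _ _ mD mG mg g0.
have ocE X : ocitv X -> mu X = m X.
  move=> /ocitvP[->|[[a b] /= ab ->]]; first by rewrite !measure0.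
  rewrite mE.
  (* The inverse of the substitution. *)
  pose e x : R := pi / 2 + atan x.
  have e0 x : 0 < e x < pi by have := atan_gtNpi2 x; have := atan_ltpi2 x; rewrite /e; lra.
  have te x : tan (e x - pi / 2) = x by rewrite /e addrAC subrr add0r atanK.
  have et t : 0 < t < pi -> e (tan (t - pi / 2)) = t.
    by move=> t0; rewrite /e tanK ?in_itv /=; lra.
  have eab : e a < e b by rewrite ltrD2l lt_atan.
  have -> : D `&` (fun t => tan (t - pi / 2)) @^-1` `]a, b] = [set` `]e a, e b]].
    apply/seteqP; split => t /=.
      rewrite /D /= !in_itv /= => -[t0 /andP[h1 h2]].
      by rewrite -(et _ t0) /e ltrD2l lerD2l lt_atan//= le_atan.
    rewrite /D /= !in_itv /= => /andP[h1 h2].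
    have t0 : 0 < t < pi by have := e0 a; have := e0 b; lra.
    split => //; apply/andP; split.
      rewrite ltNge; apply/negP => /le_atan; rewrite -(lerD2l (pi / 2)) -/(e _) -/(e _) et//.
      by rewrite leNgt h1.
    rewrite leNgt; apply/negP => /lt_atan; rewrite -(ltrD2l (pi / 2)) -/(e _) -/(e _) et//.
    by rewrite ltNge h2.
  rewrite integral_itv_obnd_cbnd; last first.
    apply/measurable_EFinP; apply: measurable_funS mg => //.
    by move=> t; rewrite /D /= !in_itv /=; have := e0 a; have := e0 b; lra.
  have pos t : e a <= t <= e b -> 0 < t < pi by have := e0 a; have := e0 b; lra.
  have dab t : e a <= t <= e b -> is_derive t 1 (fun t => tan (t - pi / 2)) (1 + tan (t - pi / 2) ^+ 2).
    by move/pos/dtan.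
  have cab : {within `[e a, e b], continuous (fun t => 1 + tan (t - pi / 2) ^+ 2)}.
    apply: der_within => t /=; rewrite in_itv /= => /pos t0.
    by eexists; exact: (derD (der_cst 1 t) (der2 (dtan t t0))).
  rewrite (integral_is_derive (ltW eab) dab cab) !te.
  by rewrite lebesgue_measure_itv /= lte_fin ab -EFinB.
have E := @lebesgue_measure_unique R m ocE.
exact: (@density_change _ _ _ (measurableTypeR R) _ mu _ _ _ mD mG mg g0 mu (fun A mA => etrans (E A mA) (mE A)) F F0 mF).
Qed.
End calculus.

(** * Tonelli's theorem on rectangles *)

Section tonelli.
Context d1 d2 (T1 : measurableType d1) (T2 : measurableType d2) (R : realType).
Variables (m1 : {sigma_finite_measure set T1 -> \bar R}) (m2 : {sigma_finite_measure set T2 -> \bar R}).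
Variables (A : set T1) (B : set T2) (f : T1 * T2 -> \bar R).
Hypotheses (mA : measurable A) (mB : measurable B).
Local Open Scope ereal_scope.
Hypotheses (mf : measurable_fun (A `*` B) f) (f0 : forall x, 0 <= f x).

(** Extension by zero off the rectangle reduces everything to the full product. *)
Let g := f \_ (A `*` B).

Let memX x y : ((x, y) \in A `*` B) = (x \in A) && (y \in B).
Proof. by apply/idP/andP; rewrite !inE. Qed.

Let mg : measurable_fun setT g.
Proof. by apply/(measurable_restrictT _ _).1 => //; exact: measurableX. Qed.

Let g0 x : 0 <= g x.
Proof. by rewrite /g /patch; case: ifP. Qed.

Let innerB x : \int[m2]_y g (x, y) = (fun x => \int[m2]_(y in B) f (x, y)) \_ A x.
Proof.
rewrite /patch; case: ifPn => xA; last first.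
  by apply: integral0_eq => y _; rewrite /g /patch memX (negbTE xA).
rewrite [RHS]integral_mkcond; apply: eq_integral => y _.
by rewrite /g /patch memX xA.
Qed.

Let innerA y : \int[m1]_x g (x, y) = (fun y => \int[m1]_(x in A) f (x, y)) \_ B y.
Proof.
rewrite /patch; case: ifPn => xA; last first.
  by apply: integral0_eq => x _; rewrite /g /patch memX (negbTE xA) andbF.
rewrite [RHS]integral_mkcond; apply: eq_integral => x _.
by rewrite /g /patch memX xA andbT.
Qed.

Lemma measurable_integral_l : measurable_fun A (fun x => \int[m2]_(y in B) f (x, y)).
Proof.
apply/(measurable_restrictT _ _).2 => //.
have := @measurable_fun_fubini_tonelli_F _ _ _ _ _ m2 g mg g0.
by apply: eq_measurable_fun => x _; rewrite -innerB.
Qed.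

Lemma measurable_integral_r : measurable_fun B (fun y => \int[m1]_(x in A) f (x, y)).
Proof.
apply/(measurable_restrictT _ _).2 => //.
have := @measurable_fun_fubini_tonelli_G _ _ _ _ _ m1 g mg g0.
by apply: eq_measurable_fun => x _; rewrite -innerA.
Qed.

Lemma tonelli_setX : \int[m1]_(x in A) \int[m2]_(y in B) f (x, y) =
  \int[m2]_(y in B) \int[m1]_(x in A) f (x, y).
Proof.
rewrite [LHS]integral_mkcond [RHS]integral_mkcond.
under eq_integral do rewrite -innerB.
under [RHS]eq_integral do rewrite -innerA.
exact: fubini_tonelli.
Qed.

End tonelli.

Section tonelli_real.
Variable R : realType.
Notation mu := (@lebesgue_measure R).
Local Open Scope ereal_scope.
Variables (A B : set R) (f : R -> R -> \bar R).
Hypotheses (mA : measurable A) (mB : measurable B).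
Hypotheses (mf : measurable_fun (A `*` B) (fun p : R * R => f p.1 p.2)).
Hypotheses (f0 : forall x y, 0 <= f x y).

Lemma measurable_int_l : measurable_fun A (fun x => \int[mu]_(y in B) f x y).
Proof.
exact: (@measurable_integral_l _ _ (measurableTypeR R) (measurableTypeR R) _ mu A B _ mA mB mf
  (fun p => f0 p.1 p.2)).
Qed.

Lemma measurable_int_r : measurable_fun B (fun y => \int[mu]_(x in A) f x y).
Proof.
exact: (@measurable_integral_r _ _ (measurableTypeR R) (measurableTypeR R) _ mu A B _ mA mB mf
  (fun p => f0 p.1 p.2)).
Qed.

Lemma tonelli_real : \int[mu]_(x in A) \int[mu]_(y in B) f x y =
  \int[mu]_(y in B) \int[mu]_(x in A) f x y.
Proof.
exact: (@tonelli_setX _ _ (measurableTypeR R) (measurableTypeR R) _ mu mu A B _ mA mB mf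
  (fun p => f0 p.1 p.2)).
Qed.
End tonelli_real.

(** * Polar coordinates in the plane *)

Section polar.
Variable R : realType.
Notation mu := (@lebesgue_measure R).

Definition pol (t s : R) : R * R := (s * cos t, s * sin t).

Lemma continuous_pair2 (T : topologicalType) (f g : T -> R) :
  continuous f -> continuous g -> continuous (fun p => (f p, g p)).
Proof. by move=> cf cg p; exact: (cvg_pair (cf p) (cg p)). Qed.

Lemma continuous_pol1 : continuous (fun p : R * R => p.2 * cos p.1).
Proof.
move=> p; apply: continuousM; first exact: cvg_snd.
by apply: continuous_comp; [exact: cvg_fst|exact: continuous_cos].
Qed.

Lemma continuous_pol2 : continuous (fun p : R * R => p.2 * sin p.1).
Proof.
move=> p; apply: continuousM; first exact: cvg_snd.
by apply: continuous_comp; [exact: cvg_fst|exact: continuous_sin].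
Qed.

Lemma continuous_pol : continuous (fun p : R * R => pol p.1 p.2).
Proof. exact: continuous_pair2 continuous_pol1 continuous_pol2. Qed.

Lemma measurable_pol : measurable_fun setT (fun p : R * R => pol p.1 p.2).
Proof.
by apply: measurable_fun_pair; apply: continuous_measurable2; [exact: continuous_pol1|exact: continuous_pol2].
Qed.

Lemma continuous_tan_shift (t : R) : 0 < t < pi -> {for t, continuous (fun t : R => tan (t - pi / 2))}.
Proof.
move=> t0; have ct : cos (t - pi / 2) != 0 by rewrite gt_eqF// cos_gt0_pihalf//; move: t0; lra.
have dB : is_derive t 1 (fun t : R => t - pi / 2) (1 - 0) := derB (der_id t) (der_cst (pi / 2) t).
exact: (@der_continuous _ (fun t => tan (t - pi / 2)) _ _ (@der_comp _ tan _ t _ _ (is_derive_tan ct) dB)).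
Qed.

Local Open Scope ereal_scope.

Lemma integral_pos_part (f : R -> \bar R) : (forall x, 0 <= f x) -> measurable_fun setT f ->
  \int[mu]_x f x = \int[mu]_(x in `]0%R, +oo[) (f x + f (- x)%R).
Proof.
move=> f0 mf.
have mfN : measurable_fun setT (f \o -%R) by exact: measurableT_comp.
have -> : setT = [set` `]-oo, 0%R]] `|` [set` `]0%R, +oo[] :> set R.
  by apply/esym/seteqP; split => // x _ /=; rewrite !in_itv /= andbT; have [|] := leP x 0%R; [left|right].
rewrite ge0_integral_setU//; last 2 first.
- exact: measurable_funTS.
- apply/disj_setPS => x [] /=; rewrite !in_itv /= andbT => h1 h2.
  by move: (lt_le_trans h2 h1); rewrite ltxx.
rewrite ge0_integralD//; last 2 first.
- exact: measurable_funTS.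
- exact: measurable_funTS.
rewrite addeC; congr (_ + _).
rewrite -integral_itv_bndo_bndc; last exact: measurable_funTS.
rewrite [LHS]integral_mkcond (@integral_affine _ (-1)%R 0%R)//; first last.
- by apply/(measurable_restrictT _ _).1 => //; exact: measurable_funTS.
- by move=> x; rewrite /patch; case: ifP.
rewrite [RHS]integral_mkcond; apply: eq_integral => x _.
rewrite normrN1 mule1 mulN1r addr0 /patch.
have -> : (- x \in (`]-oo, 0%R[%classic : set R))%R = (x \in (`]0%R, +oo[%classic : set R)).
  by apply/idP/idP; rewrite !inE /= !in_itv /= ?andbT oppr_lt0.
by [].
Qed.

Lemma integral_shift (c a b : R) (f : R -> \bar R) : (forall x, 0 <= f x) -> measurable_fun setT f ->
  \int[mu]_(x in `[a, b]) f (x + c)%R = \int[mu]_(x in `[(a + c)%R, (b + c)%R]) f x.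
Proof.
move=> f0 mf.
rewrite [RHS]integral_mkcond (@integral_affine _ 1%R c)//; first last.
- by apply/(measurable_restrictT _ _).1 => //; exact: measurable_funTS.
- by move=> x; rewrite /patch; case: ifP.
rewrite [LHS]integral_mkcond; apply: eq_integral => x _.
rewrite normr1 mule1 mul1r /patch.
have -> : (x + c \in (`[a + c, b + c]%classic : set R))%R = (x \in (`[a, b]%classic : set R)).
  by apply/idP/idP; rewrite !inE /= !in_itv /= !lerD2r.
by [].
Qed.

Lemma integral_split (a b c : R) (f : R -> \bar R) : (a <= b <= c)%R -> (forall x, 0 <= f x) -> measurable_fun setT f ->
  \int[mu]_(x in `[a, c]) f x = \int[mu]_(x in `[a, b]) f x + \int[mu]_(x in `[b, c]) f x.
Proof.
move=> /andP[ab bc] f0 mf.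
have -> : [set` `[a, c]] = [set` `[a, b]] `|` [set` `]b, c]] :> set R.
  apply/seteqP; split => x /=; rewrite !in_itv /=.
    by move=> /andP[-> ->] /=; rewrite andbT; have [|] := leP x b; [left|right].
  by move=> [] /andP[h1 h2]; apply/andP; split => //; [exact: le_trans bc|apply: le_trans ab _; exact: ltW].
rewrite ge0_integral_setU//; last 2 first.
- exact: measurable_funTS.
- apply/disj_setPS => x [] /=; rewrite !in_itv /= => /andP[_ h1] /andP[h2 _].
  by move: (lt_le_trans h2 h1); rewrite ltxx.
by rewrite integral_itv_obnd_cbnd//; exact: measurable_funTS.
Qed.

Variable F : R * R -> \bar R.
Hypotheses (F0 : forall x, 0 <= F x) (mF : measurable_fun setT F).

Lemma measurable_ray : measurable_fun setT (fun p : R * R => F (pol p.1 p.2)).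
Proof. exact: (measurableT_comp mF measurable_pol). Qed.

Let mpos : measurable (`]0%R, +oo[%classic : set (measurableTypeR R)). Proof. exact: measurable_itv. Qed.

(** The weight is written with the absolute value of [s] so that the integrand is nonnegative on the
    whole plane, as Tonelli's theorem asks. *)
Lemma measurable_polar_inner :
  measurable_fun setT (fun t => \int[mu]_(s in `]0%R, +oo[) (F (pol t s) * `|s|%:E)).
Proof.
apply: (measurable_int_l (f := fun t s => F (pol t s) * `|s|%:E) measurableT mpos).
  apply: measurable_funTS; apply: emeasurable_funM; first exact: measurable_ray.
  by apply/measurable_EFinP; apply: measurableT_comp => //; exact: measurable_snd.
by move=> t x; rewrite mule_ge0.
Qed.

(** Two one-dimensional substitutions replace the planar Jacobian. On the line at height [y] put
    [x = - y * tan (t - pi / 2)], exchange the integrals, and for fixed [t] put [y = s * sin t].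
    Negative [s] gives the ray at angle [t + pi]. *)
Lemma polar_integral : \int[@leb2 R]_x F x =
  \int[mu]_(t in `[0%R, (2 * pi)%R]) \int[mu]_(s in `]0%R, +oo[) (F (pol t s) * s%:E).
Proof.
rewrite /leb2 fubini_tonelli2//.
have pi0 := pi_gt0 R.
have m0 : measurable_fun setT (fun x : R => `|x|%:E) by apply/measurable_EFinP.
have mFx (y : R) : measurable_fun setT (fun x => F (x, y)).
  by apply: (measurableT_comp mF); exact: measurable_pair2.
pose g (t y : R) := F (- y * tan (t - pi / 2), y)%R * (`|y| * (1 + tan (t - pi / 2) ^+ 2))%:E.
pose D : set R := [set` `]0%R, pi[].
have mD : measurable D by exact: measurable_itv.
have g0 t y : 0 <= g t y by rewrite mule_ge0// lee_fin mulr_ge0// addr_ge0 ?sqr_ge0.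
have mt : measurable_fun (D `*` setT) (fun p : R * R => tan (p.1 - pi / 2)).
  apply: open_continuous_measurable2.
    have -> : D `*` [set: R] = fst @^-1` D by apply/seteqP; split=> [x []//|x ?]; split.
    by apply: open_comp => [p _|]; [exact: cvg_fst|exact: interval_open].
  move=> [t y] [/= + _]; rewrite /D /= in_itv /= => t0.
  apply: (@continuous_comp _ _ _ fst (fun t => tan (t - pi / 2))); first exact: cvg_fst.
  exact: continuous_tan_shift.
have mg : measurable_fun (D `*` setT) (fun p : R * R => g p.1 p.2).
  have mDT : measurable (D `*` [set: R]) by exact: measurableX.
  have m2 : measurable_fun (D `*` setT) (fun p : R * R => p.2).
    by apply: measurable_funTS; exact: measurable_snd.
  apply: emeasurable_funM.
    (* The tangent is set to 0 off []0, pi[], which gives a function measurable on the whole line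
       that can be composed with [F]. *)
    pose tD (t : R) := if (0 < t < pi)%R then tan (t - pi / 2) else 0%R.
    have mtD : measurable_fun setT tD.
      have -> : tD = (fun t => tan (t - pi / 2)) \_ D.
        apply/funext => t; rewrite /tD /patch; congr (if _ then _ else _).
        by apply/idP/idP; rewrite inE /D /= in_itv.
      suff mtan : measurable_fun D (fun t : R => tan (t - pi / 2)).
        by have [h _] := measurable_restrictT (fun t : R => tan (t - pi / 2)) mD; exact: h mtan.
      apply: open_continuous_measurable_fun; first exact: interval_open.
      by move=> t; rewrite inE /D /= in_itv /=; exact: continuous_tan_shift.
    have mp : measurable_fun setT (fun p : R * R => (- p.2 * tD p.1, p.2)%R).
      apply: measurable_fun_pair; last exact: measurable_snd.
      apply: measurable_funM; first by apply: measurableT_comp => //; exact: measurable_snd.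
      by apply: measurableT_comp => //; exact: measurable_fst.
    have := measurable_funTS (D := D `*` setT) (measurableT_comp mF mp).
    apply: eq_measurable_fun => -[t y]; rewrite inE /= => -[+ _].
    by rewrite /D /= in_itv /= /tD => ->.
  apply/measurable_EFinP; apply: measurable_funM; first exact: measurableT_comp.
  by apply: measurable_funD => //; exact: measurable_funX.
(* The substitution degenerates on the line [y = 0], a null set that is removed on both sides. *)
have step1 : \int[mu]_y \int[mu]_x F (x, y) = \int[mu]_y \int[mu]_(t in D) g t y.
  rewrite -(integral_setD1 (r := 0%R)) ?setTD//; last 2 first.
  - by apply: measurableC.
  - apply: measurable_funTS; exact: measurable_fun_fubini_tonelli_G.
  rewrite -[RHS](integral_setD1 (r := 0%R)) ?setTD//; last 2 first.
  - by apply: measurableC.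
  - apply: measurable_funTS.
    exact: measurable_int_r mD measurableT mg g0.
  apply: eq_integral => y; rewrite inE /= => /eqP y0.
  rewrite (@integral_affine _ (- y)%R 0%R)//; last by rewrite oppr_eq0.
  rewrite integral_tan//.
  - by apply: eq_integral => t _; rewrite /g addr0 normrN EFinM muleA.
  - by move=> x; rewrite mule_ge0.
  - apply: emeasurable_funM => //; apply: (measurableT_comp (mFx y)).
    by apply: measurable_funD => //; exact: measurable_funM.
rewrite step1.
rewrite -(tonelli_real mD measurableT mg g0).
pose G t := \int[mu]_(s in `]0%R, +oo[) (F (pol t s) * `|s|%:E).
have G0 t : 0 <= G t by apply: integral_ge0 => s _; rewrite mule_ge0.
have mG : measurable_fun setT G by exact: measurable_polar_inner.
(* The line through the origin at angle [t] splits into its two rays, at the angles [t] and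
   [t + pi]. *)
have step2 (t : R) : (0 < t < pi)%R -> \int[mu]_y g t y = G t + G (t + pi)%R.
  move=> tpi.
  have st : (0 < sin t)%R by exact: sin_gt0_pi.
  have ct : cos (t - pi / 2) = sin t by rewrite cosB cos_pihalf sin_pihalf mulr0 mulr1 add0r.
  have tt : (sin t * tan (t - pi / 2) = - cos t)%R.
    rewrite /tan ct mulrC -mulrA mulVf ?mulr1 ?gt_eqF//.
    by rewrite sinB cos_pihalf sin_pihalf mulr0 mulr1 sub0r.
  have tt2 : ((1 + tan (t - pi / 2) ^+ 2) * sin t ^+ 2 = 1)%R.
    by rewrite -cos2_tan2 ct ?mulVf// ?expf_eq0 /= gt_eqF.
  have mr c : measurable_fun setT (fun s : R => F (pol t (c * s))).
    apply: (measurableT_comp measurable_ray (g := fun s : R => (t, c * s)%R)).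
    by apply: measurable_fun_pair => //; exact: measurable_funM.
  have mgt : measurable_fun setT (g t).
    apply: emeasurable_funM.
      apply: (measurableT_comp mF); apply: measurable_fun_pair => //.
      by apply: measurable_funM => //; exact: measurableT_comp.
    apply/measurable_EFinP; apply: measurable_funM => //; exact: measurableT_comp.
  have sn : (sin t != 0)%R by apply: lt0r_neq0.
  rewrite (@integral_affine _ (sin t) 0%R (g t) sn (g0 t) mgt).
  have gs (s : R) : g t (sin t * s + 0)%R * `|sin t|%:E = F (pol t s) * `|s|%:E.
    rewrite /g addr0 -muleA; congr (F _ * _).
      have e1 : (- (sin t * s) * tan (t - pi / 2) = s * cos t)%R.
        by rewrite mulNr mulrAC tt mulNr opprK mulrC.
      by rewrite e1 /pol (mulrC s (sin t)).
    rewrite -EFinM normrM gtr0_norm//; congr EFin.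
    by transitivity (`|s| * ((1 + tan (t - pi / 2) ^+ 2) * sin t ^+ 2))%R; [ring|rewrite tt2 mulr1].
  transitivity (\int[mu]_s (F (pol t s) * `|s|%:E)).
    by apply: eq_integral => s _; exact: gs.
  pose f1 (s : R) := F (pol t s) * `|s|%:E.
  pose f2 (s : R) := f1 (- s)%R.
  have f10 s : 0 <= f1 s by rewrite mule_ge0.
  have f1m : measurable_fun setT f1.
    by apply: emeasurable_funM => //; have := mr 1%R; apply: eq_measurable_fun => s _; rewrite mul1r.
  have f2m : measurable_fun setT f2 by exact: measurableT_comp.
  rewrite (integral_pos_part f10 f1m).
  rewrite (@ge0_integralD _ _ _ mu _ mpos f1 f2 (fun x _ => f10 x) (measurable_funTS f1m)
    (fun x _ => f10 (- x)%R) (measurable_funTS f2m)).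
  congr (_ + _); apply: eq_integral => s _.
  rewrite /f2 /f1 /=.
  by rewrite normrN /pol cosDpi sinDpi !mulNr !mulrN.
transitivity (\int[mu]_(t in D) (G t + G (t + pi)%R)).
  by apply: eq_integral => t; rewrite inE /D /= in_itv /=; exact: step2.
pose G' (t : R) := G (t + pi)%R.
have mGp : measurable_fun setT G'.
  by apply: (measurableT_comp mG); exact: measurable_funD.
rewrite (@ge0_integralD _ _ _ mu _ mD G G' (fun x _ => G0 x) (measurable_funTS mG)
    (fun x _ => G0 (x + pi)%R) (measurable_funTS mGp)).
have oc (h : R -> \bar R) : measurable_fun setT h ->
    \int[mu]_(t in D) h t = \int[mu]_(t in `[0%R, pi]) h t.
  by move=> mh; rewrite (integral_itv_bndoo true false)//; exact: measurable_funTS.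
rewrite (oc _ mG) (oc _ mGp) (integral_shift pi 0%R pi G0 mG) add0r.
have -> : (pi + pi = 2 * pi :> R)%R by ring.
rewrite -(integral_split _ G0 mG); last by apply/andP; split; lra.
apply: eq_integral => t _; apply: eq_integral => s.
by rewrite inE /= in_itv /= andbT => s0; rewrite gtr0_norm.
Qed.
End polar.

(** * A smooth bump function on the line *)

Section smooth_line.
Variable R : realType.
Implicit Types (f g : R -> R).

(** Differentiability with an explicit derivative at each level, which turns stability under sums,
    products and affine substitutions into an induction on [k]. *)
Fixpoint Dk (k : nat) f : Prop :=
  if k is k'.+1 then exists2 g : R -> R, forall x : R, is_derive x 1 f (g x) & Dk k' g else continuous f.

Lemma Dk_continuous k f : Dk k f -> continuous f.
Proof. by case: k => [//|k] [g df _] x; exact: der_continuous (df x). Qed.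

Lemma DkS k f : Dk k.+1 f -> Dk k f.
Proof.
elim: k f => [|k IH] f; first by move=> h; exact: (@Dk_continuous 1).
by move=> [g df Dg]; exists g => //; exact: IH.
Qed.

Lemma DkD k f g : Dk k f -> Dk k g -> Dk k (fun x => f x + g x).
Proof.
elim: k f g => [|k IH] f g; first by move=> cf cg x; apply: cvgD; [exact: cf|exact: cg].
by move=> [f' df Df] [g' dg Dg]; exists (fun x => f' x + g' x) => [x|]; [exact: derD|exact: IH].
Qed.

Lemma DkM k f g : Dk k f -> Dk k g -> Dk k (fun x => f x * g x).
Proof.
elim: k f g => [|k IH] f g; first by move=> cf cg x; apply: cvgM; [exact: cf|exact: cg].
move=> Df Dg; have Df0 := DkS Df; have Dg0 := DkS Dg; case: Df Dg => [f' df Df] [g' dg Dg].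
exists (fun x => f' x * g x + f x * g' x) => [x|]; first exact: derM.
by apply: DkD; exact: IH.
Qed.

Lemma Dk_cst k (c : R) : Dk k (fun=> c).
Proof.
elim: k c => [|k IH] c; first by move=> x; exact: cvg_cst.
by exists (fun=> 0) => // x; exact: der_cst.
Qed.

Lemma Dk_affine k f (c d : R) : Dk k f -> Dk k (fun x => f (c * x + d)).
Proof.
have daff (x : R) : is_derive x 1 (fun y : R => c * y + d) c.
  by apply: (der_eq (derD (derZ c (der_id x)) (der_cst d x))); rewrite mulr1 addr0.
elim: k f => [|k IH] f.
  move=> cf x; apply: (@continuous_comp _ _ _ (fun x => c * x + d) f); last exact: cf.
  exact: der_continuous (daff x).
move=> [f' df Df]; exists (fun x => f' (c * x + d) * c).
  by move=> x; exact: (@der_comp _ f (fun x => c * x + d) x _ _ (df (c * x + d)) (daff x)).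
by apply: DkM; [exact: IH|exact: Dk_cst].
Qed.

Lemma Dk_derive1n f : (forall k, Dk k f) -> forall n (x : R), is_derive x 1 (derive1n n f) (derive1n n.+1 f x).
Proof.
move=> Df n x.
suff [g dg Dg] : Dk 1 (derive1n n f).
  by rewrite derive1nS (der_derive1 (dg x)).
have : Dk (n + 1) f by exact: Df.
move: {Df} 1%N => m; elim: n f => [//|n IH] f; rewrite addSn => -[g dg Dg].
rewrite /derive1n iterSr (_ : derive1 f = g); first exact: IH.
by apply/funext => y; exact: der_derive1.
Qed.

Lemma exp_pow_bound n (y : R) : 0 < y -> y ^+ n * expR (- y) <= n`!%:R.
Proof.
move=> y0; rewrite expRN ler_pdivrMr ?expR_gt0//.
case: n => [|n]; first by rewrite expr0 fact0 mul1r -(expR0 R) ler_expR ltW.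
have := expR_ge1Dxn n (ltW y0) => h.
have f0 : 0 < (n.+1)`!%:R :> R by rewrite ltr0n fact_gt0.
rewrite mulrC -ler_pdivrMr//; apply: le_trans h; by rewrite lerDr.
Qed.

Lemma poly_exp_bound (p : {poly R}) : exists2 C, 0 <= C & forall y, 0 < y -> `|p.[y]| * expR (- y) <= C.
Proof.
exists (\sum_(i < size p) `|p`_i| * i`!%:R); first by apply: sumr_ge0 => i _; rewrite mulr_ge0.
move=> y y0; rewrite horner_coef.
apply: (@le_trans _ _ ((\sum_(i < size p) `|p`_i * y ^+ i|) * expR (- y))).
  by rewrite ler_wpM2r ?expR_ge0// ler_norm_sum.
rewrite mulr_suml; apply: ler_sum => i _.
by rewrite normrM -mulrA ler_wpM2l// normrX gtr0_norm// exp_pow_bound.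
Qed.

(* [flat p] is smooth: its derivative is [flat] of another polynomial. *)
Definition flat (p : {poly R}) (t : R) : R := if 0 < t then p.[t^-1] * expR (- t^-1) else 0.

(** The exponential beats every power of [1 / t]; quadratic smallness gives continuity at the origin
    of every function of the family, and thereby the derivative there. *)
Lemma flat_small p : exists2 C, 0 <= C & forall t, `|flat p t| <= C * t ^+ 2.
Proof.
have [C C0 hC] := poly_exp_bound ('X^2 * p); exists C => // t; rewrite /flat.
case: ifPn => [t0|_]; last by rewrite normr0 mulr_ge0// sqr_ge0.
have := hC t^-1; rewrite invr_gt0 => /(_ t0).
rewrite hornerM hornerXn (normrM (t^-1 ^+ 2)) (ger0_norm (sqr_ge0 _)) => h.
rewrite normrM (gtr0_norm (expR_gt0 _)).
have t2 : 0 < t ^+ 2 by rewrite exprn_gt0.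
by rewrite -ler_pdivrMr// mulrC mulrA -exprVn.
Qed.

Lemma is_derive_flat p (t : R) : is_derive t 1 (flat p) (flat ('X^2 * (p - p^`())) t).
Proof.
have [t0|t0|->] := ltgtP t 0.
- have : is_derive t 1 (fun=> 0 : R) 0 by exact: der_cst.
  rewrite /flat (ltNge 0 t) (ltW t0) /=; apply: near_eq_is_derive.
  by near=> s; rewrite ltNge ltW//; near: s; exact: lt_nbhsl.
- have tn0 : t != 0 by rewrite gt_eqF.
  have dinv : is_derive t 1 (fun s : R => s^-1) (- 1 / t ^+ 2) := derV tn0 (der_id t).
  have : is_derive t 1 (fun s => p.[s^-1] * expR (- s^-1)) (flat ('X^2 * (p - p^`())) t).
    apply: (der_eq (derM (der_comp (is_derive_poly p t^-1) dinv) (der_exp (derN dinv)))).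
    rewrite /flat t0 hornerM hornerD hornerN hornerXn.
    by move: (p.[t^-1]) (p^`().[t^-1]) (expR _) => A B C; field.
  apply: near_eq_is_derive; near=> s; rewrite /flat ifT//.
  by near: s; exact: lt_nbhsr.
(* At the origin the difference quotient of [flat p] is [flat ('X * p)], continuous there by
   [flat_small]. *)
- apply/is_derive1_caratheodory; exists (flat ('X * p)); split.
  + move=> s; rewrite {2}/flat ltxx !subr0 /flat; case: ifPn => [s0|]; last by rewrite mul0r.
    by rewrite hornerM hornerX; field; rewrite gt_eqF.
  + have [C C0 hC] := flat_small ('X * p).
    have f0 q : flat q 0 = 0 by rewrite /flat ltxx.
    suff h : flat ('X * p) @ (0 : R) --> flat ('X * p) (0 : R) by [].
    rewrite f0; apply/cvgrPdist_lt => /= e e0.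
    have C1 : 0 < C + 1 by rewrite ltr_wpDl.
    near=> s; rewrite sub0r normrN; apply: le_lt_trans (hC s) _.
    have s1 : `|s| < 1 by near: s; apply: (@cvgr0_norm_lt _ _ _ (nbhs (0 : R)) _ id) => //; exact: cvg_id.
    have s2 : `|s| < e / (C + 1).
      near: s; apply: (@cvgr0_norm_lt _ _ _ (nbhs (0 : R)) _ id) => //; exact: divr_gt0.
    have : `|s| * (C + 1) < e by rewrite -ltr_pdivlMr.
    rewrite -real_normK ?num_real//; have : 0 <= `|s| by []; nra.
  + by rewrite /flat ltxx.
Unshelve. all: by end_near. Qed.

Lemma Dk_flat k p : Dk k (flat p).
Proof.
elim: k p => [|k IH] p; last by exists (flat ('X^2 * (p - p^`()))) => // x; exact: is_derive_flat.
by move=> x; exact: der_continuous (is_derive_flat p x).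
Qed.

(** Equal to [exp (- 1 / (1 + t) - 1 / (1 - t))] on []-1, 1[] and to 0 elsewhere; the arguments are
    written in the form expected by [Dk_affine]. *)
Definition bump (t : R) : R := flat 1 (1 * t + 1) * flat 1 (-1 * t + 1).

Lemma Dk_bump k : Dk k bump.
Proof. by apply: DkM; apply: Dk_affine; exact: Dk_flat. Qed.

Definition bumpn n : R -> R := derive1n n bump.

Lemma is_derive_bumpn n (x : R) : is_derive x 1 (bumpn n) (bumpn n.+1 x).
Proof. by apply: Dk_derive1n => k; exact: Dk_bump. Qed.

Lemma Dk_bumpn k n : Dk k (bumpn n).
Proof.
elim: k n => [|k IH] n; first by move=> x; exact: der_continuous (is_derive_bumpn n x).
by exists (bumpn n.+1) => // x; exact: is_derive_bumpn.
Qed.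

Lemma bump_ge0 t : 0 <= bump t.
Proof.
by apply: mulr_ge0; rewrite /flat; case: ifP => // _; rewrite hornerE mulr_ge0// expR_ge0.
Qed.

Lemma bump_gt0 t : `|t| < 1 -> 0 < bump t.
Proof.
rewrite ltr_norml => /andP[t1 t2]; apply: mulr_gt0; rewrite /flat ifT ?hornerE ?mulr_gt0 ?expR_gt0//; lra.
Qed.

Lemma bumpn_eq0 n t : 1 < `|t| -> bumpn n t = 0.
Proof.
elim: n t => [|n IH] t.
  rewrite lter_normr => /orP[] t1; rewrite /bumpn /= /bump /flat; last first.
    by rewrite ifF ?mul0r//; apply/negbTE; rewrite -leNgt; lra.
  by rewrite mulrC ifF ?mul0r//; apply/negbTE; rewrite -leNgt; lra.
move=> t1; rewrite /bumpn derive1nS; apply: der_derive1.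
apply: (@near_eq_is_derive _ _ _ (fun=> 0)).
near=> s; apply/esym/IH; near: s.
have : (fun s : R => `|s|) @ t --> `|t| by apply: cvg_norm; exact: cvg_id.
by move=> /cvgr_gt; apply.
Unshelve. all: by end_near. Qed.

Lemma bumpn_bounded n : exists2 M : R, 0 < M & forall t, `|bumpn n t| <= M.
Proof.
have cb : continuous (fun t => `|bumpn n t|).
  by move=> t; apply: cvg_norm; exact: (@Dk_continuous 0 _ (Dk_bumpn 0 n) t).
have [||c _ hc] := @EVT_max _ (fun t => `|bumpn n t|) (-1) 1.
- lra.
- exact: continuous_subspaceT.
exists (`|bumpn n c| + 1) => [|t]; first by rewrite ltr_wpDl.
have [t1|t1] := leP `|t| 1; last by rewrite bumpn_eq0// normr0 addr_ge0.
by apply: (@le_trans _ _ `|bumpn n c|); [apply: hc; rewrite in_itv /= -ler_norml|rewrite lerDl].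
Qed.
End smooth_line.

(** * Partial derivatives and smooth functions of two variables *)

Section smooth_plane.
Variable R : realType.
Implicit Types (f g : R * R -> R).

Lemma is_derive_fst f (a b l : R) :
  is_derive (a, b) ((1, 0) : R * R) f l <-> is_derive a 1 (fun s => f (s, b)) l.
Proof.
have E : (fun h : R => h^-1 *: ((f \o shift (a, b)) (h *: ((1, 0) : R * R)) - f (a, b))) =
         (fun h => h^-1 *: (((fun s => f (s, b)) \o shift a) (h *: (1 : R)) - f (a, b))).
  apply/funext => h; rewrite /=.
  suff -> : h *: ((1, 0) : R * R) + (a, b) = (h *: (1 : R) + a, b) by [].
  by apply: injective_projections; rewrite /= ?scaler0 ?add0r.
by split => -[d1 d2]; split; move: d1 d2; rewrite /derivable /derive /= E.
Qed.

Lemma is_derive_snd f (a b l : R) :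
  is_derive (a, b) ((0, 1) : R * R) f l <-> is_derive b 1 (fun s => f (a, s)) l.
Proof.
have E : (fun h : R => h^-1 *: ((f \o shift (a, b)) (h *: ((0, 1) : R * R)) - f (a, b))) =
         (fun h => h^-1 *: (((fun s => f (a, s)) \o shift b) (h *: (1 : R)) - f (a, b))).
  apply/funext => h; rewrite /=.
  suff -> : h *: ((0, 1) : R * R) + (a, b) = (a, h *: (1 : R) + b) by [].
  by apply: injective_projections; rewrite /= ?scaler0 ?add0r.
by split => -[d1 d2]; split; move: d1 d2; rewrite /derivable /derive /= E.
Qed.

(** Partial derivatives expressed along coordinate lines, so that the one-variable rules apply
    directly. *)
Definition has_grad f (f1 f2 : R * R -> R) : Prop :=
  forall x : R * R, is_derive x.1 1 (fun s : R => f (s, x.2)) (f1 x) /\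
    is_derive x.2 1 (fun s : R => f (x.1, s)) (f2 x).

Lemma has_gradP f f1 f2 : has_grad f f1 f2 ->
  (forall x, derivable f x (1, 0) /\ derivable f x (0, 1)) /\
  grad f = fun x => (f1 x, f2 x).
Proof.
move=> df; split => [[a b]|]; last apply/funext => -[a b].
  have [d1 d2] := df (a, b).
  have [h1 _] := (is_derive_fst f a b _).2 d1; have [h2 _] := (is_derive_snd f a b _).2 d2.
  exact: conj h1 h2.
have [d1 d2] := df (a, b).
have [_ e1] := (is_derive_fst f a b _).2 d1; have [_ e2] := (is_derive_snd f a b _).2 d2.
exact: (f_equal2 pair e1 e2).
Qed.

Lemma Ck_intro k f f1 f2 : has_grad f f1 f2 -> continuous f -> Ck k f1 -> Ck k f2 -> Ck k.+1 f.
Proof.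
move=> /has_gradP[df gf] cf h1 h2. 
have h1' : Ck k (fun x => (grad f x).1) by rewrite gf.
have h2' : Ck k (fun x => (grad f x).2) by rewrite gf.
exact: (And4 cf df h1' h2').
Qed.

Lemma Ck_elim k f : Ck k.+1 f ->
  [/\ has_grad f (fun x => (grad f x).1) (fun x => (grad f x).2), Ck k (fun x => (grad f x).1) & Ck k (fun x => (grad f x).2)].
Proof.
move=> [cf df h1 h2]; apply: (And3 _ h1 h2) => -[a b]; have [d1 d2] := df (a, b).
split; first by apply: (is_derive_fst f a b _).1; exact: (DeriveDef d1 erefl).
by apply: (is_derive_snd f a b _).1; exact: (DeriveDef d2 erefl).
Qed.

Lemma Ck_continuous k f : Ck k f -> continuous f.
Proof. by case: k => [h|k [h _ _ _]]; exact: h. Qed.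

Lemma CkS k f : Ck k.+1 f -> Ck k f.
Proof.
elim: k f => [|k IH] f; first exact: Ck_continuous.
by move=> [cf df h1 h2]; exact: (And4 cf df (IH _ h1) (IH _ h2)).
Qed.

Lemma CkD k f g : Ck k f -> Ck k g -> Ck k (fun x => f x + g x).
Proof.
elim: k f g => [|k IH] f g; first by move=> cf cg x; apply: cvgD; [exact: cf|exact: cg].
move=> Cf Cg; have cf := Ck_continuous Cf; have cg := Ck_continuous Cg.
case/Ck_elim : Cf => df f1 f2; case/Ck_elim : Cg => dg g1 g2.
apply: (Ck_intro (f1 := fun x => (grad f x).1 + (grad g x).1) (f2 := fun x => (grad f x).2 + (grad g x).2)).
- by move=> x; case: (df x) => ? ?; case: (dg x) => ? ?; split; exact: derD.
- by move=> x; apply: cvgD; [exact: cf|exact: cg].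
- exact: IH.
- exact: IH.
Qed.

Lemma CkM k f g : Ck k f -> Ck k g -> Ck k (fun x => f x * g x).
Proof.
elim: k f g => [|k IH] f g; first by move=> cf cg x; apply: cvgM; [exact: cf|exact: cg].
move=> Cf Cg; have cf := Ck_continuous Cf; have cg := Ck_continuous Cg.
have Cf0 := CkS Cf; have Cg0 := CkS Cg.
case/Ck_elim : Cf => df f1 f2; case/Ck_elim : Cg => dg g1 g2.
apply: (Ck_intro (f1 := fun x => (grad f x).1 * g x + f x * (grad g x).1)
                 (f2 := fun x => (grad f x).2 * g x + f x * (grad g x).2)).
- move=> [a b]; case: (df (a, b)) => ? ?; case: (dg (a, b)) => ? ?.
  by split; [exact: (@derM _ (fun s => f (s, b)) (fun s => g (s, b)))|exact: (@derM _ (fun s => f (a, s)) (fun s => g (a, s)))].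
- by move=> x; apply: cvgM; [exact: cf|exact: cg].
- by apply: CkD; exact: IH.
- by apply: CkD; exact: IH.
Qed.

Lemma Ck_cst k (c : R) : Ck k (fun=> c).
Proof.
elim: k c => [|k IH] c; first by move=> x; exact: cvg_cst.
by apply: (Ck_intro (f1 := fun=> 0) (f2 := fun=> 0)) => // x; [split; exact: der_cst|exact: cvg_cst].
Qed.

Lemma Ck_tensor k (f g : R -> R) : Dk k f -> Dk k g -> Ck k (fun x => f x.1 * g x.2).
Proof.
have ct (u v : R -> R) : continuous u -> continuous v -> continuous (fun x : R * R => u x.1 * v x.2).
  move=> cu cv x; apply: continuousM.
    by apply: continuous_comp; [exact: cvg_fst|exact: cu].
  by apply: continuous_comp; [exact: cvg_snd|exact: cv].
elim: k f g => [|k IH] f g; first exact: ct.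
move=> Df Dg; have cf := Dk_continuous Df; have cg := Dk_continuous Dg.
have Df0 := DkS Df; have Dg0 := DkS Dg; case: Df Dg => [f' df Df] [g' dg Dg].
apply: (Ck_intro (f1 := fun x => f' x.1 * g x.2) (f2 := fun x => f x.1 * g' x.2)).
- move=> x; split; last exact: (@derZ _ (f x.1) g x.2 _ (dg x.2)).
  by apply: (der_eq (derM (df x.1) (der_cst (g x.2) x.1))); rewrite mulr0 addr0.
- exact: ct.
- exact: IH.
- exact: IH.
Qed.

End smooth_plane.

(** * Differentiation under the integral sign *)

Section under_integral.
Context (R : realType) d (Y : measurableType d) (mu : {measure set Y -> \bar R}).

Lemma is_derive_under (D : set Y) (f df : R -> Y -> R) (a u v : R) (G : Y -> R) :
  measurable D -> u < a < v ->
  (forall x, u < x < v -> mu.-integrable D (EFin \o f x)) ->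
  (forall x y, u < x < v -> D y -> is_derive x 1 (f ^~ y) (df x y)) ->
  (forall y, 0 <= G y) -> mu.-integrable D (EFin \o G) ->
  (forall x y, u < x < v -> D y -> `|df x y| <= G y) ->
  is_derive a 1 (fun x => \int[mu]_(y in D) f x y) (\int[mu]_(y in D) df a y).
Proof.
move=> mD auv intf dfE G0 intG dG.
have Ia : (`]u, v[%classic : set R) a by rewrite /= in_itv.
have intf' x : (`]u, v[%classic : set R) x -> mu.-integrable D (EFin \o f x).
  by rewrite /= in_itv /=; exact: intf.
have der x y : (`]u, v[%classic : set R) x -> D y -> derivable (f ^~ y) x 1.
  by rewrite /= in_itv /= => xuv Dy; have [] := dfE x y xuv Dy.
have d1E x y : u < x < v -> D y -> partial1of2 f x y = df x y.
  by move=> xuv Dy; rewrite /partial1of2 (der_derive1 (dfE x y xuv Dy)).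
have bd x y : (`]u, v[%classic : set R) x -> D y -> `|partial1of2 f x y| <= G y.
  by rewrite /= in_itv /= => xuv Dy; rewrite d1E//; exact: dG.
split; first exact: (derivable_under_integral mD Ia intf' der G0 intG bd).
rewrite -derive1E (differentiation_under_integral mD Ia intf' der G0 intG bd).
by apply: eq_Rintegral => y; rewrite inE => Dy; exact: d1E.
Qed.
End under_integral.

(** * Continuity from bounded partial derivatives *)

Section lipschitz.
Variable R : realType.

Lemma lipschitz_bounded_derivative (g g' : R -> R) (M : R) : (forall x : R, is_derive x 1 g (g' x)) ->
  (forall x, `|g' x| <= M) -> forall a b, `|g a - g b| <= M * `|a - b|.
Proof.
move=> dg gM a b; wlog ab : a b / a <= b => [hw|].
  by have [|/ltW] := leP a b; [exact: hw|rewrite distrC (distrC a); exact: hw].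
have [|c _ E] := @MVT_segment _ g g' a b ab (fun x _ => dg x).
  by apply: der_within => x _; exists (g' x).
by rewrite distrC E normrM (distrC a) ler_wpM2r.
Qed.

(** Two points are compared through the corner [(x.1, b)], along segments on which the function is
    Lipschitz. Continuity of the partial derivatives is not presupposed, so the lemma can start the
    induction that proves smeared functions smooth. *)
Lemma has_grad_continuous (f f1 f2 : R * R -> R) (M : R) : has_grad f f1 f2 ->
  (forall x, `|f1 x| <= M) -> (forall x, `|f2 x| <= M) -> continuous f.
Proof.
move=> df f1M f2M [a b]; apply/cvgrPdist_lt => e e0.
have M0 : 0 <= M by apply: le_trans (f1M (a, b)).
have aux (K p q A B C : R) : 0 < K -> p < K -> q < K -> A <= M * p -> B <= M * q ->
    (M + 1) * K = e / 2 -> C <= A + B -> C < e.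
  move=> K0 /ltW pK /ltW qK hA hB; have := ler_wpM2l M0 pK; have := ler_wpM2l M0 qK.
  by move: (M * p) (M * q) hA hB => mp mq; rewrite mulrDl mul1r; move: (M * K) => mk; lra.
have K0 : 0 < e / (M + 1) / 2 by rewrite !divr_gt0// ltr_wpDl.
near=> x.
have xa : `|a - x.1| < e / (M + 1) / 2.
  by near: x; apply: (@cvgr_dist_lt _ _ _ (nbhs (a, b)) _ fst) => //; exact: cvg_fst.
have xb : `|b - x.2| < e / (M + 1) / 2.
  by near: x; apply: (@cvgr_dist_lt _ _ _ (nbhs (a, b)) _ snd) => //; exact: cvg_snd.
have h1 : `|f (a, b) - f (x.1, b)| <= M * `|a - x.1|.
  exact: (@lipschitz_bounded_derivative (fun s => f (s, b)) (fun s => f1 (s, b)) M (fun s => (df (s, b)).1)).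
have h2 : `|f (x.1, b) - f (x.1, x.2)| <= M * `|b - x.2|.
  exact: (@lipschitz_bounded_derivative (fun s => f (x.1, s)) (fun s => f2 (x.1, s)) M (fun s => (df (x.1, s)).2)).
have -> : f x = f (x.1, x.2) by case: (x).
have := ler_distD (f (x.1, b)) (f (a, b)) (f (x.1, x.2)).
have E : (M + 1) * (e / (M + 1) / 2) = e / 2 by field; rewrite gt_eqF// ltr_wpDl.
exact: (aux _ _ _ _ _ _ K0 xa xb h1 h2 E).
Unshelve. all: by end_near. Qed.
End lipschitz.

(** * Smoothing kernels *)

Section kernels.
Variable R : realType.
Notation leb2 := (@leb2 R).
Notation mu := (@lebesgue_measure R).
Notation plane := (measurableTypeR R * measurableTypeR R)%type.

Definition box (a : R * R) (r : R) : set (R * R) := [set y | `|y.1 - a.1| <= r /\ `|y.2 - a.2| <= r].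

Lemma boxE a r : box a r = [set` `[a.1 - r, a.1 + r]] `*` [set` `[a.2 - r, a.2 + r]].
Proof.
rewrite /box; apply/seteqP; split => [y []|y []] /=; rewrite !in_itv /= !ler_distl => h1 h2.
  by split; [move: h1|move: h2]; move=> /andP[? ?]; apply/andP; split; lra.
by split; [move: h1|move: h2]; move=> /andP[? ?]; apply/andP; split; lra.
Qed.

Lemma measurable_box a r : measurable (box a r : set (R * R)).
Proof. by rewrite boxE; apply: measurableX; exact: measurable_itv. Qed.

Lemma leb2_box a r : 0 <= r -> leb2 (box a r) = ((2 * r) ^+ 2)%:E.
Proof.
move=> r0; rewrite boxE /leb2 product_measure1E; try exact: measurable_itv.
have h (b : R) : mu `[b - r, b + r]%classic = (2 * r)%:E.
  rewrite lebesgue_measure_itv /= lte_fin; case: ifPn => [_|].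
    by rewrite -EFinB; congr EFin; ring.
  rewrite -leNgt => h; congr EFin; lra.
by transitivity ((2 * r)%:E * (2 * r)%:E)%E => //; congr (_ * _)%E; exact: h.
Qed.

Lemma integral_box_indic a r : 0 <= r -> (\int[leb2]_y (\1_(box a r) y)%:E = ((2 * r) ^+ 2)%:E)%E.
Proof.
by move=> r0; rewrite integral_indic// ?setIT; [exact: leb2_box|exact: measurable_box].
Qed.

(** On the box, [|f| <= 1 + f^2]; so the product is dominated by [M] times the indicator of the box
    plus [f^2]. *)
Lemma integrable_sq_bounded (f k : R * R -> R) (M : R) a r : 0 <= r -> L2 setT f ->
  measurable_fun setT k -> (forall y, `|k y| <= M) -> (forall y, ~ box a r y -> k y = 0) ->
  leb2.-integrable setT (EFin \o (fun y => k y * f y)) /\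
  `|\int[leb2]_y (k y * f y)| <= M * ((2 * r) ^+ 2 + fine (\int[leb2]_y ((f y) ^+ 2)%:E)%E).
Proof.
move=> r0 [mf f2] mk kM k0.
have M0 : 0 <= M by apply: le_trans (kM a).
have mB := measurable_box a r.
pose G (y : R * R) : R := M * (\1_(box a r) y + (f y) ^+ 2).
have m1 : measurable_fun setT (\1_(box a r) : R * R -> R) by exact: measurable_indic.
have mf2 : measurable_fun setT (fun y => f y ^+ 2) by exact: measurable_funX.
have bd y : `|k y * f y| <= G y.
  rewrite normrM /G; have [yB|yB] := pselect (box a r y); last first.
    by rewrite k0// normr0 mul0r mulr_ge0// addr_ge0// sqr_ge0.
  apply: ler_pM => //; rewrite indicE mem_set//=.
  by rewrite -real_normK ?num_real//; have : 0 <= `|f y| by []; nra.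
have i1 : leb2.-integrable setT (EFin \o (\1_(box a r) : R * R -> R)).
  apply/integrableP; split; first exact/measurable_EFinP.
  under eq_integral => y _ do rewrite /= ger0_norm//.
  by rewrite integral_box_indic// ltry.
have i2 : leb2.-integrable setT (EFin \o (fun y => f y ^+ 2)).
  apply/integrableP; split; first exact/measurable_EFinP.
  by under eq_integral => y _ do rewrite /= ger0_norm ?sqr_ge0//.
have iS : leb2.-integrable setT (EFin \o (fun y => \1_(box a r) y + f y ^+ 2)).
  by have := integrableD measurableT i1 i2; apply: eq_integrable => // y _; rewrite /= EFinD.
have iG : leb2.-integrable setT (EFin \o G).
  by have := integrableZl measurableT M iS; apply: eq_integrable => // y _; rewrite /= EFinM.
have ikf : leb2.-integrable setT (EFin \o (fun y => k y * f y)).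
  apply: (le_integrable measurableT _ _ iG) => [|y _].
    by apply/measurable_EFinP; exact: measurable_funM.
  by rewrite /= lee_fin (le_trans (bd y))// ler_norm.
split=> //; apply: (le_trans (le_normr_Rintegral measurableT ikf)).
apply: (@le_trans _ _ (\int[leb2]_y G y)).
  by apply: le_Rintegral => //; exact: integrable_norm.
rewrite /G RintegralZl// ler_wpM2l// RintegralD//.
rewrite le_eqVlt; apply/orP; left; apply/eqP; congr (_ + _).
by rewrite /Rintegral integral_box_indic.
Qed.

(** Indexing by the orders of differentiation of the two bumps gives a family closed under partial
    derivatives, up to a factor [1 / e]. *)
Definition kern (i j : nat) (e : R) (z : R * R) : R := bumpn i (z.1 / e) * bumpn j (z.2 / e).

Lemma kern_bounded i j e : exists2 M : R, 0 < M & forall z, `|kern i j e z| <= M.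
Proof.
have [M1 M10 h1] := bumpn_bounded R i; have [M2 M20 h2] := bumpn_bounded R j.
by exists (M1 * M2) => [|z]; [exact: mulr_gt0|rewrite normrM ler_pM].
Qed.

Lemma kern_eq0 i j e z : 0 < e -> (e < `|z.1|) || (e < `|z.2|) -> kern i j e z = 0.
Proof.
move=> e0 /orP[] h; rewrite /kern.
  by rewrite (bumpn_eq0 _ (t := z.1 / e)) ?mul0r// normrM normfV (gtr0_norm e0) ltr_pdivlMr// mul1r.
by rewrite (bumpn_eq0 _ (t := z.2 / e)) ?mulr0// normrM normfV (gtr0_norm e0) ltr_pdivlMr// mul1r.
Qed.

(** The point is dilated by [s] before averaging. For [s > 1] the average at a point outside a disk
    only involves values further out, so it needs no extension of [f] across the circle. *)
Definition smear i j e s (f : R * R -> R) (x : R * R) : R :=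
  \int[leb2]_y (kern i j e (s * x.1 - y.1, s * x.2 - y.2) * f y).

Lemma Ck_kern k i j e (a b c d : R) : Ck k (fun y : R * R => kern i j e (a * y.1 + b, c * y.2 + d)).
Proof.
rewrite /kern /=.
have := @Ck_tensor R k (fun t => bumpn i (a / e * t + b / e)) (fun t => bumpn j (c / e * t + d / e))
   (Dk_affine _ _ (Dk_bumpn R k i)) (Dk_affine _ _ (Dk_bumpn R k j)).
congr (Ck k _); apply/funext => y /=; congr (bumpn i _ * bumpn j _); ring.
Qed.

Lemma measurable_kern i j e (x : R * R) : measurable_fun setT (fun y : R * R => kern i j e (x.1 - y.1, x.2 - y.2)).
Proof.
apply: continuous_measurable2.
have -> : (fun y : R * R => kern i j e (x.1 - y.1, x.2 - y.2)) =
          (fun y => kern i j e (-1 * y.1 + x.1, -1 * y.2 + x.2)).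
  by apply/funext => y; rewrite !mulN1r (addrC _ x.1) (addrC _ x.2).
exact: (@Ck_continuous _ 0 _ (Ck_kern 0 i j e (-1) x.1 (-1) x.2)).
Qed.

Lemma kern_supp i j e x y : 0 < e -> ~ box x e y -> kern i j e (x.1 - y.1, x.2 - y.2) = 0.
Proof.
move=> e0 nb; apply: kern_eq0 => //=; rewrite (distrC x.1) (distrC x.2).
by apply/negP => /negP; rewrite negb_or -!leNgt => /andP[? ?]; apply: nb.
Qed.

Lemma integrable_kern i j e x f : 0 < e -> L2 setT f ->
  leb2.-integrable setT (EFin \o (fun y => kern i j e (x.1 - y.1, x.2 - y.2) * f y)).
Proof.
move=> e0 Lf; have [M M0 hM] := kern_bounded i j e.
have [] := @integrable_sq_bounded f _ M x e (ltW e0) Lf (measurable_kern i j e x) => //.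
by move=> y; exact: kern_supp.
Qed.

Lemma smear_bounded i j e s f : 0 < e -> L2 setT f -> exists M : R, forall x, `|smear i j e s f x| <= M.
Proof.
move=> e0 Lf; have [M M0 hM] := kern_bounded i j e.
exists (M * ((2 * e) ^+ 2 + fine (\int[leb2]_y ((f y) ^+ 2)%:E)%E)) => x.
have [] // := @integrable_sq_bounded f _ M (s * x.1, s * x.2) e (ltW e0) Lf (measurable_kern i j e (s * x.1, s * x.2)).
by move=> y; exact: kern_supp.
Qed.

Lemma is_derive_kern1 i j e s (b t : R) y2 : is_derive t 1 (fun t => kern i j e (s * t - b, y2))
  (s / e * kern i.+1 j e (s * t - b, y2)).
Proof.
have dl : is_derive t 1 (fun t : R => (s * t - b) / e) (s / e).
  apply: (der_eq (derM (derB (derZ s (der_id t)) (der_cst b t)) (der_cst e^-1 t))); ring.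
apply: (der_eq (derM (@der_comp _ (bumpn i) (fun t => (s * t - b) / e) t _ _ (is_derive_bumpn i _) dl) (der_cst (bumpn j (y2 / e)) t))).
rewrite /kern /=; ring.
Qed.

Lemma is_derive_kern2 i j e s (b t : R) y1 : is_derive t 1 (fun t => kern i j e (y1, s * t - b))
  (s / e * kern i j.+1 e (y1, s * t - b)).
Proof.
have dl : is_derive t 1 (fun t : R => (s * t - b) / e) (s / e).
  apply: (der_eq (derM (derB (derZ s (der_id t)) (der_cst b t)) (der_cst e^-1 t))); ring.
apply: (der_eq (@derZ _ (bumpn i (y1 / e)) _ t _ (@der_comp _ (bumpn j) (fun t => (s * t - b) / e) t _ _ (is_derive_bumpn j _) dl))).
rewrite /kern /=; ring.
Qed.

Lemma has_grad_smear i j e s f : 0 < e -> 0 < s -> L2 setT f ->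
  has_grad (smear i j e s f) (fun x => s / e * smear i.+1 j e s f x) (fun x => s / e * smear i j.+1 e s f x).
Proof.
move=> e0 s0 Lf.
have dom i' j' (x : R * R) : exists2 G : R * R -> R, (forall y, 0 <= G y) /\ leb2.-integrable setT (EFin \o G) &
    forall z y, `|z.1 - s * x.1| <= s -> `|z.2 - s * x.2| <= s ->
      `|s / e * kern i' j' e (z.1 - y.1, z.2 - y.2) * f y| <= G y.
  have [M M0 hM] := kern_bounded i' j' e.
  (* When [x] moves by at most 1 in each coordinate the dilated centre moves by at most [s], and all
     kernels involved are supported in this box. *)
  pose B := box (s * x.1, s * x.2) (s + e).
  exists (fun y => `|s / e * M * \1_B y * f y|).
    split=> // ; apply: integrable_norm.
    have [|||//] := @integrable_sq_bounded f (fun y => s / e * M * \1_B y) (s / e * M) (s * x.1, s * x.2) (s + e) (addr_ge0 (ltW s0) (ltW e0)) Lf.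
    - by apply: measurable_funM => //; apply: measurable_indic; exact: measurable_box.
    - move=> y; have c0 : 0 <= s / e * M by rewrite mulr_ge0 ?divr_ge0// ltW.
      rewrite normrM (ger0_norm c0) ler_piMr// indicE.
      by case: (_ \in _); rewrite ?normr1 ?normr0.
    - by move=> y yB; rewrite indicE memNset// mulr0.
  move=> z y z1 z2; have [yB|yB] := pselect (B y).
    rewrite indicE mem_set// mulr1 2!normrM [leRHS]normrM ler_wpM2r//.
    by rewrite [leRHS]normrM ler_wpM2l// (le_trans (hM _))// ler_norm.
  rewrite kern_eq0 ?mulr0 ?mul0r ?normr0//=.
  apply/negP => /negP; rewrite negb_or -!leNgt => /andP[h1 h2]; apply: yB; split => /=.
    by rewrite (_ : y.1 - s * x.1 = (z.1 - s * x.1) - (z.1 - y.1)); [apply: (le_trans (ler_normB _ _)); exact: lerD|ring].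
  by rewrite (_ : y.2 - s * x.2 = (z.2 - s * x.2) - (z.2 - y.2)); [apply: (le_trans (ler_normB _ _)); exact: lerD|ring].
move=> x; split.
- have [G [G0 iG] dG] := dom i.+1 j x.
  have := @is_derive_under R _ plane leb2 setT
    (fun t y => kern i j e (s * t - y.1, s * x.2 - y.2) * f y)
    (fun t y => s / e * kern i.+1 j e (s * t - y.1, s * x.2 - y.2) * f y)
    x.1 (x.1 - 1) (x.1 + 1) G measurableT.
  move=> /(_ _ _ _ G0 iG) h; apply: (der_eq (h _ _ _ _)).
  + by apply/andP; split; lra.
  + by move=> t _; exact: (integrable_kern i j (s * t, s * x.2) e0 Lf).
  + move=> t y _ _; apply: (der_eq (derM (is_derive_kern1 i j e s y.1 t (s * x.2 - y.2)) (der_cst (f y) t))).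
    by rewrite mulr0 addr0.
  + move=> t y /andP[t1 t2] _; apply: (dG (s * t, s * x.2)) => /=; last by rewrite subrr normr0 ltW.
    by rewrite -mulrBr normrM (gtr0_norm s0) ler_piMr ?(ltW s0)// ler_distl; apply/andP; split; lra.
  under eq_Rintegral => y _ do rewrite -mulrA.
  by rewrite RintegralZl//; exact: (integrable_kern i.+1 j (s * x.1, s * x.2) e0 Lf).
- have [G [G0 iG] dG] := dom i j.+1 x.
  have := @is_derive_under R _ plane leb2 setT
    (fun t y => kern i j e (s * x.1 - y.1, s * t - y.2) * f y)
    (fun t y => s / e * kern i j.+1 e (s * x.1 - y.1, s * t - y.2) * f y)
    x.2 (x.2 - 1) (x.2 + 1) G measurableT.
  move=> /(_ _ _ _ G0 iG) h; apply: (der_eq (h _ _ _ _)).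
  + by apply/andP; split; lra.
  + by move=> t _; exact: (integrable_kern i j (s * x.1, s * t) e0 Lf).
  + move=> t y _ _; apply: (der_eq (derM (is_derive_kern2 i j e s y.2 t (s * x.1 - y.1)) (der_cst (f y) t))).
    by rewrite mulr0 addr0.
  + move=> t y /andP[t1 t2] _; apply: (dG (s * x.1, s * t)) => /=; first by rewrite subrr normr0 ltW.
    by rewrite -mulrBr normrM (gtr0_norm s0) ler_piMr ?(ltW s0)// ler_distl; apply/andP; split; lra.
  under eq_Rintegral => y _ do rewrite -mulrA.
  by rewrite RintegralZl//; exact: (integrable_kern i j.+1 (s * x.1, s * x.2) e0 Lf).
Qed.

(** Partial derivatives of a smear are multiples of smears by other kernels of the family, so the
    induction stays inside it; continuity follows from the bounded gradient. *)
Lemma smooth_smear i j e s f : 0 < e -> 0 < s -> L2 setT f -> smooth (smear i j e s f).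
Proof.
move=> e0 s0 Lf k; have cont i' j' : continuous (smear i' j' e s f).
  have [M1 h1] := smear_bounded i'.+1 j' s e0 Lf; have [M2 h2] := smear_bounded i' j'.+1 s e0 Lf.
  apply: (@has_grad_continuous _ _ _ _ (s / e * Num.max M1 M2) (has_grad_smear i' j' e0 s0 Lf)) => x.
    by rewrite normrM gtr0_norm ?divr_gt0// ler_pM2l ?divr_gt0// le_max h1.
  by rewrite normrM gtr0_norm ?divr_gt0// ler_pM2l ?divr_gt0// le_max h2 orbT.
elim: k i j => [|k IH] i j; first exact: cont.
apply: (Ck_intro (has_grad_smear i j e0 s0 Lf)); first exact: cont.
  by apply: CkM; [exact: Ck_cst|exact: IH].
by apply: CkM; [exact: Ck_cst|exact: IH].
Qed.
End kernels.

(** * Extended real sequences tending to zero *)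

Section vanishing.
Variable R : realType.
Implicit Types u v : nat -> \bar R.

(** For nonnegative sequences this is convergence to 0 ([vanishP]); in this form it passes to
    smaller sequences, sums and multiples without finiteness conditions. *)
Definition vanish u : Prop := forall e : R, 0 < e -> \forall n \near \oo, (u n <= e%:E)%E.

Lemma vanishP u : (forall n, 0 <= u n)%E -> vanish u <-> u @ \oo --> 0%E.
Proof.
move=> u0; split=> [vu|cu e e0].
  apply/fine_cvgP; split.
    have [N _ hN] := vu _ ltr01; exists N => // n Nn.
    by rewrite ge0_fin_numE// (le_lt_trans (hN n Nn))// ltry.
  apply/cvgrPdist_le => e e0; have [N _ hN] := vu _ e0; exists N => // n Nn.
  have := hN n Nn => h; rewrite sub0r normrN ger0_norm ?fine_ge0//.
  by rewrite -lee_fin fineK// ge0_fin_numE// (le_lt_trans h)// ltry.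
have [fu /cvgrPdist_le h] := (fine_cvgP _ _).1 cu.
near=> n; have fn : u n \is a fin_num by near: n.
rewrite -(fineK fn) lee_fin.
have : `|0 - fine (u n)| <= e by near: n; exact: h.
by rewrite sub0r normrN ger0_norm// fine_ge0.
Unshelve. all: by end_near. Qed.

Lemma vanish_le u v : (\forall n \near \oo, (u n <= v n)%E) -> vanish v -> vanish u.
Proof.
move=> uv vv e e0; near=> n; apply: (@le_trans _ _ (v n)); first by near: n.
by near: n; exact: vv.
Unshelve. all: by end_near. Qed.

Lemma vanishD u v : vanish u -> vanish v -> vanish (fun n => u n + v n)%E.
Proof.
move=> vu vv e e0; have e20 : 0 < e / 2 by rewrite divr_gt0.
near=> n; rewrite [e in e%:E]splitr EFinD leeD//; near: n; [exact: vu|exact: vv].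
Unshelve. all: by end_near. Qed.

Lemma vanishZ (k : R) u : 0 <= k -> vanish u -> vanish (fun n => k%:E * u n)%E.
Proof.
move=> k0 vu e e0; have k1 : 0 < k + 1 by rewrite ltr_wpDl.
have e20 : 0 < e / (k + 1) by rewrite divr_gt0.
near=> n; apply: (@le_trans _ _ (k%:E * (e / (k + 1))%:E)%E).
  by rewrite lee_wpmul2l ?lee_fin//; near: n; exact: vu.
rewrite -EFinM lee_fin mulrC -mulrA ler_piMr ?(ltW e0)// mulrC ler_pdivrMr// mul1r.
by rewrite lerDl.
Unshelve. all: by end_near. Qed.

Lemma vanish_inv_nat (k : R) : vanish (fun n => (k / n.+1%:R)%:E).
Proof.
move=> e e0; near=> n; rewrite lee_fin ler_pdivrMr// mulrC -ler_pdivrMr//.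
apply: (@le_trans _ _ n%:R); last by rewrite ler_nat.
by near: n; exact: nbhs_infty_ger.
Unshelve. all: by end_near. Qed.
End vanishing.

(** * Squared norms *)

Section square_integrals.
Context (R : realType) d (T : measurableType d) (mu : {measure set T -> \bar R}) (D : set T).
Hypothesis mD : measurable D.
Implicit Types f g : T -> R.

Definition nsq f : \bar R := (\int[mu]_(x in D) ((f x) ^+ 2)%:E)%E.
Definition sqi f : Prop := measurable_fun D f /\ (nsq f < +oo)%E.

Lemma nsq_ge0 f : (0 <= nsq f)%E.
Proof. by apply: integral_ge0 => x _; rewrite lee_fin sqr_ge0. Qed.

Lemma eq_nsq f g : (forall x, D x -> f x = g x) -> nsq f = nsq g.
Proof. by move=> fg; apply: eq_integral => x; rewrite inE => /fg ->. Qed.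

Lemma nsqC f g : nsq (fun x => f x - g x)%R = nsq (fun x => g x - f x)%R.
Proof. by apply: eq_integral => x _; rewrite -sqrrN opprB. Qed.

Lemma measurable_sq f : measurable_fun D f -> measurable_fun D (fun x => ((f x) ^+ 2)%:E).
Proof. by move=> mf; apply/measurable_EFinP; exact: measurable_funX. Qed.

(** Takes the place of the triangle inequality: pointwise bounds between squares are integrated, and
    no square root of an integral appears. *)
Lemma nsq_lin2 f g (a b : R) (h : T -> R) : 0 <= a -> 0 <= b ->
  measurable_fun D f -> measurable_fun D g -> measurable_fun D h ->
  (forall x, D x -> (h x) ^+ 2 <= a * (f x) ^+ 2 + b * (g x) ^+ 2) ->
  (nsq h <= a%:E * nsq f + b%:E * nsq g)%E.
Proof.
move=> a0 b0 mf mg mh hle; rewrite /nsq -!ge0_integralZl_EFin//; last 4 first.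
- by move=> x _; rewrite lee_fin sqr_ge0.
- exact: measurable_sq.
- by move=> x _; rewrite lee_fin sqr_ge0.
- exact: measurable_sq.
rewrite -ge0_integralD//; last 4 first.
- by move=> x _; rewrite mule_ge0// lee_fin ?sqr_ge0.
- by apply: measurable_funeM; exact: measurable_sq.
- by move=> x _; rewrite mule_ge0// lee_fin ?sqr_ge0.
- by apply: measurable_funeM; exact: measurable_sq.
have m0 : measurable_fun D (fun x => a%:E * (f x ^+ 2)%:E + b%:E * (g x ^+ 2)%:E)%E.
  by apply: emeasurable_funD; apply: measurable_funeM; exact: measurable_sq.
have h0 x : D x -> (0 <= (h x ^+ 2)%:E)%E by rewrite lee_fin sqr_ge0.
apply: (@ge0_le_integral _ _ _ mu D mD _ _ h0 (measurable_sq mh) m0) => x Dx.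
by rewrite -!EFinM -EFinD lee_fin hle.
Qed.

Lemma nsqD f g : measurable_fun D f -> measurable_fun D g ->
  (nsq (fun x => f x + g x)%R <= 2%:E * nsq f + 2%:E * nsq g)%E.
Proof.
move=> mf mg; apply: nsq_lin2 => //; first exact: measurable_funD.
by move=> x _; have := sqr_ge0 (f x - g x); nra.
Qed.

Lemma nsqB f g : measurable_fun D f -> measurable_fun D g ->
  (nsq (fun x => f x - g x)%R <= 2%:E * nsq f + 2%:E * nsq g)%E.
Proof.
move=> mf mg; apply: nsq_lin2 => //; first exact: measurable_funB.
by move=> x _; have := sqr_ge0 (f x + g x); nra.
Qed.

Lemma nsqZ (k : R) f : measurable_fun D f -> nsq (fun x => k * f x) = ((k ^+ 2)%:E * nsq f)%E.
Proof.
move=> mf; rewrite /nsq -ge0_integralZl_EFin//; last 3 first.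
- by move=> x _; rewrite lee_fin sqr_ge0.
- exact: measurable_sq.
- exact: sqr_ge0.
by apply: eq_integral => x _; rewrite exprMn EFinM.
Qed.

Lemma sqiD f g : sqi f -> sqi g -> sqi (fun x => f x + g x).
Proof.
move=> [mf lf] [mg lg]; split; first exact: measurable_funD.
apply: le_lt_trans (nsqD mf mg) _.
by rewrite lte_add_pinfty// lte_mul_pinfty.
Qed.

Lemma sqiZ (k : R) f : sqi f -> sqi (fun x => k * f x).
Proof.
move=> [mf lf]; split; first exact: measurable_funM.
by rewrite nsqZ// lte_mul_pinfty// lee_fin sqr_ge0.
Qed.

Lemma sqiB f g : sqi f -> sqi g -> sqi (fun x => f x - g x).
Proof.
move=> [mf lf] [mg lg]; split; first exact: measurable_funB.
apply: le_lt_trans (nsqB mf mg) _.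
by rewrite lte_add_pinfty// lte_mul_pinfty.
Qed.

Lemma sqi_integrable f : sqi f -> mu.-integrable D (EFin \o (fun x => f x ^+ 2)).
Proof.
move=> [mf lf]; apply/integrableP; split; first exact: measurable_sq.
by under eq_integral => x _ do rewrite /= ger0_norm ?sqr_ge0//.
Qed.

Lemma sqi_integrableM f g : sqi f -> sqi g -> mu.-integrable D (EFin \o (fun x => f x * g x)).
Proof.
move=> Lf Lg; have iS := integrableD mD (sqi_integrable Lf) (sqi_integrable Lg).
case: Lf Lg => mf _ [mg _].
apply: (le_integrable mD _ _ iS) => [|x _].
  by apply/measurable_EFinP; exact: measurable_funM.
rewrite /= lee_fin normrM (ger0_norm (addr_ge0 (sqr_ge0 _) (sqr_ge0 _))).
rewrite -(real_normK (num_real (f x))) -(real_normK (num_real (g x))).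
have := sqr_ge0 (`|f x| - `|g x|); nra.
Qed.

Lemma nsq_fin f : sqi f -> nsq f \is a fin_num.
Proof. by move=> [_ lf]; rewrite ge0_fin_numE// nsq_ge0. Qed.

Lemma Rintegral_sq f : sqi f -> (\int[mu]_(x in D) (f x ^+ 2))%R%:E = nsq f.
Proof. by move=> Lf; rewrite /Rintegral fineK// nsq_fin. Qed.

(** Young's inequality [2 u v <= e v^2 + u^2 / e], with [e] left free so that the first factor can
    be brought close to 1. *)
Lemma nsq_near f g (e : R) : 0 < e -> measurable_fun D f -> measurable_fun D g ->
  (nsq f <= (1 + e)%:E * nsq g + (1 + e^-1)%:E * nsq (fun x => f x - g x)%R)%E.
Proof.
move=> e0 mf mg; have ei : 0 < e^-1 by rewrite invr_gt0.
apply: nsq_lin2 => //; [lra|lra|exact: measurable_funB|].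
suff H (u v : R) : (u + v) ^+ 2 <= (1 + e) * v ^+ 2 + (1 + e^-1) * u ^+ 2.
  by move=> x _; have := H (f x - g x) (g x); rewrite subrK.
suff : 2 * u * v <= e * v ^+ 2 + e^-1 * u ^+ 2.
  have -> : (u + v) ^+ 2 = u ^+ 2 + 2 * u * v + v ^+ 2 by ring.
  by rewrite !mulrDl !mul1r; lra.
have : 0 <= e^-1 * (u - e * v) ^+ 2 by rewrite mulr_ge0 ?sqr_ge0// ltW.
have -> : e^-1 * (u - e * v) ^+ 2 = e^-1 * u ^+ 2 - 2 * u * v + e * v ^+ 2 by field; rewrite gt_eqF.
lra.
Qed.

Lemma nsq_cvg (f : nat -> T -> R) g : (forall n, measurable_fun D (f n)) -> sqi g ->
  vanish (fun n => nsq (fun x => f n x - g x)%R) ->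
  (fun n => fine (nsq (f n))) @ \oo --> fine (nsq g).
Proof.
move=> mf Lg vf; have [mg lg] := Lg; set G := fine (nsq g).
have G0 : 0 <= G by rewrite fine_ge0 ?nsq_ge0.
have gE : nsq g = G%:E by rewrite fineK// nsq_fin.
apply/cvgrPdist_le => e e0.
(* With this [t], the factor [1 + t] changes any value up to [G + 1 + e] by at most [e / 2]; [r]
   below limits the remaining term to [e / 4]. *)
pose t := e / (2 * (G + 1 + e)).
have den : 0 < 2 * (G + 1 + e) by lra.
have t0 : 0 < t by rewrite divr_gt0.
have tden : t * (2 * (G + 1 + e)) = e by rewrite /t divfK// gt_eqF.
have t1 : 0 < 1 + t^-1 by rewrite ltr_wpDr ?invr_ge0 ?ltW.
pose r := e / (4 * (1 + t^-1)).
have r0 : 0 < r by rewrite divr_gt0// mulr_gt0.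
have rden : (1 + t^-1) * r = e / 4 by rewrite /r; move: (1 + t^-1) t1 => q q0; field; rewrite gt_eqF.
near=> n.
have dn : (nsq (fun x => f n x - g x)%R <= r%:E)%E by near: n; exact: vf.
have dn' : (nsq (fun x => g x - f n x)%R <= r%:E)%E.
  by rewrite nsqC.
have up : (nsq (f n) <= ((1 + t) * G + e / 4)%:E)%E.
  apply: le_trans (nsq_near t0 (mf n) mg) _; rewrite gE.
  have -> : ((1 + t) * G + e / 4)%:E = ((1 + t)%:E * G%:E + (1 + t^-1)%:E * r%:E)%E by rewrite -!EFinM -EFinD rden.
  by rewrite leeD2l// lee_wpmul2l// lee_fin ltW.
have fin : nsq (f n) \is a fin_num by rewrite ge0_fin_numE ?nsq_ge0// (le_lt_trans up)// ltry.
have lo : (nsq g <= ((1 + t) * fine (nsq (f n)) + e / 4)%:E)%E.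
  apply: le_trans (nsq_near t0 mg (mf n)) _; have -> : ((1 + t) * fine (nsq (f n)) + e / 4)%:E = ((1 + t)%:E * nsq (f n) + (1 + t^-1)%:E * r%:E)%E.
    by rewrite -{2}(fineK fin) -!EFinM -EFinD rden.
  by rewrite leeD2l// lee_wpmul2l// lee_fin ltW.
move: up lo; rewrite gE -(fineK fin) !lee_fin /=; set F := fine _ => up lo.
have F0 : 0 <= F by rewrite fine_ge0 ?nsq_ge0.
by rewrite ler_distl; apply/andP; split; nra.
Unshelve. all: by end_near. Qed.
End square_integrals.

(** * Square-integrable functions of the plane *)

Section plane_L2.
Variable R : realType.
Implicit Types (f g : R * R -> R) (U : set (R * R)).

Lemma leb2_sigma_finite : sigma_finite setT (@leb2 R).
Proof.
exists (fun n => box (0, 0) n%:R) => [|n].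
  apply/esym/seteqP; split => // -[x y] _.
  exists (Num.bound (Num.max `|x| `|y|)) => //.
  have := archi_boundP (x := Num.max `|x| `|y|); rewrite le_max normr_ge0 => /(_ isT).
  by rewrite gt_max => /andP[h1 h2]; split; rewrite /= subr0 ltW.
by split; [exact: measurable_box|rewrite leb2_box// ltry].
Qed.

(** Lebesgue measure of the plane with its sigma-finiteness attached, for Tonelli's theorem on pairs
    of points of the plane. *)
Definition leb2s : {sigma_finite_measure set (measurableTypeR R * measurableTypeR R)%type -> \bar R} :=
  HB.pack (product_measure1 (@lebesgue_measure R) (@lebesgue_measure R))
    (Measure_isSigmaFinite.Build _ _ _ (product_measure1 (@lebesgue_measure R) (@lebesgue_measure R))
       leb2_sigma_finite).

Lemma L2D U f g : measurable U -> L2 U f -> L2 U g -> L2 U (fun x => f x + g x).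
Proof. by move=> mU Lf Lg; exact: (@sqiD R _ _ (@leb2 R) U mU f g Lf Lg). Qed.

Lemma L2B U f g : measurable U -> L2 U f -> L2 U g -> L2 U (fun x => f x - g x).
Proof. by move=> mU Lf Lg; exact: (@sqiB R _ _ (@leb2 R) U mU f g Lf Lg). Qed.

Lemma L2Z U (k : R) f : measurable U -> L2 U f -> L2 U (fun x => k * f x).
Proof. by move=> mU Lf; exact: (@sqiZ R _ _ (@leb2 R) U mU k f Lf). Qed.

Lemma integral_itv_indic (a b c : R) : 0 <= c -> a <= b ->
  (\int[@lebesgue_measure R]_t (c%:E * (\1_(`[a, b]%classic) t)%:E) = (c * (b - a))%:E)%E.
Proof.
move=> c0 ab.
have m1 : measurable_fun setT (fun t : R => ((\1_(`[a, b]%classic) t) : R)%:E).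
  by apply/measurable_EFinP; apply: measurable_indic; exact: measurable_itv.
rewrite ge0_integralZl_EFin// integral_indic// setIT EFinM; congr (_ * _)%E.
transitivity (@lebesgue_measure R [set` `[a, b]]) => //.
rewrite lebesgue_measure_itv /= lte_fin; case: ifPn => [_|]; first by rewrite EFinB.
by rewrite -leNgt => ba; congr EFin; lra.
Qed.
End plane_L2.

(** * Mollification combined with dilation *)

Section mollifier.
Variable R : realType.
Notation leb2 := (@leb2 R).
Notation mu := (@lebesgue_measure R).
Notation plane := (measurableTypeR R * measurableTypeR R)%type.
Notation nrm := (nsq leb2 setT).

Definition bint : R := \int[mu]_t bump t.

Lemma measurable_bump : measurable_fun setT (@bump R).
Proof. by apply: continuous_measurable_fun; exact: (@Dk_continuous R 0 _ (Dk_bump R 0)). Qed.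

Lemma integral_bump : (\int[mu]_t (bump t)%:E = bint%:E)%E.
Proof.
have [M M0 hM] := bumpn_bounded R 0.
have b0 (t : R) : (0 <= (bump t)%:E)%E by rewrite lee_fin bump_ge0.
rewrite /bint /Rintegral fineK// ge0_fin_numE; last exact: integral_ge0.
apply: (@le_lt_trans _ _ (\int[mu]_t (M%:E * (\1_(`[-1, 1]%classic) t)%:E))%E); last first.
  by rewrite integral_itv_indic ?ltry ?ltW//; lra.
apply: ge0_le_integral => //.
- by apply/measurable_EFinP; exact: measurable_bump.
- by apply: measurable_funeM; apply/measurable_EFinP; apply: measurable_indic; exact: measurable_itv.
- move=> t _; rewrite -EFinM lee_fin indicE; have [tI|tI] := boolP (t \in `[-1, 1]%classic).
    by rewrite mulr1; apply: le_trans (hM t); exact: ler_norm.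
  rewrite mulr0 (_ : bump t = bumpn 0 t)// bumpn_eq0// ltNge; apply: contra tI => t1.
  by rewrite inE /= in_itv /= -ler_norml.
Qed.

Lemma bint_gt0 : 0 < bint.
Proof.
have low (t : R) : - 2^-1 <= t <= 2^-1 -> expR (-4) <= bump t.
  have fl (u : R) : 0 < u -> flat 1 u = expR (- u^-1) by move=> u0; rewrite /flat u0 hornerC mul1r.
  move=> /andP[t1 t2]; rewrite /bump !fl; [|lra|lra].
  rewrite -expRD ler_expR.
  have h (u : R) : 2^-1 <= u -> u^-1 <= 2.
    by move=> u2; rewrite -[leRHS]invrK lef_pV2 ?posrE//; lra.
  have := h (1 * t + 1); have := h (-1 * t + 1); lra.
have c0 := expR_gt0 (-4 : R).
suff : (expR (-4 : R) <= bint) by apply: lt_le_trans.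
rewrite -lee_fin -integral_bump.
apply: (@le_trans _ _ (\int[mu]_t ((expR (-4))%:E * (\1_(`[-2^-1, 2^-1]%classic) t)%:E))%E).
  by rewrite integral_itv_indic ?(ltW c0)// ?lee_fin; [rewrite (_ : 2^-1 - - 2^-1 = 1) ?mulr1//; lra|lra].
apply: ge0_le_integral => //.
- by apply: measurable_funeM; apply/measurable_EFinP; apply: measurable_indic; exact: measurable_itv.
- by apply/measurable_EFinP; exact: measurable_bump.
- move=> t _; rewrite -EFinM lee_fin indicE; have [|tI] := boolP (t \in `[-2^-1, 2^-1]%classic); last first.
    by rewrite mulr0 bump_ge0.
  by rewrite inE /= in_itv /= mulr1; exact: low.
Qed.

Lemma kern00_ge0 e z : 0 <= kern 0 0 e z :> R.
Proof. by rewrite /kern mulr_ge0 ?bump_ge0. Qed.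

Lemma integral_kern00 (e c : R) (a : R * R) : 0 < e -> c != 0 ->
  (\int[leb2]_y (kern 0 0 e (c * y.1 + a.1, c * y.2 + a.2))%:E = ((bint * e / `|c|) ^+ 2)%:E)%E.
Proof.
move=> e0 c0.
have one (b : R) : (\int[mu]_t (bump ((c * t + b) / e))%:E = (bint * e / `|c|)%:E)%E.
  have ce0 : c / e != 0 by rewrite mulf_neq0// invr_eq0 gt_eqF.
  have nc : 0 < `|c| by rewrite normr_gt0.
  have b0 (t : R) : (0 <= (bump t)%:E)%E by rewrite lee_fin bump_ge0.
  have mb : measurable_fun setT (fun t : R => (bump t)%:E) by apply/measurable_EFinP; exact: measurable_bump.
  have := integral_affine (b / e) ce0 b0 mb.
  have mbc : measurable_fun setT (fun t : R => (bump (c / e * t + b / e))%:E).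
    by apply: (measurableT_comp mb); apply: measurable_funD => //; exact: measurable_funM.
  rewrite integral_bump ge0_integralZr//.
  have E2 (t : R) : c / e * t + b / e = (c * t + b) / e by ring.
  under eq_integral => t _ do rewrite E2.
  move=> /esym E.
  rewrite -[LHS]mule1 (_ : (1 = (`|c / e|)%:E * (e / `|c|)%:E)%E); last first.
    by rewrite -EFinM normrM normfV (gtr0_norm e0); congr EFin; field; rewrite !gt_eqF.
  by rewrite muleA E -EFinM mulrA.
have mb (b : R) : measurable_fun setT (fun t : R => (bump ((c * t + b) / e))%:E).
  apply/measurable_EFinP; apply: (measurableT_comp measurable_bump).
  apply: measurable_funM => //; apply: measurable_funD => //; exact: measurable_funM.
have b0 (t : R) : (0 <= (bump t)%:E)%E by rewrite lee_fin bump_ge0.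
have mk : measurable_fun setT (fun y : plane => (kern 0 0 e (c * y.1 + a.1, c * y.2 + a.2))%:E).
  by apply/measurable_EFinP; apply: continuous_measurable2; exact: (@Ck_continuous R 0 _ (Ck_kern 0 0 0 e c a.1 c a.2)).
have k0 (y : plane) : (0 <= (kern 0 0 e (c * y.1 + a.1, c * y.2 + a.2))%:E)%E by rewrite lee_fin kern00_ge0.
rewrite /leb2 fubini_tonelli1// /fubini_F.
transitivity (\int[mu]_t ((bump ((c * t + a.1) / e))%:E * (bint * e / `|c|)%:E))%E.
  apply: eq_integral => t _.
  by rewrite -(one a.2) -ge0_integralZl_EFin ?bump_ge0//; exact: mb.
rewrite ge0_integralZr//; last by rewrite lee_fin divr_ge0// mulr_ge0 ?ltW ?bint_gt0.
  by rewrite one -EFinM.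
exact: mb.
Qed.

Variable delta : R.
(** The radius and the excess of the dilation over 1 shrink at the same rate, so that for [delta]
    small enough the kernel around the dilated point always stays outside a disk that the point
    itself lies outside. *)
Definition rad n : R := delta / n.+1%:R.
Definition dil n : R := 1 + n.+1%:R^-1.

Definition moll n (f : R * R -> R) (x : R * R) : R := (bint * rad n) ^- 2 * smear 0 0 (rad n) (dil n) f x.

Hypothesis delta0 : 0 < delta.

Lemma rad_gt0 n : 0 < rad n. Proof. by rewrite divr_gt0. Qed.
Lemma dil_gt1 n : 1 < dil n. Proof. by rewrite ltrDl invr_gt0. Qed.
Lemma dil_gt0 n : 0 < dil n. Proof. exact: lt_trans (dil_gt1 n). Qed.
Let C n := (bint * rad n) ^+ 2.
Lemma mass_gt0 n : 0 < (bint * rad n) ^+ 2.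
Proof. by rewrite exprn_gt0// mulr_gt0// ?bint_gt0 ?rad_gt0. Qed.

Lemma smooth_moll n f : L2 setT f -> smooth (moll n f).
Proof.
move=> Lf k; apply: CkM; first exact: Ck_cst.
by apply: smooth_smear => //; [exact: rad_gt0|exact: dil_gt0].
Qed.

Lemma measurable_moll n f : L2 setT f -> measurable_fun setT (moll n f).
Proof. by move=> Lf; apply: continuous_measurable2; exact: (@Ck_continuous R 0 _ (smooth_moll n Lf 0)). Qed.

Let K n (x y : R * R) := kern 0 0 (rad n) (dil n * x.1 - y.1, dil n * x.2 - y.2) : R.

Lemma moll_lin n f g (a b : R) x : L2 setT f -> L2 setT g ->
  moll n (fun y => a * f y + b * g y) x = a * moll n f x + b * moll n g x.
Proof.
move=> Lf Lg; have e0 := rad_gt0 n.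
have If := integrable_kern 0 0 (dil n * x.1, dil n * x.2) e0 Lf.
have Ig := integrable_kern 0 0 (dil n * x.1, dil n * x.2) e0 Lg.
rewrite /moll !(mulrCA _ ((bint * rad n) ^- 2)) -mulrDr; congr (_ * _).
rewrite /smear -RintegralZl// -RintegralZl// -RintegralD//; last 2 first.
- by have := integrableZl measurableT a If; apply: eq_integrable => // y _; rewrite /= EFinM.
- by have := integrableZl measurableT b Ig; apply: eq_integrable => // y _; rewrite /= EFinM.
by apply: eq_Rintegral => y _; ring.
Qed.

Lemma K_ge0 n x y : 0 <= K n x y. Proof. exact: kern00_ge0. Qed.

Lemma measurable_K n x : measurable_fun setT (K n x : R * R -> R).
Proof. exact: (measurable_kern 0 0 (rad n) (dil n * x.1, dil n * x.2)). Qed.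

Lemma integral_K n x : (\int[leb2]_y (K n x y)%:E = (C n)%:E)%E.
Proof.
have := @integral_kern00 (rad n) (-1) (dil n * x.1, dil n * x.2) (rad_gt0 n).
rewrite oppr_eq0 oner_eq0 normrN1 divr1 => /(_ isT) <-.
by apply: eq_integral => y _; rewrite /K !mulN1r /= (addrC (- y.1)) (addrC (- y.2)).
Qed.

(** Integration in the dilated variable gains a factor [dil n ^- 2], which is at most 1. *)
Lemma integral_K_l n y : (\int[leb2]_x (K n x y)%:E <= (C n)%:E)%E.
Proof.
have := @integral_kern00 (rad n) (dil n) (- y.1, - y.2) (rad_gt0 n).
rewrite gt_eqF ?dil_gt0// => /(_ isT) E.
have B0 : 0 <= bint * rad n := ltW (mulr_gt0 bint_gt0 (rad_gt0 n)).
rewrite [leLHS]E lee_fin /C lerXn2r ?nnegrE ?divr_ge0//.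
by rewrite gtr0_norm ?dil_gt0// ler_pdivrMr ?dil_gt0// ler_peMr// ltW// dil_gt1.
Qed.

Lemma integrable_K n x : leb2.-integrable setT (EFin \o K n x).
Proof.
apply/integrableP; split; first by apply/measurable_EFinP; exact: measurable_K.
under eq_integral => y _ do rewrite /= ger0_norm ?K_ge0//.
by rewrite integral_K ltry.
Qed.

Lemma Rintegral_K n x : \int[leb2]_y (K n x y) = C n.
Proof. by rewrite /Rintegral integral_K. Qed.

Lemma integrable_Ksq n x f : L2 setT f -> leb2.-integrable setT (EFin \o (fun y => K n x y * f y ^+ 2)).
Proof.
move=> Lf; have [M M0 hM] := kern_bounded 0 0 (rad n).
have iM : leb2.-integrable setT (EFin \o (fun y => M * f y ^+ 2)).
  have := integrableZl measurableT M (@sqi_integrable R _ _ leb2 setT f Lf).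
  by apply: eq_integrable => // y _; rewrite /= EFinM.
apply: (le_integrable measurableT _ _ iM) => [|y _].
  apply/measurable_EFinP; apply: measurable_funM; first exact: measurable_K.
  by apply: measurable_funX; case: Lf.
rewrite /= lee_fin (normrM (K n x y)) (normrM M) ler_wpM2r//.
by apply: (le_trans (hM _)); exact: ler_norm.
Qed.

(** Jensen's inequality, obtained by expanding the nonnegative integral of [K * (f - m)^2] with [m]
    the mean. *)
Lemma moll_sq_le n f x : L2 setT f ->
  ((moll n f x ^+ 2)%:E <= ((C n)^-1)%:E * \int[leb2]_y (K n x y * f y ^+ 2)%:E)%E.
Proof.
move=> Lf; set m := moll n f x.
have I1 := integrable_Ksq n x Lf.
have I2 : leb2.-integrable setT (EFin \o (fun y => K n x y * f y)).
  exact: (integrable_kern 0 0 (dil n * x.1, dil n * x.2) (rad_gt0 n) Lf).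
have I3 := integrable_K n x.
have C0 : 0 < C n by exact: mass_gt0.
have mE : \int[leb2]_y (K n x y * f y) = C n * m by rewrite /m /moll mulrA divff ?mul1r// gt_eqF.
have : 0 <= \int[leb2]_y (K n x y * (f y - m) ^+ 2).
  by apply: Rintegral_ge0 => y _; rewrite mulr_ge0 ?sqr_ge0// K_ge0.
have I2' := integrableZl measurableT (- (2 * m)) I2; have I3' := integrableZl measurableT (m ^+ 2) I3.
have -> : \int[leb2]_y (K n x y * (f y - m) ^+ 2) =
    \int[leb2]_y (K n x y * f y ^+ 2 + (- (2 * m) * (K n x y * f y) + m ^+ 2 * K n x y)).
  by apply: eq_Rintegral => y _; ring.
have J2 : leb2.-integrable setT (EFin \o (fun y => - (2 * m) * (K n x y * f y))).
  by apply: eq_integrable I2' => // y _; rewrite /= EFinM.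
have J3 : leb2.-integrable setT (EFin \o (fun y => m ^+ 2 * K n x y)).
  by apply: eq_integrable I3' => // y _; rewrite /= EFinM.
have J23 : leb2.-integrable setT (EFin \o (fun y => - (2 * m) * (K n x y * f y) + m ^+ 2 * K n x y)).
  by apply: eq_integrable (integrableD measurableT J2 J3).
rewrite (RintegralD measurableT I1 J23) (RintegralD measurableT J2 J3).
rewrite RintegralZl// RintegralZl// mE Rintegral_K => h.
have -> : (\int[leb2]_y (K n x y * f y ^+ 2)%:E)%E = (\int[leb2]_y (K n x y * f y ^+ 2))%:E.
  by rewrite /Rintegral fineK//; exact: integrable_fin_num I1.
by rewrite -EFinM lee_fin mulrC ler_pdivlMr//; nra.
Qed.

Lemma measurable_K2 n : measurable_fun setT (fun p : plane * plane => K n p.1 p.2).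
Proof.
have mk : measurable_fun setT (kern 0 0 (rad n) : plane -> R).
  apply: continuous_measurable2.
  have -> : (kern 0 0 (rad n) : R * R -> R) = (fun y => kern 0 0 (rad n) (1 * y.1 + 0, 1 * y.2 + 0)).
    by apply/funext => -[y1 y2]; rewrite /= !mul1r !addr0.
  exact: (@Ck_continuous R 0 _ (Ck_kern 0 0 0 (rad n) 1 0 1 0)).
have m11 : measurable_fun setT (fun p : plane * plane => p.1.1) by exact: measurableT_comp measurable_fst measurable_fst.
have m12 : measurable_fun setT (fun p : plane * plane => p.1.2) by exact: measurableT_comp measurable_snd measurable_fst.
have m21 : measurable_fun setT (fun p : plane * plane => p.2.1) by exact: measurableT_comp measurable_fst measurable_snd.
have m22 : measurable_fun setT (fun p : plane * plane => p.2.2) by exact: measurableT_comp measurable_snd measurable_snd.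
have mp : measurable_fun setT (fun p : plane * plane => (dil n * p.1.1 - p.2.1, dil n * p.1.2 - p.2.2) : plane).
  by apply: measurable_fun_pair; apply: measurable_funB => //; exact: measurable_funM.
exact: measurableT_comp mk mp.
Qed.

(** Jensen's inequality followed by Tonelli's theorem: mollification is a contraction, the fact that
    lets approximability pass to limits. *)
Lemma nsq_moll n f : L2 setT f -> (nrm (moll n f) <= nrm f)%E.
Proof.
move=> Lf; have [mf _] := Lf; have C0 : 0 < C n by exact: mass_gt0.
have mf2 : measurable_fun setT (fun y : plane => (f y ^+ 2)%:E) by apply/measurable_EFinP; exact: measurable_funX.
have mG : measurable_fun (setT `*` setT) (fun p : plane * plane => (K n p.1 p.2 * f p.2 ^+ 2)%:E).
  rewrite setXTT; apply/measurable_EFinP; apply: measurable_funM; first exact: measurable_K2.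
  by apply: measurable_funX; exact: measurableT_comp mf measurable_snd.
have G0 (p : plane * plane) : (0 <= (K n p.1 p.2 * f p.2 ^+ 2)%:E)%E by rewrite lee_fin mulr_ge0 ?sqr_ge0 ?K_ge0.
have mI := measurable_integral_l (leb2s R) measurableT measurableT mG G0.
apply: (@le_trans _ _ (\int[leb2]_x (((C n)^-1)%:E * \int[leb2]_y (K n x y * f y ^+ 2)%:E))%E).
  apply: ge0_le_integral => //.
  - by move=> x _; rewrite lee_fin sqr_ge0.
  - by apply/measurable_EFinP; apply: measurable_funX; exact: measurable_moll.
  - exact: measurable_funeM.
  - by move=> x _; exact: moll_sq_le.
rewrite ge0_integralZl_EFin//; last 2 first.
- by move=> x _; apply: integral_ge0 => y _; exact: (G0 (x, y)).
- by rewrite invr_ge0 ltW.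
rewrite (@tonelli_setX _ _ plane plane R (leb2s R) (leb2s R) setT setT _ measurableT measurableT mG G0)/=.
apply: (@le_trans _ _ (((C n)^-1)%:E * \int[leb2]_y ((f y ^+ 2)%:E * (C n)%:E))%E).
  apply: lee_wpmul2l; first by rewrite lee_fin invr_ge0 ltW.
  apply: ge0_le_integral => //.
  - by move=> y _; apply: integral_ge0 => x _; exact: (G0 (x, y)).
  - exact: (measurable_integral_r (leb2s R) measurableT measurableT mG G0).
  - apply: emeasurable_funM => //.
  - move=> y _; under eq_integral => x _ do rewrite EFinM muleC.
    rewrite ge0_integralZl_EFin//; last 3 first.
    + by move=> x _; rewrite lee_fin K_ge0.
    + apply/measurable_EFinP; exact: (measurableT_comp (measurable_K2 n) (measurable_pair2 y)).
    + exact: sqr_ge0.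
    by rewrite lee_wpmul2l ?lee_fin ?sqr_ge0// integral_K_l.
rewrite ge0_integralZr//; last 2 first.
- by move=> y _; rewrite lee_fin sqr_ge0.
- by rewrite lee_fin ltW.
by rewrite muleCA -EFinM mulVf ?mule1// gt_eqF.
Qed.

Lemma moll_cst_on n f x c : L2 setT f ->
  (forall y, box (dil n * x.1, dil n * x.2) (rad n) y -> f y = c) -> moll n f x = c.
Proof.
move=> Lf fc; rewrite /moll /smear.
have -> : \int[leb2]_y (kern 0 0 (rad n) (dil n * x.1 - y.1, dil n * x.2 - y.2) * f y) = \int[leb2]_y (c * K n x y).
  apply: eq_Rintegral => y _.
  have [yb|yb] := pselect (box (dil n * x.1, dil n * x.2) (rad n) y); first by rewrite fc// mulrC.
  by rewrite /K (kern_supp 0 0 (rad_gt0 n) yb) mul0r mulr0.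
rewrite RintegralZl//; last exact: integrable_K.
by rewrite Rintegral_K mulrCA mulVf ?mulr1// gt_eqF ?mass_gt0.
Qed.

Definition approximable f : Prop := vanish (fun n => nrm (fun x => moll n f x - f x)%R).

Lemma approximable_lin f g (a b : R) : L2 setT f -> L2 setT g -> approximable f -> approximable g ->
  approximable (fun x => a * f x + b * g x).
Proof.
move=> Lf Lg Af Ag.
have m h : L2 setT h -> forall n, measurable_fun setT (fun x => moll n h x - h x)%R.
  by move=> Lh n; apply: measurable_funB; [exact: measurable_moll|case: Lh].
apply: (@vanish_le _ _ (fun n => (2 * a ^+ 2)%:E * nrm (fun x => moll n f x - f x)%R +
    (2 * b ^+ 2)%:E * nrm (fun x => moll n g x - g x)%R)%E).
  apply: nearW => n; apply: nsq_lin2 => //.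
  - by rewrite mulr_ge0// sqr_ge0.
  - by rewrite mulr_ge0// sqr_ge0.
  - exact: m.
  - exact: m.
  - by apply: (m (fun x => a * f x + b * g x)); apply: L2D => //; exact: L2Z.
  move=> x _; rewrite moll_lin//; set u := moll n f x; set v := moll n g x.
  by have := sqr_ge0 (a * (u - f x) - b * (v - g x)); nra.
by apply: vanishD; apply: vanishZ => //; rewrite mulr_ge0// sqr_ge0.
Qed.

(** The error for [f] is the error for [g] plus that for [f - g], and the latter is controlled by
    the norm of [f - g] because mollification is a contraction. *)
Lemma approximable_closed f : L2 setT f ->
  (forall e, 0 < e -> exists g, [/\ L2 setT g, approximable g & (nrm (fun x => f x - g x)%R <= e%:E)%E]) ->
  approximable f.
Proof.
move=> Lf H e e0.
have quarters (u : R) : u%:E = (2%:E * (u / 4)%:E + 2%:E * (u / 4)%:E)%E.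
  by rewrite -!EFinM -EFinD; congr EFin; field.
have e4 : 0 < e / 4 by rewrite divr_gt0.
have e16 : 0 < e / 4 / 4 by rewrite divr_gt0.
have [g [Lg Ag fg]] := H _ e16.
have Lfg := L2B measurableT Lf Lg.
have m h : L2 setT h -> forall n, measurable_fun setT (fun x => moll n h x - h x)%R.
  by move=> Lh n; apply: measurable_funB; [exact: measurable_moll|case: Lh].
near=> n.
have gn : (nrm (fun x => moll n g x - g x)%R <= (e / 4)%:E)%E by near: n; exact: Ag.
have dn : (nrm (fun x => moll n (fun x => f x - g x) x - (f x - g x))%R <= (e / 4)%:E)%E.
  apply: (@le_trans _ _ (2%:E * nrm (moll n (fun x => f x - g x)%R) + 2%:E * nrm (fun x => f x - g x)%R)%E).
    exact: (@nsqB _ _ _ leb2 setT measurableT _ _ (measurable_moll n Lfg) Lfg.1).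
  rewrite (quarters (e / 4)) leeD// lee_wpmul2l// (le_trans (nsq_moll n Lfg))//.
rewrite (_ : nrm _ = nrm (fun x => (moll n (fun x => f x - g x) x - (f x - g x)) + (moll n g x - g x))%R); last first.
  apply: eq_nsq => x _; have := moll_lin n 1 (-1) x Lf Lg.
  rewrite (_ : (fun y => 1 * f y + -1 * g y) = (fun x => f x - g x)); last by apply/funext => y; ring.
  by move=> ->; ring.
apply: (le_trans (@nsqD _ _ _ leb2 setT measurableT _ _ (m _ Lfg n) (m _ Lg n))).
by rewrite [leRHS](quarters e) leeD// lee_wpmul2l.
Unshelve. all: by end_near. Qed.

Lemma dil_rad_near (a r : R) : 0 < r -> \forall n \near \oo, `|dil n * a - a| + rad n < r.
Proof.
move=> r0; near=> n.
rewrite (_ : dil n * a - a = a / n.+1%:R); last by rewrite /dil; ring.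
rewrite normrM normfV (ger0_norm (ler0n _ _)) /rad -mulrDl ltr_pdivrMr//.
rewrite mulrC -ltr_pdivrMr//; apply: (@lt_le_trans _ _ n%:R); last by rewrite ler_nat.
by near: n; exact: nbhs_infty_gtr.
Unshelve. all: by end_near. Qed.

Lemma approximable_locally_cst f (r : R) (N : set (R * R)) : 0 <= r -> L2 setT f ->
  (forall x, `|f x| <= 1) -> (forall x, ~ box (0, 0) r x -> f x = 0) ->
  measurable N -> leb2 N = 0%E ->
  (forall x, ~ N x -> exists2 e : R, 0 < e & forall y, box x e y -> f y = f x) ->
  approximable f.
Proof.
move=> r0 Lf f1 f0 mN N0 loc; have [mf _] := Lf.
have rd0 : 0 <= r + delta by rewrite addr_ge0// ltW.
have mB := measurable_box (0, 0) (r + delta).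
pose F n x := ((moll n f x - f x) ^+ 2)%:E.
(* Both [f] and its mollifications are bounded by 1 and vanish off this box, so the squared
   difference is at most 4 there. *)
pose G (x : R * R) : \bar R := (4%:E * (\1_(box (0, 0) (r + delta)) x)%:E)%E.
have bd n x : `|moll n f x| <= 1.
  rewrite /moll normrM gtr0_norm ?invr_gt0 ?mass_gt0// mulrC ler_pdivrMr ?mass_gt0// mul1r.
  rewrite -[leRHS](Rintegral_K n x) /smear.
  have I1 := integrable_kern 0 0 (dil n * x.1, dil n * x.2) (rad_gt0 n) Lf.
  apply: (le_trans (le_normr_Rintegral measurableT I1)).
  apply: le_Rintegral => //; [exact: integrable_norm I1|exact: integrable_K|].
  by move=> y _; rewrite normrM (ger0_norm (kern00_ge0 _ _)) ler_piMr ?kern00_ge0.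
have sup n x : ~ box (0, 0) (r + delta) x -> moll n f x = 0.
  move=> nb; apply: moll_cst_on => // y [y1 y2]; apply: f0 => -[]; rewrite /= !subr0 => z1 z2.
  have rn : rad n <= delta by rewrite /rad ler_pdivrMr// ler_peMr ?(ltW delta0)// ler1n.
  apply: nb; have key (a b : R) : `|b - dil n * a| <= rad n -> `|b| <= r -> `|a| <= r + delta.
    move=> h1 h2; apply: (@le_trans _ _ `|dil n * a|).
      by rewrite normrM ler_peMl// gtr0_norm ?dil_gt0// ltW ?dil_gt1.
    rewrite (_ : dil n * a = b - (b - dil n * a)); last by ring.
    by apply: le_trans (ler_normB _ _) _; apply: lerD => //; exact: le_trans rn.
  by split; rewrite /= subr0; [exact: key y1 z1|exact: key y2 z2].
have mF n : measurable_fun setT (F n).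
  by apply/measurable_EFinP; apply: measurable_funX; apply: measurable_funB => //; exact: measurable_moll.
have iG : leb2.-integrable setT G.
  apply: integrableZl => //; apply/integrableP; split; first by apply/measurable_EFinP; exact: measurable_indic.
  under eq_integral => y _ do rewrite /= ger0_norm//.
  by rewrite integral_box_indic// ltry.
have FG n x : (`|F n x| <= G x)%E.
  rewrite /F /G gee0_abs ?lee_fin ?sqr_ge0// indicE; have [xb|xb] := pselect (box (0, 0) (r + delta) x).
    rewrite mem_set//= mulr1 -(real_normK (num_real _)).
    have : `|moll n f x - f x| <= 2.
      by rewrite (le_trans (ler_normB _ _))// -[leRHS]/(1 + 1) lerD.
    by have := normr_ge0 (moll n f x - f x); nra.
  rewrite memNset//= mulr0 sup// f0 ?subr0 ?expr0n//.
  by move=> [h1 h2]; apply: xb; split; [apply: le_trans h1 _|apply: le_trans h2 _]; rewrite lerDl ltW.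
have cv : {ae leb2, forall x, setT x -> F ^~ x @ \oo --> (cst 0%E) x}.
  exists N; split => // x /=; apply: contra_notP => Nx _.
  have [e e0 he] := loc x Nx.
  apply: cvg_near_cst; near=> n.
  rewrite /F (moll_cst_on (c := f x)) ?subrr ?expr0n// => y [/= y1 y2]; apply: he; split.
    rewrite (_ : y.1 - x.1 = (y.1 - dil n * x.1) + (dil n * x.1 - x.1)); last by ring.
    apply: le_trans (ler_normD _ _) _; rewrite addrC ltW//.
    apply: (@le_lt_trans _ _ (`|dil n * x.1 - x.1| + rad n)); first by rewrite lerD2l.
    by near: n; exact: dil_rad_near.
  rewrite (_ : y.2 - x.2 = (y.2 - dil n * x.2) + (dil n * x.2 - x.2)); last by ring.
  apply: le_trans (ler_normD _ _) _; rewrite addrC ltW//.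
  apply: (@le_lt_trans _ _ (`|dil n * x.2 - x.2| + rad n)); first by rewrite lerD2l.
  by near: n; exact: dil_rad_near.
have FG' : {ae leb2, forall x n, setT x -> (`|F n x| <= G x)%E} by apply: aeW => x n _; exact: FG.
have [_ _] := @dominated_convergence _ _ _ leb2 setT measurableT F (cst 0%E) G mF (measurable_cst _) cv iG FG'.
rewrite integral0; move=> h; apply/vanishP; first by move=> n; exact: nsq_ge0.
exact: h.
Unshelve. all: by end_near. Qed.
End mollifier.

(** * Convergence of mollifications in L2 *)

Section approximation.
Variable R : realType.
Notation leb2 := (@leb2 R).
Notation mu := (@lebesgue_measure R).
Notation nrm := (nsq leb2 setT).

Definition ocitvT (A : set R) : Prop := ocitv A \/ A = setT.

Lemma setI_ocitvT : setI_closed ocitvT.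
Proof.
move=> A B [oA|->] [oB|->]; rewrite ?setIT ?setTI; [|by left|by left|by right].
left; exact: (@measurableI _ (ocitv_type R)).
Qed.

Definition boxes : set (set (R * R)) := [set A `*` B | A in ocitvT & B in ocitvT].

Lemma setI_boxes : setI_closed boxes.
Proof.
move=> _ _ [A oA [B oB <-]] [A' oA' [B' oB' <-]].
exists (A `&` A'); first exact: setI_ocitvT.
exists (B `&` B'); first exact: setI_ocitvT.
by rewrite setXI.
Qed.

Lemma measurable_boxes (X : set (R * R)) : measurable X <-> <<s boxes >> X.
Proof.
have sB := @smallest_sigma_algebra _ setT boxes.
split=> [|]; last first.
  apply: smallest_sub; first exact: sigma_algebra_measurable.
  move=> _ [A oA [B oB <-]].
  have mo (C : set R) : ocitvT C -> measurable C by move=> [oC|->] //; apply: sub_sigma_algebra; exact: oC.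
  by apply: measurableX; exact: mo.
rewrite measurable_prod_measurableType; apply: smallest_sub => // _ [A mA [B mB <-]].
have key (p : R * R -> R) : (forall C, ocitv C -> <<s boxes >> (p @^-1` C)) ->
    forall C : set R, measurable C -> <<s boxes >> (p @^-1` C).
  move=> h C; apply: (smallest_sub (C := sigma_algebra setT) (X := [set C | <<s boxes >> (p @^-1` C)])) => //.
  split=> [|D sD|F sF] /=.
  - by rewrite preimage_set0; case: sB.
  - by rewrite setTD preimage_setC -setTD; case: sB => _ + _; apply.
  - by rewrite preimage_bigcup; case: sB => _ _; apply.
have -> : A `*` B = (fst @^-1` A) `&` (snd @^-1` B) by [].
have sI (C D : set (R * R)) : <<s boxes >> C -> <<s boxes >> D -> <<s boxes >> (C `&` D).
  by move=> sC sD; exact: (@measurableI _ (g_sigma_algebraType boxes)).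
apply: sI.
- apply: key => // C oC; apply: sub_sigma_algebra; exists C; first by left.
  by exists setT; [right|apply/seteqP; split=> [x []|x ?]].
- apply: key => // C oC; apply: sub_sigma_algebra; exists setT; first by right.
  by exists C; [left|apply/seteqP; split=> [x []|x ?]].
Qed.

Variable delta : R.
Hypothesis delta0 : 0 < delta.
Notation approx := (approximable delta).

(** Almost every point has a neighbourhood that lies in [A] or in its complement. Intervals have
    this property, and it makes their indicators locally constant almost everywhere. *)
Definition tame (A : set R) : Prop :=
  exists2 E : set R, measurable E /\ mu E = 0%E &
    forall x, ~ E x -> exists2 e : R, 0 < e & forall y, `|y - x| <= e -> (A y <-> A x).

Lemma tame_ray b (a : R) : tame [set` Interval -oo%O (BSide b a)].
Proof.
exists [set a]; first by split => //; exact: lebesgue_measure_set1.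
move=> x /eqP xa; exists (`|x - a| / 2); first by rewrite divr_gt0// normr_gt0 subr_eq0.
move=> y; rewrite /= !in_itv /=; case: b => /=; rewrite ler_distl => /andP[h1 h2].
- by move: xa h1 h2; rewrite neq_lt => /orP[] xa; [rewrite ltr0_norm ?subr_lt0//|rewrite gtr0_norm ?subr_gt0//] => h1 h2; split=> ?; lra.
- by move: xa h1 h2; rewrite neq_lt => /orP[] xa; [rewrite ltr0_norm ?subr_lt0//|rewrite gtr0_norm ?subr_gt0//] => h1 h2; split=> ?; lra.
Qed.

Lemma tameT : tame setT.
Proof. by exists set0 => [|x _]; [split|exists 1]. Qed.

Lemma tameC A : tame A -> tame (~` A).
Proof.
move=> [E mE hE]; exists E => // x /hE[e e0 he]; exists e => // y /he h.
by split => + /h.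
Qed.

Lemma tameI A B : tame A -> tame B -> tame (A `&` B).
Proof.
move=> [E [mE E0] hE] [F [mF F0] hF]; exists (E `|` F).
  by split; [exact: measurableU|rewrite measureU0].
move=> x /not_orP[/hE[e e0 he] /hF[f f0 hf]]; exists (Num.min e f); first by rewrite lt_min e0.
by move=> y; rewrite le_min => /andP[/he h1 /hf h2]; split=> -[/h1 ? /h2 ?].
Qed.

Lemma tame_itv (a b : R) b0 b1 : tame [set` Interval (BSide b0 a) (BSide b1 b)].
Proof.
have -> : [set` Interval (BSide b0 a) (BSide b1 b)] =
    ~` [set` Interval -oo%O (BSide b0 a)] `&` [set` Interval -oo%O (BSide b1 b)].
  apply/seteqP; split => x /=; rewrite !in_itv /=.
    move=> /andP[h1 h2]; split => //; case: b0 h1 => /= h1; apply/negP.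
      by rewrite -leNgt.
    by rewrite -ltNge.
  move=> [/negP h1 h2]; rewrite h2 andbT; case: b0 h1 => /=.
    by rewrite -leNgt.
  by rewrite -ltNge.
by apply: tameI; [apply: tameC|]; exact: tame_ray.
Qed.

Definition square (m : nat) : set (R * R) := box (0, 0) m%:R.

Lemma measurable_square m : measurable (square m : set (R * R)).
Proof. exact: measurable_box. Qed.

Definition ind m (X : set (R * R)) : R * R -> R := \1_(X `&` square m).

Lemma ind_L2 m X : measurable X -> L2 setT (ind m X).
Proof.
move=> mX; have mI : measurable (X `&` square m) by apply: measurableI => //; exact: measurable_square.
split; first exact: measurable_indic.
apply: (@le_lt_trans _ _ (leb2 (square m))); last by rewrite leb2_box// ltry.
have -> : (\int[leb2]_x (ind m X x ^+ 2)%:E = \int[leb2]_x (\1_(X `&` square m) x)%:E)%E.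
  by apply: eq_integral => x _; rewrite /ind indicE; case: (_ \in _); rewrite ?expr1n ?expr0n.
rewrite integral_indic// setIT.
by apply: le_measure; rewrite ?inE//; exact: measurable_square.
Qed.

Lemma approx_tame m A B : tame A -> tame B -> measurable A -> measurable B -> approx (ind m (A `*` B)).
Proof.
move=> tA tB mA mB.
have mAB : measurable (A `*` B : set (R * R)) by exact: measurableX.
have tm : tame `[- m%:R, m%:R]%classic by exact: tame_itv.
have [E [mE E0] hE] := tameI tA tm; have [F [mF F0] hF] := tameI tB tm.
have supp x : (A `*` B `&` square m) x <->
    (A `&` `[- m%:R, m%:R]) x.1 /\ (B `&` `[- m%:R, m%:R]) x.2.
  rewrite /square /box /= !in_itv /= !subr0 !ler_norml; tauto.
apply: (@approximable_locally_cst _ _ delta0 _ m%:R (E `*` setT `|` setT `*` F)) => //.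
- exact: ind_L2.
- by move=> x; rewrite /ind indicE; case: (_ \in _); rewrite ?normr1 ?normr0.
- by move=> x nb; rewrite /ind indicE memNset// => -[].
- by apply: measurableU; exact: measurableX.
- have z1 : leb2 (E `*` setT) = 0%E.
    by transitivity (mu E * mu setT)%E; [exact: (product_measure1E mu mu mE measurableT)|rewrite E0 mul0e].
  have z2 : leb2 (setT `*` F) = 0%E.
    by transitivity (mu setT * mu F)%E; [exact: (product_measure1E mu mu measurableT mF)|rewrite F0 mule0].
  rewrite -[RHS]z1; apply: measureU0 => //; exact: measurableX.
- move=> x /not_orP[nE nF].
  have [|e e0 he] := hE x.1; first by move=> Ex; apply: nE; split.
  have [|f f0 hf] := hF x.2; first by move=> Ex; apply: nF; split.
  exists (Num.min e f); first by rewrite lt_min e0.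
  move=> y [] /=; rewrite !le_min => /andP[h1 _] /andP[_ h2].
  rewrite /ind !indicE; congr (_%:R); congr nat_of_bool.
  have := he _ h1; have := hf _ h2 => k2 k1.
  apply/idP/idP; rewrite !inE => /supp[s1 s2]; apply/supp; split.
  + exact/k1.
  + exact/k2.
  + exact/k1.
  + exact/k2.
Qed.

Lemma nsq_ind m X : measurable X -> nrm (ind m X) = leb2 (X `&` square m).
Proof.
move=> mX; have mI : measurable (X `&` square m) by apply: measurableI => //; exact: measurable_square.
transitivity (\int[leb2]_x (\1_(X `&` square m) x)%:E)%E; last by rewrite integral_indic// setIT.
by apply: eq_integral => x _; rewrite /ind indicE; case: (_ \in _); rewrite ?expr1n ?expr0n.
Qed.

(** Dynkin's argument: the property holds on boxes, a family stable under intersection, and passes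
    to complements and disjoint countable unions. *)
Lemma approx_ind m X : measurable X -> approx (ind m X).
Proof.
move=> mX; have /measurable_boxes sX := mX.
have GE : measurable = <<s boxes >> by apply/funext => Y; apply/propext; exact: measurable_boxes.
have ocT (C : set R) : ocitvT C -> tame C /\ measurable C.
  move=> [oC|->]; last by split => //; exact: tameT.
  split; last by apply: sub_sigma_algebra; exact: oC.
  move: oC => /ocitvP[->|[[a b] /= _ ->]]; last exact: tame_itv.
  by rewrite -setCT; apply: tameC; exact: tameT.
have PT : approx (ind m setT) by rewrite -setXTT; apply: approx_tame => //; exact: tameT.
apply: (@dynkin_induction _ _ boxes (fun X => approx (ind m X)) GE setI_boxes PT) => //.
- by move=> _ [A /ocT[tA mA] [B /ocT[tB mB] <-]]; exact: approx_tame.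
- move=> S mS aS.
  have -> : ind m (~` S) = (fun x => 1 * ind m setT x + -1 * ind m S x).
    apply/funext => x; rewrite /ind !indicE !in_setI in_setT in_setC /=.
    by case: (x \in S); case: (x \in square m) => /=; ring.
  by apply: approximable_lin => //; exact: ind_L2.
- move=> F mF tF aF.
  pose G n := \big[setU/set0]_(i < n) F i.
  have mG n : measurable (G n) by apply: bigsetU_measurable.
  have mU : measurable (\bigcup_k F k) by exact: bigcup_measurable.
  have aG n : approx (ind m (G n)).
    elim: n => [|n IH].
      rewrite /G big_ord0.
      have -> : ind m set0 = (fun x => 0 * ind m setT x + 0 * ind m setT x).
        by apply/funext => x; rewrite /ind indicE set0I in_set0 !mul0r addr0.
      by apply: approximable_lin => //; exact: ind_L2.
    have -> : ind m (G n.+1) = (fun x => 1 * ind m (G n) x + 1 * ind m (F n) x).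
      apply/funext => x; rewrite /ind /G big_ord_recr /= -/(G n) !indicE (in_setI x (G n `|` F n)) (in_setI x (G n)) (in_setI x (F n)) in_setU.
      have [xG|xG] := boolP (x \in G n); have [xF|xF] := boolP (x \in F n); case: (x \in square m) => /=; try ring.
      exfalso; move: xG xF; rewrite !inE /G -bigcup_mkord => -[i /= lin Fi] Fn.
      by have := tF i n I I (ex_intro _ x (conj Fi Fn)) => E; move: lin; rewrite E ltnn.
    by apply: approximable_lin => //; exact: ind_L2.
  apply: (@approximable_closed _ _ delta0) => [|e e0]; first exact: ind_L2.
  (* The tails of the union decrease to the empty set inside a square of finite measure; their
     measure, which is the squared error of the partial unions, tends to 0. *)
  pose D n := (\bigcup_k F k `\` G n) `&` square m.
  have mD n : measurable (D n).
    by apply: measurableI; [exact: measurableD|exact: measurable_square].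
  have D0 : (leb2 (D 0%N) < +oo)%E.
    apply: (@le_lt_trans _ _ (leb2 (square m))); last by rewrite leb2_box// ltry.
    exact: (@le_measure _ _ _ leb2 (D 0%N) (square m) (mem_set (mD 0%N)) (mem_set (measurable_square m)) (@subIsetr _ _ _)).
  have Dcap : \bigcap_n D n = set0.
    rewrite -subset0 => x Dx; have [[[k _ Fk] _] _] := Dx 0%N I.
    have [[_ + ] _] := Dx k.+1 I; apply; rewrite /G -bigcup_mkord; exists k => //=.
  have nD : nonincreasing_seq D.
    apply/nonincreasing_seqP => n; apply/subsetPset => x [[Ux Gx] sx]; split => //; split => //.
    by move=> Gn; apply: Gx; rewrite /G big_ord_recr /=; left.
  have := nonincreasing_cvg_mu D0 mD (bigcapT_measurable mD) nD.
  rewrite Dcap measure0 => /vanishP => /(_ (fun n => measure_ge0 _ _)) /(_ e e0) [N _ hN].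
  exists (ind m (G N)); split; [exact: ind_L2|exact: aG|].
  apply: le_trans (hN N (leqnn N)); rewrite [leLHS](_ : _ = nrm (ind m (\bigcup_k F k `\` G N))).
    by rewrite nsq_ind//; exact: measurableD.
  apply: eq_nsq => x _; rewrite /ind !indicE (in_setI x (\bigcup_k F k)) (in_setI x (G N)) (in_setI x (\bigcup_k F k `\` G N)) in_setD.
  have [xG|xG] := boolP (x \in G N); have [xF|xF] := boolP (x \in \bigcup_k F k); case: (x \in square m) => /=; try ring.
  exfalso; move: xF => /negP; apply; move: xG; rewrite !inE /G -bigcup_mkord => -[i _ Fi]; by exists i.
Qed.

Import HBNNSimple.

Lemma approx_nonneg f : L2 setT f -> (forall x, 0 <= f x) -> approx f.
Proof.
move=> Lf f0; have [mf _] := Lf.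
have mE : measurable_fun setT (EFin \o f) by exact/measurable_EFinP.
pose h := nnsfun_approx measurableT mE.
have Ef0 (y : R * R) : setT y -> (0 <= (EFin \o f) y)%E by move=> _; rewrite lee_fin.
have hcv x : (fun n => h n x) @ \oo --> f x.
  by have /fine_cvgP[_] := cvg_nnsfun_approx measurableT mE Ef0 (I : setT x); exact.
have hf n x : h n x <= f x.
  have nd : nondecreasing_seq (fun n => h n x) by move=> a b ab; exact/lefP/nd_nnsfun_approx.
  have cv := hcv x.
  by have := nondecreasing_cvgn_le nd (cvgP _ cv) n; rewrite (cvg_lim _ cv).
(* Truncation to squares makes each simple approximant a finite combination of truncated
   indicators. *)
pose g n x := h n x * \1_(square n) x.
have mg n : measurable_fun setT (g n).
  by apply: measurable_funM => //; apply: measurable_indic; exact: measurable_square.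
have g0 n x : 0 <= g n x by rewrite mulr_ge0.
have gf n x : g n x <= f x.
  by rewrite /g indicE; case: (_ \in _); rewrite ?mulr1 ?mulr0.
have Lg n : L2 setT (g n).
  split => //; apply: le_lt_trans Lf.2; apply: ge0_le_integral => //.
  - by move=> x _; rewrite lee_fin sqr_ge0.
  - exact: (measurable_sq (mg n)).
  - exact: (measurable_sq mf).
  - by move=> x _; rewrite lee_fin lerXn2r ?nnegrE.
have ag n : approx (g n).
  have Lr r : L2 setT (ind n (h n @^-1` [set r])) by exact: ind_L2.
  have fin : finite_set (range (h n)) by [].
  pose s : seq R := finmap.enum_fset (fset_set (range (h n))).
  have gE x : g n x = \sum_(r <- s) r * ind n (h n @^-1` [set r]) x.
    rewrite /g (fimfunE (h n) x) fsbig_finite//= mulr_suml; apply: eq_bigr => r _.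
    by rewrite /ind -mulrA indicI.
  have -> : g n = (fun x => \sum_(r <- s) r * ind n (h n @^-1` [set r]) x) by apply/funext.
  suff [] : L2 setT (fun x => \sum_(r <- s) r * ind n (h n @^-1` [set r]) x) /\
    approx (fun x => \sum_(r <- s) r * ind n (h n @^-1` [set r]) x) by [].
  elim: (s : seq R) => [|r t [IL IA]].
    have -> : (fun x => \sum_(r <- [::]) r * ind n (h n @^-1` [set r]) x) = (fun x => 0 * ind n setT x + 0 * ind n setT x).
      by apply/funext => x; rewrite big_nil !mul0r addr0.
    split; first by apply: L2D => //; apply: L2Z => //; exact: ind_L2.
    by apply: approximable_lin => //; try exact: ind_L2; exact: approx_ind.
  have -> : (fun x => \sum_(r <- r :: t) r * ind n (h n @^-1` [set r]) x) =
     (fun x => r * ind n (h n @^-1` [set r]) x + 1 * \sum_(r <- t) r * ind n (h n @^-1` [set r]) x).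
    by apply/funext => x; rewrite big_cons mul1r.
  split; first by apply: L2D => //; exact: L2Z.
  by apply: approximable_lin => //; exact: approx_ind.
apply: (@approximable_closed _ _ delta0) => // e e0.
pose F n x := ((f x - g n x) ^+ 2)%:E.
have mF n : measurable_fun setT (F n) by apply: measurable_sq; exact: measurable_funB.
have iG := @sqi_integrable R _ _ leb2 setT f Lf.
have cv : {ae leb2, forall x, setT x -> F ^~ x @ \oo --> (cst 0%E : R * R -> \bar R) x}.
  apply: aeW => x _ /=.
  have c2 : (fun n => (f x - h n x) ^+ 2) @ \oo --> 0.
    have d : (fun n => f x - h n x) @ \oo --> 0.
      by rewrite -[X in _ --> X](subrr (f x)); apply: cvgB => //; exact: cvg_cst.
    have -> : (fun n => (f x - h n x) ^+ 2) = (fun n => (f x - h n x) * (f x - h n x)).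
      by apply/funext => n; rewrite expr2.
    by rewrite -[X in _ --> X](mulr0 (0 : R)); exact: cvgM.
  suff : (fun n => (f x - g n x) ^+ 2) @ \oo --> 0 by move=> h2; apply/fine_cvgP; split; [exact: nearW|exact: h2].
  apply: cvg_trans c2; apply: near_eq_cvg; near=> n; rewrite /g indicE mem_set ?mulr1//.
  split; rewrite /= subr0.
    by near: n; exact: nbhs_infty_ger.
  by near: n; exact: nbhs_infty_ger.
have FG : {ae leb2, forall x n, setT x -> (`|F n x| <= (f x ^+ 2)%:E)%E}.
  apply: aeW => x n _; rewrite gee0_abs ?lee_fin ?sqr_ge0// lerXn2r ?nnegrE ?subr_ge0//.
  by rewrite lerBlDr lerDl.
have [_ _] := @dominated_convergence _ _ _ leb2 setT measurableT F (cst 0%E) _ mF (measurable_cst _) cv iG FG.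
rewrite integral0 => /vanishP => /(_ (fun n => nsq_ge0 _ _ _)) /(_ e e0) [N _ hN].
by exists (g N); split => //; exact: (hN N (leqnn N)).
Unshelve. all: by end_near. Qed.

Lemma mollifier_approximation f : L2 setT f -> approx f.
Proof.
move=> Lf; have [mf _] := Lf.
pose fp x := Num.max (f x) 0; pose fn x := Num.max (- f x) 0.
have mp : measurable_fun setT fp by exact: measurable_maxr.
have mn : measurable_fun setT fn by apply: measurable_maxr => //; exact: measurableT_comp.
have L (u : R * R -> R) : measurable_fun setT u -> (forall x, `|u x| <= `|f x|) -> L2 setT u.
  move=> mu' uf; split => //; apply: le_lt_trans Lf.2; apply: ge0_le_integral => //.
  - by move=> x _; rewrite lee_fin sqr_ge0.
  - exact: (measurable_sq mu').
  - exact: (measurable_sq mf).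
  - by move=> x _; rewrite lee_fin -[leLHS]real_normK ?num_real// -[leRHS]real_normK ?num_real// lerXn2r ?nnegrE.
have -> : f = (fun x => 1 * fp x + -1 * fn x).
  apply/funext => x; rewrite /fp /fn; have [h|h] := leP 0 (f x).
    by rewrite max_r ?oppr_le0//; ring.
  by rewrite max_l ?oppr_ge0 ?(ltW h)//; ring.
apply: approximable_lin => //.
- by apply: L => // x; rewrite /fp /Num.max; case: ltP => // _; rewrite normr0.
- by apply: L => // x; rewrite /fn /Num.max; case: ltP => // _; rewrite ?normrN ?normr0.
- apply: approx_nonneg; last by move=> x; rewrite /fp le_max lexx orbT.
  by apply: L => // x; rewrite /fp /Num.max; case: ltP => // _; rewrite normr0.
- apply: approx_nonneg; last by move=> x; rewrite /fn le_max lexx orbT.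
  by apply: L => // x; rewrite /fn /Num.max; case: ltP => // _; rewrite ?normrN ?normr0.
Qed.
End approximation.

(** * Zero extension, test functions and uniqueness of weak gradients *)

Section zero_extension.
Variable R : realType.
Implicit Types (f g u v : R * R -> R) (U : set (R * R)).
Notation leb2 := (@leb2 R).

Definition zext U u : R * R -> R := u \_ U.

Lemma zext_in U u x : U x -> zext U u x = u x.
Proof. by move=> Ux; rewrite /zext patchE mem_set. Qed.

Lemma measurable_zext U u : measurable U -> measurable_fun U u -> measurable_fun setT (zext U u).
Proof. by move=> mU mu; have [h _] := measurable_restrictT u mU; exact: h. Qed.

Lemma nsq_zext U u : nsq leb2 setT (zext U u) = nsq leb2 U u.
Proof.
rewrite /nsq [RHS]integral_mkcond; apply: eq_integral => x _.
by rewrite /zext !patchE; case: ifP => // _; rewrite expr0n.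
Qed.

Lemma L2_zext U u : measurable U -> L2 U u -> L2 setT (zext U u).
Proof.
move=> mU [mu Lu]; split; first exact: measurable_zext.
by have := nsq_zext U u; rewrite /nsq => ->.
Qed.

Lemma nsqS U V u : measurable U -> measurable V -> measurable_fun V u -> U `<=` V ->
  (nsq leb2 U u <= nsq leb2 V u)%E.
Proof.
move=> mU mV mu UV; rewrite /nsq; apply: ge0_subset_integral => //; first exact: measurable_sq.
by move=> x _; rewrite lee_fin sqr_ge0.
Qed.

Lemma L2S U V u : measurable U -> measurable V -> U `<=` V -> L2 V u -> L2 U u.
Proof.
move=> mU mV UV [mu Lu]; split; first exact: measurable_funS mu.
exact: le_lt_trans (nsqS mU mV mu UV) Lu.
Qed.

Lemma Rintegral_zext U u v : \int[leb2]_x (v x * zext U u x) = \int[leb2]_(x in U) (u x * v x).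
Proof.
rewrite /Rintegral [in RHS]integral_mkcond; congr fine; apply: eq_integral => x _.
by rewrite /zext !patchE; case: ifP => // _; [rewrite mulrC|rewrite mulr0].
Qed.

Lemma compact_box (a : R * R) (r : R) : compact (box a r).
Proof. by rewrite boxE; apply: compact_setX; exact: segment_compact. Qed.

Lemma closed_box (a : R * R) (r : R) : closed (box a r).
Proof. by apply: compact_closed; [exact: norm_hausdorff|exact: compact_box]. Qed.

Lemma test_fun_box U u a r : smooth u -> (forall x, ~ box a r x -> u x = 0) -> box a r `<=` U -> test_fun U u.
Proof.
move=> su u0 bU.
have sub : tsupport u `<=` box a r.
  rewrite (closure_id (box a r)).1; last exact: closed_box.
  by apply: closureS => x /= /eqP ux; apply: contrapT => /u0.
split => //; last exact: subset_trans bU.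
have cl : closed (tsupport u) by exact: closed_closure.
have cb := @compact_box a r.
apply: (@subclosed_compact _ (tsupport u) (box a r)) => //.
Qed.

(** The kernels are themselves test functions of [U], so weak identities can be evaluated on
    them. *)
Lemma test_fun_kern i j U (e : R) x : 0 < e -> box x e `<=` U ->
  test_fun U (fun y => kern i j e (x.1 - y.1, x.2 - y.2)).
Proof.
move=> e0 bU; apply: (test_fun_box (a := x) (r := e)) => //; last by move=> y; exact: kern_supp.
move=> k; have := Ck_kern k i j e (-1) x.1 (-1) x.2; congr (Ck k _).
by apply/funext => y; rewrite !mulN1r /= (addrC (- y.1)) (addrC (- y.2)).
Qed.

Lemma box_open_near U (x : R * R) : open U -> U x -> exists2 e : R, 0 < e & box x e `<=` U.
Proof.
move=> oU Ux; have /nbhs_ballP[e e0 be] : nbhs x U by exact: open_nbhs_nbhs.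
exists (e / 2); first by rewrite divr_gt0.
move=> y [h1 h2]; apply: be; split; rewrite /ball /= distrC.
  by apply: le_lt_trans h1 _; rewrite ltr_pdivrMr// ltr_pMr// ltr1n.
by apply: le_lt_trans h2 _; rewrite ltr_pdivrMr// ltr_pMr// ltr1n.
Qed.

Lemma dil_box_near (delta : R) U x : 0 < delta -> open U -> U x ->
  \forall n \near \oo, box (dil _ n * x.1, dil _ n * x.2) (rad delta n) `<=` U.
Proof.
move=> d0 oU /(box_open_near oU)[e e0 be]; near=> n.
have h1 : `|dil R n * x.1 - x.1| + rad delta n < e by near: n; exact: dil_rad_near.
have h2 : `|dil R n * x.2 - x.2| + rad delta n < e by near: n; exact: dil_rad_near.
have tr (a b c : R) : `|a - b| <= rad delta n -> `|b - c| + rad delta n < e -> `|a - c| <= e.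
  by move=> ab bc; have := ler_distD b a c; lra.
by move=> y /= [y1 y2]; apply: be; split; [exact: tr y1 h1|exact: tr y2 h2].
Unshelve. all: by end_near. Qed.

Lemma leb2_ae_filter : Filter (almost_everywhere leb2).
Proof. exact: (ae_filter_ringOfSetsType (leb2s R)). Qed.
#[local] Existing Instance leb2_ae_filter.

Lemma nsq_ae_zero U u : measurable U -> measurable_fun U u -> nsq leb2 U u = 0%E -> ae_zero U u.
Proof.
move=> mU mu n0; have mu2 := measurable_sq mu.
have /(ae_eq_integral_abs leb2 mU mu2) h : (\int[leb2]_(x in U) `|(u x ^+ 2)%:E| = 0)%E.
  by rewrite -n0; apply: eq_integral => x _; rewrite gee0_abs// lee_fin sqr_ge0.
by apply: filterS h => x /= h Ux; have /eqP := h Ux; rewrite eqe sqrf_eq0 => /eqP.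
Qed.

Lemma ae_zero_nsq U u : measurable U -> measurable_fun U u -> ae_zero U u -> nsq leb2 U u = 0%E.
Proof.
move=> mU mu h; rewrite /nsq -(integral0 leb2 U); apply: ae_eq_integral => //; first exact: measurable_sq.
by apply: filterS h => x /= h Ux; rewrite (h Ux) expr0n.
Qed.

(** Tested against kernels, the mollifications of [u] at a point of [U] are eventually 0, so the
    squared errors tend to [u^2] pointwise while their integrals tend to 0; Fatou's lemma gives a
    vanishing norm. *)
Lemma du_bois_reymond U u : open U -> L2 U u ->
  (forall phi, test_fun U phi -> \int[leb2]_(x in U) (u x * phi x) = 0) -> ae_zero U u.
Proof.
move=> oU Lu h; have mU := open_measurable2 oU; have d0 : (0 : R) < 1 by [].
have Lz := L2_zext mU Lu; have [mz _] := Lz.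
pose F n x := ((moll 1 n (zext U u) x - zext U u x) ^+ 2)%:E.
have mF n : measurable_fun U (F n).
  apply: measurable_funTS; apply: measurable_sq; apply: measurable_funB => //; exact: measurable_moll.
have F0 n x : U x -> (0 <= F n x)%E by move=> _; rewrite lee_fin sqr_ge0.
have := fatou leb2 mU mF F0.
have van : vanish (fun n => \int[leb2]_(x in U) F n x)%E.
  apply: vanish_le (mollifier_approximation d0 Lz); apply: nearW => n; apply: nsqS => //.
  apply: measurable_funB => //; exact: measurable_moll.
have n0 n : (0 <= \int[leb2]_(x in U) F n x)%E by apply: integral_ge0 => x; exact: F0.
have cv := (vanishP n0).1 van.
rewrite [leRHS](_ : _ = 0)%E; last first.
  by have [] := cvg_limn_einf_sup cv.
move=> le0; apply: nsq_ae_zero => //; first by case: Lu.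
apply/eqP; rewrite eq_le nsq_ge0 andbT; apply: le_trans le0; rewrite le_eqVlt; apply/orP; left; apply/eqP.
apply: eq_integral => x /set_mem Ux.
suff cF : F n x @[n --> \oo] --> ((u x) ^+ 2)%:E.
  by have [] := cvg_limn_einf_sup cF.
apply: cvg_near_cst; apply: filterS (dil_box_near d0 oU Ux) => n bU; rewrite /F zext_in// /moll /smear Rintegral_zext.
by rewrite (h _ (test_fun_kern 0 0 (rad_gt0 d0 n) bU)) mulr0 sub0r sqrrN.
Qed.

Lemma test_fun_supp U phi : test_fun U phi -> exists2 r : R, 0 <= r & forall x, ~ box (0, 0) r x -> phi x = 0.
Proof.
move=> [_ cphi _]; have [M' [_ hM]] := compact_bounded cphi.
exists (Num.max (M' + 1) 0); first by rewrite le_max lexx orbT.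
move=> x bx; apply: contrapT => /eqP px; apply: bx.
have : `|x| <= M' + 1 by apply: hM; rewrite ?ltrDl//; apply: subset_closure.
rewrite prod_normE ge_max => /andP[h1 h2].
by split; rewrite /= subr0 le_max ?h1 ?h2.
Qed.

Lemma test_fun_L2 U phi : open U -> test_fun U phi -> L2 U phi.
Proof.
move=> oU [sphi cphi sub]; have mU := open_measurable2 oU.
have cp : continuous phi := sphi 0%N.
have [M Mphi] : exists M : R, forall x, `|phi x| <= M.
  have [] := @compact_bounded R _ _ (continuous_compact (continuous_subspaceT (A := tsupport phi) cp) cphi) => M [_ hM].
  exists (Num.max (M + 1) 0) => x; have [->|/eqP px] := eqVneq (phi x) 0; first by rewrite normr0 le_max lexx orbT.
  by rewrite le_max hM ?ltrDl//; exists x => //; apply: subset_closure => /=; exact/eqP.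
have [r r0 hr] := test_fun_supp (And3 sphi cphi sub).
have mp := continuous_measurable2 cp.
apply: (L2S mU measurableT) => //; split => //.
apply: (@le_lt_trans _ _ (\int[leb2]_x ((M ^+ 2)%:E * (\1_(box (0, 0) r) x)%:E))%E).
  apply: ge0_le_integral => //.
  - by move=> x _; rewrite lee_fin sqr_ge0.
  - exact: measurable_sq.
  - by apply: measurable_funeM; apply/measurable_EFinP; apply: measurable_indic; exact: measurable_box.
  - move=> x _; rewrite -EFinM lee_fin indicE; case: (boolP (x \in _)) => [_|/negP xb].
      by rewrite mulr1 -[leLHS]real_normK ?num_real// lerXn2r ?nnegrE// (le_trans _ (Mphi x)).
    by rewrite mulr0 hr ?expr0n// => /mem_set.
rewrite ge0_integralZl_EFin ?sqr_ge0//; last first.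
  by apply/measurable_EFinP; apply: measurable_indic; exact: measurable_box.
by rewrite integral_box_indic// -EFinM ltry.
Qed.

Lemma weak_partial_unique U (g1 g2 : R * R -> R) : open U -> L2 U g1 -> L2 U g2 ->
  (forall phi, test_fun U phi -> \int[leb2]_(x in U) (g1 x * phi x) = \int[leb2]_(x in U) (g2 x * phi x)) ->
  ae_zero U (fun x => g1 x - g2 x).
Proof.
move=> oU L1 L2' h; have mU := open_measurable2 oU.
apply: du_bois_reymond => //; first exact: L2B.
move=> phi tp; have Lp := test_fun_L2 oU tp.
under eq_Rintegral do rewrite mulrBl.
rewrite RintegralB// ?h ?subrr//; exact: (@sqi_integrableM R _ _ leb2 U mU).
Qed.

Lemma weak_grad_unique U u (g h : R * R -> R * R) : open U -> weak_grad U u g -> weak_grad U u h ->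
  ae_zero U (fun x => (g x).1 - (h x).1) /\ ae_zero U (fun x => (g x).2 - (h x).2).
Proof.
move=> oU [g1 g2 Hg] [h1 h2 Hh]; split; apply: weak_partial_unique => // phi tp; apply: oppr_inj.
  by have [<- _] := Hg _ tp; have [<- _] := Hh _ tp.
by have [_ <-] := Hg _ tp; have [_ <-] := Hh _ tp.
Qed.
End zero_extension.

(** * Cut-off at infinity *)

Section cut_off.
Variable R : realType.
Implicit Types (f g u v : R * R -> R) (U : set (R * R)).
Notation leb2 := (@leb2 R).
Notation nrm := (nsq leb2 setT).

(** Normalised to 1 at the origin: it tends to 1 pointwise while its gradient is of order [1 / n].
    The summands [+ 0] put the arguments in the form of [Dk_affine]. *)
Definition chi n (x : R * R) : R := (bump 0 ^- 2) * (bump (n.+1%:R^-1 * x.1 + 0) * bump (n.+1%:R^-1 * x.2 + 0)).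

Lemma bump00 : 0 < bump 0 :> R. Proof. by rewrite bump_gt0// normr0. Qed.

Lemma smooth_chi n : smooth (chi n).
Proof.
move=> k; apply: CkM; first exact: Ck_cst.
by apply: (@Ck_tensor _ k (fun t => bump (n.+1%:R^-1 * t + 0)) (fun t => bump (n.+1%:R^-1 * t + 0)));
  apply: Dk_affine; exact: Dk_bump.
Qed.

Lemma measurable_chi n : measurable_fun setT (@chi n).
Proof. exact: continuous_measurable2 (smooth_chi n 0). Qed.

Lemma chi_eq0 n x : ~ box (0, 0) n.+1%:R x -> chi n x = 0.
Proof.
move=> bx; rewrite /chi !addr0.
have b0 (t : R) : n.+1%:R < `|t| -> bump (n.+1%:R^-1 * t) = 0.
  by move=> h; apply: (bumpn_eq0 0); rewrite normrM gtr0_norm ?invr_gt0// mulrC ltr_pdivlMr// mul1r.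
have [h1|h1] := leP `|x.1| n.+1%:R; last by rewrite b0// mul0r mulr0.
have [h2|h2] := leP `|x.2| n.+1%:R; last by rewrite (b0 x.2)// !mulr0.
by exfalso; apply: bx; split; rewrite /= subr0.
Qed.

Lemma chi_bounded : exists2 M : R, 0 < M &
  [/\ forall n x, `|chi n x| <= M, forall n x, `|(grad (chi n) x).1| <= M / n.+1%:R &
      forall n x, `|(grad (chi n) x).2| <= M / n.+1%:R].
Proof.
have [M0 M00 h0] := bumpn_bounded R 0; have [M1 M10 h1] := bumpn_bounded R 1.
have b2 : 0 < bump 0 ^- 2 :> R by rewrite invr_gt0 exprn_gt0// bump00.
have G n : has_grad (chi n)
    (fun x => (bump 0 ^- 2) * (n.+1%:R^-1 * (bumpn 1 (n.+1%:R^-1 * x.1 + 0) * bump (n.+1%:R^-1 * x.2 + 0))))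
    (fun x => (bump 0 ^- 2) * (n.+1%:R^-1 * (bump (n.+1%:R^-1 * x.1 + 0) * bumpn 1 (n.+1%:R^-1 * x.2 + 0)))).
  have dl (t : R) : is_derive t 1 (fun t : R => n.+1%:R^-1 * t + 0) n.+1%:R^-1.
    by apply: (der_eq (derD (derZ n.+1%:R^-1 (der_id t)) (der_cst 0 t))); ring.
  have db (t : R) := @der_comp _ (@bump R) (fun t : R => n.+1%:R^-1 * t + 0) t _ _ (is_derive_bumpn 0 _) (dl t).
  move=> x; split.
    by apply: (der_eq (derZ (bump 0 ^- 2) (derM (db x.1) (der_cst (bump (n.+1%:R^-1 * x.2 + 0)) x.1)))); ring.
  by apply: (der_eq (derZ (bump 0 ^- 2) (derM (der_cst (bump (n.+1%:R^-1 * x.1 + 0)) x.2) (db x.2)))); ring.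
have bd (a b A B : R) : `|a| <= A -> `|b| <= B -> `|a * b| <= A * B.
  by move=> ha hb; rewrite normrM ler_pM.
pose M := bump 0 ^- 2 * (M0 * M0 + M1 * M0).
have Mp : 0 < M by rewrite mulr_gt0// addr_gt0// mulr_gt0.
have le01 : M0 * M0 <= M0 * M0 + M1 * M0 by rewrite lerDl ltW// mulr_gt0.
have le10 : M1 * M0 <= M0 * M0 + M1 * M0 by rewrite lerDr ltW// mulr_gt0.
exists M => //; split => n x.
- rewrite normrM gtr0_norm// /M ler_pM2l//; apply: le_trans le01; apply: bd; exact: (h0).
- have [_ ->] := has_gradP (G n); rewrite /= normrM gtr0_norm// /M -(mulrA (bump 0 ^- 2)) ler_pM2l// mulrC normrM (gtr0_norm (x := n.+1%:R^-1)) ?invr_gt0//.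
  rewrite ler_pM2r ?invr_gt0//; apply: le_trans le10; apply: bd; [exact: h1|exact: h0].
- have [_ ->] := has_gradP (G n); rewrite /= normrM gtr0_norm// /M -(mulrA (bump 0 ^- 2)) ler_pM2l// mulrC normrM (gtr0_norm (x := n.+1%:R^-1)) ?invr_gt0//.
  rewrite ler_pM2r ?invr_gt0//; apply: le_trans le10; rewrite mulrC; apply: bd; [exact: h1|exact: h0].
Qed.

Lemma chi_cvg x : (fun n => chi n x) @ \oo --> (1 : R).
Proof.
have lim0 (t : R) : (fun n => bump (n.+1%:R^-1 * t + 0)) @ \oo --> (bump 0 : R).
  have cb : {for (0 : R), continuous (@bump R)} by exact: (Dk_continuous (Dk_bump R 0)).
  have l0 : (fun n : nat => n.+1%:R^-1 * t + 0 : R) @ \oo --> (0 : R).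
    rewrite -[X in _ --> X]addr0; apply: cvgD; last exact: cvg_cst.
    rewrite -[X in _ --> X](mul0r t); apply: cvgM; [exact: cvg_harmonic|exact: cvg_cst].
  exact: (@cvg_comp _ _ _ (fun n : nat => n.+1%:R^-1 * t + 0 : R) (@bump R) _ _ _ l0 cb).
rewrite (_ : 1 = bump 0 ^- 2 * (bump 0 * bump 0) :> R); last first.
  by rewrite -expr2 mulVf// expf_neq0// gt_eqF// bump00.
by apply: cvgM; [exact: cvg_cst|apply: cvgM; exact: lim0].
Qed.

(** Disposes of the error terms with a factor of order [1 / n]: the gradient falling on the cut-off,
    and the excess of the dilation. *)
Lemma nsq_small (c F : nat -> R * R -> R) (M : R) (K : \bar R) : 0 <= M -> (K < +oo)%E ->
  (forall n, measurable_fun setT (c n)) -> (forall n, measurable_fun setT (F n)) ->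
  (forall n x, `|c n x| <= M / n.+1%:R) -> (forall n, (nrm (F n) <= K)%E) ->
  vanish (fun n => nrm (fun x => c n x * F n x)).
Proof.
move=> M0 Kf mc mF cM FK.
have K0 : (0 <= K)%E by apply: le_trans (FK 0%N); exact: nsq_ge0.
have [k k0 Ek] : exists2 k : R, 0 <= k & K = k%:E.
  by exists (fine K); [exact: fine_ge0|rewrite fineK// ge0_fin_numE].
apply: vanish_le (vanish_inv_nat (M ^+ 2 * k)); apply: nearW => n.
apply: (@le_trans _ _ (((M / n.+1%:R) ^+ 2)%:E * nrm (F n) + 0%:E * nrm (F n))%E).
  apply: (@nsq_lin2 _ _ _ leb2 setT measurableT (F n) (F n) _ _ (fun x => c n x * F n x) (sqr_ge0 _) (lexx 0) (mF n) (mF n) (measurable_funM (mc n) (mF n))) => x _.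
  by rewrite mul0r addr0 exprMn ler_wpM2r ?sqr_ge0// -[leLHS]real_normK ?num_real// lerXn2r ?nnegrE// divr_ge0.
rewrite mul0e adde0; apply: (@le_trans _ _ (((M / n.+1%:R) ^+ 2)%:E * k%:E)%E).
  by apply: lee_pmul => //; [rewrite lee_fin sqr_ge0|exact: nsq_ge0|rewrite -Ek].
rewrite -EFinM lee_fin exprMn mulrAC ler_wpM2l ?mulr_ge0 ?sqr_ge0// exprVn lef_pV2 ?posrE ?exprn_gt0//.
by rewrite expr2 ler_peMr// ler1n.
Qed.

Lemma chi_tail f : L2 setT f -> vanish (fun n => nrm (fun x => (chi n x - 1) * f x)).
Proof.
move=> Lf; have [mf _] := Lf; have [M M0 [cM _ _]] := chi_bounded.
pose F n x := (((chi n x - 1) * f x) ^+ 2)%:E.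
have mF n : measurable_fun setT (F n).
  by apply: measurable_sq; apply: measurable_funM => //; apply: measurable_funB => //; exact: measurable_chi.
have cv : {ae leb2, forall x, setT x -> F n x @[n --> \oo] --> 0%E}.
  have Fl := leb2_ae_filter R; apply: nearW => x _; apply/fine_cvgP; split; first exact: nearW.
  rewrite (_ : 0 = ((1 - 1) * f x) ^+ 2); last by rewrite subrr mul0r expr0n.
  rewrite /F /=; under eq_fun do rewrite expr2.
  have h : (fun n => (chi n x - 1) * f x) @ \oo --> (1 - 1) * f x.
    apply: cvgM; last exact: cvg_cst; apply: cvgB; [exact: chi_cvg|exact: cvg_cst].
  by rewrite expr2; exact: cvgM.
pose G (x : R * R) := (M + 1) ^+ 2 * f x ^+ 2.
have iG : leb2.-integrable setT (EFin \o G).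
  have := integrableZl measurableT ((M + 1) ^+ 2) (@sqi_integrable R _ _ leb2 setT f Lf).
  by apply: eq_integrable => // y _; rewrite /= EFinM.
have FG : {ae leb2, forall x n, setT x -> (`|F n x| <= (EFin \o G) x)%E}.
  have Fl := leb2_ae_filter R; apply: nearW => x n _.
  rewrite /F /G /= lee_fin ger0_norm ?sqr_ge0// exprMn ler_wpM2r ?sqr_ge0// -[leLHS]real_normK ?num_real// lerXn2r ?nnegrE//.
    by rewrite addr_ge0// ltW.
  by apply: le_trans (ler_normB _ _) _; rewrite normr1 lerD2r.
have [_ _] := @dominated_convergence _ _ _ leb2 setT measurableT F (cst 0%E) _ mF (measurable_cst _) cv iG FG.
rewrite integral0 => h; have n0 n : (0 <= nrm (fun x => (chi n x - 1) * f x)%R)%E by exact: nsq_ge0.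
exact: (vanishP n0).2 h.
Qed.

Lemma chi_approx (F : nat -> R * R -> R) f : L2 setT f -> (forall n, measurable_fun setT (F n)) ->
  vanish (fun n => nrm (fun x => F n x - f x)) -> vanish (fun n => nrm (fun x => chi n x * F n x - f x)).
Proof.
move=> Lf mF vF; have [mf _] := Lf; have [M M0 [cM _ _]] := chi_bounded.
apply: vanish_le (vanishD (vanishZ (k := 2 * M ^+ 2) _ vF) (vanishZ (k := 2) _ (chi_tail Lf))) => //; last first.
  by rewrite mulr_ge0// sqr_ge0.
apply: nearW => n; have mc := measurable_chi n; apply: nsq_lin2 => //.
- by rewrite mulr_ge0// sqr_ge0.
- exact: (measurable_funB (mF n) mf).
- by apply: measurable_funM => //; exact: measurable_funB.
- by apply: measurable_funB => //; exact: (measurable_funM mc (mF n)).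
move=> x _; have := cM n x; set c := chi n x; set p := F n x; set q := f x => cle.
have c2 : c ^+ 2 <= M ^+ 2 by rewrite -[leLHS]real_normK ?num_real// lerXn2r ?nnegrE// ltW.
have h : c ^+ 2 * (p - q) ^+ 2 <= M ^+ 2 * (p - q) ^+ 2 by rewrite ler_wpM2r ?sqr_ge0.
have := sqr_ge0 (c * (p - q) - (c - 1) * q); nra.
Qed.
End cut_off.

(** * Density of test functions in H1 outside a disk *)

Section disk_density.
Variable R : realType.
Implicit Types (f u v : R * R -> R) (U : set (R * R)).
Notation leb2 := (@leb2 R).

Lemma has_grad_kern (e : R) (z : R * R) : 
  has_grad (fun y => kern 0 0 e (z.1 - y.1, z.2 - y.2))
    (fun y => - e^-1 * kern 1 0 e (z.1 - y.1, z.2 - y.2)) (fun y => - e^-1 * kern 0 1 e (z.1 - y.1, z.2 - y.2)).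
Proof.
have E (a b : R) : a - b = -1 * b - (- a) by ring.
move=> y; split.
  have := is_derive_kern1 0 0 e (-1) (- z.1) y.1 (z.2 - y.2).
  rewrite mulN1r -E; congr (is_derive _ _ _ _); by apply/funext => t; rewrite -E.
have := is_derive_kern2 0 0 e (-1) (- z.2) y.2 (z.1 - y.1).
rewrite mulN1r -E; congr (is_derive _ _ _ _); by apply/funext => t; rewrite -E.
Qed.

(** The derivative of the kernel in the integration variable and the weak identity each contribute a
    sign, and the two cancel. *)
Lemma smear_weak U u g (e s : R) x : open U -> L2 U u -> weak_grad U u g -> 0 < e ->
  box (s * x.1, s * x.2) e `<=` U ->
  e^-1 * smear 1 0 e s (zext U u) x = smear 0 0 e s (zext U (fun y => (g y).1)) x /\
  e^-1 * smear 0 1 e s (zext U u) x = smear 0 0 e s (zext U (fun y => (g y).2)) x.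
Proof.
move=> oU Lu [g1 g2 H] e0 bU; have mU := open_measurable2 oU; pose z := (s * x.1, s * x.2) : R * R.
have [_ Gk] := has_gradP (has_grad_kern e z).
have [] := H _ (test_fun_kern 0 0 e0 bU); rewrite Gk /smear !Rintegral_zext /= => h1 h2.
have I i j := @sqi_integrableM R _ _ leb2 U mU _ _ Lu (test_fun_L2 oU (test_fun_kern i j e0 bU)).
have P i j : \int[leb2]_(y in U) (u y * (- e^-1 * kern i j e (z.1 - y.1, z.2 - y.2))) =
    - (e^-1 * \int[leb2]_(y in U) (u y * kern i j e (z.1 - y.1, z.2 - y.2))).
  rewrite -mulNr -(@RintegralZl _ _ _ leb2 U _ (- e^-1) mU (I i j)).
  by apply: eq_Rintegral => y _; rewrite mulrCA.
by split; apply: oppr_inj; [rewrite -h1 -(P 1%N 0%N)|rewrite -h2 -(P 0%N 1%N)].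
Qed.

Lemma grad_moll (delta : R) U u g n x : 0 < delta -> open U -> L2 U u -> weak_grad U u g ->
  box (dil _ n * x.1, dil _ n * x.2) (rad delta n) `<=` U ->
  grad (moll delta n (zext U u)) x =
    (dil _ n * moll delta n (zext U (fun y => (g y).1)) x, dil _ n * moll delta n (zext U (fun y => (g y).2)) x).
Proof.
move=> d0 oU Lu wg bU; have e0 := rad_gt0 d0 n; have s0 := dil_gt0 R n.
have Lz := L2_zext (open_measurable2 oU) Lu.
have G : has_grad (moll delta n (zext U u))
   (fun x => (bint R * rad delta n) ^- 2 * (dil R n / rad delta n * smear 1 0 (rad delta n) (dil R n) (zext U u) x))
   (fun x => (bint R * rad delta n) ^- 2 * (dil R n / rad delta n * smear 0 1 (rad delta n) (dil R n) (zext U u) x)).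
  by move=> y; have [h1 h2] := has_grad_smear 0 0 e0 s0 Lz y; split; apply: derZ.
have [_ ->] := has_gradP G; rewrite /moll.
have [<- <-] := smear_weak oU Lu wg e0 bU.
by congr pair; ring.
Qed.

Definition disk_ext (r : R) : set (R * R) := [set x | r ^+ 2 < sqn x].

Lemma continuous_sqn : continuous (@sqn R).
Proof.
move=> x; rewrite /sqn; apply: cvgD.
  by apply: (continuous_comp (f := fst) (g := fun t : R => t ^+ 2)); [exact: cvg_fst|exact: exprn_continuous].
by apply: (continuous_comp (f := snd) (g := fun t : R => t ^+ 2)); [exact: cvg_snd|exact: exprn_continuous].
Qed.

Lemma open_disk_ext r : open (disk_ext r).
Proof.
have -> : disk_ext r = @sqn R @^-1` [set` `]r ^+ 2, +oo[] by apply/seteqP; split => x; rewrite /disk_ext /= in_itv /= andbT.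
by apply: open_comp => [x _|]; [exact: continuous_sqn|exact: interval_open].
Qed.

(** Dilation moves [x] outwards by more than [r / (n + 1)], four times the half-side of the box,
    while no point of the box is further from its centre than twice the half-side. *)
Lemma box_disk_ext (r : R) n x : 0 < r -> disk_ext r x ->
  box (dil _ n * x.1, dil _ n * x.2) (rad (r / 4) n) `<=` disk_ext r.
Proof.
move=> r0; rewrite /disk_ext /= => rx y [/=]; set s := dil R n; set e := rad (r / 4) n => h1 h2.
pose N := Num.sqrt (sqn x); have N2 : N ^+ 2 = x.1 ^+ 2 + x.2 ^+ 2 by rewrite sqr_sqrtr// addr_ge0 ?sqr_ge0.
have N0 : 0 <= N by exact: sqrtr_ge0.
have rN : r < N by rewrite -(ltr_pXn2r (n := 2)) ?nnegrE ?(ltW r0)// N2.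
have e0 : 0 < e by rewrite rad_gt0 ?divr_gt0.
have s1 : 1 < s by exact: dil_gt1.
have Es : N < s * N - 4 * e.
  have -> : s = 1 + n.+1%:R^-1 by []. have -> : 4 * e = r / n.+1%:R.
    rewrite /e /rad; have : n.+1%:R != 0 :> R by rewrite pnatr_eq0.
    by move: (n.+1%:R : R) => m m0; field.
  have : r / n.+1%:R < N / n.+1%:R by rewrite ltr_pM2r ?invr_gt0.
  by rewrite mulrDl mul1r (mulrC n.+1%:R^-1 N); move: (r / _) (N / _) => a b; lra.
have xN (t : R) : t ^+ 2 <= N ^+ 2 -> - N <= t <= N.
  by move=> tN; rewrite -ler_norml -(ler_pXn2r (n := 2)) ?nnegrE// real_normK ?num_real.
have /andP[x1l x1u] : - N <= x.1 <= N by apply: xN; rewrite N2 lerDl sqr_ge0.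
have /andP[x2l x2u] : - N <= x.2 <= N by apply: xN; rewrite N2 lerDr sqr_ge0.
move: h1 h2; rewrite !ler_norml => /andP[d1 d1'] /andP[d2 d2'].
rewrite /sqn; set p := y.1 - s * x.1 in d1 d1'; set q := y.2 - s * x.2 in d2 d2'.
have -> : y.1 = s * x.1 + p by rewrite /p; ring.
have -> : y.2 = s * x.2 + q by rewrite /q; ring.
have below (a b : R) : - N <= a -> a <= N -> - e <= b -> b <= e -> - (N * e) <= a * b.
  move=> a1 a2 b1 b2; have : 0 <= (N - a) * (e - b) by rewrite mulr_ge0// subr_ge0.
  have : 0 <= (N + a) * (e + b) by apply: mulr_ge0; lra.
  nra.
have k1 := below _ _ x1l x1u d1 d1'; have k2 := below _ _ x2l x2u d2 d2'.
have : s * N * N < (s * x.1 + p) ^+ 2 + (s * x.2 + q) ^+ 2.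
  have P : (s * x.1 + p) ^+ 2 + (s * x.2 + q) ^+ 2 = s ^+ 2 * N ^+ 2 + 2 * s * (x.1 * p + x.2 * q) + (p ^+ 2 + q ^+ 2) by rewrite N2; ring.
  have s0 : 0 < s by lra.
  have : 2 * s * (- (2 * (N * e))) <= 2 * s * (x.1 * p + x.2 * q) by rewrite ler_pM2l; lra.
  have : s * N * N < s * N * (s * N - 4 * e) by rewrite ltr_pM2l// mulr_gt0// (lt_trans r0).
  have := sqr_ge0 p; have := sqr_ge0 q; rewrite P; nra.
apply: lt_trans; have : r ^+ 2 < N ^+ 2 by rewrite N2.
have : N ^+ 2 <= s * N ^+ 2 by rewrite ler_peMl ?sqr_ge0// ltW.
by rewrite -mulrA -expr2; lra.
Qed.

Lemma H1_disk_density (r : R) u g : 0 < r -> L2 (disk_ext r) u -> weak_grad (disk_ext r) u g ->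
  exists phi : nat -> R * R -> R, [/\ forall n, test_fun setT (phi n),
    vanish (fun n => nsq leb2 (disk_ext r) (fun x => phi n x - u x)),
    vanish (fun n => nsq leb2 (disk_ext r) (fun x => (grad (phi n) x).1 - (g x).1)) &
    vanish (fun n => nsq leb2 (disk_ext r) (fun x => (grad (phi n) x).2 - (g x).2))].
Proof.
move=> r0 Lu wg; have [Lg1 Lg2 _] := wg; set U := disk_ext r.
have oU : open U by exact: open_disk_ext.
have mU := open_measurable2 oU; have d0 : 0 < r / 4 by rewrite divr_gt0.
have Lz := L2_zext mU Lu; have Lz1 := L2_zext mU Lg1; have Lz2 := L2_zext mU Lg2.
pose v n := moll (r / 4) n (zext U u); pose phi n x := chi n x * v n x.
have sv n : smooth (v n) by exact: smooth_moll.
have mv n : measurable_fun setT (v n) by exact: measurable_moll.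
have [M M0 [cM cM1 cM2]] := chi_bounded R.
have gphi n x : grad (phi n) x = ((grad (chi n) x).1 * v n x + chi n x * (grad (v n) x).1,
    (grad (chi n) x).2 * v n x + chi n x * (grad (v n) x).2).
  have [hc _ _] := Ck_elim (smooth_chi R n 1); have [hv _ _] := Ck_elim (sv n 1%N).
  have G : has_grad (phi n) (fun x => (grad (chi n) x).1 * v n x + chi n x * (grad (v n) x).1)
    (fun x => (grad (chi n) x).2 * v n x + chi n x * (grad (v n) x).2).
    by move=> y; have [a1 a2] := hc y; have [b1 b2] := hv y; split; [exact: derM a1 b1|exact: derM a2 b2].
  by have [_ ->] := has_gradP G.
have mgc n : measurable_fun setT (fun x : R * R => (grad (chi n) x).1 : R) /\ measurable_fun setT (fun x : R * R => (grad (chi n) x).2 : R).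
  have [_ h1 h2] := Ck_elim (smooth_chi R n 1).
  by split; apply: continuous_measurable2; [exact: Ck_continuous h1|exact: Ck_continuous h2].
(* The error in one partial derivative has four sources: the derivative of the cut-off ([v5]), the
   excess of the dilation ([v2]), the mollification of [gi] ([v1]), and the tail removed by the
   cut-off ([v4]). *)
have aux (gi : R * R -> R) (ci : nat -> R * R -> R) : L2 U gi -> (forall n, measurable_fun setT (ci n)) ->
    (forall n x, `|ci n x| <= M / n.+1%:R) ->
    vanish (fun n => nsq leb2 U (fun x => ci n x * v n x + chi n x * (dil R n * moll (r / 4) n (zext U gi) x) - gi x)).
  move=> Lgi mci ciM; have Lzi := L2_zext mU Lgi; have [mzi fzi] := Lzi.
  have mm n : measurable_fun setT (moll (r / 4) n (zext U gi)) by exact: measurable_moll.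
  have v1 := mollifier_approximation d0 Lzi.
  have v2 : vanish (fun n => nsq leb2 setT (fun x => (n.+1%:R^-1 : R) * moll (r / 4) n (zext U gi) x)).
    apply: (nsq_small (M := 1) (K := nsq leb2 setT (zext U gi)) (c := fun n _ => n.+1%:R^-1)) => //.
      by move=> n x; rewrite div1r gtr0_norm// invr_gt0.
    by move=> n; exact: nsq_moll.
  have v3 : vanish (fun n => nsq leb2 setT (fun x => dil R n * moll (r / 4) n (zext U gi) x - zext U gi x)).
    apply: vanish_le (vanishD (vanishZ (k := 2) _ v1) (vanishZ (k := 2) _ v2)) => //.
    apply: nearW => n.
    have := @nsqD R _ _ leb2 setT measurableT (fun x => moll (r / 4) n (zext U gi) x - zext U gi x)
       (fun x => (n.+1%:R^-1 : R) * moll (r / 4) n (zext U gi) x).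
    rewrite (@eq_nsq _ _ _ leb2 setT _ (fun x => dil R n * moll (r / 4) n (zext U gi) x - zext U gi x)); last first.
      by move=> x _; rewrite /dil; ring.
    by apply; [exact: (measurable_funB (mm n) mzi)|exact: (measurable_funM (measurable_cst _) (mm n))].
  have v4 := chi_approx Lzi (fun n => measurable_funM (measurable_cst _) (mm n)) v3.
  have v5 : vanish (fun n => nsq leb2 setT (fun x => ci n x * v n x)).
    apply: (nsq_small (M := M) (K := nsq leb2 setT (zext U u))) => //; first exact: ltW.
      by case: Lz.
    by move=> n; exact: nsq_moll.
  apply: vanish_le (vanishD (vanishZ (k := 2) _ v5) (vanishZ (k := 2) _ v4)) => //.
  apply: nearW => n; have mc := @measurable_chi R n.
  have m1 : measurable_fun setT (fun x => ci n x * v n x) by exact: measurable_funM.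
  have m2 : measurable_fun setT (fun x => chi n x * (dil R n * moll (r / 4) n (zext U gi) x) - zext U gi x).
    by apply: measurable_funB (proj1 Lzi); exact: (measurable_funM mc (measurable_funM (measurable_cst _) (mm n))).
  apply: le_trans (@nsqD R _ _ leb2 setT measurableT _ _ m1 m2).
  rewrite (@eq_nsq _ _ _ leb2 U _ (fun x => ci n x * v n x + (chi n x * (dil R n * moll (r / 4) n (zext U gi) x) - zext U gi x))).
    by apply: nsqS => //; exact: measurable_funD.
  by move=> x Ux; rewrite zext_in// addrA.
exists phi; split.
- move=> n; apply: (test_fun_box (a := (0, 0)) (r := n.+1%:R)) => //.
    by move=> k; apply: CkM; [exact: smooth_chi|exact: sv].
  by move=> x bx; rewrite /phi chi_eq0// mul0r.
- apply: vanish_le (chi_approx Lz mv (mollifier_approximation d0 Lz)); apply: nearW => n.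
  have mc := @measurable_chi R n; have [mz _] := Lz.
  rewrite (@eq_nsq _ _ _ leb2 U _ (fun x => chi n x * v n x - zext U u x)).
    by apply: nsqS => //; apply: measurable_funB => //; exact: measurable_funM.
  by move=> x Ux; rewrite zext_in.
- have := aux _ (fun n x => (grad (chi n) x).1) Lg1 (fun n => (mgc n).1) cM1.
  apply: vanish_le; apply: nearW => n; rewrite le_eqVlt; apply/orP; left; apply/eqP.
  by apply: eq_nsq => x Ux; rewrite gphi (grad_moll d0 oU Lu wg (box_disk_ext r0 Ux)).
- have := aux _ (fun n x => (grad (chi n) x).2) Lg2 (fun n => (mgc n).2) cM2.
  apply: vanish_le; apply: nearW => n; rewrite le_eqVlt; apply/orP; left; apply/eqP.
  by apply: eq_nsq => x Ux; rewrite gphi (grad_moll d0 oU Lu wg (box_disk_ext r0 Ux)).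
Qed.
End disk_density.

(** * Picone's and Wirtinger's inequalities *)

Section line_calculus.
Variable R : realType.
Notation mu := (@lebesgue_measure R).
Implicit Types (f g z Q G : R -> R).

Lemma mean_value f f' : (forall x : R, is_derive x 1 f (f' x)) ->
  forall a b : R, exists c : R, `|c - b| <= `|a - b| /\ f a - f b = f' c * (a - b).
Proof.
move=> df a b; have [ab|ba] := leP a b.
  have [|c] := @MVT_segment _ f f' a b ab (fun x _ => df x).
    by apply: der_within => x _; exists (f' x).
  rewrite in_itv /= => /andP[c1 c2] E; exists c; split.
    by rewrite !ler0_norm ?subr_le0// lerN2 lerD2r.
  by rewrite -opprB E; ring.
have [|c] := @MVT_segment _ f f' b a (ltW ba) (fun x _ => df x).
  by apply: der_within => x _; exists (f' x).
rewrite in_itv /= => /andP[c1 c2] E; exists c; split => //.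
by rewrite !ger0_norm ?subr_ge0 ?(ltW ba)// lerD2r.
Qed.

Lemma der_quotP f (t l : R) :
  is_derive t 1 f l <-> (fun h => h^-1 * (f (h + t) - f t)) @ 0^' --> l.
Proof.
have E : (fun h : R => h^-1 *: ((f \o shift t) (h *: (1 : R)) - f t)) = (fun h => h^-1 * (f (h + t) - f t)).
  by apply/funext => h; rewrite /= [h *: _]mulr1.
split => [[d1 d2]|h].
  by move: d1 d2; rewrite /derivable /derive E => d1 <-; exact: d1.
by split; rewrite /derivable /derive E; [apply/cvg_ex; exists l|exact: cvg_lim h].
Qed.

(** The increment is split at the corner [(x t, y (h + t))] and each half is a mean value;
    continuity of the partial derivatives then takes the place of total differentiability. *)
Lemma der_curve (phi phi1 phi2 : R * R -> R) (x y : R -> R) (x' y' t : R) :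
  has_grad phi phi1 phi2 -> continuous phi1 -> continuous phi2 ->
  is_derive t 1 x x' -> is_derive t 1 y y' ->
  is_derive t 1 (fun s => phi (x s, y s)) (phi1 (x t, y t) * x' + phi2 (x t, y t) * y').
Proof.
move=> dphi c1 c2 dx dy.
have mx (h : R) : exists c : R, `|c - x t| <= `|x (h + t) - x t| /\
    phi (x (h + t), y (h + t)) - phi (x t, y (h + t)) = phi1 (c, y (h + t)) * (x (h + t) - x t).
  exact: (@mean_value (fun s => phi (s, y (h + t))) (fun s => phi1 (s, y (h + t))) (fun s => (dphi (s, y (h + t))).1)).
have my (h : R) : exists c : R, `|c - y t| <= `|y (h + t) - y t| /\
    phi (x t, y (h + t)) - phi (x t, y t) = phi2 (x t, c) * (y (h + t) - y t).
  exact: (@mean_value (fun s => phi (x t, s)) (fun s => phi2 (x t, s)) (fun s => (dphi (x t, s)).2)).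
have [xi hxi] := choice mx; have [eta heta] := choice my.
have shift_cvg (u : R -> R) u' : is_derive t 1 u u' -> (fun h => u (h + t)) @ 0^' --> u t.
  move=> du; have cu : u (h + t) @[h --> (0 : R)] --> u t.
    have ct : (fun h : R => h + t) @ (0 : R) --> t.
      by rewrite -[X in _ --> X]add0r; apply: cvgD; [exact: cvg_id|exact: cvg_cst].
    exact: (@cvg_comp _ _ _ (fun h : R => h + t) u _ (nbhs t) _ ct (der_continuous du)).
  by move=> A /cu; exact: nbhs_dnbhs.
have sq (u c : R -> R) u' : is_derive t 1 u u' -> (forall h, `|c h - u t| <= `|u (h + t) - u t|) -> c @ 0^' --> u t.
  move=> du cu; have := shift_cvg _ _ du => /cvgrPdist_lt hu; apply/cvgrPdist_lt => e e0.
  by apply: filterS (hu e e0) => h; rewrite distrC => hh; rewrite distrC; exact: le_lt_trans (cu h) hh.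
have yc := shift_cvg _ _ dy; have xc := sq _ _ _ dx (fun h => (hxi h).1); have ec := sq _ _ _ dy (fun h => (heta h).1).
apply/der_quotP.
have -> : (fun h => h^-1 * (phi (x (h + t), y (h + t)) - phi (x t, y t))) =
  (fun h => phi1 (xi h, y (h + t)) * (h^-1 * (x (h + t) - x t)) + phi2 (x t, eta h) * (h^-1 * (y (h + t) - y t))).
  apply/funext => h; rewrite (mulrCA _ h^-1) (mulrCA _ h^-1) -mulrDr; congr (_ * _).
  by have [_ <-] := hxi h; have [_ <-] := heta h; ring.
apply: cvgD; apply: cvgM; [|exact: (der_quotP _ _ _).1 dx| |exact: (der_quotP _ _ _).1 dy].
  have cp : (fun h => (xi h, y (h + t))) @ 0^' --> (x t, y t) by exact: (cvg_pair xc yc).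
  exact: (@cvg_comp _ _ _ (fun h => (xi h, y (h + t))) phi1 _ (nbhs (x t, y t)) _ cp (c1 (x t, y t))).
have cp : (fun h => (x t, eta h)) @ 0^' --> (x t, y t) by exact: (cvg_pair (cvg_cst _) ec).
exact: (@cvg_comp _ _ _ (fun h => (x t, eta h)) phi2 _ (nbhs (x t, y t)) _ cp (c2 (x t, y t))).
Qed.

Lemma continuous_integrable f (a b : R) : {within `[a, b], continuous f} -> mu.-integrable `[a, b] (EFin \o f).
Proof. by move=> cf; apply: (@continuous_compact_integrable R f `[a, b]%classic) => //; exact: segment_compact. Qed.

Lemma Rintegral_EFin f (a b : R) : {within `[a, b], continuous f} ->
  ((\int[mu]_(x in `[a, b]) f x)%R%:E = \int[mu]_(x in `[a, b]) (f x)%:E)%E.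
Proof.
move=> cf; rewrite /Rintegral fineK//.
exact: (@integrable_fin_num _ (measurableTypeR R) _ mu _ (measurable_itv _) _ (continuous_integrable cf)).
Qed.

(** Integration of the derivative of [Q z^2]. The weight decides the outcome: an affine [Q] gives a
    trace bound, a tangent gives Wirtinger's inequality, and [s h' / h] the bound outside the
    disk. *)
Lemma picone Q Q' z z' G (a b : R) : a <= b ->
  (forall x, a <= x <= b -> is_derive x 1 z (z' x)) -> (forall x, a <= x <= b -> is_derive x 1 Q (Q' x)) ->
  {within `[a, b], continuous z'} -> {within `[a, b], continuous Q'} -> {within `[a, b], continuous G} ->
  (forall x, a <= x <= b -> 2 * Q x * z x * z' x + Q' x * z x ^+ 2 <= G x) ->
  Q b * z b ^+ 2 - Q a * z a ^+ 2 <= \int[mu]_(x in `[a, b]) G x.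
Proof.
move=> ab dz dQ cz' cQ' cG H.
have ab' x : (`[a, b]%classic : set R) x -> a <= x <= b by rewrite /= in_itv.
have cz : {within `[a, b], continuous z} by apply: der_within => x /ab' /dz; exists (z' x).
have cQ : {within `[a, b], continuous Q} by apply: der_within => x /ab' /dQ; exists (Q' x).
pose g x := 2 * Q x * z x * z' x + Q' x * z x ^+ 2.
have cg : {within `[a, b], continuous g}.
  have cM (u v : R -> R) : {within `[a, b], continuous u} -> {within `[a, b], continuous v} ->
      {within `[a, b], continuous (fun x => u x * v x)}.
    by move=> cu cv x; apply: cvgM; [exact: cu|exact: cv].
  have cD (u v : R -> R) : {within `[a, b], continuous u} -> {within `[a, b], continuous v} ->
      {within `[a, b], continuous (fun x => u x + v x)}.
    by move=> cu cv x; apply: cvgD; [exact: cu|exact: cv].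
  have c2 : {within `[a, b], continuous (fun _ : R => 2 : R)} by move=> x; exact: cvg_cst.
  have cz2 : {within `[a, b], continuous (fun x => z x ^+ 2)} by exact: cM.
  exact: (cD _ _ (cM _ _ (cM _ _ (cM _ _ c2 cQ) cz) cz') (cM _ _ cQ' cz2)).
have dP x : a <= x <= b -> is_derive x 1 (fun x => Q x * z x ^+ 2) (g x).
  by move=> xab; apply: (der_eq (derM (dQ x xab) (der2 (dz x xab)))); rewrite /g; ring.
have -> : Q b * z b ^+ 2 - Q a * z a ^+ 2 = \int[mu]_(x in `[a, b]) g x.
  by apply: EFin_inj; rewrite (Rintegral_EFin cg) (integral_is_derive ab dP cg).
apply: (@le_Rintegral _ (measurableTypeR R) _ mu _ _ _ (measurable_itv _) (continuous_integrable cg) (continuous_integrable cG)).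
by move=> x /ab'; exact: H.
Qed.

Lemma ray_trace z z' (a : R) : (forall x, a <= x -> is_derive x 1 z (z' x)) -> {within `[a, a + 1], continuous z'} ->
  ((z a ^+ 2)%:E <= \int[mu]_(x in `[a, (a + 1)%R]) (2 * z x ^+ 2 + z' x ^+ 2)%:E)%E.
Proof.
move=> dz cz'; have aa : a <= a + 1 by rewrite lerDl.
have ge x : a <= x <= a + 1 -> a <= x by case/andP.
have cz : {within `[a, a + 1], continuous z}.
  by apply: der_within => x /=; rewrite in_itv /= => /ge/dz; exists (z' x).
have cG : {within `[a, a + 1], continuous (fun x => 2 * z x ^+ 2 + z' x ^+ 2)}.
  move=> x; apply: cvgD; first by apply: cvgM; [exact: cvg_cst|apply: cvgM; exact: cz].
  by apply: cvgM; exact: cz'.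
(* The weight vanishes at [a + 1] and equals -1 at [a], so only the boundary value at [a]
   survives. *)
have := @picone (fun x => x - (a + 1)) (fun=> 1) z z' (fun x => 2 * z x ^+ 2 + z' x ^+ 2) a (a + 1) aa.
rewrite subrr mul0r sub0r -mulNr opprB addrAC subrr add0r mul1r => h.
rewrite -(Rintegral_EFin cG) lee_fin; apply: h => //.
- by move=> x /ge; exact: dz.
- by move=> x _; apply: (der_eq (derB (der_id x) (der_cst (a + 1) x))); rewrite subr0.
- by move=> x; exact: cvg_cst.
move=> x /andP[x1 x2]; set q := x - (a + 1); set u := z x; set v := z' x.
have q1 : q ^+ 2 <= 1 by rewrite /q; nra.
have : q ^+ 2 * u ^+ 2 <= 1 * u ^+ 2 by rewrite ler_wpM2r ?sqr_ge0.
have := sqr_ge0 (v - q * u); nra.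
Qed.

(** Picone's inequality with [Q = - l * tan (l * (x - m))], [m] the midpoint, a solution of
    [Q' + Q^2 = - l^2]. Taking [l < 1] keeps the tangent finite on the closed interval. *)
Lemma half_wirtinger_lt z z' (l p : R) : 0 < l < 1 -> (forall x : R, is_derive x 1 z (z' x)) -> continuous z' ->
  z p = 0 -> z (p + pi) = 0 ->
  l ^+ 2 * \int[mu]_(x in `[p, p + pi]) (z x ^+ 2) <= \int[mu]_(x in `[p, p + pi]) (z' x ^+ 2).
Proof.
move=> /andP[l0 l1] dz cz' zp zp'; have pp : p <= p + pi by rewrite lerDl pi_ge0.
have cz : continuous z by move=> x; exact: der_continuous (dz x).
pose m := p + pi / 2; pose T x := tan (l * (x - m)).
have dT x : p <= x <= p + pi -> is_derive x 1 T (l * (1 + T x ^+ 2)).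
  move=> xp; have cx : cos (l * (x - m)) != 0.
    rewrite gt_eqF// cos_gt0_pihalf//; have := pi_gt0 R; move: xp; rewrite /m; set P := pi => xp P0; nra.
  have := @der_comp _ (@tan R) (fun x => l * (x - m)) x _ _ (is_derive_tan cx) (derZ l (derB (der_id x) (der_cst m x))).
  by move=> d; apply: (der_eq d); rewrite subr0 mulr1 mulrC -cos2_tan2// exprVn.
have cT : {within `[p, p + pi], continuous T}.
  by apply: der_within => x /=; rewrite in_itv /= => /dT; exists (l * (1 + T x ^+ 2)).
have cw (f : R -> R) : continuous f -> {within `[p, p + pi], continuous f} by exact: continuous_subspaceT.
have cz2 : {within `[p, p + pi], continuous (fun x => z x ^+ 2)} by apply: cw => x; apply: cvgM; exact: cz.
have cz'2 : {within `[p, p + pi], continuous (fun x => z' x ^+ 2)} by apply: cw => x; apply: cvgM; exact: cz'.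
have clz2 : {within `[p, p + pi], continuous (fun x => l ^+ 2 * z x ^+ 2)} by move=> x; apply: cvgM; [exact: cvg_cst|exact: cz2].
have := @picone (fun x => - l * T x) (fun x => - l * (l * (1 + T x ^+ 2))) z z' (fun x => z' x ^+ 2 - l ^+ 2 * z x ^+ 2) p (p + pi) pp.
rewrite zp zp' expr0n /= !mulr0 subrr => h.
have E1 : \int[mu]_(x in `[p, p + pi]) (l ^+ 2 * z x ^+ 2) = l ^+ 2 * \int[mu]_(x in `[p, p + pi]) (z x ^+ 2).
  exact: (@RintegralZl _ (measurableTypeR R) _ mu _ _ (l ^+ 2) (measurable_itv _) (continuous_integrable cz2)).
have E2 : \int[mu]_(x in `[p, p + pi]) (z' x ^+ 2 - l ^+ 2 * z x ^+ 2) =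
    \int[mu]_(x in `[p, p + pi]) (z' x ^+ 2) - \int[mu]_(x in `[p, p + pi]) (l ^+ 2 * z x ^+ 2).
  exact: (@RintegralB _ (measurableTypeR R) _ mu _ _ _ (measurable_itv _) (continuous_integrable cz'2) (continuous_integrable clz2)).
rewrite -subr_ge0 -E1 -E2.
apply: h.
- by move=> x xp; exact: derZ (dT x xp).
- exact: cw.
- move=> x; apply: cvgM; first exact: cvg_cst.
  by apply: cvgM; [exact: cvg_cst|apply: cvgD; [exact: cvg_cst|apply: cvgM; exact: cT]].
- by move=> x; apply: cvgB; [exact: cz'2|exact: clz2].
by move=> x _; have := sqr_ge0 (z' x + l * T x * z x); nra.
Qed.

Lemma half_wirtinger z z' (p : R) : (forall x : R, is_derive x 1 z (z' x)) -> continuous z' ->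
  z p = 0 -> z (p + pi) = 0 ->
  (\int[mu]_(x in `[p, (p + pi)%R]) (z x ^+ 2)%:E <= \int[mu]_(x in `[p, (p + pi)%R]) (z' x ^+ 2)%:E)%E.
Proof.
move=> dz cz' zp zp'; have cz : continuous z by move=> x; exact: der_continuous (dz x).
have cw (f : R -> R) : continuous f -> {within `[p, p + pi], continuous f} by exact: continuous_subspaceT.
rewrite -Rintegral_EFin; last by apply: cw => x; apply: cvgM; exact: cz.
rewrite -Rintegral_EFin; last by apply: cw => x; apply: cvgM; exact: cz'.
rewrite lee_fin; set A := (X in X <= _); set B := (X in _ <= X).
have H l : 0 < l < 1 -> l ^+ 2 * A <= B by move=> l01; exact: half_wirtinger_lt.
have A0 : 0 <= A by apply: Rintegral_ge0 => x _; exact: sqr_ge0.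
rewrite leNgt; apply/negP => BA.
have B0 : 0 <= B by apply: Rintegral_ge0 => x _; exact: sqr_ge0.
have A0' : 0 < A by exact: le_lt_trans BA.
(* The mean of [B / A] and 1 is below 1, and its square exceeds [B / A] by the inequality between
   the arithmetic and geometric means. *)
pose l := (B / A + 1) / 2.
have BA1 : B / A < 1 by rewrite ltr_pdivrMr// mul1r.
have BA0 : 0 <= B / A by rewrite divr_ge0.
have l01 : 0 < l < 1 by rewrite /l; apply/andP; split; lra.
have := H l l01; rewrite -ler_pdivlMr// leNgt => /negP; apply.
by have : (B / A) < l ^+ 2 by rewrite /l; set q := B / A in BA1 BA0 *; have := sqr_ge0 (q - 1); nra.
Qed.

Lemma integral_period (h : R -> \bar R) (p : R) : 0 <= p <= 2 * pi -> (forall x, 0 <= h x)%E -> measurable_fun setT h ->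
  (forall x, h (x + 2 * pi) = h x) ->
  (\int[mu]_(x in `[p, (p + 2 * pi)%R]) h x = \int[mu]_(x in `[0%R, (2 * pi)%R]) h x)%E.
Proof.
move=> /andP[p0 p1] h0 mh hp; have P0 := pi_gt0 R.
rewrite (@integral_split _ p (2 * pi))//; last by rewrite p1 /= lerDr.
rewrite (@integral_split _ 0 p (2 * pi))//; last by rewrite p0.
rewrite addeC; congr (_ + _)%E.
rewrite -[X in `[X, _]](add0r (2 * pi)) -(integral_shift _ _ _ h0 mh).
by apply: eq_integral => x _; rewrite hp.
Qed.

(** The difference of [z] between opposite points changes sign over a half-turn, so [z] takes one
    value [c] at some opposite points [p] and [p + pi]. Then [z - c] vanishes at the ends of both
    half-circles and [half_wirtinger] applies to each. This [c] need not be the mean. *)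
Lemma wirtinger z z' : (forall x : R, is_derive x 1 z (z' x)) -> continuous z' ->
  (forall x, z (x + 2 * pi) = z x) -> (forall x, z' (x + 2 * pi) = z' x) ->
  exists c : R, (\int[mu]_(x in `[0%R, (2 * pi)%R]) ((z x - c) ^+ 2)%:E <=
    \int[mu]_(x in `[0%R, (2 * pi)%R]) (z' x ^+ 2)%:E)%E.
Proof.
move=> dz cz' zp zp'; have cz : continuous z by move=> x; exact: der_continuous (dz x).
have P0 := pi_gt0 R.
pose w t := z (t + pi) - z t.
have [||p] := @IVT R w 0 pi 0 (ltW P0).
- apply: continuous_subspaceT => x; apply: cvgB; last exact: cz.
  apply: (@cvg_comp _ _ _ (fun t : R => t + pi) z _ (nbhs (x + pi))); last exact: cz.
  by apply: cvgD; [exact: cvg_id|exact: cvg_cst].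
- rewrite /w add0r (_ : pi + pi = 0 + 2 * pi); last by ring.
  rewrite zp ge_min le_max !subr_ge0 !subr_le0.
  by have [h|h] := leP (z 0) (z pi); rewrite ?orbT// ?(ltW h) ?orbT.
rewrite in_itv /= => /andP[p0 p1] /eqP; rewrite /w subr_eq0 => /eqP Ep.
exists (z p); have dy (x : R) : is_derive x 1 (fun x => z x - z p) (z' x).
  by apply: (der_eq (derB (dz x) (der_cst (z p) x))); rewrite subr0.
have mz : measurable_fun setT (fun x => ((z x - z p) ^+ 2)%:E).
  apply: measurable_sq; apply: measurable_funB => //; exact: continuous_measurable_fun.
have mz' : measurable_fun setT (fun x => (z' x ^+ 2)%:E).
  apply: measurable_sq; exact: continuous_measurable_fun.
rewrite -(@integral_period _ p)//; first last.
- by move=> x; rewrite zp.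
- by move=> x; rewrite lee_fin sqr_ge0.
- by rewrite p0 /=; lra.
rewrite -(@integral_period (fun x => (z' x ^+ 2)%:E) p)//; first last.
- by move=> x; rewrite zp'.
- by move=> x; rewrite lee_fin sqr_ge0.
- by rewrite p0 /=; lra.
rewrite (@integral_split _ p (p + pi))//; [|by apply/andP; split; lra|by move=> x; rewrite lee_fin sqr_ge0].
rewrite (@integral_split _ p (p + pi) (p + 2 * pi) (fun x => (z' x ^+ 2)%:E))//; [|by apply/andP; split; lra|by move=> x; rewrite lee_fin sqr_ge0].
apply: leeD.
  by apply: (@half_wirtinger (fun x => z x - z p) z') => //; rewrite ?Ep subrr.
rewrite (_ : p + 2 * pi = p + pi + pi); last by ring.
apply: (@half_wirtinger (fun x => z x - z p) z') => //; first by rewrite Ep subrr.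
by rewrite (_ : p + pi + pi = p + 2 * pi) ?zp ?subrr//; ring.
Qed.
End line_calculus.

(** * Nonnegative integrals against a set function *)

Section integral_of_set_function.
Context d (T : measurableType d) (R : realType) (m : set T -> \bar R).
Hypothesis m0 : m set0 = 0%E.
Import HBNNSimple.
Local Open Scope ereal_scope.

(** The integral of a nonnegative function is a supremum over simple functions below it, from the
    value of the set function on the empty set alone. Monotonicity follows with neither additivity
    of [m] nor measurability of the integrands, which serves both Hausdorff and Lebesgue
    integrals. *)
Lemma nonneg_integralE (D : set T) (f : T -> \bar R) : (forall x, D x -> 0 <= f x) ->
  \int[m]_(x in D) f x =
  ereal_sup [set sintegral m h | h in [set h : {nnsfun T >-> R} | forall x, (h x)%:E <= (f \_ D) x]].
Proof.
move=> f0; rewrite /integral.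
have g0 x : 0 <= (f \_ D) x by rewrite patchE; case: ifPn => // /set_mem /f0.
have -> : (f \_ D)^\+ = f \_ D by apply/funext => x; rewrite (ge0_funeposE (D := setT))// inE.
have -> : (f \_ D)^\- = cst 0 by apply/funext => x; rewrite (ge0_funenegE (D := setT))// inE.
rewrite [X in _ - X](_ : _ = 0) ?sube0//.
have z (h : {nnsfun T >-> R}) : (forall x, (h x)%:E <= cst 0 x) -> sintegral m h = 0.
  move=> h0; rewrite /sintegral fsbig1// => x _.
  have [->|x0] := eqVneq x 0%R; first by rewrite mul0e.
  rewrite (_ : _ @^-1` _ = set0) ?m0 ?mule0//; rewrite -subset0 => y /= hy.
  move: x0; rewrite -hy => /eqP; apply; apply/eqP.
  by rewrite eq_le fun_ge0 andbT -lee_fin; exact: h0.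
apply/eqP; rewrite eq_le; apply/andP; split.
  by apply: ge_ereal_sup => _ [h h0 <-]; rewrite z.
apply: ereal_sup_ubound; exists (nnsfun0 : {nnsfun T >-> R}) => [x //=|].
by apply: z => x.
Qed.

Lemma le_nonneg_integral (D D' : set T) (f g : T -> \bar R) : D `<=` D' -> (forall x, D x -> 0 <= f x) ->
  (forall x, D' x -> 0 <= g x) -> (forall x, D x -> f x <= g x) -> \int[m]_(x in D) f x <= \int[m]_(x in D') g x.
Proof.
move=> DD' f0 g0 fg; rewrite !nonneg_integralE//.
apply: ereal_sup_le => _ [h hf <-]; exists h => // x.
apply: le_trans (hf x) _; rewrite !patchE; case: ifPn => [/set_mem Dx|_].
  by rewrite (mem_set (DD' _ Dx)); exact: fg.
by case: ifPn => // /set_mem /g0.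
Qed.
End integral_of_set_function.

(** * Polar coordinates outside a star-shaped domain *)

Section polar_exterior.
Variable R : realType.
Notation mu := (@lebesgue_measure R).
Notation leb2 := (@leb2 R).
Local Open Scope ereal_scope.

Definition polar_ext (U : set (R * R)) (rho : R -> R) : Prop :=
  (forall t, 0 <= t <= 2 * pi -> 0 < rho t)%R /\
  (forall t s, (0 <= t <= 2 * pi)%R -> (0 < s)%R -> U (pol t s) <-> (rho t < s)%R).

Lemma polar_ext_integral U rho (F : R * R -> \bar R) : polar_ext U rho -> measurable U ->
  measurable_fun U F -> (forall x, 0 <= F x) ->
  \int[leb2]_(x in U) F x =
  \int[mu]_(t in `[0%R, (2 * pi)%R]) \int[mu]_(s in `[(rho t), +oo[) (F (pol t s) * s%:E).
Proof.
move=> [rho0 Urho] mU mF F0; rewrite integral_mkcond polar_integral.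
- apply: eq_integral => t /set_mem; rewrite /= in_itv /= => t0.
  have mp : measurable_fun `](rho t), +oo[%classic (fun s => F (pol t s) * s%:E).
    have mz : measurable_fun setT (F \_ U) by have [h _] := measurable_restrictT F mU; exact: h.
    have mt : measurable_fun setT (fun s : R => (F \_ U) (pol t s)).
      apply: (measurableT_comp mz); exact: (measurableT_comp (@measurable_pol R) (measurable_pair1 t)).
    have : measurable_fun `](rho t), +oo[%classic (fun s : R => (F \_ U) (pol t s) * s%:E).
      by apply: measurable_funTS; apply: emeasurable_funM => //; apply/measurable_EFinP.
    apply: eq_measurable_fun => s; rewrite inE /= in_itv /= andbT => st.
    by rewrite patchE (mem_set ((Urho t s t0 (lt_trans (rho0 _ t0) st)).2 st)).
  (* The ray meets [U] in an open half-line; closing it at [rho t] adds a null set. *)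
  rewrite -(integral_itv_obnd_cbnd (r := rho t))//.
  rewrite [LHS]integral_mkcond [RHS]integral_mkcond; apply: eq_integral => s _.
  rewrite !patchE; have [|/negP] := boolP (s \in `](rho t), +oo[%classic).
    move=> /set_mem /=; rewrite in_itv /= andbT => st.
    have s0 : (0 < s)%R by exact: lt_trans (rho0 _ t0) st.
    by rewrite (mem_set (_ : `]0%R, +oo[%classic s)) ?(mem_set ((Urho t s t0 s0).2 st))//= in_itv /= s0.
  move=> sn; case: ifPn => // /set_mem /=; rewrite in_itv /= andbT => s0.
  case: ifPn => [/set_mem /(Urho t s t0 s0).1 st|]; last by rewrite mul0e.
  by exfalso; apply: sn; apply/mem_set; rewrite /= in_itv /= st.
- by move=> x; rewrite patchE; case: ifP.
- by have [h _] := measurable_restrictT F mU; exact: h.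
Qed.

Lemma tonelli3 (A B : set R) (f : R -> R -> R -> \bar R) : measurable A -> measurable B ->
  measurable_fun setT (fun p : measurableTypeR R * measurableTypeR R * measurableTypeR R => f p.1.1 p.1.2 p.2) ->
  (forall s t u, 0 <= f s t u) ->
  \int[mu]_(s in A) \int[mu]_(t in B) \int[mu]_(u in B) f s t u =
  \int[mu]_(t in B) \int[mu]_(u in B) \int[mu]_(s in A) f s t u.
Proof.
move=> mA mB mf f0.
have mi : measurable_fun (A `*` B) (fun p : R * R => \int[mu]_(u in B) f p.1 p.2 u).
  apply: measurable_funTS.
  apply: (@measurable_integral_l _ _ (measurableTypeR R * measurableTypeR R)%type (measurableTypeR R) _ mu setT B
    (fun p => f p.1.1 p.1.2 p.2)) => //.
  exact: measurable_funTS.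
rewrite (tonelli_real mA mB mi); last by move=> s t; exact: integral_ge0.
apply: eq_integral => t _; apply: (tonelli_real (f := fun s u => f s t u)) => //; apply: measurable_funTS.
apply: (measurableT_comp (f := fun p : measurableTypeR R * measurableTypeR R * measurableTypeR R => f p.1.1 p.1.2 p.2)
  (g := fun p : measurableTypeR R * measurableTypeR R => ((p.1, t), p.2)) mf).
by apply: measurable_fun_pair => //; apply: measurable_fun_pair.
Qed.
End polar_exterior.

(** * Radial and angular derivatives of a smooth function *)

Section polar_gradient.
Variable R : realType.
Notation mu := (@lebesgue_measure R).
Notation leb2 := (@leb2 R).
Variable phi : R * R -> R.
Hypothesis sphi : smooth phi.

Definition rad_der (t s : R) : R := (grad phi (pol t s)).1 * cos t + (grad phi (pol t s)).2 * sin t.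
Definition ang_der (t s : R) : R := (grad phi (pol t s)).1 * (s * - sin t) + (grad phi (pol t s)).2 * (s * cos t).

Lemma grad_continuous : continuous (fun x => (grad phi x).1) /\ continuous (fun x => (grad phi x).2).
Proof. by have [_ h1 h2] := Ck_elim (sphi 1); split; [exact: Ck_continuous h1|exact: Ck_continuous h2]. Qed.

Lemma is_derive_rad (t s : R) : is_derive s 1 (fun s => phi (pol t s)) (rad_der t s).
Proof.
have [d _ _] := Ck_elim (sphi 1); have [c1 c2] := grad_continuous.
have dc (c : R) : is_derive s 1 (fun s : R => s * c) c.
  by apply: (der_eq (derM (der_id s) (der_cst c s))); ring.
exact: (@der_curve _ phi _ _ (fun s => s * cos t) (fun s => s * sin t) _ _ _ d c1 c2 (dc _) (dc _)).
Qed.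

Lemma is_derive_circle (t s : R) : is_derive t 1 (fun t => phi (pol t s)) (ang_der t s).
Proof.
have [d _ _] := Ck_elim (sphi 1); have [c1 c2] := grad_continuous.
exact: (@der_curve _ phi _ _ (fun t => s * cos t) (fun t => s * sin t) _ _ _ d c1 c2
  (derZ s (is_derive_cos t)) (derZ s (is_derive_sin t))).
Qed.

Lemma polar_sqn (t s : R) : s != 0 -> sqn (grad phi (pol t s)) = rad_der t s ^+ 2 + ang_der t s ^+ 2 / s ^+ 2.
Proof.
move=> s0; rewrite /sqn /rad_der /ang_der; move: (grad phi _).1 (grad phi _).2 => a b.
have := cos2Dsin2 t; move: (cos t) (sin t) => c d cd.
transitivity ((a ^+ 2 + b ^+ 2) * (c ^+ 2 + d ^+ 2)); first by rewrite cd mulr1.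
by field.
Qed.

Lemma continuous_polar (f : R * R -> R) : continuous f -> continuous (fun p : R * R => f (pol p.1 p.2)).
Proof. by move=> cf x; apply: (continuous_comp (f := fun p : R * R => pol p.1 p.2)); [exact: continuous_pol|exact: cf]. Qed.

Lemma continuous_sections (f : R * R -> R) : continuous f ->
  (forall t, continuous (fun s => f (t, s))) /\ (forall s, continuous (fun t => f (t, s))).
Proof.
move=> cf; split => [t s|s t].
  have ci : (fun s : R => s) @ s --> s by exact: cvg_id.
  have cp : (fun s : R => (t, s)) @ s --> (t, s) by exact: (cvg_pair (cvg_cst t) ci).
  exact: (@cvg_comp _ _ _ (fun s : R => (t, s)) f _ (nbhs (t, s)) _ cp (cf (t, s))).
have ci : (fun t : R => t) @ t --> t by exact: cvg_id.
have cp : (fun t : R => (t, s)) @ t --> (t, s) by exact: (cvg_pair ci (cvg_cst s)).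
exact: (@cvg_comp _ _ _ (fun t : R => (t, s)) f _ (nbhs (t, s)) _ cp (cf (t, s))).
Qed.

Lemma continuous_rad_der : continuous (fun p : R * R => rad_der p.1 p.2).
Proof.
have [c1 c2] := grad_continuous; move=> p; rewrite /rad_der; apply: cvgD; apply: cvgM.
- exact: (continuous_polar c1).
- by apply: (continuous_comp (f := fst) (g := cos)); [exact: cvg_fst|exact: continuous_cos].
- exact: (continuous_polar c2).
- by apply: (continuous_comp (f := fst) (g := sin)); [exact: cvg_fst|exact: continuous_sin].
Qed.

Lemma continuous_ang_der : continuous (fun p : R * R => ang_der p.1 p.2).
Proof.
have [c1 c2] := grad_continuous; move=> p; rewrite /ang_der; apply: cvgD; apply: cvgM.
- exact: (continuous_polar c1).
- apply: cvgM; first exact: cvg_snd.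
  by apply: cvgN; apply: (continuous_comp (f := fst) (g := sin)); [exact: cvg_fst|exact: continuous_sin].
- exact: (continuous_polar c2).
- apply: cvgM; first exact: cvg_snd.
  by apply: (continuous_comp (f := fst) (g := cos)); [exact: cvg_fst|exact: continuous_cos].
Qed.

Lemma pol_period (t s : R) : pol (t + 2 * pi) s = pol t s.
Proof. by rewrite mulr_natl /pol cosD2pi sinD2pi. Qed.

Lemma ang_der_period (t s : R) : ang_der (t + 2 * pi) s = ang_der t s.
Proof. by rewrite /ang_der pol_period mulr_natl cosD2pi sinD2pi. Qed.

Lemma measurable_sqn_grad : measurable_fun setT (fun x : R * R => sqn (grad phi x)).
Proof.
have [c1 c2] := grad_continuous; rewrite /sqn.
by apply: measurable_funD; apply: measurable_funX; apply: continuous_measurable2; [exact: c1|exact: c2].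
Qed.
End polar_gradient.

(** * Differences of values on pairs of angles *)

Section pairs_on_the_circle.
Variable R : realType.
Notation mu := (@lebesgue_measure R).
Notation C := (`[0%R, (2 * pi)%R]%classic : set R).
Implicit Types f u : R -> R.

Lemma Rintegral_lin f u (a b c : R) : continuous f -> continuous u ->
  \int[mu]_(t in C) (a * f t + b * u t + c) = a * \int[mu]_(t in C) f t + b * \int[mu]_(t in C) u t + c * (2 * pi).
Proof.
move=> cf cu; have P := pi_ge0 R.
have I (g : R -> R) : continuous g -> mu.-integrable C (EFin \o g).
  by move=> cg; apply: continuous_integrable; exact: continuous_subspaceT.
have cc (k : R) : continuous (fun _ : R => k) by move=> x; exact: cvg_cst.
have caf : continuous (fun t => a * f t) by move=> x; apply: cvgM; [exact: cvg_cst|exact: cf].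
have cbu : continuous (fun t => b * u t) by move=> x; apply: cvgM; [exact: cvg_cst|exact: cu].
have cs : continuous (fun t => a * f t + b * u t) by move=> x; apply: cvgD; [exact: caf|exact: cbu].
have mC : measurable (C : set (measurableTypeR R)) by exact: measurable_itv.
rewrite (@RintegralD _ (measurableTypeR R) _ mu _ _ _ mC (I _ cs) (I _ (cc c))).
rewrite (@RintegralD _ (measurableTypeR R) _ mu _ _ _ mC (I _ caf) (I _ cbu)).
rewrite (@RintegralZl _ (measurableTypeR R) _ mu _ _ a mC (I _ cf)).
rewrite (@RintegralZl _ (measurableTypeR R) _ mu _ _ b mC (I _ cu)).
congr (_ + _); rewrite /Rintegral integral_cst//= lebesgue_measure_itv /= lte_fin.
case: ltP => [_|]; first by rewrite -EFinD -EFinM /= subr0.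
by move=> h; rewrite mule0 /=; have -> : 2 * pi = 0 :> R; [apply: le_anti; rewrite h mulr_ge0|rewrite mulr0].
Qed.

(** The integral of [(f t - f u)^2] over pairs of angles, by [pair_integral]; equivalently [4 * pi]
    times the squared deviation from the mean. Pairs avoid handling the mean as a function of the
    radius. *)
Definition spread f : R := 4 * pi * \int[mu]_(t in C) (f t ^+ 2) - 2 * (\int[mu]_(t in C) f t) ^+ 2.

Let W (g : R -> R) : continuous g -> {within C, continuous g}. Proof. exact: continuous_subspaceT. Qed.

Lemma pair_integral2 (a b : R) f1 f2 : continuous f1 -> continuous f2 ->
  (\int[mu]_(t in C) \int[mu]_(u in C) (a * (f1 t - f1 u) ^+ 2 + b * (f2 t - f2 u) ^+ 2)%:E =
    (a * spread f1 + b * spread f2)%:E)%E.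
Proof.
move=> c1 c2.
have cd f (t : R) : continuous f -> continuous (fun v : R => (f t - f v) ^+ 2).
  by move=> cf x; apply: cvgM; apply: cvgB; try exact: cvg_cst; exact: cf.
have csq f : continuous f -> continuous (fun v : R => f v ^+ 2) by move=> cf x; apply: cvgM; exact: cf.
have clin f1' f2' (k l c : R) : continuous f1' -> continuous f2' -> continuous (fun v : R => k * f1' v + l * f2' v + c).
  move=> d1 d2 x; apply: cvgD; last exact: cvg_cst.
  by apply: cvgD; apply: cvgM; try exact: cvg_cst; [exact: d1|exact: d2].
pose q f t := (2 * pi) * f t ^+ 2 + (- 2 * \int[mu]_(t in C) f t) * f t + \int[mu]_(t in C) (f t ^+ 2).
have cq f : continuous f -> continuous (q f) by move=> cf; apply: clin => //; exact: csq.
have qE f (t : R) : continuous f -> \int[mu]_(v in C) ((f t - f v) ^+ 2) = q f t.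
  move=> cf; have -> : (fun v : R => (f t - f v) ^+ 2) = (fun v => 1 * f v ^+ 2 + (- 2 * f t) * f v + f t ^+ 2).
    by apply/funext => v; ring.
  by rewrite Rintegral_lin//; [rewrite /q; ring|exact: csq].
have qI f : continuous f -> \int[mu]_(t in C) q f t = spread f.
  by move=> cf; rewrite /q Rintegral_lin//; [rewrite /spread; ring|exact: csq].
have inner (t : R) : (\int[mu]_(u in C) (a * (f1 t - f1 u) ^+ 2 + b * (f2 t - f2 u) ^+ 2)%:E =
    (a * q f1 t + b * q f2 t + 0)%:E)%E.
  have E : (fun v : R => a * (f1 t - f1 v) ^+ 2 + b * (f2 t - f2 v) ^+ 2) =
           (fun v => a * (f1 t - f1 v) ^+ 2 + b * (f2 t - f2 v) ^+ 2 + 0).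
    by apply/funext => v; rewrite addr0.
  rewrite -(Rintegral_EFin (f := fun v : R => a * (f1 t - f1 v) ^+ 2 + b * (f2 t - f2 v) ^+ 2)) ?E.
    by rewrite Rintegral_lin ?qE ?mul0r//; exact: cd.
  by apply: W; apply: clin; exact: cd.
transitivity (\int[mu]_(t in C) (a * q f1 t + b * q f2 t + 0)%:E)%E.
  by apply: eq_integral => t _; exact: inner.
rewrite -(Rintegral_EFin (f := fun t => a * q f1 t + b * q f2 t + 0)); last first.
  by apply: W; apply: clin; exact: cq.
by rewrite Rintegral_lin ?qI ?mul0r ?addr0//; exact: cq.
Qed.

Lemma pair_integral f : continuous f ->
  (\int[mu]_(t in C) \int[mu]_(u in C) ((f t - f u) ^+ 2)%:E = (spread f)%:E)%E.
Proof.
move=> cf; rewrite (_ : spread f = 1 * spread f + 0 * spread f); last by ring.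
rewrite -(pair_integral2 1 0 cf cf); apply: eq_integral => t _; apply: eq_integral => v _.
by rewrite mul1r mul0r addr0.
Qed.

(** Differences do not see the constant [c], so the unspecified constant of [wirtinger] is good
    enough. *)
Lemma pair_integral_le f (c : R) : continuous f ->
  (\int[mu]_(t in C) \int[mu]_(u in C) ((f t - f u) ^+ 2)%:E <=
   (4 * pi)%:E * \int[mu]_(t in C) ((f t - c) ^+ 2)%:E)%E.
Proof.
move=> cf; pose g t := f t - c.
have cg : continuous g by move=> x; apply: cvgB; [exact: cf|exact: cvg_cst].
have -> : (\int[mu]_(t in C) \int[mu]_(u in C) ((f t - f u) ^+ 2)%:E =
           \int[mu]_(t in C) \int[mu]_(u in C) ((g t - g u) ^+ 2)%:E)%E.
  by apply: eq_integral => t _; apply: eq_integral => u _; rewrite /g; congr (_ ^+ 2)%:E; ring.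
rewrite pair_integral// -(Rintegral_EFin (f := fun t => g t ^+ 2)); last first.
  by apply: continuous_subspaceT => x; apply: cvgM; exact: cg.
by rewrite -EFinM lee_fin /spread gerBl mulr_ge0// sqr_ge0.
Qed.
End pairs_on_the_circle.

(** * The lower bound outside a disk, for test functions *)

Section lower_bound.
Variable R : realType.
Notation mu := (@lebesgue_measure R).
Notation leb2 := (@leb2 R).
Notation C := (`[0%R, (2 * pi)%R]%classic : set R).

Lemma sqn_pol (t s : R) : sqn (pol t s) = s ^+ 2.
Proof. by rewrite /sqn /pol /= !exprMn -mulrDr cos2Dsin2 mulr1. Qed.

Lemma polar_disk_ext (r : R) : 0 < r -> polar_ext (disk_ext r) (fun=> r).
Proof.
move=> r0; split=> // t s _ s0; rewrite /disk_ext /= sqn_pol.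
by rewrite ltr_pXn2r ?nnegrE ?(ltW r0) ?(ltW s0).
Qed.

Lemma test_fun_pol0 (phi : R * R -> R) (r : R) : test_fun setT phi -> exists2 b : R, r <= b & forall t, phi (pol t b) = 0.
Proof.
(* A circle of radius above [sqrt 2 * M] misses the square of half-side [M] that carries the
   support; [2 * M + 1] is such a radius. *)
move=> /test_fun_supp[M M0 h]; exists (Num.max r (2 * M + 1)); first by rewrite le_max lexx.
set b := Num.max _ _ => t; have Mb : 2 * M + 1 <= b by rewrite /b le_max lexx orbT.
apply: h => -[/=]; rewrite !subr0 => h1 h2.
have s1 : (b * cos t) ^+ 2 <= M ^+ 2 by rewrite -[leLHS]real_normK ?num_real// lerXn2r ?nnegrE.
have s2 : (b * sin t) ^+ 2 <= M ^+ 2 by rewrite -[leLHS]real_normK ?num_real// lerXn2r ?nnegrE.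
have := sqn_pol t b; rewrite /sqn /pol /= => E.
have : b ^+ 2 <= 2 * M ^+ 2 by rewrite -E; lra.
by apply/negP; rewrite -ltNge; nra.
Qed.

Variables (phi : R * R -> R) (r k : R) (Q Q' : R -> R).
Hypotheses (tphi : test_fun setT phi) (r0 : 0 < r).
Hypothesis dQ : forall s : R, r <= s -> is_derive s 1 Q (Q' s).
Hypothesis cQ' : forall b, {within `[r, b], continuous Q'}.
Hypothesis riccati : forall s, r <= s -> Q' s + Q s ^+ 2 / s <= k ^+ 2 * s + s^-1.
Hypothesis Qr : Q r <= 0.

Let sphi : smooth phi. Proof. by case: tphi. Qed.
Let cphi : continuous phi. Proof. exact: sphi 0%N. Qed.
Let F t s := phi (pol t s).
Let D t s := rad_der phi t s.
(* [v s = s] on the domain of interest [s >= r], but [1 / v] is continuous on the whole line. *)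
Let v s := r + `|s - r|.
Let vE s : r <= s -> v s = s. Proof. by move=> rs; rewrite /v ger0_norm ?subr_ge0//; ring. Qed.
Let v0 s : 0 < v s. Proof. by rewrite /v ltr_pwDl. Qed.
Let cv : continuous v.
Proof.
move=> s; apply: cvgD; first exact: cvg_cst.
by apply: cvg_norm; apply: cvgB; [exact: cvg_id|exact: cvg_cst].
Qed.
Let cw : continuous (fun s => (v s)^-1 + k ^+ 2 * v s).
Proof.
move=> s; apply: cvgD; first by apply: cvgV; [rewrite gt_eqF|exact: cv].
by apply: cvgM; [exact: cvg_cst|exact: cv].
Qed.
Let g s t u := (v s * (D t s - D u s) ^+ 2 + ((v s)^-1 + k ^+ 2 * v s) * (F t s - F u s) ^+ 2)%:E.
Let G x := (sqn (grad phi x) + k ^+ 2 * phi x ^+ 2)%:E.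

Let w0 s : 0 <= (v s)^-1 + k ^+ 2 * v s.
Proof. by have vs := ltW (v0 s); rewrite addr_ge0 ?invr_ge0// mulr_ge0// sqr_ge0. Qed.
Let g0 s t u : (0 <= g s t u)%E.
Proof. by have vs := ltW (v0 s); rewrite lee_fin addr_ge0// mulr_ge0// sqr_ge0. Qed.
Let G0 x : (0 <= G x)%E.
Proof. by rewrite lee_fin; apply: addr_ge0; [apply: addr_ge0; exact: sqr_ge0|apply: mulr_ge0; exact: sqr_ge0]. Qed.

Let cF := continuous_sections (continuous_polar cphi).
Let cD := continuous_sections (continuous_rad_der sphi).
Let cA := continuous_sections (continuous_ang_der sphi).

Let measurable_g : measurable_fun setT
  (fun p : measurableTypeR R * measurableTypeR R * measurableTypeR R => g p.1.1 p.1.2 p.2).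
Proof.
have m1 : measurable_fun setT (fun p : measurableTypeR R * measurableTypeR R * measurableTypeR R => (p.1.2, p.1.1)).
  by apply: measurable_fun_pair; exact: measurableT_comp.
have m2 : measurable_fun setT (fun p : measurableTypeR R * measurableTypeR R * measurableTypeR R => (p.2, p.1.1)).
  by apply: measurable_fun_pair => //; exact: measurableT_comp.
have m3 (h : R -> R) : continuous h -> measurable_fun setT (fun p : measurableTypeR R * measurableTypeR R * measurableTypeR R => h p.1.1).
  move=> ch; have mh : measurable_fun setT h by exact: continuous_measurable_fun.
  by apply: (measurableT_comp mh); exact: measurableT_comp.
have mD : measurable_fun setT (fun p : R * R => D p.1 p.2) by apply: continuous_measurable2; exact: continuous_rad_der.
have mF : measurable_fun setT (fun p : R * R => F p.1 p.2) by apply: continuous_measurable2; exact: continuous_polar.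
apply/measurable_EFinP; apply: measurable_funD; apply: measurable_funM; try exact: (m3 _ cv); try exact: (m3 _ cw).
  by apply: measurable_funX; apply: measurable_funB; [exact: (measurableT_comp mD m1)|exact: (measurableT_comp mD m2)].
by apply: measurable_funX; apply: measurable_funB; [exact: (measurableT_comp mF m1)|exact: (measurableT_comp mF m2)].
Qed.

Let W (h : R -> R) : continuous h -> {within C, continuous h}. Proof. exact: continuous_subspaceT. Qed.
Let csq (f : R -> R) : continuous f -> continuous (fun v : R => f v ^+ 2).
Proof. by move=> cf x; apply: cvgM; exact: cf. Qed.

Let spread_le (f : R -> R) : spread f <= 4 * pi * \int[mu]_(t in C) (f t ^+ 2).
Proof. by rewrite /spread gerBl mulr_ge0// sqr_ge0. Qed.

Let spread_ang s : spread (F ^~ s) <= 4 * pi * \int[mu]_(t in C) (ang_der phi t s ^+ 2).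
Proof.
have cf : continuous (F ^~ s) := cF.2 s; have ca : continuous (ang_der phi ^~ s) := cA.2 s.
have [c hc] := wirtinger (fun t => is_derive_circle sphi t s) ca
  (fun t => congr1 phi (pol_period t s)) (fun t => ang_der_period phi t s).
rewrite -lee_fin -pair_integral//; apply: le_trans (pair_integral_le c cf) _.
rewrite (EFinM (4 * pi)) (Rintegral_EFin (W (csq ca))); apply: lee_wpmul2l => //.
by rewrite lee_fin mulr_ge0// pi_ge0.
Qed.

(** On one circle: for the radial derivative and the zero-order term the mean in [spread] is simply
    dropped, while the spread of [phi] divided by [s] is paid for by the angular energy through
    Wirtinger's inequality. *)
Let slice s : r <= s ->
  (\int[mu]_(t in C) \int[mu]_(u in C) g s t u <= (4 * pi)%:E * \int[mu]_(t in C) (G (pol t s) * s%:E))%E.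
Proof.
move=> rs; have s0 : 0 < s by exact: lt_le_trans rs.
rewrite pair_integral2; [|exact: cD.2|exact: cF.2].
rewrite vE//.
have E : (\int[mu]_(t in C) (G (pol t s) * s%:E) = \int[mu]_(t in C)
  (s * rad_der phi t s ^+ 2 + 1 * (s^-1 * ang_der phi t s ^+ 2 + k ^+ 2 * s * F t s ^+ 2) + 0)%:E)%E.
  apply: eq_integral => t _; rewrite /G -EFinM polar_sqn ?gt_eqF//; congr EFin; rewrite /F.
  by field; rewrite gt_eqF.
have c1 := csq (cD.2 s); have c2 := csq (cA.2 s); have c3 := csq (cF.2 s).
have c4 : continuous (fun t : R => s^-1 * ang_der phi t s ^+ 2 + k ^+ 2 * s * F t s ^+ 2).
  by move=> t; apply: cvgD; apply: cvgM; try exact: cvg_cst; [exact: c2|exact: c3].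
have c5 : continuous (fun t : R => s * rad_der phi t s ^+ 2 + 1 * (s^-1 * ang_der phi t s ^+ 2 + k ^+ 2 * s * F t s ^+ 2) + 0).
  move=> t; apply: cvgD; last exact: cvg_cst.
  by apply: cvgD; apply: cvgM; try exact: cvg_cst; [exact: c1|exact: c4].
rewrite E -(Rintegral_EFin (W c5)) -EFinM lee_fin Rintegral_lin//.
have -> : \int[mu]_(t in C) (s^-1 * ang_der phi t s ^+ 2 + k ^+ 2 * s * F t s ^+ 2) =
  s^-1 * \int[mu]_(t in C) (ang_der phi t s ^+ 2) + k ^+ 2 * s * \int[mu]_(t in C) (F t s ^+ 2).
  have := Rintegral_lin s^-1 (k ^+ 2 * s) 0 c2 c3; rewrite mul0r addr0 => <-.
  by apply: eq_Rintegral => t _; rewrite addr0.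
have h1 : s * spread (D ^~ s) <= s * (4 * pi * \int[mu]_(t in C) (rad_der phi t s ^+ 2)).
  by rewrite ler_pM2l//; exact: spread_le.
have h2 : s^-1 * spread (F ^~ s) <= s^-1 * (4 * pi * \int[mu]_(t in C) (ang_der phi t s ^+ 2)).
  by rewrite ler_pM2l ?invr_gt0//; exact: spread_ang.
have h3 : k ^+ 2 * s * spread (F ^~ s) <= k ^+ 2 * s * (4 * pi * \int[mu]_(t in C) (F t s ^+ 2)).
  by apply: ler_wpM2l; [rewrite mulr_ge0 ?sqr_ge0 ?(ltW s0)|exact: spread_le].
rewrite mulrDl; apply: le_trans (lerD h1 (lerD h2 h3)) _.
by rewrite le_eqVlt; apply/orP; left; apply/eqP; ring.
Qed.

Let ray t u : ((- Q r * (F t r - F u r) ^+ 2)%:E <= \int[mu]_(s in `[r, +oo[) g s t u)%E.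
Proof.
(* Ending the segment at a radius where [phi] vanishes in all directions removes the outer boundary
   term of Picone's inequality. *)
have [b rb phib] := test_fun_pol0 r tphi.
pose z s := F t s - F u s; pose z' s := D t s - D u s.
have dz (s : R) : is_derive s 1 z (z' s) by apply: derB; exact: is_derive_rad.
have cz : continuous z by move=> s; exact: der_continuous (dz s).
have cz' : continuous z' by move=> s; apply: cvgB; [exact: cD.1|exact: cD.1].
have cg : continuous (fun s => v s * z' s ^+ 2 + ((v s)^-1 + k ^+ 2 * v s) * z s ^+ 2).
  move=> s; apply: cvgD; apply: cvgM; [exact: cv|exact: csq|exact: cw|exact: csq].
have := @picone _ Q Q' z z' (fun s => v s * z' s ^+ 2 + ((v s)^-1 + k ^+ 2 * v s) * z s ^+ 2) r b rb
  (fun s _ => dz s) (fun s h => dQ (andP h).1) (continuous_subspaceT cz') (@cQ' b) (continuous_subspaceT cg).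
have -> : z b = 0 by rewrite /z /F !phib subrr.
rewrite expr0n /= mulr0 sub0r => P.
apply: (@le_trans _ _ (\int[mu]_(s in `[r, b]) g s t u)%E).
  rewrite -[leRHS](Rintegral_EFin (f := fun s => v s * z' s ^+ 2 + ((v s)^-1 + k ^+ 2 * v s) * z s ^+ 2)).
    rewrite lee_fin mulNr; apply: P => s /andP[rs _]; have s0 : 0 < s by exact: lt_le_trans rs.
    rewrite vE//; have := riccati rs => h.
    have : (Q' s + Q s ^+ 2 / s) * z s ^+ 2 <= (k ^+ 2 * s + s^-1) * z s ^+ 2 by rewrite ler_wpM2r ?sqr_ge0.
    (* Completing the square in [z']; the leftover [Q^2 / s] is exactly the term that [riccati]
       controls. *)
    have : 0 <= s * (z' s - Q s * z s / s) ^+ 2 by rewrite mulr_ge0 ?sqr_ge0// ltW.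
    have -> : s * (z' s - Q s * z s / s) ^+ 2 = s * z' s ^+ 2 - 2 * Q s * z s * z' s + Q s ^+ 2 / s * z s ^+ 2.
      by field; rewrite gt_eqF.
    by lra.
  exact: continuous_subspaceT.
apply: le_nonneg_integral => //.
by move=> s /=; rewrite !in_itv /= andbT => /andP[].
Qed.

(** Picone's inequality along each pair of rays ([ray]) and Wirtinger's on each circle ([slice]) are
    joined by exchanging the integrals over radii and over pairs of angles. The weight to be
    inserted is [Q s = s h' / h], for which [riccati] is an equality. *)
Lemma lower_test : ((- Q r * spread (fun t => phi (pol t r)))%:E <=
  (4 * pi)%:E * \int[leb2]_(x in disk_ext r) (sqn (grad phi x) + k ^+ 2 * phi x ^+ 2)%:E)%E.
Proof.
have P0 : 0 <= 4 * pi :> R by rewrite mulr_ge0// pi_ge0.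
have mC : measurable (C : set (measurableTypeR R)) by exact: measurable_itv.
have mr : measurable (`[r, +oo[%classic : set (measurableTypeR R)) by exact: measurable_itv.
have mG : measurable_fun setT G.
  apply/measurable_EFinP; apply: measurable_funD; first exact: measurable_sqn_grad.
  by apply: measurable_funM => //; apply: measurable_funX; exact: continuous_measurable2.
have mU : measurable (disk_ext r) by apply: open_measurable2; exact: open_disk_ext.
rewrite (polar_ext_integral (polar_disk_ext r0) mU (measurable_funTS mG) G0).
pose H t s := (G (pol t s) * (v s)%:E)%E.
have mH : measurable_fun setT (fun p : R * R => H p.1 p.2).
  apply: emeasurable_funM; first exact: measurable_ray.
  apply/measurable_EFinP; have mv : measurable_fun setT v by exact: continuous_measurable_fun.
  exact: (measurableT_comp mv).
have H0 t s : (0 <= H t s)%E by apply: mule_ge0; [exact: G0|rewrite lee_fin; exact: ltW (v0 s)].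
have -> : (\int[mu]_(t in C) \int[mu]_(s in `[r, +oo[) (G (pol t s) * s%:E) =
           \int[mu]_(t in C) \int[mu]_(s in `[r, +oo[) H t s)%E.
  apply: eq_integral => t _; apply: eq_integral => s; rewrite inE /= in_itv /= andbT => rs.
  by rewrite /H vE.
rewrite (tonelli_real mC mr (measurable_funTS mH) H0) -ge0_integralZl_EFin//; last first.
- exact: (measurable_int_r mC mr (measurable_funTS mH) H0).
- by move=> s _; exact: integral_ge0.
apply: (@le_trans _ _ (\int[mu]_(s in `[r, +oo[) \int[mu]_(t in C) \int[mu]_(u in C) g s t u)%E); last first.
  apply: le_nonneg_integral => //.
  - by move=> s _; apply: integral_ge0 => t _; exact: integral_ge0.
  - by move=> s _; apply: mule_ge0 => //; exact: integral_ge0.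
  - move=> s /=; rewrite in_itv /= andbT => rs; apply: le_trans (slice rs) _.
    apply: lee_wpmul2l => //; rewrite le_eqVlt; apply/orP; left; apply/eqP.
    by apply: eq_integral => t _; rewrite /H vE.
rewrite (tonelli3 mr mC measurable_g g0).
have cr : continuous (fun t => phi (pol t r)) := cF.2 r.
have := pair_integral2 (- Q r) 0 cr cr; rewrite mul0r addr0 => <-.
have nQ : 0 <= - Q r by rewrite oppr_ge0.
have n0 t u : (0 <= (- Q r * (F t r - F u r) ^+ 2 + 0 * (F t r - F u r) ^+ 2)%:E)%E.
  by rewrite lee_fin mul0r addr0 mulr_ge0// sqr_ge0.
apply: le_nonneg_integral => //.
- by move=> t _; apply: integral_ge0 => u _; exact: n0.
- by move=> t _; apply: integral_ge0 => u _; apply: integral_ge0 => s _; exact: g0.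
move=> t _; apply: le_nonneg_integral => //.
- by move=> u _; exact: n0.
- by move=> u _; apply: integral_ge0 => s _; exact: g0.
by move=> u _; rewrite mul0r addr0; exact: ray.
Qed.
End lower_bound.

(** * Linearity of weak gradients *)

Section linear_combinations.
Variable R : realType.
Implicit Types (u v phi : R * R -> R) (U : set (R * R)) (g h : R * R -> R * R).
Notation leb2 := (@leb2 R).

Lemma test_funT U phi : test_fun U phi -> test_fun setT phi.
Proof. by move=> [s c _]; split. Qed.

(** Makes the partial derivatives of test functions square integrable, so that the integrals in the
    weak identities are finite and can be added. *)
Lemma test_fun_grad phi : test_fun setT phi ->
  test_fun setT (fun x => (grad phi x).1) /\ test_fun setT (fun x => (grad phi x).2).
Proof.
move=> tp; have [r r0 h] := test_fun_supp tp; have [sp _ _] := tp.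
have [d _ _] := Ck_elim (sp 1%N).
have c1 k : Ck k (fun x => (grad phi x).1) by have [_ h1 _] := Ck_elim (sp k.+1); exact: h1.
have c2 k : Ck k (fun x => (grad phi x).2) by have [_ _ h2] := Ck_elim (sp k.+1); exact: h2.
have far (z : R -> R) (t l : R) : is_derive t 1 z l -> r < `|t| -> (forall s, r < `|s| -> z s = 0) -> l = 0.
  move=> dz tr z0; rewrite -(der_derive1 dz); apply: der_derive1.
  apply: (@near_eq_is_derive _ _ _ (fun=> 0)).
  have ct : (fun s : R => `|s|) @ t --> `|t| by apply: cvg_norm; exact: cvg_id.
  by near=> s; apply/esym/z0; near: s; move: ct => /cvgr_gt; apply.
have zero (t l : R) : is_derive t 1 (fun _ : R => 0 : R) l -> l = 0.
  by move=> dz; rewrite -(der_derive1 dz); apply: der_derive1; exact: der_cst.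
have out1 (a b : R) : r < `|a| -> phi (a, b) = 0.
  by move=> ra; apply: h => -[/=]; rewrite subr0 leNgt ra.
have out2 (a b : R) : r < `|b| -> phi (a, b) = 0.
  by move=> ra; apply: h => -[_ /=]; rewrite subr0 leNgt ra.
have sup (f : R * R -> R) : (forall a b : R, (r < `|a|) || (r < `|b|) -> f (a, b) = 0) -> forall x, ~ box (0, 0) r x -> f x = 0.
  move=> hf [a b] bx; apply: hf; rewrite !ltNge -negb_and; apply/negP => /andP[ra rb].
  by apply: bx; split; rewrite /= subr0.
split; apply: (test_fun_box (a := (0, 0)) (r := r)) => //; apply: sup => a b; have [d1 d2] := d (a, b).
  move=> /orP[ra|rb]; first by apply: (far _ _ _ d1 ra) => s; exact: out1.
  apply: (zero a); have -> : (fun _ : R => 0) = (fun s : R => phi (s, b)) by apply/funext => s; rewrite out2.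
  exact: d1.
move=> /orP[ra|rb]; last by apply: (far _ _ _ d2 rb) => s; exact: out2.
apply: (zero b); have -> : (fun _ : R => 0) = (fun s : R => phi (a, s)) by apply/funext => s; rewrite out1.
exact: d2.
Unshelve. all: by end_near. Qed.

Lemma test_fun_L2S U phi : open U -> test_fun setT phi -> L2 U phi.
Proof.
move=> oU tp; apply: (L2S (open_measurable2 oU) measurableT) => //; exact: (test_fun_L2 openT tp).
Qed.

Lemma L2_lin U u v (a b : R) : measurable U -> L2 U u -> L2 U v -> L2 U (fun x => a * u x + b * v x).
Proof. by move=> mU Lu Lv; apply: L2D => //; exact: L2Z. Qed.

Lemma Rintegral_L2_lin U u v phi (a b : R) : measurable U -> L2 U u -> L2 U v -> L2 U phi ->
  \int[leb2]_(x in U) ((a * u x + b * v x) * phi x) =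
  a * \int[leb2]_(x in U) (u x * phi x) + b * \int[leb2]_(x in U) (v x * phi x).
Proof.
move=> mU Lu Lv Lp.
have Iu := @sqi_integrableM R _ _ leb2 U mU _ _ Lu Lp.
have Iv := @sqi_integrableM R _ _ leb2 U mU _ _ Lv Lp.
have Iau := @sqi_integrableM R _ _ leb2 U mU _ _ (L2Z a mU Lu) Lp.
have Ibv := @sqi_integrableM R _ _ leb2 U mU _ _ (L2Z b mU Lv) Lp.
rewrite -(@RintegralZl _ _ _ leb2 U _ a mU Iu) -(@RintegralZl _ _ _ leb2 U _ b mU Iv).
have -> : \int[leb2]_(x in U) ((a * u x + b * v x) * phi x) =
          \int[leb2]_(x in U) (a * u x * phi x + b * v x * phi x).
  by apply: eq_Rintegral => x _; rewrite mulrDl.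
rewrite (@RintegralD _ _ _ leb2 U _ _ mU Iau Ibv).
by congr (_ + _); apply: eq_Rintegral => x _; rewrite mulrA.
Qed.

Lemma weak_grad_lin U u v g h (a b : R) : open U -> L2 U u -> L2 U v -> weak_grad U u g -> weak_grad U v h ->
  weak_grad U (fun x => a * u x + b * v x) (fun x => (a * (g x).1 + b * (h x).1, a * (g x).2 + b * (h x).2)).
Proof.
move=> oU Lu Lv [g1 g2 Hg] [h1 h2 Hh]; have mU := open_measurable2 oU.
split; [exact: L2_lin|exact: L2_lin|move=> phi tp].
have Lp := test_fun_L2 oU tp; have [t1 t2] := test_fun_grad (test_funT tp).
have Lp1 := test_fun_L2S oU t1; have Lp2 := test_fun_L2S oU t2.
have [a1 a2] := Hg _ tp; have [b1 b2] := Hh _ tp.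
apply: conj.
  apply: (etrans (Rintegral_L2_lin a b mU Lu Lv Lp1)).
  apply: (etrans _ (congr1 -%R (esym (Rintegral_L2_lin a b mU g1 h1 Lp)))).
  by rewrite a1 b1 !mulrN -opprD.
apply: (etrans (Rintegral_L2_lin a b mU Lu Lv Lp2)).
apply: (etrans _ (congr1 -%R (esym (Rintegral_L2_lin a b mU g2 h2 Lp)))).
by rewrite a2 b2 !mulrN -opprD.
Qed.
End linear_combinations.

(** * A trace inequality along rays, and the trace on a circle *)

Section traces.
Variable R : realType.
Notation mu := (@lebesgue_measure R).
Notation leb2 := (@leb2 R).
Notation C := (`[0%R, (2 * pi)%R]%classic : set R).

(** [ray_trace] on the first unit of each ray gives the factor 2, and the polar weight [s >= m] the
    factor [1 / m]. *)
Lemma trace_inequality (U : set (R * R)) (rho : R -> R) (m : R) (F : R * R -> \bar R) (z z' : R -> R -> R) :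
  polar_ext U rho -> measurable U -> 0 < m -> (forall t, C t -> m <= rho t) ->
  measurable_fun U F -> (forall x, 0 <= F x)%E ->
  (forall t s, C t -> rho t <= s -> is_derive s 1 (z t) (z' t s)) ->
  (forall t, C t -> {within `[rho t, rho t + 1], continuous z' t}) ->
  (forall t s, C t -> rho t <= s -> ((z t s ^+ 2 + z' t s ^+ 2)%:E <= F (pol t s))%E) ->
  (\int[mu]_(t in C) (z t (rho t) ^+ 2)%:E <= (2 / m)%:E * \int[leb2]_(x in U) F x)%E.
Proof.
move=> pU mU m0 rm mF F0 dz cz' H; rewrite (polar_ext_integral pU mU mF F0).
have mc : 0 <= 2 / m by rewrite divr_ge0// ltW.
have Fs0 t s : C t -> rho t <= s -> (0 <= F (pol t s) * s%:E)%E.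
  by move=> Ct rs; apply: mule_ge0 => //; rewrite lee_fin (le_trans (ltW m0))// (le_trans (rm t Ct)).
have -> : ((2 / m)%:E * \int[mu]_(t in C) \int[mu]_(s in `[rho t, +oo[) (F (pol t s) * s%:E) =
   \int[mu]_(t in C) ((2 / m)%:E * \int[mu]_(s in `[rho t, +oo[) (F (pol t s) * s%:E)))%E.
  rewrite ge0_integralZl_EFin//.
    by move=> t Ct; apply: integral_ge0 => s /=; rewrite in_itv /= andbT; exact: Fs0.
  have mpos : measurable (`]0%R, +oo[%classic : set (measurableTypeR R)) by exact: measurable_itv.
  have mz : measurable_fun setT (F \_ U) by have [h _] := measurable_restrictT F mU; exact: h.
  have z0 x : (0 <= (F \_ U) x)%E by rewrite patchE; case: ifP.
  have := measurable_funTS (D := C) (@measurable_polar_inner R _ z0 mz).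
  apply: eq_measurable_fun => t tC; have /set_mem Ct := tC; have [rho0 Urho] := pU.
  have tC' : 0 <= t <= 2 * pi by move: Ct; rewrite /= in_itv.
  have mp : measurable_fun `](rho t), +oo[%classic (fun s => F (pol t s) * s%:E)%E.
    have mt : measurable_fun setT (fun s : R => (F \_ U) (pol t s)).
      apply: (measurableT_comp mz); exact: (measurableT_comp (@measurable_pol R) (measurable_pair1 t)).
    have : measurable_fun `](rho t), +oo[%classic (fun s : R => (F \_ U) (pol t s) * s%:E)%E.
      by apply: measurable_funTS; apply: emeasurable_funM => //; apply/measurable_EFinP.
    apply: eq_measurable_fun => s; rewrite inE /= in_itv /= andbT => st.
    by rewrite patchE (mem_set ((Urho t s tC' (lt_trans (rho0 _ tC') st)).2 st)).
  rewrite -(integral_itv_obnd_cbnd (r := rho t))// [LHS]integral_mkcond [RHS]integral_mkcond.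
  apply: eq_integral => s _; rewrite !patchE; have [|/negP] := boolP (s \in `](rho t), +oo[%classic).
    move=> /set_mem /=; rewrite in_itv /= andbT => st.
    have s0 : 0 < s by exact: lt_trans (rho0 _ tC') st.
    by rewrite (mem_set (_ : `]0%R, +oo[%classic s)) ?(mem_set ((Urho t s tC' s0).2 st)) ?gtr0_norm//= in_itv /= s0.
  move=> sn; case: ifPn => // /set_mem /=; rewrite in_itv /= andbT => s0.
  case: ifPn => [/set_mem /(Urho t s tC' s0).1 st|]; last by rewrite mul0e.
  by exfalso; apply: sn; apply/mem_set; rewrite /= in_itv /= st.
apply: le_nonneg_integral => //.
- by move=> t _; rewrite lee_fin sqr_ge0.
- move=> t Ct; apply: mule_ge0 => //; apply: integral_ge0 => s /=.
  by rewrite in_itv /= andbT; exact: Fs0.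
move=> t Ct; apply: le_trans (ray_trace (fun s rs => dz t s Ct rs) (cz' t Ct)) _.
have cz : {within `[rho t, rho t + 1], continuous (z t)}.
  by apply: der_within => s /=; rewrite in_itv /= => /andP[rs _]; exists (z' t s); exact: dz.
apply: (@le_trans _ _ (\int[mu]_(s in `[rho t, (rho t + 1)%R]) ((2 / m)%:E * (m%:E * (z t s ^+ 2 + z' t s ^+ 2)%:E)))%E).
  apply: le_nonneg_integral => //.
  - by move=> s _; rewrite lee_fin; apply: addr_ge0; [apply: mulr_ge0; [by []|exact: sqr_ge0]|exact: sqr_ge0].
  - move=> s _; rewrite -!EFinM lee_fin; apply: mulr_ge0 => //.
    by rewrite mulr_ge0 ?(ltW m0)// addr_ge0// sqr_ge0.
  - move=> s _; rewrite -!EFinM lee_fin mulrA divfK ?gt_eqF//.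
    by have := sqr_ge0 (z' t s); lra.
have cS : {within `[rho t, rho t + 1], continuous (fun s => m * (z t s ^+ 2 + z' t s ^+ 2))}.
  move=> s; apply: cvgM; first exact: cvg_cst.
  by apply: cvgD; apply: cvgM; try exact: cz; exact: cz'.
have mS : measurable_fun `[rho t, rho t + 1] (fun s => (m * (z t s ^+ 2 + z' t s ^+ 2))%:E).
  exact: (@measurable_int _ _ _ mu _ _ (continuous_integrable cS)).
rewrite ge0_integralZl_EFin//; last first.
  by move=> s _; rewrite lee_fin mulr_ge0 ?(ltW m0)// addr_ge0// sqr_ge0.
apply: lee_wpmul2l; first by rewrite lee_fin.
apply: le_nonneg_integral => //.
- by move=> s /=; rewrite !in_itv /= andbT => /andP[].
- by move=> s _; rewrite lee_fin mulr_ge0 ?(ltW m0)// addr_ge0// sqr_ge0.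
- by move=> s /=; rewrite in_itv /= andbT; exact: Fs0.
move=> s /=; rewrite in_itv /= => /andP[rs _].
rewrite muleC; apply: lee_pmul => //.
- by rewrite lee_fin addr_ge0// sqr_ge0.
- by rewrite lee_fin ltW.
- exact: H.
- by rewrite lee_fin (le_trans (rm t Ct)).
Qed.

Section unit_interval.
Variable a : R.
Notation I := (`]a, (a + 1)%R]%classic : set (measurableTypeR R)).

Lemma mu_unit : mu I = 1%E.
Proof. by rewrite lebesgue_measure_itv /= lte_fin ltrDl ltr01 -EFinD addrAC subrr add0r. Qed.

(** The Cauchy-Schwarz inequality on an interval of length 1, from the square of [f - g - c] with
    [c] its integral. If the right-hand side is infinite there is nothing to prove, so [g] need only
    be measurable. *)
Lemma sq_unit_integralB (f g : R -> R) : sqi mu I f -> measurable_fun I g ->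
  (((\int[mu]_(s in I) f s - \int[mu]_(s in I) g s) ^+ 2)%:E <= nsq mu I (fun s => f s - g s)%R)%E.
Proof.
move=> Lf mg; have mI : measurable I by exact: measurable_itv.
have [mf _] := Lf; have mfg : measurable_fun I (fun s => f s - g s) by exact: measurable_funB.
have [fin|] := boolP ((nsq mu I (fun s => f s - g s)%R < +oo)%E); last first.
  by rewrite -leNgt leye_eq => /eqP ->; exact: leey.
have Ld : sqi mu I (fun s => f s - g s) by split.
have L1 : sqi mu I (cst 1).
  split => //; rewrite /nsq /=; under eq_integral do rewrite expr1n.
  have -> : (\int[mu]_(s in I) 1 = 1)%E by rewrite integral_cst// mul1e; exact: mu_unit.
  exact: ltry.
have int h : sqi mu I h -> mu.-integrable I (EFin \o h).
  move=> Lh; have := sqi_integrableM mI Lh L1; apply: eq_integrable => // s _.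
  by rewrite /= mulr1.
have If := int _ Lf; have Id := int _ Ld.
have Ig : mu.-integrable I (EFin \o g).
  have := int _ (sqiB mI Lf Ld); apply: eq_integrable => // s _.
  by rewrite /=; congr EFin; ring.
rewrite -(@RintegralB _ (measurableTypeR R) _ mu _ _ _ mI If Ig); set c := (X in X ^+ 2).
rewrite -(Rintegral_sq Ld) lee_fin.
have Ic : mu.-integrable I (EFin \o (fun s => 2 * c * (f s - g s) - c ^+ 2)).
  have I1 := @integrableZl _ (measurableTypeR R) _ mu _ mI (2 * c) _ Id.
  have I2 := @integrableZl _ (measurableTypeR R) _ mu _ mI (c ^+ 2) _ (int _ L1).
  have := @integrableB _ (measurableTypeR R) _ mu _ mI _ _ I1 I2.
  by apply: eq_integrable => // s _; rewrite /= mulr1.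
have E : \int[mu]_(s in I) (2 * c * (f s - g s) - c ^+ 2) = c ^+ 2.
  have I1 := @integrableZl _ (measurableTypeR R) _ mu _ mI (2 * c) _ Id.
  have I2 : mu.-integrable I (EFin \o cst (c ^+ 2)).
    have := @integrableZl _ (measurableTypeR R) _ mu _ mI (c ^+ 2) _ (int _ L1).
    by apply: eq_integrable => // s _; rewrite /= mule1.
  rewrite (@RintegralB _ (measurableTypeR R) _ mu _ _ _ mI I1 I2).
  rewrite (@RintegralZl _ (measurableTypeR R) _ mu _ _ _ mI Id) -/c.
  have -> : \int[mu]_(s in I) cst (c ^+ 2) s = c ^+ 2.
    have K : (\int[mu]_(s in I) (c ^+ 2)%:E = (c ^+ 2)%:E)%E.
      by transitivity ((c ^+ 2)%:E * mu I)%E; [exact: integral_cst|rewrite mu_unit mule1].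
    by rewrite /Rintegral /= K.
  by ring.
rewrite -{1}E; apply: (@le_Rintegral _ (measurableTypeR R) _ mu _ _ _ mI Ic (sqi_integrable Ld)) => s _.
by have := sqr_ge0 (f s - g s - c); nra.
Qed.
End unit_interval.

Section circle_trace.
Variables (r : R) (u : R * R -> R) (g : R * R -> R * R).
Hypothesis r0 : 0 < r.
Notation U := (disk_ext r).
Hypotheses (Lu : L2 U u) (wg : weak_grad U u g).
Notation I := (`]r, (r + 1)%R]%classic : set (measurableTypeR R)).

Let mU : measurable U. Proof. by apply: open_measurable2; exact: open_disk_ext. Qed.
Let ray (x : R * R) (s : R) : R * R := (s * (x.1 / r), s * (x.2 / r)).

(* The boundary value of a smooth [z] is [\int_r^(r+1) (z s - (r + 1 - s) z' s) ds]. *)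
Definition circle_integrand (x : R * R) (s : R) : R := zext U u (ray x s) -
  (r + 1 - s) * (x.1 / r * zext U (fun y => (g y).1) (ray x s) + x.2 / r * zext U (fun y => (g y).2) (ray x s)).

(** A trace given by a formula in [u] and its weak gradient instead of as a limit, which replaces an
    appeal to completeness and yields a function on the whole plane. *)
Definition circle_trace (x : R * R) : R := \int[mu]_(s in I) circle_integrand x s.

Lemma measurable_circle_integrand : measurable_fun setT
  (fun p : measurableTypeR R * measurableTypeR R * measurableTypeR R => circle_integrand p.1 p.2).
Proof.
have [g1 g2 _] := wg.
have m1 : measurable_fun setT (fun p : measurableTypeR R * measurableTypeR R * measurableTypeR R => p.1.1 / r).
  by apply: measurable_funM => //; exact: measurableT_comp.
have m2 : measurable_fun setT (fun p : measurableTypeR R * measurableTypeR R * measurableTypeR R => p.1.2 / r).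
  by apply: measurable_funM => //; exact: measurableT_comp.
have m3 : measurable_fun setT (fun p : measurableTypeR R * measurableTypeR R * measurableTypeR R => p.2) by exact: measurable_snd.
have mr : measurable_fun setT (fun p : measurableTypeR R * measurableTypeR R * measurableTypeR R => ray p.1 p.2).
  by apply: measurable_fun_pair; exact: measurable_funM.
have mz (f : R * R -> R) : L2 U f -> measurable_fun setT
    (fun p : measurableTypeR R * measurableTypeR R * measurableTypeR R => zext U f (ray p.1 p.2)).
  by move=> Lf; have [mf _] := L2_zext mU Lf; exact: (measurableT_comp mf mr).
apply: measurable_funB; first exact: mz.
apply: measurable_funM; first by apply: measurable_funB.
by apply: measurable_funD; apply: measurable_funM => //; exact: mz.
Qed.

Lemma measurable_circle_trace : measurable_fun setT circle_trace.
Proof.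
have mI : measurable I by exact: measurable_itv.
have mE : measurable_fun setT
    (fun p : measurableTypeR R * measurableTypeR R * measurableTypeR R => (circle_integrand p.1 p.2)%:E).
  by apply/measurable_EFinP; exact: measurable_circle_integrand.
have mp := measurable_funTS (D := setT `*` I) (measurable_funepos mE).
have mn := measurable_funTS (D := setT `*` I) (measurable_funeneg mE).
have M1 := @measurable_integral_l _ _ (measurableTypeR R * measurableTypeR R)%type (measurableTypeR R) _ mu
  setT I _ measurableT mI mp (fun p => funepos_ge0 _ p).
have M2 := @measurable_integral_l _ _ (measurableTypeR R * measurableTypeR R)%type (measurableTypeR R) _ mu
  setT I _ measurableT mI mn (fun p => funeneg_ge0 _ p).
have -> : circle_trace = fine \o (fun x : R * R =>
    \int[mu]_(s in I) ((fun p : R * R * R => (circle_integrand p.1 p.2)%:E) ^\+ (x, s)) -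
    \int[mu]_(s in I) ((fun p : R * R * R => (circle_integrand p.1 p.2)%:E) ^\- (x, s)))%E.
  apply/funext => x; rewrite /circle_trace /Rintegral integralE /=; congr (fine (_ - _)%E).
    by apply: eq_integral => s _; rewrite !funeposE.
  by apply: eq_integral => s _; rewrite !funenegE.
apply: (measurableT_comp (f := fine)); first exact: fine_measurable.
exact: emeasurable_funB M1 M2.
Qed.

Lemma ray_pol (t s : R) : ray (pol t r) s = pol t s.
Proof. by rewrite /ray /pol /=; congr (_, _); field; rewrite gt_eqF. Qed.

Lemma circle_trace_le (phi : R * R -> R) : smooth phi ->
  (\int[mu]_(t in C) ((phi (pol t r) - circle_trace (pol t r)) ^+ 2)%:E <=
   (2 / r)%:E * \int[leb2]_(x in U) ((phi x - u x) ^+ 2 + sqn (grad phi x - g x))%:E)%E.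
Proof.
move=> sphi; have [g1 g2 _] := wg; have mI : measurable I by exact: measurable_itv.
have cphi : continuous phi := sphi 0%N; have [c1 c2] := grad_continuous sphi.
pose G x := ((phi x - zext U u x) ^+ 2 + sqn (grad phi x - (zext U (fun y => (g y).1) x, zext U (fun y => (g y).2) x)))%:E.
have G0 x : (0 <= G x)%E by rewrite lee_fin addr_ge0 ?sqr_ge0// addr_ge0// sqr_ge0.
have mG : measurable_fun setT G.
  apply/measurable_EFinP; apply: measurable_funD.
    apply: measurable_funX; apply: measurable_funB; first exact: continuous_measurable2.
    by apply: measurable_zext => //; case: Lu.
  apply: measurable_funD; apply: measurable_funX; apply: measurable_funB.
  - exact: continuous_measurable2 c1.
  - by apply: measurable_zext => //; case: g1.
  - exact: continuous_measurable2 c2.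
  - by apply: measurable_zext => //; case: g2.
have -> : (\int[leb2]_(x in U) ((phi x - u x) ^+ 2 + sqn (grad phi x - g x))%:E = \int[leb2]_(x in U) G x)%E.
  by apply: eq_integral => x /set_mem Ux; rewrite /G !zext_in//; congr (_ + sqn (_ - _))%:E; case: (g x).
rewrite (polar_ext_integral (polar_disk_ext r0) mU (measurable_funTS mG) G0).
have rr : 0 <= 2 / r by rewrite divr_ge0// ltW.
have mH : measurable_fun setT (fun p : R * R => (G (pol p.1 p.2) * `|p.2|%:E)%E).
  apply: emeasurable_funM; first exact: measurable_ray.
  by apply/measurable_EFinP; apply: measurableT_comp => //; exact: measurable_snd.
have mC : measurable (C : set (measurableTypeR R)) by exact: measurable_itv.
have mr : measurable (`[r, +oo[%classic : set (measurableTypeR R)) by exact: measurable_itv.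
have -> : (\int[mu]_(t in C) \int[mu]_(s in `[r, +oo[) (G (pol t s) * s%:E) =
   \int[mu]_(t in C) \int[mu]_(s in `[r, +oo[) (G (pol t s) * `|s|%:E))%E.
  apply: eq_integral => t _; apply: eq_integral => s; rewrite inE /= in_itv /= andbT => rs.
  by rewrite ger0_norm// (le_trans (ltW r0)).
have H0 t s : (0 <= G (pol t s) * `|s|%:E)%E by apply: mule_ge0 => //; rewrite lee_fin.
rewrite -ge0_integralZl_EFin//; last first.
- exact: (measurable_int_l (f := fun t s => (G (pol t s) * `|s|%:E)%E) mC mr (measurable_funTS mH) H0).
- by move=> t _; apply: integral_ge0 => s _; exact: H0.
apply: le_nonneg_integral => //.
- by move=> t _; rewrite lee_fin sqr_ge0.
- by move=> t _; apply: mule_ge0; rewrite ?lee_fin//; apply: integral_ge0 => s _; exact: H0.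
move=> t _.
pose A s := phi (pol t s) - (r + 1 - s) * rad_der phi t s.
have cD : continuous (rad_der phi t) := (continuous_sections (continuous_rad_der sphi)).1 t.
have cF : continuous (fun s => phi (pol t s)) := (continuous_sections (continuous_polar cphi)).1 t.
have cA : continuous A.
  move=> s; apply: cvgB; first exact: cF.
  by apply: cvgM; [apply: cvgB; [exact: cvg_cst|exact: cvg_id]|exact: cD].
have LA : sqi mu I A.
  split; first by apply: measurable_funTS; exact: continuous_measurable_fun.
  have cA2 : {within `[r, r + 1], continuous (fun s => A s ^+ 2)}.
    by apply: continuous_subspaceT => s; apply: cvgM; exact: cA.
  apply: (@le_lt_trans _ _ (\int[mu]_(s in `[r, (r + 1)%R]) (A s ^+ 2)%:E)%E).
    apply: le_nonneg_integral => //.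
    - by move=> s /=; rewrite !in_itv /= => /andP[h ->]; rewrite ltW.
    - by move=> s _; rewrite lee_fin sqr_ge0.
    - by move=> s _; rewrite lee_fin sqr_ge0.
  by rewrite -(Rintegral_EFin cA2) ltry.
(* [A] is the derivative of [- (r + 1 - s) * phi (pol t s)], which vanishes at [r + 1] and equals
   [- phi (pol t r)] at [r]. *)
have EA : \int[mu]_(s in I) A s = phi (pol t r).
  have dA (s : R) : is_derive s 1 (fun s => - (r + 1 - s) * phi (pol t s)) (A s).
    have d := derM (derN (derB (der_cst (r + 1) s) (der_id s))) (is_derive_rad sphi t s).
    by apply: (der_eq d); rewrite /A; ring.
  have rle : r <= r + 1 by rewrite lerDl.
  rewrite /Rintegral integral_itv_obnd_cbnd; last first.
    by apply/measurable_EFinP; apply: measurable_funTS; exact: continuous_measurable_fun.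
  rewrite (integral_is_derive rle (fun s _ => dA s) (continuous_subspaceT cA)) /=.
  by rewrite subrr; ring.
have mB : measurable_fun I (circle_integrand (pol t r)).
  apply: measurable_funTS; exact: (measurableT_comp measurable_circle_integrand (measurable_pair1 (pol t r))).
rewrite -EA; apply: le_trans (sq_unit_integralB LA mB) _.
have mray : measurable_fun setT (fun s : R => (G (pol t s) * `|s|%:E)%E).
  exact: (measurableT_comp mH (measurable_pair1 t)).
rewrite -ge0_integralZl_EFin//; last by exact: measurable_funTS.
apply: le_nonneg_integral => //.
- by move=> s /=; rewrite !in_itv /= andbT => /andP[h _]; rewrite ltW.
- by move=> s _; rewrite lee_fin sqr_ge0.
- by move=> s _; apply: mule_ge0; [rewrite lee_fin|exact: H0].
move=> s /=; rewrite in_itv /= => /andP[rs s1].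
have s0 : 0 < s by exact: lt_trans rs.
rewrite /A /circle_integrand ray_pol /G -!EFinM lee_fin gtr0_norm// /rad_der /sqn.
have -> : (pol t r).1 / r = cos t by rewrite /pol /= mulrAC divff ?mul1r// gt_eqF.
have -> : (pol t r).2 / r = sin t by rewrite /pol /= mulrAC divff ?mul1r// gt_eqF.
have -> y : (grad phi y - (zext U (fun y => (g y).1) y, zext U (fun y => (g y).2) y)).1 = (grad phi y).1 - zext U (fun y => (g y).1) y by [].
have -> y : (grad phi y - (zext U (fun y => (g y).1) y, zext U (fun y => (g y).2) y)).2 = (grad phi y).2 - zext U (fun y => (g y).2) y by [].
move: (zext U u (pol t s)) (zext U (fun y => (g y).1) (pol t s)) (zext U (fun y => (g y).2) (pol t s)) => q q1 q2.
move: (grad phi (pol t s)).1 (grad phi (pol t s)).2 (phi (pol t s)) => p1 p2 p.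
have := cos2Dsin2 t; move: (cos t) (sin t) => c d cd.
set e := r + 1 - s; have e0 : 0 <= e by rewrite /e; lra.
have e1 : e <= 1 by rewrite /e; lra.
set X := (p - q) ^+ 2; set Y := (p1 - q1) ^+ 2 + (p2 - q2) ^+ 2.
apply: (@le_trans _ _ (2 * (X + Y))).
  set k := (p1 - q1) * c + (p2 - q2) * d.
  have -> : p - e * (p1 * c + p2 * d) - (q - e * (c * q1 + d * q2)) = (p - q) - e * k by rewrite /k; ring.
  have kY : k ^+ 2 <= Y.
    have -> : Y = Y * (c ^+ 2 + d ^+ 2) by rewrite cd mulr1.
    by have := sqr_ge0 ((p1 - q1) * d - (p2 - q2) * c); rewrite /k /Y; nra.
  have ek : (e * k) ^+ 2 <= k ^+ 2.
    by rewrite exprMn ler_piMl ?sqr_ge0// expr_le1.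
  by have := sqr_ge0 (p - q + e * k); rewrite /X; nra.
have XY : 0 <= X + Y by rewrite /X /Y addr_ge0 ?sqr_ge0// addr_ge0// sqr_ge0.
have -> : 2 / r * ((X + Y) * s) = 2 * (X + Y) * s / r by ring.
by rewrite ler_pdivlMr// ler_wpM2l ?mulr_ge0// ltW.
Qed.
End circle_trace.
End traces.

(** * Improper integrals and limits at infinity *)

Section improper_integrals.
Variable R : realType.
Notation mu := (@lebesgue_measure R).
Implicit Types F f : R -> R.

Lemma ftc_infty F f (a l : R) : (forall x : R, a <= x -> is_derive x 1 F (f x)) -> {within `[a, +oo[, continuous f} ->
  (forall x, a <= x -> 0 <= f x) -> F @ +oo --> l ->
  (\int[mu]_(x in `[a, +oo[) (f x)%:E = (l - F a)%:E)%E.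
Proof.
move=> dF cf f0 Fl; rewrite EFinB; apply: ge0_continuous_FTC2y => //.
- by move=> x ax; have [] := dF x (ltW ax).
- by apply: cvg_at_right_filter; exact: der_continuous (dF a (lexx a)).
- by move=> x; rewrite in_itv /= andbT => ax; apply: der_derive1; apply: dF; exact: ltW.
Qed.

Lemma cvg_inv_bound F (K : R) : 0 <= K -> (forall t, 0 < t -> `|F t| <= K / t) -> F @ +oo --> (0 : R).
Proof.
move=> K0 FK; apply/cvgrPdist_le => e e0; near=> t.
have t0 : 0 < t by near: t; exact: nbhs_pinfty_gt.
have te : K / e <= t by near: t; apply: nbhs_pinfty_ge; exact: num_real.
rewrite sub0r normrN; apply: le_trans (FK t t0) _.
by rewrite ler_pdivrMr// mulrC -ler_pdivrMr.
Unshelve. all: by end_near. Qed.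

Lemma exp_inv_bound (y : R) : 0 < y -> expR (- y) <= y^-1.
Proof.
move=> y0; have := exp_pow_bound 1 y0; rewrite expr1 (_ : 1`!%:R = 1)// => h.
by rewrite -[leRHS]mul1r ler_pdivlMr// mulrC.
Qed.
End improper_integrals.

(** * The Bessel function K_1 as an integral of exponentials *)

Section bessel.
Variable R : realType.
Notation mu := (@lebesgue_measure R).
Notation H := (`[0%R, +oo[%classic : set R).
Notation Hm := (H : set (measurableTypeR R)).
Implicit Types r s t : R.

Definition ch (t : R) : R := (expR t + expR (- t)) / 2.
Definition sh (t : R) : R := (expR t - expR (- t)) / 2.

Let dexp (t : R) : is_derive t 1 (fun t : R => expR t) (expR t).
Proof. by have := der_exp (der_id t); rewrite mul1r. Qed.
Let dexpN (t : R) : is_derive t 1 (fun t : R => expR (- t)) (- expR (- t)).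
Proof. by have := der_exp (derN (der_id t)); rewrite mulN1r. Qed.

Lemma is_derive_ch (t : R) : is_derive t 1 ch (sh t).
Proof. by apply: (der_eq (derM (derD (dexp t) (dexpN t)) (der_cst 2^-1 t))); rewrite mulr0 addr0. Qed.

Lemma is_derive_sh (t : R) : is_derive t 1 sh (ch t).
Proof. by apply: (der_eq (derM (derB (dexp t) (dexpN t)) (der_cst 2^-1 t))); rewrite mulr0 addr0 opprK. Qed.

Let expV (t : R) : expR t * expR (- t) = 1. Proof. by rewrite -expRD subrr expR0. Qed.

Lemma ch2Bsh2 t : ch t ^+ 2 - sh t ^+ 2 = 1.
Proof. by transitivity (expR t * expR (- t)); [rewrite /ch /sh; field|exact: expV]. Qed.

Lemma ch_ge1 t : 1 <= ch t.
Proof.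
rewrite /ch ler_pdivlMr// mul1r; have := expV t; have := expR_gt0 t; have := expR_gt0 (- t).
move: (expR t) (expR (- t)) => x y y0 x0 xy; have := sqr_ge0 (x - y); nra.
Qed.

Lemma ch_ge_exp t : expR t / 2 <= ch t.
Proof. by rewrite /ch ler_pM2r ?invr_gt0// lerDl expR_ge0. Qed.

Lemma ch_gt0 t : 0 < ch t. Proof. exact: lt_le_trans (ch_ge1 t). Qed.

Lemma sh_ge t : 0 <= t -> t / 2 <= sh t.
Proof.
move=> t0; rewrite /sh ler_pM2r ?invr_gt0//; have := expR_ge1Dx t.
have : expR (- t) <= 1 by rewrite expR_le1 oppr_le0.
by lra.
Qed.

Lemma sh_le_ch t : sh t <= ch t.
Proof. by rewrite /sh /ch ler_pM2r ?invr_gt0//; have := expR_gt0 (- t); lra. Qed.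

Definition besf j (r t : R) : R := ch t ^+ j * expR (- r * ch t).

Lemma continuous_ch : continuous ch. Proof. by move=> t; exact: der_continuous (is_derive_ch t). Qed.
Lemma continuous_sh : continuous sh. Proof. by move=> t; exact: der_continuous (is_derive_sh t). Qed.

Lemma besf_ge0 j r t : 0 <= besf j r t.
Proof. by rewrite mulr_ge0 ?expR_ge0// exprn_ge0// ltW// ch_gt0. Qed.

Let cexp (u : R -> R) : continuous u -> continuous (fun t => expR (u t)).
Proof. by move=> cu t; apply: (continuous_comp (f := u)); [exact: cu|exact: continuous_expR]. Qed.

Lemma continuous_besf j r : continuous (besf j r).
Proof.
move=> t; apply: cvgM.
  by apply: (continuous_comp (f := ch) (g := fun x => x ^+ j)); [exact: continuous_ch|exact: exprn_continuous].
apply: (@cexp (fun t => - r * ch t)) => {}t; apply: cvgM; [exact: cvg_cst|exact: continuous_ch].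
Qed.

Definition besC j (r : R) : R := 2 * (j.+1)`!%:R / r ^+ j.+1.

Lemma besC_ge0 j r : 0 < r -> 0 <= besC j r.
Proof. by move=> r0; rewrite /besC divr_ge0// ?mulr_ge0// exprn_ge0// ltW. Qed.

(** The bound [x^(j+1) * exp (- x) <= (j+1)!] at [x = r * ch t] leaves over one factor [1 / ch t],
    at most [2 * exp (- t)]; the constant [besC] collects the rest. *)
Lemma besf_le j r t : 0 < r -> besf j r t <= besC j r * expR (- t).
Proof.
move=> r0; have c0 := ch_gt0 t; have rc : 0 < r * ch t by rewrite mulr_gt0.
have := exp_pow_bound j.+1 rc => h; rewrite /besf /besC mulNr.
have rj : 0 < r ^+ j.+1 by rewrite exprn_gt0.
rewrite mulrAC ler_pdivlMr//.
have e0 := expR_gt0 t.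
have -> : ch t ^+ j * expR (- (r * ch t)) * r ^+ j.+1 = (r * ch t) ^+ j.+1 * expR (- (r * ch t)) / ch t.
  by rewrite (exprMn j.+1 r (ch t)) (exprS (ch t)); field; rewrite gt_eqF.
rewrite ler_pdivrMr//; apply: le_trans h _.
have : 1 <= 2 * expR (- t) * ch t.
  have E : 2 * expR (- t) * (expR t / 2) = 1 by transitivity (expR t * expR (- t)); [field|exact: expV].
  by rewrite -[leLHS]E ler_pM2l ?ch_ge_exp// mulr_gt0// expR_gt0.
move=> k; have -> : 2 * (j.+1)`!%:R * expR (- t) * ch t = (j.+1)`!%:R * (2 * expR (- t) * ch t) by ring.
by rewrite ler_peMr.
Qed.

Lemma integral_exp : (\int[mu]_(t in H) (expR (- t))%:E = 1%:E)%E.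
Proof.
have dF (x : R) : 0 <= x -> is_derive x 1 (fun t => - expR (- t)) (expR (- x)).
  by move=> _; apply: (der_eq (derN (dexpN x))); rewrite opprK.
have cf : {within `[0, +oo[, continuous (fun t : R => expR (- t))}.
  by apply: continuous_subspaceT; apply: cexp => t; apply: cvgN; exact: cvg_id.
have cF : (fun t : R => - expR (- t)) @ +oo --> (0 : R).
  by rewrite -[X in _ --> X]oppr0; apply: cvgN; exact: cvgr_expR.
rewrite (ftc_infty dF cf (fun x _ => expR_ge0 _) cF).
by rewrite oppr0 expR0 sub0r opprK.
Qed.

Let mH : measurable Hm. Proof. exact: measurable_itv. Qed.

Lemma integrable_besf j r : 0 < r -> mu.-integrable Hm (EFin \o besf j r).
Proof.
move=> r0; apply/integrableP; split.
  by apply/measurable_EFinP; apply: measurable_funTS; apply: continuous_measurable_fun; exact: continuous_besf.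
apply: (@le_lt_trans _ _ (\int[mu]_(t in H) ((besC j r)%:E * (expR (- t))%:E))%E).
  apply: le_nonneg_integral => //.
    by move=> t _; rewrite -EFinM lee_fin mulr_ge0 ?expR_ge0 ?besC_ge0.
  by move=> t _; rewrite /= ger0_norm ?besf_ge0// -EFinM lee_fin; exact: besf_le.
rewrite ge0_integralZl_EFin//.
- by rewrite integral_exp -EFinM ltry.
- apply/measurable_EFinP; apply: measurable_funTS; apply: continuous_measurable_fun.
  by apply: cexp => t; apply: cvgN; exact: cvg_id.
- exact: (besC_ge0 j r0).
Qed.

(** [bes 0] is [K_0], [bes 1] is [K_1], and [bes j] is [(-1)^j] times the derivative of order [j] of
    [K_0]. With powers of [ch] in place of hyperbolic cosines of multiples of [t], differentiation
    merely raises [j]. *)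
Definition bes j (r : R) : R := \int[mu]_(t in H) besf j r t.

Lemma bes_comb i j k r (a b c : R) : 0 < r ->
  mu.-integrable Hm (EFin \o (fun t => a * besf i r t + b * besf j r t + c * besf k r t)) /\
  \int[mu]_(t in H) (a * besf i r t + b * besf j r t + c * besf k r t) = a * bes i r + b * bes j r + c * bes k r.
Proof.
move=> r0; have I l := integrable_besf l r0.
have Z (e : R) l : mu.-integrable Hm (EFin \o (fun t => e * besf l r t)).
  by have := @integrableZl _ (measurableTypeR R) _ mu _ mH e _ (I l); apply: eq_integrable.
have D : mu.-integrable Hm (EFin \o (fun t => a * besf i r t + b * besf j r t)).
  by have := @integrableD _ (measurableTypeR R) _ mu _ mH _ _ (Z a i) (Z b j); apply: eq_integrable.
split.
  by have := @integrableD _ (measurableTypeR R) _ mu _ mH _ _ D (Z c k); apply: eq_integrable.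
rewrite (@RintegralD _ (measurableTypeR R) _ mu _ _ _ mH D (Z c k)).
rewrite (@RintegralD _ (measurableTypeR R) _ mu _ _ _ mH (Z a i) (Z b j)).
rewrite (@RintegralZl _ (measurableTypeR R) _ mu _ _ _ mH (I i)).
rewrite (@RintegralZl _ (measurableTypeR R) _ mu _ _ _ mH (I j)).
by rewrite (@RintegralZl _ (measurableTypeR R) _ mu _ _ _ mH (I k)).
Qed.

Lemma bes_gt0 j r : 0 < r -> 0 < bes j r.
Proof.
(* An upper bound of [ch] on [[0, 1]], where the integrand is bounded away from 0. *)
move=> r0; pose c := (expR 1 + 1) / 2 : R.
have low (t : R) : 0 <= t <= 1 -> expR (- r * c) <= besf j r t.
  move=> /andP[t0 t1]; have tc : ch t <= c.
    rewrite /ch /c ler_pM2r ?invr_gt0//; apply: lerD; first by rewrite ler_expR.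
    by rewrite expR_le1 oppr_le0.
  apply: (@le_trans _ _ (expR (- r * ch t))); first by rewrite ler_expR !mulNr lerN2 ler_pM2l.
  by rewrite /besf ler_peMl ?expR_ge0// exprn_ege1// ch_ge1.
apply: (@lt_le_trans _ _ (expR (- r * c))); first exact: expR_gt0.
rewrite -lee_fin /bes /Rintegral fineK; last first.
  exact: (@integrable_fin_num _ (measurableTypeR R) _ mu _ mH _ (integrable_besf j r0)).
apply: (@le_trans _ _ (\int[mu]_(t in `[0%R, 1%R]) (expR (- r * c))%:E)%E).
  rewrite integral_cst//= lebesgue_measure_itv /= lte_fin ltr01 -EFinD -EFinM subr0 mulr1//.
apply: le_nonneg_integral => //.
- by move=> t /=; rewrite !in_itv /= andbT => /andP[].
- by move=> t _; rewrite lee_fin besf_ge0.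
Qed.

Lemma is_derive_bes j (r : R) : 0 < r -> is_derive r 1 (bes j) (- bes j.+1 r).
Proof.
move=> r0; have r2 : 0 < r / 2 by rewrite divr_gt0.
have [_ E] := bes_comb j.+1 j j (-1) 0 0 r0.
have -> : - bes j.+1 r = \int[mu]_(t in H) (- besf j.+1 r t).
  rewrite -mulN1r; have := E; rewrite !mul0r !addr0 => <-.
  by apply: eq_Rintegral => t _; rewrite !mul0r !addr0 mulN1r.
apply: (@is_derive_under R _ (measurableTypeR R) mu Hm (fun r t => besf j r t) (fun r t => - besf j.+1 r t)
  r (r / 2) (2 * r) (besf j.+1 (r / 2)) mH).
- by apply/andP; split; lra.
- by move=> x /andP[x1 _]; apply: integrable_besf; exact: lt_trans x1.
- move=> x t _ _; rewrite /besf.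
  have d : is_derive x 1 (fun x : R => - x * ch t) (- ch t).
    by apply: (der_eq (derM (derN (der_id x)) (der_cst (ch t) x))); ring.
  by apply: (der_eq (derZ (ch t ^+ j) (der_exp d))); rewrite exprS; ring.
- exact: besf_ge0.
- exact: integrable_besf.
- move=> x t /andP[x1 _] _; rewrite normrN ger0_norm ?besf_ge0// /besf ler_wpM2l ?exprn_ge0 ?(ltW (ch_gt0 t))//.
  by rewrite ler_expR !mulNr lerN2 ler_wpM2r ?(ltW (ch_gt0 t))// ltW.
Qed.

(* Integral of the derivative of [sh t * exp (- r ch t)]; the term [exp (- r sh t) / r] makes the
   integrand nonnegative. *)
Lemma bes_rec r : 0 < r -> bes 1 r = r * (bes 2 r - bes 0 r).
Proof.
move=> r0; pose p t := ch t * expR (- r * sh t); pose G t := - expR (- r * sh t) / r.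
have cp : continuous p.
  move=> t; apply: cvgM; first exact: continuous_ch.
  by apply: (@cexp (fun t => - r * sh t)) => {}t; apply: cvgM; [exact: cvg_cst|exact: continuous_sh].
have p0 t : 0 <= p t by rewrite mulr_ge0 ?expR_ge0// ltW// ch_gt0.
have dG (t : R) : is_derive t 1 G (p t).
  have d := derM (derN (der_exp (derZ (- r) (is_derive_sh t)))) (der_cst r^-1 t).
  by apply: (der_eq d); rewrite /p; field; rewrite gt_eqF.
have rr0 : 0 <= 2 / r ^+ 2 by rewrite divr_ge0// sqr_ge0.
have Gb t : 0 < t -> `|G t| <= (2 / r ^+ 2) / t.
  move=> t0; have -> : `|G t| = expR (- r * sh t) / r.
    by rewrite /G mulNr normrN ger0_norm// divr_ge0 ?expR_ge0 ?(ltW r0).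
  have st := sh_ge (ltW t0); have s0 : 0 < sh t by apply: lt_le_trans st; rewrite divr_gt0.
  have := exp_inv_bound (mulr_gt0 r0 s0); rewrite mulNr => h.
  have -> : 2 / r ^+ 2 / t = (r * (t / 2))^-1 / r by field; rewrite !gt_eqF.
  rewrite ler_pM2r ?invr_gt0//; apply: le_trans h _.
  have a1 : 0 < r * sh t by exact: mulr_gt0.
  have a2 : 0 < r * (t / 2) by apply: mulr_gt0 => //; rewrite divr_gt0.
  by rewrite lef_pV2 ?posrE// ler_pM2l.
have G00 : G 0 = - r^-1 by rewrite /G /sh oppr0 expR0 subrr mul0r mulr0 expR0 mulN1r.
have cG : G @ +oo --> (0 : R) by exact: cvg_inv_bound rr0 Gb.
have Ip : (\int[mu]_(t in H) (p t)%:E = (r^-1)%:E)%E.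
  by rewrite (ftc_infty (fun x _ => dG x) (continuous_subspaceT cp) (fun x _ => p0 x) cG) G00 sub0r opprK.
pose q t := r * besf 2 r t + (-1) * besf 1 r t + (- r) * besf 0 r t.
have cq : continuous q.
  by move=> t; apply: cvgD; [apply: cvgD|]; apply: cvgM; try exact: cvg_cst; exact: continuous_besf.
have qE t : q t = (r * sh t ^+ 2 - ch t) * expR (- r * ch t).
  have e : sh t ^+ 2 = ch t ^+ 2 - 1 by have := ch2Bsh2 t; move: (ch t ^+ 2) (sh t ^+ 2) => x y; lra.
  by rewrite /q /besf e; ring.
have qp0 t : 0 <= t -> 0 <= q t + p t.
  move=> t0; rewrite qE /p.
  have : expR (- r * ch t) <= expR (- r * sh t) by rewrite ler_expR !mulNr lerN2 ler_pM2l// sh_le_ch.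
  have := ch_gt0 t; have := expR_gt0 (- r * ch t); move: (expR _) (expR _) => y x x0 c0 xy.
  have : 0 <= r * sh t ^+ 2 * x.
    by apply: mulr_ge0; [apply: mulr_ge0; [exact: ltW|exact: sqr_ge0]|exact: ltW].
  have : ch t * x <= ch t * y by rewrite ler_pM2l.
  by lra.
pose F t := - sh t * expR (- r * ch t) + G t.
have dF (t : R) : is_derive t 1 F (q t + p t).
  have d := derD (derM (derN (is_derive_sh t)) (der_exp (derZ (- r) (is_derive_ch t)))) (dG t).
  by apply: (der_eq d); rewrite qE; ring.
have Fb t : 0 < t -> `|- sh t * expR (- r * ch t)| <= besC 1 r / t.
  move=> t0; have s0 : 0 <= sh t by apply: le_trans (sh_ge (ltW t0)); rewrite divr_ge0// ltW.
  have -> : `|- sh t * expR (- r * ch t)| = sh t * expR (- r * ch t).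
    by rewrite mulNr normrN ger0_norm// mulr_ge0 ?expR_ge0.
  apply: (@le_trans _ _ (besf 1 r t)); first by rewrite /besf expr1 ler_wpM2r ?expR_ge0// sh_le_ch.
  apply: le_trans (besf_le 1 t r0) _; by apply: ler_wpM2l; [exact: (besC_ge0 1 r0)|exact: exp_inv_bound].
have cF : F @ +oo --> (0 : R).
  rewrite -[X in _ --> X](addr0 0); apply: cvgD => //.
  exact: cvg_inv_bound (besC_ge0 1 r0) Fb.
have IF : (\int[mu]_(t in H) (q t + p t)%:E = (r^-1)%:E)%E.
  have cqp : continuous (fun t => q t + p t) by move=> t; apply: cvgD; [exact: cq|exact: cp].
  rewrite (ftc_infty (fun x _ => dF x) (continuous_subspaceT cqp) qp0 cF).
  by rewrite /F G00 /sh oppr0 expR0 subrr mul0r oppr0 mul0r add0r sub0r opprK.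
have intp : mu.-integrable Hm (EFin \o p).
  apply/integrableP; split; first by apply/measurable_EFinP; apply: measurable_funTS; exact: continuous_measurable_fun.
  rewrite (_ : (\int[mu]_(x in H) `|(EFin \o p) x| = (r^-1)%:E)%E) ?ltry// -Ip.
  by apply: eq_integral => t _; rewrite /= ger0_norm.
have [intq qI] := bes_comb 2 1 0 r (-1) (- r) r0.
have : \int[mu]_(t in H) (q t + p t) = \int[mu]_(t in H) q t + \int[mu]_(t in H) p t.
  exact: (@RintegralD _ (measurableTypeR R) _ mu _ _ _ mH intq intp).
rewrite {1 3}/Rintegral IF Ip /= -{1}[r^-1]add0r => /addIr; rewrite [X in _ = X -> _]qI.
by lra.
Qed.

(** The Cauchy-Schwarz inequality through a discriminant: the integral of [besf 1 * (l + ch)^2] is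
    nonnegative, and [l] is taken at its minimum. *)
Lemma bes_log_convex r : 0 < r -> bes 2 r ^+ 2 <= bes 1 r * bes 3 r.
Proof.
move=> r0; have b1 := bes_gt0 1 r0.
have pos (l : R) : 0 <= l ^+ 2 * bes 1 r + 2 * l * bes 2 r + 1 * bes 3 r.
  have [_ <-] := bes_comb 1 2 3 (l ^+ 2) (2 * l) 1 r0; apply: Rintegral_ge0 => t _.
  have -> : l ^+ 2 * besf 1 r t + 2 * l * besf 2 r t + 1 * besf 3 r t = besf 1 r t * (l + ch t) ^+ 2.
    by rewrite /besf; ring.
  by rewrite mulr_ge0 ?besf_ge0 ?sqr_ge0.
have := pos (- bes 2 r / bes 1 r).
have -> : (- bes 2 r / bes 1 r) ^+ 2 * bes 1 r + 2 * (- bes 2 r / bes 1 r) * bes 2 r + 1 * bes 3 r =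
  (bes 1 r * bes 3 r - bes 2 r ^+ 2) / bes 1 r by field; rewrite gt_eqF.
by rewrite pmulr_lge0 ?invr_gt0// subr_ge0.
Qed.

Lemma bes0_le1 r : 0 < r -> bes 0 r <= bes 1 r.
Proof.
move=> r0; apply: (@le_Rintegral _ (measurableTypeR R) _ mu _ _ _ mH (integrable_besf 0 r0) (integrable_besf 1 r0)).
by move=> t _; rewrite /besf expr0 expr1 ler_pM2r ?expR_gt0// ch_ge1.
Qed.

(** Since [ch >= 1], raising [r] to [s] gains at least the factor [exp (- (s - r))] under the
    integral. *)
Lemma bes_decay j r s : 0 < r -> r <= s -> bes j s <= expR (- (s - r)) * bes j r.
Proof.
move=> r0 rs; have s0 : 0 < s by exact: lt_le_trans rs.
have [I E] := bes_comb j j j (expR (- (s - r))) 0 0 r0.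
have -> : expR (- (s - r)) * bes j r =
    \int[mu]_(t in H) (expR (- (s - r)) * besf j r t + 0 * besf j r t + 0 * besf j r t).
  by rewrite E; ring.
apply: (@le_Rintegral _ (measurableTypeR R) _ mu _ _ _ mH (integrable_besf j s0) I) => t _.
rewrite !mul0r !addr0 /besf.
have -> : expR (- (s - r)) * (ch t ^+ j * expR (- r * ch t)) = ch t ^+ j * (expR (- (s - r)) * expR (- r * ch t)) by ring.
rewrite ler_wpM2l ?exprn_ge0 ?(ltW (ch_gt0 t))//.
rewrite -expRD ler_expR; have := ch_ge1 t; have : 0 <= s - r by rewrite subr_ge0.
by move: (ch t) => c; nra.
Qed.

(** The link with Bessel functions ends here: what follows uses these five properties only. The
    bound on [- h1] is [- K_1' = K_1 / x + K_0] together with [K_0 <= K_1]. *)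
Lemma radial_profile (k : R) : 0 < k -> exists h h1 h2 : R -> R, [/\
  forall s : R, 0 < s -> [/\ is_derive s 1 h (h1 s), is_derive s 1 h1 (h2 s), 0 < h s & h1 s < 0],
  forall s, 0 < s -> s * h2 s + h1 s = h s / s + k ^+ 2 * s * h s,
  forall s, 0 < s -> h1 s ^+ 2 <= h s * h2 s,
  forall s, 0 < s -> - h1 s <= (s^-1 + k) * h s &
  forall a s, 0 < a -> a <= s -> h s <= expR (- k * (s - a)) * h a /\ - h1 s <= expR (- k * (s - a)) * - h1 a].
Proof.
move=> k0; exists (fun s => bes 1 (k * s)), (fun s => - k * bes 2 (k * s)), (fun s => k ^+ 2 * bes 3 (k * s)).
have dk (s : R) : is_derive s 1 (fun s : R => k * s) k.
  by apply: (der_eq (derZ k (der_id s))); rewrite mulr1.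
have ks (s : R) : 0 < s -> 0 < k * s by exact: mulr_gt0.
split.
- move=> s s0; have b := ks s s0; split.
  + by apply: (der_eq (@der_comp _ (bes 1) _ s _ _ (is_derive_bes 1 b) (dk s))); ring.
  + by apply: (der_eq (derZ (- k) (@der_comp _ (bes 2) _ s _ _ (is_derive_bes 2 b) (dk s)))); ring.
  + exact: bes_gt0.
  + by rewrite mulNr oppr_lt0 mulr_gt0// bes_gt0.
- move=> s s0; have b := ks s s0.
  (* differentiating [bes 1 x = x * (bes 2 x - bes 0 x)] *)
  have e : - bes 2 (k * s) = 1 * (bes 2 (k * s) - bes 0 (k * s)) + (k * s) * (- bes 3 (k * s) - - bes 1 (k * s)).
    have d := derM (der_id (k * s)) (derB (is_derive_bes 2 b) (is_derive_bes 0 b)).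
    rewrite -(der_derive1 d); apply/esym/der_derive1; apply: near_eq_is_derive (is_derive_bes 1 b).
    near=> x; apply: bes_rec; near: x; exact: lt_nbhsr.
  have e1 := bes_rec b; have -> : bes 1 (k * s) / s = k * (bes 2 (k * s) - bes 0 (k * s)).
    by rewrite {1}e1; field; rewrite gt_eqF.
  have : k * (k * s) * bes 3 (k * s) = k * (2 * bes 2 (k * s) - bes 0 (k * s) + (k * s) * bes 1 (k * s)).
    by rewrite -mulrA; congr (k * _); lra.
  move=> E; have -> : s * (k ^+ 2 * bes 3 (k * s)) = k * (k * s) * bes 3 (k * s) by ring.
  by rewrite E; ring.
- move=> s s0; have := bes_log_convex (ks s s0) => h.
  have -> : (- k * bes 2 (k * s)) ^+ 2 = k ^+ 2 * bes 2 (k * s) ^+ 2 by ring.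
  have -> : bes 1 (k * s) * (k ^+ 2 * bes 3 (k * s)) = k ^+ 2 * (bes 1 (k * s) * bes 3 (k * s)) by ring.
  by rewrite ler_pM2l// exprn_gt0.
- move=> s s0; have b := ks s s0; have e1 := bes_rec b; have h := bes0_le1 b.
  have : k * bes 2 (k * s) = bes 1 (k * s) / s + k * bes 0 (k * s).
    by rewrite {1}e1; field; rewrite gt_eqF.
  have : k * bes 0 (k * s) <= k * bes 1 (k * s) by rewrite ler_pM2l.
  by rewrite mulrDl (mulrC s^-1) mulNr opprK; lra.
- move=> a s a0 as_.
  have kas : k * a <= k * s by rewrite ler_pM2l.
  have E : - k * (s - a) = - (k * s - k * a) by ring.
  have h1 := bes_decay 1 (ks a a0) kas; have h2 := bes_decay 2 (ks a a0) kas.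
  rewrite E; split=> //; rewrite !mulNr !opprK mulrCA ler_pM2l//.
Unshelve. all: by end_near. Qed.
End bessel.

(** * Diameters and elementary properties of the Hausdorff measure *)

Section hausdorff_basics.
Variable R : realType.
Implicit Types (A F : set (R * R)) (p q : R * R).
Local Open Scope ereal_scope.

Definition edist p q : R := Num.sqrt (sqn (p - q)%R).

Lemma ediam_ge0 A : 0 <= ediam A. Proof. by rewrite /ediam le_max lexx. Qed.

Lemma ediam_set0 : ediam (set0 : set (R * R)) = 0.
Proof.
rewrite /ediam (_ : [set _ | _ in _] = set0) ?ereal_sup0 ?max_l//.
by rewrite -subset0 => _ [p [[]]].
Qed.

Lemma ediam_le A (d : R) : (0 <= d)%R -> (forall p q, A p -> A q -> (edist p q <= d)%R) -> ediam A <= d%:E.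
Proof.
move=> d0 h; rewrite /ediam ge_max lee_fin d0 /=; apply: ge_ereal_sup => _ [[p q] [/= Ap Aq] <-].
by rewrite lee_fin; exact: h.
Qed.

Lemma edist_le_ediam A p q : A p -> A q -> (edist p q)%:E <= ediam A.
Proof. by move=> Ap Aq; rewrite /ediam le_max; apply/orP; right; apply: ereal_sup_ubound; exists (p, q). Qed.

Lemma hausdorff1_delta_ge0 (delta : R) A : 0 <= hausdorff1_delta delta A.
Proof.
apply: le_ereal_inf_tmp => _ [F _ <-]; apply: nneseries_ge0 => n _ _; exact: ediam_ge0.
Qed.

Lemma hausdorff1_set0 : hausdorff1 (set0 : set (R * R)) = 0.
Proof.
apply/eqP; rewrite eq_le; apply/andP; split; last first.
  apply: (le_trans (hausdorff1_delta_ge0 1 set0)); apply: ereal_sup_ubound; exists 1%R => //=.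
apply: ge_ereal_sup => _ [delta /= d0 <-]; apply: ereal_inf_lbound; exists (fun=> set0).
  by split=> // i; rewrite ediam_set0 lee_fin ltW.
by rewrite eseries0// => i _ _; exact: ediam_set0.
Qed.
End hausdorff_basics.

(** * Subdivision of an interval into half-open cells *)

Section mesh.
Variable R : realType.
Implicit Types a c d s : R.

Lemma small_mesh a d : 0 <= a -> 0 < d -> exists2 N : nat, (0 < N)%N & a / N%:R <= d.
Proof.
move=> a0 d0; exists (Num.bound (a / d)).+1 => //; rewrite ler_pdivrMr ?ltr0n// mulrC -ler_pdivrMr//.
apply: le_trans (ltW (archi_boundP (divr_ge0 a0 (ltW d0)))) _.
by rewrite ler_nat.
Qed.

Lemma cell_exists c (N : nat) s : (0 < N)%N -> 0 < s -> s <= c ->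
  exists2 j, (j < N)%N & j%:R * (c / N%:R) < s <= j.+1%:R * (c / N%:R).
Proof.
move=> N0 s0 sc; have N0' : 0 < N%:R :> R by rewrite ltr0n.
have top : N%:R * (c / N%:R) = c by rewrite mulrCA mulfV ?mulr1// gt_eqF.
have ex : exists j, s <= j.+1%:R * (c / N%:R) by exists N.-1; rewrite prednK// top.
case: (ex_minnP ex) => j hj minj; exists j.
  have := minj N.-1; rewrite prednK// top => /(_ sc) jN.
  by rewrite -(prednK N0) ltnS.
rewrite hj andbT; case: j hj minj => [|j] hj minj; first by rewrite mul0r.
by rewrite ltNge; apply/negP => sj; have := minj j sj; rewrite ltnn.
Qed.
End mesh.

(** * Hausdorff measure of Lipschitz images, from above *)

Section hausdorff_upper_bound.
Variable R : realType.
Notation mu := (@lebesgue_measure R).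
Variables (gam : R -> R * R) (L c : R).
Hypotheses (L0 : 0 < L) (c0 : 0 < c).
Hypothesis lip : forall s t, 0 < s <= c -> 0 < t <= c -> edist (gam s) (gam t) <= L * `|s - t|.
Local Open Scope ereal_scope.

Lemma image_interval_ediam (J : set R) (m : R) : is_interval J -> J `<=` [set` `]0%R, c]] ->
  measurable (J : set (measurableTypeR R)) -> mu J <= m%:E -> ediam (gam @` J) <= (L * m)%:E.
Proof.
move=> iJ Jc mJ Jm; have m0 : (0 <= m)%R by rewrite -lee_fin; exact: le_trans Jm.
have dist s t : J s -> J t -> (s <= t)%R -> (t - s <= m)%R.
  move=> Js Jt st; rewrite -lee_fin; apply: le_trans Jm.
  have <- : mu [set` `]s, t]] = (t - s)%:E.
    rewrite lebesgue_measure_itv /= lte_fin; case: ltP => [_|ts]; first by rewrite EFinB.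
    by rewrite (@le_anti _ _ s t) ?subrr// st ts.
  apply: (@le_measure _ _ _ mu); rewrite ?inE//=.
  move=> x /=; rewrite in_itv /= => /andP[sx xt]; apply: (iJ _ _ Js Jt).
  by rewrite (ltW sx) xt.
apply: ediam_le => [|_ _ [s Js <-] [t Jt <-]]; first by rewrite mulr_ge0// ltW.
have Jc' x : J x -> (0 < x <= c)%R by move=> /Jc /=; rewrite in_itv.
apply: le_trans (lip (Jc' _ Js) (Jc' _ Jt)) _; rewrite ler_pM2l//.
have [st|ts] := leP s t; first by rewrite distrC ger0_norm ?subr_ge0//; exact: dist.
by rewrite ger0_norm ?subr_ge0 ?(ltW ts)//; apply: dist => //; exact: ltW.
Qed.

(** Outer regularity encloses [T] in an open set of nearly the same measure. Its component
    intervals, cut by a fine mesh, are mapped to sets of diameter at most [L] times their length,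
    and these form the cover. *)
Lemma hausdorff1_le (A : set (R * R)) (T : set R) : measurable (T : set (measurableTypeR R)) ->
  T `<=` [set` `]0%R, c]] -> A `<=` gam @` T -> hausdorff1 A <= L%:E * mu T.
Proof.
move=> mT Tc AT.
have muT : mu T < +oo.
  apply: (@le_lt_trans _ _ (mu [set` `]0%R, c]])); last by rewrite lebesgue_measure_itv /= lte_fin c0 -EFinD ltry.
  by apply: (@le_measure _ _ _ mu); rewrite ?inE.
apply: ge_ereal_sup => _ [delta /= d0 <-].
apply/lee_addgt0Pr => e e0; have eL : (0 < e / L)%R by rewrite divr_gt0.
have [U [oU TU UT]] := lebesgue_regularity_outer mT muT eL.
have mU : measurable (U : set (measurableTypeR R)) by exact: open_measurable.
have muU : mu U <= mu T + (e / L)%:E.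
  rewrite -(setDUK TU) measureU//; [|exact: measurableD|by rewrite -subset0 => x [Tx []]].
  by apply: leeD => //; exact: ltW.
pose I := open_disjoint_itv oU.
have iI k : is_interval (I k) by exact: open_disjoint_itv_is_interval.
have mI k : measurable (I k : set (measurableTypeR R)) by exact: is_interval_measurable.
(* The cells are so short that their images have diameter at most [delta]. *)
have [N N0 cN] := small_mesh (mulr_ge0 (ltW L0) (ltW c0)) d0.
pose eta : R := (c / N%:R)%R; have eta0 : (0 < eta)%R by rewrite divr_gt0// ltr0n.
pose E j : set R := [set` `](j%:R * eta)%R, (j.+1%:R * eta)%R]].
have muE j : mu (E j) = eta%:E.
  rewrite /E lebesgue_measure_itv /= lte_fin ltr_pM2r// ltr_nat ltnSn -EFinD; congr EFin.
  by rewrite -mulrBl -natrB// subSnn mul1r.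
have mE j : measurable (E j : set (measurableTypeR R)) by exact: measurable_itv.
(* Division by [N] enumerates the pairs made of a component interval and a mesh cell. *)
pose G n : set R := I (n %/ N)%N `&` E (n %% N)%N.
have mG n : measurable (G n : set (measurableTypeR R)) by exact: measurableI.
have iG n : is_interval (G n).
  move=> x y [Ix Ex] [Iy Ey] z xyz; split; first exact: (iI _ _ _ Ix Iy).
  by move: (interval_is_interval Ex Ey); apply.
have Gc n : G n `<=` [set` `]0%R, c]].
  move=> x [_]; rewrite /E /= !in_itv /= => /andP[x1 x2]; apply/andP; split.
    by apply: le_lt_trans x1; rewrite mulr_ge0// ltW.
  apply: le_trans x2 _; rewrite /eta mulrA ler_pdivrMr ?ltr0n// mulrC ler_pM2l// ler_nat.
  by rewrite ltn_pmod.
have fG n : mu (G n) \is a fin_num.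
  rewrite ge0_fin_numE//; apply: (@le_lt_trans _ _ (mu (E (n %% N)%N))); last by rewrite muE ltry.
  by apply: (@le_measure _ _ _ mu); rewrite ?inE//; exact: subIsetr.
have dG n : ediam (gam @` G n) <= L%:E * mu (G n).
  by rewrite -(fineK (fG n)) -EFinM; apply: image_interval_ediam; rewrite ?fineK.
apply: (@le_trans _ _ (\sum_(0 <= n <oo) ediam (gam @` G n))).
  apply: ereal_inf_lbound; exists (fun n => gam @` G n) => //; split.
    apply: subset_trans AT _ => _ [s Ts <-]; have /andP[s0 sc] : (0 < s <= c)%R by have := Tc s Ts; rewrite /= in_itv.
    have Us := TU s Ts; rewrite (open_disjoint_itv_bigcup oU) in Us; have [k _ Iks] := Us.
    have [j jN /andP[j1 j2]] := cell_exists N0 s0 sc.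
    exists (k * N + j)%N => //=; exists s => //; split.
      by rewrite divnMDl// divn_small// addn0.
    by rewrite modnMDl modn_small// /E /= in_itv /= j1 j2.
  move=> n; apply: (@le_trans _ _ (L * eta)%:E); last by rewrite lee_fin /eta mulrA.
  apply: (image_interval_ediam (iG n) (@Gc n) (mG n)); rewrite -(muE (n %% N)%N).
  by apply: (@le_measure _ _ _ mu); rewrite ?inE//; exact: subIsetr.
have bound : L%:E * mu U <= L%:E * mu T + e%:E.
  apply: (@le_trans _ _ (L%:E * (mu T + (e / L)%:E))); first by apply: lee_wpmul2l => //; rewrite lee_fin ltW.
  by rewrite ge0_muleDr ?lee_fin ?(ltW eL)// -EFinM mulrCA mulfV ?gt_eqF// mulr1.
apply: le_trans bound.
have ge0 n : 0 <= L%:E * mu (G n) by apply: mule_ge0 => //; rewrite lee_fin ltW.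
apply: (@le_trans _ _ (\sum_(0 <= n <oo) L%:E * mu (G n))).
  by apply: lee_nneseries => [n _ _|n _]; [exact: ediam_ge0|exact: dG].
rewrite nneseriesZl//; apply: lee_wpmul2l; first by rewrite lee_fin ltW.
apply: lime_le; first by apply: is_cvg_nneseries.
apply: nearW => K.
have cells k n : (n <= N)%N -> \sum_(0 <= j < n) mu (I k `&` E j) <= mu (I k `&` [set` `]0%R, (n%:R * eta)%R]]).
  move=> _; elim: n => [|n IH]; first by rewrite big_geq.
  rewrite big_nat_recr//=; apply: le_trans (leeD IH (lexx _)) _.
  rewrite -measureU//; [|exact: measurableI|exact: measurableI|].
  - apply: (@le_measure _ _ _ mu); rewrite ?inE//.
    + by apply: measurableU; exact: measurableI.
    + exact: measurableI.
    + move=> x [[Ix]|[Ix]]; rewrite /E /= !in_itv /= => /andP[x1 x2]; split => //; apply/andP; split => //.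
        by apply: le_trans x2 _; rewrite ler_pM2r// ler_nat.
      by apply: le_lt_trans x1; rewrite mulr_ge0// ltW.
  - rewrite -subset0 => x [[_ /=]]; rewrite /E in_itv /= => /andP[_ x1] [_ /=]; rewrite in_itv /= => /andP[x2 _].
    by move: (lt_le_trans x2 x1); rewrite ltxx.
have row k : \sum_(k * N <= n < k.+1 * N) mu (G n) <= mu (I k).
  rewrite -{1}[(k * N)%N]add0n mulSn big_addn addnK.
  rewrite (eq_big_nat _ _ (F2 := fun j => mu (I k `&` E j))).
    apply: le_trans (cells k N (leqnn N)) _.
    by apply: (@le_measure _ _ _ mu); rewrite ?inE//; apply: measurableI.
  by move=> j /andP[_ jN]; rewrite /G addnC divnMDl// divn_small// addn0 modnMDl modn_small.
apply: (@le_trans _ _ (\sum_(0 <= n < K * N) mu (G n))).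
  apply: lee_sum_nneg_natr => //; exact: leq_pmulr.
rewrite big_nat_mul; apply: (@le_trans _ _ (\sum_(0 <= k < K) mu (I k))).
  by apply: lee_sum => k _; exact: row.
apply: (@le_trans _ _ (\sum_(0 <= k <oo) mu (I k))); first exact: nneseries_lim_ge.
rewrite [in leRHS](open_disjoint_itv_bigcup oU) measure_bigcup//; last exact: open_disjoint_itv_trivIset.
by rewrite le_eqVlt; apply/orP; left; apply/eqP; apply: eq_eseriesl => i; rewrite in_setT.
Qed.
End hausdorff_upper_bound.

(** * Comparison of integrals against two set functions *)

Section set_function_comparison.
Context d (T : measurableType d) (R : realType) (m1 m2 : set T -> \bar R) (D : set T).
Hypotheses (m10 : m1 set0 = 0%E) (m20 : m2 set0 = 0%E).
Import HBNNSimple.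
Local Open Scope ereal_scope.

Lemma sintegral_range (m : set T -> \bar R) (h : {nnsfun T >-> R}) : m set0 = 0 ->
  sintegral m h = \sum_(x \in range h) x%:E * m (h @^-1` [set x]).
Proof.
move=> m0; rewrite /sintegral; apply/esym/fsbig_widen => // x [_ nr] /=.
by rewrite (_ : _ @^-1` _ = set0) ?m0 ?mule0// -subset0 => y /= hy; apply: nr; exists y.
Qed.

(** Only level sets of simple functions enter. Those with a nonzero value lie in [D] because the
    simple function is below [f] extended by zero, so the comparison on subsets of [D] is enough. *)
Lemma le_integral_set_function (f : T -> \bar R) : (forall x, D x -> 0 <= f x) ->
  (forall A, measurable A -> A `<=` D -> m1 A <= m2 A) ->
  \int[m1]_(x in D) f x <= \int[m2]_(x in D) f x.
Proof.
move=> f0 m12; rewrite !nonneg_integralE//; apply: ge_ereal_sup => _ [h hf <-].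
apply: (@le_trans _ _ (sintegral m2 h)); last by apply: ereal_sup_ubound; exists h.
rewrite !sintegral_range//; apply: lee_fsum; first exact: fimfunP.
move=> x [y _ hy]; have x0 : (0 <= x)%R by rewrite -hy fun_ge0.
have [->|x0'] := eqVneq x 0%R; first by rewrite !mul0e.
apply: lee_wpmul2l; first by rewrite lee_fin.
apply: m12; first exact: measurable_sfunP.
move=> z /= hz; apply: contrapT => nDz; have := hf z; rewrite hz patchE memNset// lee_fin => xle.
by move: x0'; rewrite eq_le xle x0.
Qed.
End set_function_comparison.

(** * Integrals along a parametrised curve *)

Section curve_measure.
Variable R : realType.
Notation mu := (@lebesgue_measure R).
Notation plane := (R * R)%type.
Variables (gam : R -> R * R) (g : R -> R) (c : R).
Notation C := (`[0%R, c]%classic : set R).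
Hypotheses (mgam : measurable_fun C (gam : R -> plane)) (mg : measurable_fun C g).
Hypothesis g0 : forall t, C t -> 0 <= g t.
Local Open Scope ereal_scope.

Lemma curve_integral (m : {measure set plane -> \bar R}) (D : set (R * R)) (f : R * R -> \bar R) :
  (forall A, m A = \int[mu]_(x in C `&` gam @^-1` A) (g x)%:E) ->
  measurable D -> (forall t, C t -> D (gam t)) -> (forall x, D x -> 0 <= f x) -> measurable_fun D f ->
  \int[m]_(x in D) f x = \int[mu]_(t in C) (f (gam t) * (g t)%:E).
Proof.
move=> mE mD CD f0 mf; rewrite integral_mkcond.
have mC : measurable (C : set (measurableTypeR R)) by exact: measurable_itv.
rewrite (@density_change _ _ (measurableTypeR R) plane R mu C g gam mC mgam mg g0 m (fun A _ => mE A) (f \_ D)).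
- by apply: eq_integral => t /set_mem Ct; rewrite patchE mem_set//; exact: CD.
- by move=> y; rewrite patchE; case: ifPn => // /set_mem /f0.
- by have [h _] := measurable_restrictT f mD; exact: h.
Qed.
End curve_measure.

(** * Hausdorff measure of curves, from below *)

Section hausdorff_lower_bound.
Variable R : realType.
Notation mu := (@lebesgue_measure R).
Variables (gam : R -> R * R) (rho : R -> R) (c M : R).
Notation C := (`[0%R, c]%classic : set R).
Hypotheses (c0 : 0 <= c) (M0 : 0 <= M) (mrho : measurable_fun C rho).
Hypotheses (rho0 : forall t, C t -> 0 <= rho t) (rhoM : forall t, C t -> rho t <= M).
Local Open Scope ereal_scope.
Variable m : {measure set (measurableTypeR R) -> \bar R}.
Hypothesis mE : forall A, m A = \int[mu]_(x in C `&` A) (rho x)%:E.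
Hypothesis loc : forall eta e : R, (0 < eta)%R -> (0 < e)%R -> exists2 delta : R, (0 < delta)%R &
  forall s t, (eta <= s)%R -> (s <= t)%R -> (t <= c - eta)%R -> (edist (gam s) (gam t) <= delta)%R ->
    m `[s, t]%classic <= ((1 + e) * edist (gam s) (gam t))%:E.

Lemma arc_le (a b : R) : (a <= b)%R -> m `[a, b]%classic <= (M * (b - a))%:E.
Proof.
move=> ab; rewrite mE; apply: (@le_trans _ _ (\int[mu]_(x in `[a, b]) M%:E)).
  apply: le_nonneg_integral => //.
  - by move=> x [Cx _]; rewrite lee_fin rho0.
  - by move=> x [Cx _]; rewrite lee_fin rhoM.
have mab : mu `[a, b]%classic <= (b - a)%:E.
  by rewrite lebesgue_measure_itv /= lte_fin; case: ltP => // _; rewrite lee_fin subr_ge0.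
by rewrite integral_cst// EFinM; apply: lee_wpmul2l.
Qed.

Lemma arc_hull (T : set R) (d eta e : R) : (0 <= d)%R -> (0 < e)%R ->
  (forall s, T s -> (eta <= s <= c - eta)%R) ->
  (forall s t, T s -> T t -> (s <= t)%R -> m `[s, t]%classic <= ((1 + e) * d)%:E) ->
  exists J : set R, [/\ measurable (J : set (measurableTypeR R)), T `<=` J & m J <= ((1 + e) * d)%:E].
Proof.
move=> d0 e0 Teta Td; have [[x Tx]|nT] := pselect (T !=set0); last first.
  exists set0; split => //; first by move=> x Tx; apply: nT; exists x.
  by rewrite measure0 lee_fin mulr_ge0// addr_ge0// ltW.
have hs : has_sup T by split; [exists x|exists (c - eta)%R => y /Teta /andP[]].
have hi : has_inf T by split; [exists x|exists eta => y /Teta /andP[]].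
set a := inf T; set b := sup T.
have aT y : T y -> (a <= y)%R by move=> Ty; apply: ge_inf => //; case: hi.
have Tb y : T y -> (y <= b)%R by move=> Ty; apply: sup_ubound => //; case: hs.
have mI (y z : R) : measurable (`[y, z]%classic : set (measurableTypeR R)) by exact: measurable_itv.
exists `[a, b]%classic; split => //; first by move=> y Ty /=; rewrite in_itv /= aT// Tb.
(* The extreme parameters need not belong to [T]; elements of [T] within [k'] of them cost at most
   [2 * M * k' <= k]. *)
apply/lee_addgt0Pr => k k0; pose k' := (k / (2 * (M + 1)))%R.
have M1 : (0 < 2 * (M + 1))%R by rewrite mulr_gt0// ltr_wpDl.
have k'0 : (0 < k')%R by rewrite divr_gt0.
have kM : (2 * (M * k') <= k)%R.
  have -> : k = (2 * ((M + 1) * k'))%R by rewrite /k'; field; rewrite gt_eqF// ltr_wpDl.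
  by rewrite ler_pM2l// ler_pM2r// lerDl.
have [s Ts sa] := inf_adherent k'0 hi; have [t Tt tb] := sup_adherent k'0 hs.
have [st|ts] := leP s t.
  apply: (@le_trans _ _ (m `[a, s]%classic + m `[s, t]%classic + m `[t, b]%classic)).
    have U1 : m (`[a, s]%classic `|` `[s, t]%classic) <= m `[a, s]%classic + m `[s, t]%classic by exact: measureU2.
    have mU := measurableU _ _ (mI a s) (mI s t).
    have U2 := measureU2 m mU (mI t b).
    apply: le_trans (leeD U1 (lexx (m `[t, b]%classic))); apply: le_trans U2.
    apply: le_measure; rewrite ?inE//; first exact: measurableU.
    move=> y /=; rewrite in_itv /= => /andP[ay yb]; have [ys|sy] := leP y s.
      by left; left; rewrite /= in_itv /= ay ys.
    have [yt|ty] := leP y t; [left; right|right]; rewrite /= in_itv /= ?yb ?(ltW ty) ?(ltW sy)//.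
  apply: (@le_trans _ _ ((M * k')%:E + ((1 + e) * d)%:E + (M * k')%:E)).
    apply: leeD; first apply: leeD.
    - apply: le_trans (arc_le (aT _ Ts)) _; rewrite lee_fin ler_wpM2l//.
      by rewrite lerBlDl ltW.
    - exact: Td.
    - apply: le_trans (arc_le (Tb _ Tt)) _; rewrite lee_fin ler_wpM2l//.
      by rewrite lerBlDr -lerBlDl ltW.
  by rewrite -!EFinD lee_fin; lra.
have ab : (a <= b)%R by exact: le_trans (aT _ Tx) (Tb _ Tx).
apply: le_trans (arc_le ab) _; rewrite -EFinD lee_fin.
have : (M * (b - a) <= M * (2 * k'))%R.
  by rewrite ler_wpM2l//; move: sa tb ts; rewrite -/a -/b; lra.
have : (0 <= (1 + e) * d)%R by rewrite mulr_ge0// addr_ge0// ltW.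
by move: kM; rewrite mulrCA; lra.
Qed.

(** A set of small diameter in the cover meets the curve in parameters whose hull has weight at most
    [1 + e] times that diameter, by [loc], and subadditivity adds these up. Parameters within [eta]
    of the ends are set aside at cost [2 * M * eta]: on a closed curve the two ends of the parameter
    interval give nearby points, where no such local estimate can hold. *)
Lemma hausdorff1_ge (A : set (R * R)) (T : set R) : measurable (T : set (measurableTypeR R)) -> T `<=` C ->
  (forall t, T t -> A (gam t)) -> m T <= hausdorff1 A.
Proof.
move=> mT TC TA.
have mfin : m T \is a fin_num.
  rewrite ge0_fin_numE//; apply: (@le_lt_trans _ _ (m C)).
    by apply: le_measure; rewrite ?inE//; exact: measurable_itv.
  exact: le_lt_trans (arc_le c0) (ltry _).
set x := fine (m T); have mx : m T = x%:E by rewrite /x fineK.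
have mI (y z : R) : measurable (`[y, z]%classic : set (measurableTypeR R)) by exact: measurable_itv.
have key (eta e : R) : (0 < eta)%R -> (0 < e)%R -> ((x - 2 * (M * eta)) / (1 + e))%:E <= hausdorff1 A.
  move=> eta0 e0; have [delta d0 hd] := loc eta0 e0; have e1 : (0 < 1 + e)%R by rewrite ltr_wpDr// ltW.
  apply: (@le_trans _ _ (hausdorff1_delta delta A)); last by apply: ereal_sup_ubound; exists delta.
  apply: le_ereal_inf_tmp => _ [F [AF Fd] <-].
  have fF i : ediam (F i) \is a fin_num.
    by rewrite ge0_fin_numE ?ediam_ge0//; exact: le_lt_trans (Fd i) (ltry _).
  pose TF i := [set s | (eta <= s <= c - eta)%R /\ F i (gam s)].
  have HJ i : exists J : set R, [/\ measurable (J : set (measurableTypeR R)), TF i `<=` J &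
      m J <= ((1 + e) * fine (ediam (F i)))%:E].
    apply: (@arc_hull _ _ eta) => //.
    - by rewrite fine_ge0// ediam_ge0.
    - by move=> s [].
    - move=> s t [/andP[s1 s2] Fs] [/andP[t1 t2] Ft] st.
      have h := edist_le_ediam Fs Ft; rewrite -(fineK (fF i)) lee_fin in h.
      have h2 : (edist (gam s) (gam t) <= delta)%R by rewrite -lee_fin; apply: le_trans (Fd i); rewrite -(fineK (fF i)) lee_fin.
      apply: le_trans (hd s t s1 st t2 h2) _; rewrite lee_fin ler_pM2l//.
  have [J hJ] := choice HJ.
  have mJ i : measurable (J i : set (measurableTypeR R)) by case: (hJ i).
  pose W := `[0%R, eta]%classic `|` `[(c - eta)%R, c]%classic : set R.
  have cover : T `<=` W `|` \bigcup_i J i.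
    move=> t Tt; have := TC t Tt; rewrite /= in_itv /= => /andP[t0 tc].
    have [t1|t1] := leP t eta; first by left; left; rewrite /= in_itv /= t0 t1.
    have [t2|t2] := leP (c - eta)%R t; first by left; right; rewrite /= in_itv /= t2 tc.
    right; have [i _ Fi] := AF _ (TA t Tt); exists i => //.
    by have [_ sub _] := hJ i; apply: sub; split => //; rewrite !ltW.
  have mW : measurable (W : set (measurableTypeR R)) by exact: measurableU.
  have mU : measurable (\bigcup_i J i : set (measurableTypeR R)) by exact: bigcup_measurable.
  have S1 : m T <= m W + m (\bigcup_i J i).
    apply: le_trans (measureU2 _ _ _) => //.
    by apply: le_measure; rewrite ?inE//; exact: measurableU.
  have S2 : m W <= (2 * (M * eta))%:E.
    apply: (@le_trans _ _ (m `[0%R, eta]%classic + m `[(c - eta)%R, c]%classic)); first exact: measureU2.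
    rewrite (_ : (2 * (M * eta))%R = M * (eta - 0) + M * (c - (c - eta)))%R; last by ring.
    by rewrite EFinD; apply: leeD; apply: arc_le; [exact: ltW|rewrite gerBl ltW].
  have S3 : m (\bigcup_i J i) <= (1 + e)%:E * \sum_(0 <= i <oo) ediam (F i).
    apply: (@le_trans _ _ (\sum_(0 <= i <oo) m (J i))); first exact: measure_sigma_subadditive.
    rewrite -nneseriesZl; last by move=> i _; exact: ediam_ge0.
    apply: lee_nneseries => [i _ _//|i _]; have [_ _ h] := hJ i.
    by rewrite -(fineK (fF i)) -EFinM.
  rewrite EFinM muleC lee_pdivrMl// EFinB leeBlDr//.
  rewrite -mx; apply: le_trans S1 _; rewrite addeC; exact: leeD.
have H0 : 0 <= hausdorff1 A.
  by apply: (le_trans (hausdorff1_delta_ge0 1 A)); apply: ereal_sup_ubound; exists 1%R => //=.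
case: (hausdorff1 A) key H0 => [h key H0||]; last 2 first.
- by move=> _ _; exact: leey.
- by move=> key _; have := key 1%R 1%R ltr01 ltr01.
rewrite lee_fin in H0; rewrite mx lee_fin leNgt; apply/negP => hx.
have h1 : (0 < h + 1)%R by rewrite ltr_wpDl.
have M1 : (0 < M + 1)%R by rewrite ltr_wpDl.
have p0 : (0 < x - h)%R by rewrite subr_gt0.
(* If [h < x], these values of [e] and [eta] cost at most [(x - h) / 4] each, which contradicts
   [key]. *)
have ep : (0 < (x - h) / (4 * (h + 1)))%R by rewrite divr_gt0// mulr_gt0.
have tp : (0 < (x - h) / (8 * (M + 1)))%R by rewrite divr_gt0// mulr_gt0.
have := key _ _ tp ep; rewrite lee_fin.
set e := (X in (1 + X)%R) in ep *; set t := ((x - h) / (8 * (M + 1)))%R in tp *.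
rewrite ler_pdivrMr; last by rewrite ltr_wpDr// ltW.
have E1 : ((h + 1) * e = (x - h) / 4)%R by rewrite /e; field; rewrite gt_eqF.
have E2 : ((M + 1) * t = (x - h) / 8)%R by rewrite /t; field; rewrite gt_eqF.
apply/negP; rewrite -ltNge mulrDr mulr1; nra.
Qed.
End hausdorff_lower_bound.

(** * Curves given by a radius function of the angle *)

Section polar_curves.
Variable R : realType.
Notation mu := (@lebesgue_measure R).
Notation plane := (R * R)%type.
Notation C := (`[0%R, (2 * pi)%R]%classic : set R).
Implicit Types s t x : R.

Lemma twopi_gt0 : 0 < 2 * pi :> R.
Proof. by rewrite mulr_gt0// pi_gt0. Qed.

Lemma CP t : C t <-> 0 <= t <= 2 * pi.
Proof. by rewrite /= in_itv. Qed.

Lemma polar_dist s t (a b : R) : sqn (pol s a - pol t b) = (a - b) ^+ 2 + 4 * a * b * sin ((s - t) / 2) ^+ 2.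
Proof.
have c2 : cos s * cos t + sin s * sin t = 1 - 2 * sin ((s - t) / 2) ^+ 2.
  have e : s - t = ((s - t) / 2) *+ 2 by rewrite -mulr_natr; field.
  rewrite -cosB; move: ((s - t) / 2) e => d e.
  by rewrite e cos_mulr2n cos2sin2 -mulr_natl; move: (sin d) => w; ring.
have cs := cos2Dsin2 s; have ct := cos2Dsin2 t; rewrite /sqn /pol /=.
move: (sin ((s - t) / 2)) (cos s) (sin s) (cos t) (sin t) c2 cs ct => w x y x' y' c2 cs ct.
transitivity (a ^+ 2 * (x ^+ 2 + y ^+ 2) + b ^+ 2 * (x' ^+ 2 + y' ^+ 2) - 2 * a * b * (x * x' + y * y')); first by ring.
by rewrite c2 cs ct; ring.
Qed.

Lemma sin_le_norm x : `|sin x| <= `|x|.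
Proof.
have [c [_ e]] := mean_value (fun x : R => is_derive_sin x) x 0.
have -> : sin x = cos c * x by rewrite -[LHS]subr0 -(sin0 R) e subr0.
rewrite normrM ler_piMl// ler_norml; apply/andP; split; [exact: cos_geN1|exact: cos_le1].
Qed.

(** The mean value theorem applied twice gives a quadratic defect, which is small compared with the
    length of a short arc, as [curve_loc] demands. *)
Lemma sin_ge_quad x : 0 <= x -> x - x ^+ 2 <= sin x.
Proof.
move=> x0; have [c [+ e]] := mean_value (fun x : R => is_derive_sin x) x 0.
rewrite !subr0 (ger0_norm x0) => cx.
have -> : sin x = cos c * x by rewrite -[LHS]subr0 -(sin0 R) e subr0.
suff h : 1 - cos c <= x by have := ler_wpM2r x0 h; rewrite mulrBl mul1r expr2; lra.
have [d [_ e']] := mean_value (fun x : R => is_derive_cos x) c 0.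
have -> : 1 - cos c = sin d * c by rewrite -(cos0 R) -opprB e' subr0 mulNr opprK.
apply: le_trans cx; apply: le_trans (ler_norm _) _; rewrite normrM ler_piMl//.
by rewrite ler_norml; apply/andP; split; [exact: sin_geN1|exact: sin_le1].
Qed.

(** Half the difference of the two sines is the cosine of the half-sum times the sine of the
    half-difference, and both factors are nonnegative here. *)
Lemma sin_ge_middle x y : 0 <= y -> y <= x -> x <= pi - y -> sin y <= sin x.
Proof.
move=> y0 yx xy; pose a := (x + y) / 2; pose b := (x - y) / 2.
have ex : sin x = sin a * cos b + cos a * sin b by rewrite -sinD; congr sin; rewrite /a /b; field.
have ey : sin y = sin a * cos b - cos a * sin b by rewrite -sinB; congr sin; rewrite /a /b; field.
suff : 0 <= cos a * sin b by rewrite ex ey; lra.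
apply: mulr_ge0.
  by apply: cos_ge0_pihalf; rewrite /a; apply/andP; split; lra.
by apply: sin_ge0_pi; rewrite /b; apply/andP; split; lra.
Qed.

Lemma pol_inj s t (a b : R) : C s -> C t -> 0 < a -> 0 < b -> pol s a = pol t b ->
  a = b /\ [\/ s = t, s = 0 /\ t = 2 * pi | s = 2 * pi /\ t = 0].
Proof.
wlog st : s t a b / t <= s.
  move=> h Cs Ct a0 b0 e; have [ts|st] := leP t s; first exact: h.
  have [|<- []] := h t s b a (ltW st) Ct Cs b0 a0; first by rewrite e.
  - by move=> ->; split=> //; constructor 1.
  - by move=> [-> ->]; split=> //; constructor 3.
  - by move=> [-> ->]; split=> //; constructor 2.
move=> /CP/andP[s0 s1] /CP/andP[t0 t1] a0 b0 e.
have := polar_dist s t a b; rewrite e subrr /sqn /= expr0n addr0 => /esym/eqP.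
have ab : 0 < 4 * a * b by rewrite !mulr_gt0.
rewrite paddr_eq0 ?sqr_ge0//; last by apply: mulr_ge0; [exact: ltW|exact: sqr_ge0].
rewrite sqrf_eq0 subr_eq0 mulf_eq0 (gt_eqF ab) sqrf_eq0 /= => /andP[/eqP -> /eqP sn]; split=> //.
have [->|ne] := eqVneq s t; first by constructor 1.
have h0 : 0 < (s - t) / 2 by rewrite divr_gt0// subr_gt0 lt_neqAle eq_sym ne.
have h1 : pi <= (s - t) / 2.
  by rewrite leNgt; apply/negP => h; have := @sin_gt0_pi R ((s - t) / 2); rewrite h0 h sn ltxx => /(_ isT).
by constructor 3; split; lra.
Qed.

Lemma polar_exists (p : R * R) (a : R) : 0 < a -> sqn p = a ^+ 2 -> exists2 t, C t & p = pol t a.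
Proof.
case: p => x y a0; rewrite /sqn /= => e.
have a2 : a ^+ 2 != 0 by rewrite sqrf_eq0 gt_eqF.
have e1 : (x / a) ^+ 2 + (y / a) ^+ 2 = 1.
  by rewrite !expr_div_n -mulrDl e divff.
have xa : -1 <= x / a <= 1.
  have : (x / a) ^+ 2 <= 1 by rewrite -e1 lerDl sqr_ge0.
  by move: (x / a) => z z1; apply/andP; split; nra.
have C1 : cos (acos (x / a)) = x / a by apply: acosK; rewrite in_itv.
have S1 : sin (acos (x / a)) = `|y / a|.
  by rewrite sin_acos// -e1 [_ ^+ 2 + _ - _]addrAC subrr add0r sqrtr_sqr.
have [l u] := (acos_ge0 xa, acos_lepi xa).
have xE : x = a * (x / a) by field; rewrite gt_eqF.
have yE : y = a * (y / a) by field; rewrite gt_eqF.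
have [y0|y0] := leP 0 (y / a).
  exists (acos (x / a)); first by apply/CP; rewrite l /=; have := pi_gt0 R; lra.
  by rewrite /pol C1 S1 (ger0_norm y0) -xE -yE.
exists (2 * pi - acos (x / a)); first by apply/CP; apply/andP; split; lra.
have p2 : 2 * pi = pi *+ 2 :> R by rewrite mulr_natl.
by rewrite /pol cosB sinB p2 cos2pi sin2pi C1 S1 (ltr0_norm y0) !(mul0r, mul1r, add0r, addr0, opprK) -xE -yE.
Qed.

Lemma polar_opp t s : - pol t s = pol (t + pi) s.
Proof. by rewrite /pol cosDpi sinDpi !mulrN. Qed.

Section curve.
Variables (rho : R -> R) (m0 M K : R).
Hypotheses (m00 : 0 < m0) (K0 : 0 <= K).
Hypotheses (rho_ge : forall t, C t -> m0 <= rho t) (rho_le : forall t, C t -> rho t <= M).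
Hypothesis lip : forall s t, C s -> C t -> `|rho s - rho t| <= K * `|s - t|.
Hypothesis mrho : measurable_fun (C : set (measurableTypeR R)) rho.
Hypothesis per : rho 0 = rho (2 * pi).
Let gam t := pol t (rho t).

Let M0 : 0 < M.
Proof.
have C0 : C 0 by apply/CP; rewrite lexx ltW// twopi_gt0.
exact: lt_le_trans (lt_le_trans m00 (rho_ge C0)) (rho_le C0).
Qed.

Let rho_gt0 t : C t -> 0 < rho t. Proof. by move=> /rho_ge; exact: lt_le_trans. Qed.

Lemma curve_lip s t : C s -> C t -> edist (gam s) (gam t) <= (K + M) * `|s - t|.
Proof.
move=> Cs Ct; have d0 : 0 <= (K + M) * `|s - t| by rewrite mulr_ge0// addr_ge0// ltW.
rewrite /edist -[leRHS](ger0_norm d0) -sqrtr_sqr ler_wsqrtr// polar_dist.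
have h1 : (rho s - rho t) ^+ 2 <= (K * `|s - t|) ^+ 2.
  by rewrite -[leLHS]real_normK ?num_real// ler_sqr ?nnegrE// ?mulr_ge0//; exact: lip.
have h2 : 4 * rho s * rho t * sin ((s - t) / 2) ^+ 2 <= (M * `|s - t|) ^+ 2.
  have h3 : rho s * rho t <= M * M by apply: ler_pM; [exact: ltW (rho_gt0 Cs)|exact: ltW (rho_gt0 Ct)|exact: rho_le|exact: rho_le].
  have h4 : sin ((s - t) / 2) ^+ 2 <= (`|s - t| / 2) ^+ 2.
    rewrite -[leLHS]real_normK ?num_real// ler_sqr ?nnegrE//; apply: le_trans (sin_le_norm _) _.
    by rewrite normrM (ger0_norm (_ : 0 <= 2^-1)).
  have h5 : rho s * rho t * sin ((s - t) / 2) ^+ 2 <= M * M * (`|s - t| / 2) ^+ 2.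
    by apply: ler_pM => //; [apply: mulr_ge0; exact/ltW/rho_gt0|exact: sqr_ge0].
  have -> : (M * `|s - t|) ^+ 2 = 4 * (M * M * (`|s - t| / 2) ^+ 2) by field.
  have -> : 4 * rho s * rho t * sin ((s - t) / 2) ^+ 2 = 4 * (rho s * rho t * sin ((s - t) / 2) ^+ 2) by rewrite !mulrA.
  by rewrite ler_pM2l.
have h6 : 0 <= (K * `|s - t|) * (M * `|s - t|) by rewrite !mulr_ge0// ltW.
apply: (@le_trans _ _ ((K * `|s - t|) ^+ 2 + (M * `|s - t|) ^+ 2)); first exact: lerD.
rewrite mulrDl.
by move: h6; move: (K * _) (M * _) => x y; rewrite sqrrD -mulr_natl; nra.
Qed.

Let mI (a b : R) : measurable (`[a, b]%classic : set (measurableTypeR R)). Proof. exact: measurable_itv. Qed.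

(** The weight [rho] is the length element without its radial part, so the angular term of
    [polar_dist] suffices: a chord is at least [2 * p * sin ((t - s) / 2)] with [p] the smaller of
    the two end radii. *)
Lemma curve_loc (m : {measure set (measurableTypeR R) -> \bar R}) :
  (forall A, m A = (\int[mu]_(x in C `&` A) (rho x)%:E)%E) ->
  forall eta e : R, 0 < eta -> 0 < e -> exists2 delta : R, 0 < delta &
  forall s t, eta <= s -> s <= t -> t <= 2 * pi - eta -> edist (gam s) (gam t) <= delta ->
    (m `[s, t]%classic <= ((1 + e) * edist (gam s) (gam t))%:E)%E.
Proof.
move=> mE eta e eta0 e0.
(* [K / m0] accounts for the variation of [rho] along the arc and [(1 + e) / 2] for the defect in
   [sin_ge_quad]; together they stay below [e] on arcs of angle at most [D]. *)
pose q := K / m0 + (1 + e) / 2; have q0 : 0 < q by rewrite ltr_wpDl ?divr_ge0 ?divr_gt0 ?addr_gt0// ltW.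
pose D := Num.min (Num.min eta 1) (e / q).
have D0 : 0 < D by rewrite !lt_min eta0 ltr01 divr_gt0.
have De : D <= eta by rewrite !ge_min lexx.
have D1 : D <= 1 by rewrite !ge_min lexx orbT.
have Dq : D * q <= e by rewrite -ler_pdivlMr// !ge_min lexx !orbT.
have p2 := pi_ge2 R.
have sD : 0 < sin (D / 2) by apply: sin_gt0_pi; apply/andP; split; lra.
exists (m0 * sin (D / 2)); first exact: mulr_gt0.
move=> s t es st te.
have Cs : C s by apply/CP; apply/andP; split; lra.
have Ct : C t by apply/CP; apply/andP; split; lra.
set p := Num.min (rho s) (rho t).
have pm : m0 <= p by rewrite le_min !rho_ge.
have p0 : 0 < p by exact: lt_le_trans pm.
have s0 : 0 <= sin ((t - s) / 2) by apply: sin_ge0_pi; apply/andP; split; lra.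
have low : 2 * p * sin ((t - s) / 2) <= edist (gam s) (gam t).
  have d0 : 0 <= 2 * p * sin ((t - s) / 2) by rewrite !mulr_ge0// ltW.
  rewrite /edist -[leLHS](ger0_norm d0) -sqrtr_sqr ler_wsqrtr// polar_dist.
  rewrite (_ : (s - t) / 2 = - ((t - s) / 2)); last by field.
  rewrite sinN sqrrN; apply: ler_wpDl; first exact: sqr_ge0.
  rewrite exprMn; apply: ler_wpM2r; first exact: sqr_ge0.
  rewrite (_ : (2 * p) ^+ 2 = 4 * (p * p)); last by ring.
  rewrite -!mulrA ler_pM2l//; apply: ler_pM; rewrite ?(ltW p0)//.
    by rewrite ge_min lexx.
  by rewrite ge_min lexx orbT.
move=> small.
(* The margin [eta] keeps [t - s] below [2 pi - D]; a gap above [D] would thus put [(t - s) / 2]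
   where the sine is at least [sin (D / 2)], and the chord would exceed [delta]. *)
have dD : t - s <= D.
  rewrite leNgt; apply/negP => Dts.
  have [Dh1 Dh2] : D / 2 <= (t - s) / 2 /\ (t - s) / 2 <= pi - D / 2 by split; lra.
  have Dh0 : 0 <= D / 2 by rewrite divr_ge0// ltW.
  have := le_trans low small => h.
  have h1 := sin_ge_middle Dh0 Dh1 Dh2.
  have h2 : m0 * sin (D / 2) <= p * sin ((t - s) / 2) by apply: ler_pM => //; exact: ltW.
  have h3 : 0 < p * sin ((t - s) / 2) by apply: lt_le_trans h2; exact: mulr_gt0.
  by move: h h2 h3; rewrite -mulrA; move: (p * _) (m0 * _) => x y; lra.
have ts0 : 0 <= t - s by rewrite subr_ge0.
have up : (m `[s, t]%classic <= ((t - s) * (p + K * (t - s)))%:E)%E.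
  have pK0 : 0 <= p + K * (t - s) by rewrite addr_ge0 ?(ltW p0) ?mulr_ge0.
  have mst : (mu `[s, t]%classic <= (t - s)%:E)%E.
    by rewrite lebesgue_measure_itv /= lte_fin; case: ltP => // _; rewrite lee_fin.
  rewrite mE; apply: (@le_trans _ _ (\int[mu]_(x in `[s, t]) (p + K * (t - s))%:E)%E).
    apply: le_nonneg_integral => //.
    - by move=> x [Cx _]; rewrite lee_fin ltW// rho_gt0.
    - move=> x [Cx]; rewrite /= in_itv /= => /andP[sx xt]; rewrite lee_fin.
      have h y : C y -> `|x - y| <= t - s -> rho x <= rho y + K * (t - s).
        move=> Cy xy; rewrite -lerBlDl; apply: le_trans (ler_norm _) _; apply: le_trans (lip Cx Cy) _.
        exact: ler_wpM2l.
      rewrite /p /Num.min; case: ifP => _; apply: h => //.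
        by rewrite ger0_norm ?subr_ge0//; lra.
      by rewrite ler0_norm ?subr_le0//; lra.
  rewrite integral_cst// EFinM muleC; apply: lee_wpmul2r; first by rewrite lee_fin.
  exact: mst.
apply: le_trans up _; rewrite lee_fin.
have sq : (t - s) / 2 - ((t - s) / 2) ^+ 2 <= sin ((t - s) / 2) by apply: sin_ge_quad; rewrite divr_ge0.
apply: (@le_trans _ _ ((1 + e) * (2 * p * ((t - s) / 2 - ((t - s) / 2) ^+ 2)))); last first.
  rewrite ler_pM2l; last by rewrite ltr_wpDr// ltW.
  by apply: le_trans low; rewrite ler_pM2l// mulr_gt0.
rewrite (_ : (1 + e) * _ = (t - s) * (p * ((1 + e) * (1 - (t - s) / 2)))); last by field.
apply: ler_wpM2l => //.
have KK : K <= p * (K / m0) by rewrite mulrCA ler_peMr// ler_pdivlMr// mul1r.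
have k1 : (t - s) * q <= e by apply: le_trans Dq; rewrite ler_wpM2r// ltW.
have k2 : p * ((t - s) * q) <= p * e by rewrite ler_wpM2l// ltW.
have k3 : K * (t - s) <= p * (K / m0) * (t - s) by rewrite ler_wpM2r.
move: k2; rewrite /q; move: k3; move: (K / m0) => y; set d := t - s.
have -> : p * (d * (y + (1 + e) / 2)) = p * y * d + p * ((1 + e) * d / 2) by field.
have -> : p * ((1 + e) * (1 - d / 2)) = p + p * e - p * ((1 + e) * d / 2) by field.
by move: (p * y * d) (p * ((1 + e) * d / 2)) (K * d) (p * e) => *; lra.
Qed.

Let Cm : measurable (C : set (measurableTypeR R)). Proof. exact: mI. Qed.

Lemma measurable_curve : measurable_fun (C : set (measurableTypeR R)) (gam : R -> plane).
Proof.
have mz : measurable_fun setT (rho \_ C : measurableTypeR R -> measurableTypeR R).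
  by have [h _] := measurable_restrictT rho Cm; exact: h.
have mt := measurable_fun_pair (@measurable_id _ (measurableTypeR R) setT) mz.
have mp : measurable_fun (C : set (measurableTypeR R)) ((fun t => pol t ((rho \_ C) t)) : R -> plane).
  apply: measurable_funTS; exact: (measurableT_comp (@measurable_pol R) mt).
by apply: eq_measurable_fun mp => t /= Ct; rewrite patchE Ct.
Qed.

(** The density [rho] is carried both to the plane, where it integrates [f], and on the line, where
    [hausdorff1_ge] compares it with the Hausdorff measure of [B] through the parameters that land
    in [B]. *)
Lemma curve_integral_le (A : set (R * R)) (f : R * R -> \bar R) : measurable (A : set plane) ->
  (forall t, C t -> A (gam t)) -> (forall x : R * R, A x -> (0 <= f x)%E) -> measurable_fun (A : set plane) f ->
  (\int[mu]_(t in C) (f (gam t) * (rho t)%:E) <= \int[@hausdorff1 R]_(x in A) f x)%E.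
Proof.
move=> mA CA f0 mf.
have rho0 t : C t -> 0 <= rho t by move=> /rho_gt0/ltW.
have [m mE] := @density_measure _ _ (measurableTypeR R) plane R mu C rho gam Cm measurable_curve mrho rho0.
have [m' mE'] := @density_measure _ _ (measurableTypeR R) (measurableTypeR R) R mu C rho id Cm (@measurable_id _ (measurableTypeR R) C) mrho rho0.
rewrite -(curve_integral measurable_curve mrho rho0 mE mA CA f0 mf).
apply: (@le_integral_set_function _ plane R m (@hausdorff1 R) A (measure0 m) (@hausdorff1_set0 R) f f0).
move=> B mB BA; have mT : measurable (C `&` gam @^-1` B : set (measurableTypeR R)) by exact: measurable_curve.
apply: (@le_trans _ _ (m' (C `&` gam @^-1` B))); first by rewrite mE mE' preimage_id setIA setIid.
apply: (@hausdorff1_ge R gam rho (2 * pi) M (ltW twopi_gt0) (ltW M0) rho0 rho_le m' mE' (curve_loc mE')) => //.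
by move=> t [].
Qed.

(** The constant density [K + M] is a Lipschitz constant of the curve. It is exact for a circle,
    where [K = 0]; for other domains it keeps boundary integrals finite and controlled by those in
    the angle. *)
Lemma curve_integral_ge (A : set (R * R)) (f : R * R -> \bar R) : measurable (A : set plane) ->
  A = [set gam t | t in C] -> (forall x : R * R, A x -> (0 <= f x)%E) -> measurable_fun (A : set plane) f ->
  (\int[@hausdorff1 R]_(x in A) f x <= \int[mu]_(t in C) (f (gam t) * (K + M)%:E))%E.
Proof.
move=> mA AE f0 mf; have KM : 0 < K + M by rewrite ltr_wpDl.
have c0 t : C t -> 0 <= (fun=> K + M) t by move=> _; exact: ltW.
have mc : measurable_fun (C : set (measurableTypeR R)) (fun=> K + M : R) by exact: measurable_cst.
have [m mE] := @density_measure _ _ (measurableTypeR R) plane R mu C (fun=> K + M) gam Cm measurable_curve mc c0.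
have CA t : C t -> A (gam t) by move=> Ct; rewrite AE; exists t.
rewrite -(curve_integral measurable_curve mc c0 mE mA CA f0 mf).
apply: (@le_integral_set_function _ plane R (@hausdorff1 R) m A (@hausdorff1_set0 R) (measure0 m) f f0).
move=> B mB BA; have mT0 : measurable (C `&` gam @^-1` B : set (measurableTypeR R)) by exact: measurable_curve.
have mo : measurable (`]0, (2 * pi)]%classic : set (measurableTypeR R)) by exact: measurable_itv.
have mT := measurableI _ _ mT0 mo.
have up : (hausdorff1 B <= (K + M)%:E * mu (C `&` gam @^-1` B `&` `]0%R, (2 * pi)%R]%classic))%E; last first.
  apply: (le_trans up); rewrite mE integral_cst//; apply: lee_wpmul2l; first by rewrite lee_fin ltW.
  by apply: le_measure; rewrite ?inE// => t [].
have lip' s t : 0 < s <= 2 * pi -> 0 < t <= 2 * pi -> edist (gam s) (gam t) <= (K + M) * `|s - t|.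
  by move=> /andP[s0 s1] /andP[t0 t1]; apply: curve_lip; apply/CP; apply/andP; split=> //; exact: ltW.
apply: (@hausdorff1_le R gam _ (2 * pi) KM twopi_gt0 lip' B _ mT); first by move=> t [].
  move=> x Bx; have := BA _ Bx; rewrite AE => -[t Ct gt].
  (* [hausdorff1_le] works on half-open parameter intervals; the excluded angle 0 is replaced by
     [2 * pi], which gives the same point. *)
  have [t0|t0] := eqVneq t 0; last first.
    exists t => //; split; first by split=> //=; rewrite gt.
    by move/CP: Ct => /andP[a b]; rewrite /= in_itv /= b lt_neqAle eq_sym t0 a.
  have g2 : gam (2 * pi) = x.
    have p2 : 2 * pi = pi *+ 2 :> R by rewrite mulr_natl.
    by rewrite -gt t0 /gam -per /pol p2 cos2pi sin2pi cos0 sin0.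
  have C2 : C (2 * pi) by apply/CP; rewrite lexx ltW// twopi_gt0.
  exists (2 * pi) => //; split; first by split=> //=; rewrite g2.
  by rewrite /= in_itv /= lexx twopi_gt0.
Qed.
End curve.
End polar_curves.

(** * Star-shaped domains and disks in polar coordinates *)

Section domains.
Variable R : realType.
Notation C := (`[0%R, (2 * pi)%R]%classic : set R).
Implicit Types (O Omega : set (R * R)) (s t : R).

(** On a path that misses the boundary, [O] and its closure cut out the same set, which is open and
    closed in the connected image. *)
Lemma path_avoids_boundary O (g : R -> R * R) (a b : R) : open O -> continuous g -> a <= b ->
  (forall x : R, a <= x <= b -> ~ boundary O (g x)) -> O (g a) -> O (g b).
Proof.
move=> oO cg ab nb Oa; pose A := [set g x | x in `[a, b]%classic].
have cA : connected A.
  by apply: connected_continuous_connected; [exact: segment_connected|exact: continuous_subspaceT].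
have Ia : A (g a) by exists a => //=; rewrite in_itv /= lexx.
have Ib : A (g b) by exists b => //=; rewrite in_itv /= lexx ab.
have : A `&` O = A.
  apply: cA; [by exists (g a)|by exists O|exists (closure O); first exact: closed_closure].
  apply/seteqP; split=> x [Ax Ox]; split=> //; first exact: subset_closure.
  case: Ax Ox => y + <- cO; rewrite /= in_itv /= => yab; apply: contrapT => nO; apply: (nb y yab); split=> //.
  by move=> /interior_subset.
by move=> AO; move: Ib; rewrite -AO => -[].
Qed.

Lemma continuous_pol_radial t : continuous (fun s => pol t s).
Proof. by apply: continuous_pair2 => s; apply: cvgMl; exact: cvg_id. Qed.

Lemma bounded_box O : bounded_set O -> exists2 M : R, 0 < M & forall x, O x -> `|x.1| <= M /\ `|x.2| <= M.
Proof.
move=> [M [Mr h]]; exists (Num.max 1 (M + 1)); first by rewrite lt_max ltr01.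
move=> x Ox; have := h (Num.max 1 (M + 1)); rewrite lt_max ltrDl ltr01 orbT => /(_ isT x Ox).
by rewrite /Num.norm /= ge_max => /andP[].
Qed.

Lemma closure_opp O x : centrally_symmetric O -> closure O x -> closure O (- x).
Proof.
move=> sO cx B /opp_continuous nB; have [y [Oy By]] := cx _ nB.
by exists (- y); split=> //; rewrite -sO; exists y.
Qed.

Lemma exterior_opp O x : centrally_symmetric O -> exterior O (- x) <-> exterior O x.
Proof.
move=> sO; split=> h c; apply: h; first exact: closure_opp.
by rewrite -(opprK x); exact: closure_opp.
Qed.

Section star_shaped.
Variables (O : set (R * R)) (rho : R -> R) (r : R).
Hypotheses (oO : open O) (bO : bounded_set O) (r0 : 0 < r) (rO : disk r `<=` O).
Hypotheses (rho0 : forall t, C t -> 0 < rho t) (per : rho 0 = rho (2 * pi)).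
Hypothesis bd : boundary O = [set pol t (rho t) | t in C].

Let boundary_pol t s : C t -> 0 < s -> boundary O (pol t s) -> s = rho t.
Proof.
rewrite bd => Ct s0 [t' Ct' e]; have [<- []] := pol_inj Ct' Ct (rho0 Ct') s0 e.
- by move=> ->.
- by move=> [-> ->].
- by move=> [-> ->].
Qed.

Let O0 (t : R) : O (pol t 0).
Proof. by apply: rO; rewrite /disk /= sqn_pol expr0n /= exprn_gt0. Qed.

Lemma star_radius_ge t : C t -> r <= rho t.
Proof.
move=> Ct; rewrite leNgt; apply/negP => h.
have : boundary O (pol t (rho t)) by rewrite bd; exists t.
case=> _; apply; rewrite ((interior_id O).1 oO); apply: rO.
by rewrite /disk /= sqn_pol ltr_pXn2r ?nnegrE ?(ltW r0)// ltW// rho0.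
Qed.

(** A ray meets the boundary only at radius [rho t]. Before it, the ray is joined to the centre
    inside [O]; beyond it, one point in [O] would force the rest of the ray into the bounded set
    [O]. *)
Lemma star_polar_ext : polar_ext (exterior O) rho.
Proof.
split=> [t|t s] /CP Ct; first exact: rho0.
move=> s0; split=> h.
  rewrite ltNge; apply/negP => sr; apply: h; have [->|ne] := eqVneq s (rho t).
    by have : boundary O (pol t (rho t)) by [rewrite bd; exists t]; case.
  apply: subset_closure; apply: (@path_avoids_boundary O (fun s => pol t s) 0 s) => //.
  - exact: continuous_pol_radial.
  - exact: ltW.
  - move=> x /andP[x0 xs]; have [->|x0'] := eqVneq x 0.
      by case=> _; apply; rewrite ((interior_id O).1 oO).
    move=> bx; have xr : x = rho t by apply: boundary_pol Ct _ bx; rewrite lt_neqAle eq_sym x0'.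
    by move: ne; rewrite eq_le sr -xr xs.
move=> cO; have Os : O (pol t s).
  apply: contrapT => nO; have bs : boundary O (pol t s) by split=> // /(@interior_subset _ O).
  by move: h; rewrite (boundary_pol Ct s0 bs) ltxx.
have [M M0 hM] := bounded_box bO.
pose b := Num.max s (2 * M + 1).
have Ob : O (pol t b).
  apply: (@path_avoids_boundary O (fun s => pol t s) s b) => //.
  - exact: continuous_pol_radial.
  - by rewrite le_max lexx.
  - move=> x /andP[sx _] /(boundary_pol Ct (lt_le_trans s0 sx)) e.
    by move: h; rewrite -e ltNge sx.
have [h1 h2] := hM _ Ob; have := sqn_pol t b; rewrite /sqn /= => e.
have bM : 2 * M + 1 <= b by rewrite le_max lexx orbT.
move: h1 h2 e; rewrite /= !ler_norml => /andP[h1 h1'] /andP[h2 h2'].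
move: (b * cos t) (b * sin t) h1 h1' h2 h2' => u v *; nra.
Qed.

Lemma star_exterior_ge x : exterior O x -> r ^+ 2 <= sqn x.
Proof. by move=> ex; rewrite leNgt; apply/negP => h; apply: ex; apply: subset_closure; exact: rO. Qed.

(** The radius at an angle is recovered from the exterior along the ray, and central symmetry
    exchanges the rays at [t] and [t + pi]. *)
Lemma star_symmetric t : centrally_symmetric O -> 0 <= t <= pi -> rho (t + pi) = rho t.
Proof.
move=> sO /andP[t0 t1]; have [pos U] := star_polar_ext; have p0 := pi_gt0 R.
have Ct : 0 <= t <= 2 * pi by apply/andP; split; lra.
have Ct' : 0 <= t + pi <= 2 * pi by apply/andP; split; lra.
have h s : 0 < s -> rho t < s <-> rho (t + pi) < s.
  by move=> s0; rewrite -(U t s Ct s0) -(U _ s Ct' s0) -polar_opp exterior_opp.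
apply/eqP; rewrite eq_le; apply/andP; split; rewrite leNgt; apply/negP => lt.
  by have /h := lt; rewrite ltxx => /(_ (pos _ Ct')).
by have /h := lt; rewrite ltxx => /(_ (pos _ Ct)).
Qed.
End star_shaped.

Lemma strictly_star_shapedP O (r : R) : bounded_domain O -> strictly_star_shaped O -> 0 < r -> disk r `<=` O ->
  exists (rho : R -> R) (M K : R), [/\ 0 <= K /\ continuous rho,
    forall t, C t -> r <= rho t <= M,
    forall s t, C s -> C t -> `|rho s - rho t| <= K * `|s - t|,
    polar_ext (exterior O) rho /\ (centrally_symmetric O -> forall t, 0 <= t <= pi -> rho (t + pi) = rho t) &
    boundary O = [set pol t (rho t) | t in C] /\ rho 0 = rho (2 * pi)].
Proof.
move=> [_ oO _ bO] [rho [drho rho0 per bd]] r0 rO.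
have rho0' t : C t -> 0 < rho t by move=> /CP; exact: rho0.
have per0 : rho 0 = rho (2 * pi) by exact: per 0%N.
have d1 (x : R) : is_derive x 1 rho (derive1 rho x).
  by rewrite derive1E; apply: (@DeriveDef _ _ _ x 1 rho) => //; exact: drho 0%N x.
have c1 : continuous (derive1 rho) by move=> x; apply: differentiable_continuous; apply/derivable1_diffP; exact: drho 1%N x.
have cr : continuous rho by move=> x; exact: der_continuous (d1 x).
(* [mean_value] only places its point within [|s - t|] of [t], hence the interval wider than one
   period. *)
have [K K0 hK] : exists2 K : R, 0 <= K & forall x, - (2 * pi) <= x <= 4 * pi -> `|derive1 rho x| <= K.
  have cn : {within `[- (2 * pi), 4 * pi], continuous (fun x => `|derive1 rho x|)}.
    by apply: continuous_subspaceT => x; apply: (continuous_comp (c1 x)); exact: norm_continuous.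
  have p0 := pi_gt0 R; have le : - (2 * pi) <= 4 * pi :> R by lra.
  have [c _ hc] := EVT_max le cn; exists `|derive1 rho c| => // x xp; apply: hc; exact: xp.
have lip s t : C s -> C t -> `|rho s - rho t| <= K * `|s - t|.
  move=> /CP/andP[s0 s1] /CP/andP[t0 t1]; have [c [hc ->]] := mean_value d1 s t.
  rewrite normrM ler_wpM2r//; apply: hK; apply/andP.
  have : `|s - t| <= 2 * pi by rewrite ler_norml; apply/andP; split; lra.
  move=> /(le_trans hc); rewrite ler_norml => /andP[]; split; lra.
have C0 : C 0 by apply/CP; rewrite lexx ltW// twopi_gt0.
exists rho, (rho 0 + K * (2 * pi)), K; split=> //.
- move=> t Ct; rewrite (star_radius_ge oO r0 rO rho0' bd Ct) /= -lerBlDl.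
  apply: le_trans (ler_norm _) _; apply: le_trans (lip _ _ Ct C0) _; rewrite ler_wpM2l// subr0.
  by move/CP: Ct => /andP[t0 t1]; rewrite ger0_norm.
- split; first exact: (star_polar_ext oO bO r0 rO rho0' per0 bd).
  by move=> sO t; exact: (star_symmetric oO bO r0 rO rho0' per0 bd sO).
Qed.

Section disks.
Variable r : R.
Hypothesis r0 : 0 < r.

Lemma open_disk : open (disk r).
Proof.
have -> : disk r = @sqn R @^-1` [set` `]-oo, r ^+ 2[] by apply/seteqP; split=> x; rewrite /disk /= in_itv.
by apply: open_comp => [x _|]; [exact: continuous_sqn|exact: interval_open].
Qed.

Lemma closure_disk : closure (disk r) = [set x | sqn x <= r ^+ 2].
Proof.
apply/seteqP; split=> x.
  move=> cx; have cl : closed [set x : R * R | sqn x <= r ^+ 2].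
    have -> : [set x : R * R | sqn x <= r ^+ 2] = @sqn R @^-1` [set y | y <= r ^+ 2] by [].
    by apply: closed_comp => [y _|]; [exact: continuous_sqn|exact: closed_le].
  have /(closure_subset (A := disk r)) h : disk r `<=` [set x : R * R | sqn x <= r ^+ 2] by move=> y /ltW.
  by have := h _ cx; rewrite -((closure_id _).1 cl).
rewrite /= => xr; have [lt|ge] := ltP (sqn x) (r ^+ 2); first exact: subset_closure.
have e : sqn x = r ^+ 2 by apply/eqP; rewrite eq_le xr ge.
have [t _ ->] := polar_exists r0 e => B nB.
have := continuous_pol_radial (t := t) (x := r) nB => /nbhs_ballP[d /= d0 hd].
pose q := Num.max 0 (r - d / 2).
have q0 : 0 <= q by rewrite le_max lexx.
have qr : q < r by rewrite gt_max r0 ltrBlDr ltrDl divr_gt0.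
have qd : r - q < d by rewrite ltrBlDr -ltrBlDl lt_max; apply/orP; right; lra.
exists (pol t q); split; first by rewrite /disk /= sqn_pol ltr_pXn2r// nnegrE ltW.
by apply: hd; rewrite /ball /= ger0_norm// subr_ge0 ltW.
Qed.

Lemma exterior_disk : exterior (disk r) = disk_ext r.
Proof.
by rewrite /exterior closure_disk; apply/seteqP; split=> x; rewrite /disk_ext /= ltNge => /negP.
Qed.

Lemma boundary_disk : boundary (disk r) = [set pol t r | t in C].
Proof.
rewrite /boundary ((interior_id _).1 open_disk) closure_disk.
apply/seteqP; split=> x.
  move=> [/= xr /negP]; rewrite -leNgt => rx.
  by have [|t Ct ->] := @polar_exists _ x r r0; [apply/eqP; rewrite eq_le xr rx|exists t].
by move=> [t Ct <-]; rewrite /disk /= sqn_pol lexx ltxx; split.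
Qed.
End disks.
End domains.

(** * Classical derivatives are weak derivatives *)

Section integration_by_parts.
Variable R : realType.
Notation mu := (@lebesgue_measure R).
Notation leb2 := (@leb2 R).
Implicit Types (U : set (R * R)) (w phi F G : R * R -> R).

(** The margin 1 puts the end points of the segment strictly outside the box, where the function to
    be integrated vanishes. *)
Lemma box_section (x y a : R) : box (0, 0) a (x, y) -> x \in `[- (a + 1), a + 1].
Proof.
move=> [/= + _]; rewrite subr0 ler_norml in_itv /= => /andP[h1 h2]; apply/andP; split; lra.
Qed.

Lemma integral_line_derivative (f g : R -> R) (a : R) : 0 <= a -> (forall x : R, is_derive x 1 f (g x)) -> continuous g ->
  f (- (a + 1)) = 0 -> f (a + 1) = 0 -> (forall x, x \notin `[- (a + 1), a + 1] -> g x = 0) ->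
  (\int[mu]_x (g x)%:E = 0)%E.
Proof.
move=> a0 df cg f1 f2 g0; have le : - (a + 1) <= a + 1 by lra.
transitivity (\int[mu]_(x in `[(- (a + 1))%R, (a + 1)%R]) (g x)%:E)%E.
  rewrite [RHS]integral_mkcond; apply: eq_integral => x _; rewrite patchE; case: ifPn => // /negP xn.
  by rewrite g0//; apply/negP => h; apply: xn; apply/mem_set.
by rewrite (integral_is_derive le (fun x _ => df x) (continuous_subspaceT cg)) f1 f2 subrr.
Qed.

Lemma integrable_box F (a : R) : 0 <= a -> continuous F -> (forall x, ~ box (0, 0) a x -> F x = 0) ->
  leb2.-integrable setT (EFin \o F).
Proof.
move=> a0 cF F0; have mF := continuous_measurable2 cF; have mB := measurable_box (0, 0) a.
have [M0 [_ hM]] := @compact_bounded R _ _ (continuous_compact (continuous_subspaceT (A := box (0, 0) a) cF) (@compact_box R (0, 0) a)).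
pose M := Num.max (M0 + 1) 0; have MM0 : 0 <= M by rewrite le_max lexx orbT.
have FM x : `|F x| <= M * \1_(box (0, 0) a) x.
  rewrite indicE; have [bx|nb] := boolP (x \in box (0, 0) a).
    by rewrite mulr1 le_max hM ?ltrDl//; exists x => //; exact/set_mem.
  by rewrite mulr0 F0 ?normr0// => h; move/negP: nb; apply; exact/mem_set.
apply/integrableP; split; first exact/measurable_EFinP.
apply: (@le_lt_trans _ _ (\int[leb2]_x (M%:E * (\1_(box (0, 0) a) x)%:E))%E).
  apply: le_nonneg_integral => //.
  - by move=> x _; rewrite -EFinM lee_fin; exact: le_trans (FM x).
  - by move=> x _; rewrite /= -EFinM lee_fin.
rewrite ge0_integralZl_EFin//; last by apply/measurable_EFinP; exact: measurable_indic.
by rewrite integral_box_indic// -EFinM ltry.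
Qed.

Lemma integral_partial1 F G (a : R) : 0 <= a -> continuous G ->
  (forall x : R * R, is_derive x.1 1 (fun s : R => F (s, x.2)) (G x)) ->
  (forall x, ~ box (0, 0) a x -> F x = 0 /\ G x = 0) -> \int[leb2]_x G x = 0.
Proof.
move=> a0 cG dF off; have IG := integrable_box a0 cG (fun x nb => (off x nb).2).
rewrite /Rintegral -[X in fine X](integral21_prod_meas1 IG) (eq_integral (cst 0%E)); first by rewrite integral0.
move=> y _; apply: (@integral_line_derivative (fun s => F (s, y)) (fun s => G (s, y)) a) => //.
- by move=> x; exact: (dF (x, y)).
- by move=> x; apply: (continuous_comp (f := fun s : R => (s, y))); [exact: cvg_pair cvg_id (cvg_cst _)|exact: cG].
- by apply: (off _ _).1 => -[/= + _]; rewrite subr0 normrN ger0_norm; lra.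
- by apply: (off _ _).1 => -[/= + _]; rewrite subr0 ger0_norm; lra.
- by move=> x /negP xn; apply: (off _ _).2 => /box_section.
Qed.

Lemma integral_partial2 F G (a : R) : 0 <= a -> continuous G ->
  (forall x : R * R, is_derive x.2 1 (fun s : R => F (x.1, s)) (G x)) ->
  (forall x, ~ box (0, 0) a x -> F x = 0 /\ G x = 0) -> \int[leb2]_x G x = 0.
Proof.
move=> a0 cG dF off; have IG := integrable_box a0 cG (fun x nb => (off x nb).2).
rewrite /Rintegral -[X in fine X](integral12_prod_meas1 IG) (eq_integral (cst 0%E)); first by rewrite integral0.
move=> y _; apply: (@integral_line_derivative (fun s => F (y, s)) (fun s => G (y, s)) a) => //.
- by move=> x; exact: (dF (y, x)).
- by move=> x; apply: (continuous_comp (f := fun s : R => (y, s))); [exact: cvg_pair (cvg_cst _) cvg_id|exact: cG].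
- by apply: (off _ _).1 => -[/= _]; rewrite subr0 normrN ger0_norm; lra.
- by apply: (off _ _).1 => -[/= _]; rewrite subr0 ger0_norm; lra.
- by move=> x /negP xn; apply: (off _ _).2 => -[/= h1 h2]; apply: xn; apply: (@box_section _ y); split.
Qed.

Lemma test_fun_off U phi x : test_fun U phi -> ~ tsupport phi x -> \forall y \near x, phi y = 0.
Proof.
move=> _ nx; have cl : closed (tsupport phi) by exact: closed_closure.
have : nbhs x (~` tsupport phi) by apply: open_nbhs_nbhs; split=> //; rewrite openC.
apply: filterS => y ny; apply: contrapT => /eqP py; apply: ny; exact: subset_closure.
Qed.

Lemma near_zero_lines F x : (\forall y \near x, F y = 0) ->
  is_derive x.1 1 (fun s : R => F (s, x.2)) 0 /\ is_derive x.2 1 (fun s : R => F (x.1, s)) 0.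
Proof.
have z1 : is_derive x.1 1 (fun _ : R => 0 : R) (0 : R) := der_cst 0 x.1.
have z2 : is_derive x.2 1 (fun _ : R => 0 : R) (0 : R) := der_cst 0 x.2.
have ex : (x.1, x.2) = x by case: (x).
move=> h; split.
  apply: (near_eq_is_derive _ z1).
  have : (fun s : R => (s, x.2)) @ x.1 --> (x.1, x.2) by exact: cvg_pair cvg_id (cvg_cst _).
  rewrite ex => c; have c' : \forall s \near x.1, F (s, x.2) = 0 := c _ h.
  by apply: filterS c' => s ->.
apply: (near_eq_is_derive _ z2).
have : (fun s : R => (x.1, s)) @ x.2 --> (x.1, x.2) by exact: cvg_pair (cvg_cst _) cvg_id.
rewrite ex => c; have c' : \forall s \near x.2, F (x.1, s) = 0 := c _ h.
by apply: filterS c' => s ->.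
Qed.

(** The function [w] is regular in [U] only, but [w * phi] is supported inside [U]: its partial
    derivatives extend continuously by zero to the plane, and their integrals vanish line by
    line. *)
Lemma classical_weak_grad U w (w1 w2 : R * R -> R) : open U ->
  L2 U w -> L2 U w1 -> L2 U w2 ->
  (forall x, U x -> is_derive x.1 1 (fun s : R => w (s, x.2)) (w1 x) /\ is_derive x.2 1 (fun s : R => w (x.1, s)) (w2 x)) ->
  (forall x, U x -> [/\ {for x, continuous w}, {for x, continuous w1} & {for x, continuous w2}]) ->
  weak_grad U w (fun x => (w1 x, w2 x)).
Proof.
move=> oU Lw L1 L2w dw cw; split=> // phi tphi; have [sphi _ sub] := tphi; have mU := open_measurable2 oU.
have [dphi _ _] := Ck_elim (sphi 1%N); have cphi : continuous phi := sphi 0%N.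
have [cg1 cg2] := grad_continuous sphi; have [t1 t2] := test_fun_grad (test_funT tphi).
have [a a0 off] := test_fun_supp tphi.
have [a1 a10 off1] := test_fun_supp t1; have [a2 a20 off2] := test_fun_supp t2.
pose g1 x := (grad phi x).1; pose g2 x := (grad phi x).2.
pose A := Num.max a (Num.max a1 a2).
have A0 : 0 <= A by rewrite le_max a0.
have boxA b x : b <= A -> ~ box (0, 0) A x -> ~ box (0, 0) b x.
  by move=> bA nA [h1 h2]; apply: nA; split; [exact: le_trans h1 bA|exact: le_trans h2 bA].
have offA x : ~ box (0, 0) A x -> [/\ phi x = 0, g1 x = 0 & g2 x = 0].
  move=> nb; split; [apply: off|apply: off1|apply: off2]; apply: boxA nb; rewrite /A !le_max lexx ?orbT//.
have outU x : ~ U x -> \forall y \near x, phi y = 0.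
  by move=> nU; apply: (test_fun_off tphi) => /sub.
have gz x : (\forall y \near x, phi y = 0) -> [/\ phi x = 0, g1 x = 0 & g2 x = 0].
  move=> h; have [d1 d2] := near_zero_lines h; have [e1 e2] := dphi x; split; first exact: nbhs_singleton h.
    exact: (etrans (esym (der_derive1 e1)) (der_derive1 d1)).
  exact: (etrans (esym (der_derive1 e2)) (der_derive1 d2)).
(* A point off [U] is off the closed support of [phi]; near it [phi] and its gradient vanish, so
   products with [w] are continuous there whatever [w] is. *)
have gnear x : ~ U x -> \forall y \near x, [/\ phi y = 0, g1 y = 0 & g2 y = 0].
  move=> nU; apply: filterS (nbhs_interior (outU x nU)) => y; exact: gz.
have Lphi := test_fun_L2 oU tphi.
have Lg1 : L2 U g1 := test_fun_L2S oU t1.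
have Lg2 : L2 U g2 := test_fun_L2S oU t2.
have split_int (wi gi : R * R -> R) : L2 U wi -> L2 U gi -> (forall x, ~ U x -> phi x = 0 /\ gi x = 0) ->
    \int[leb2]_x (wi x * phi x + w x * gi x) = 0 ->
    \int[leb2]_(x in U) (w x * gi x) = - \int[leb2]_(x in U) (wi x * phi x).
  move=> Li Lgi out; rewrite (_ : \int[leb2]_x _ = \int[leb2]_(x in U) (wi x * phi x + w x * gi x)); last first.
    rewrite /Rintegral [in RHS]integral_mkcond; congr fine; apply: eq_integral => x _.
    rewrite patchE; case: ifPn => // /negP nU; have [-> ->] := out x (fun Ux => nU (mem_set Ux)).
    by rewrite !mulr0 addr0.
  rewrite RintegralD//; [|exact: (@sqi_integrableM R _ _ leb2 U mU)|exact: (@sqi_integrableM R _ _ leb2 U mU)].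
  by move=> /eqP; rewrite addr_eq0 => /eqP ->; rewrite opprK.
have zU x : ~ U x -> [/\ phi x = 0, g1 x = 0 & g2 x = 0] by move=> nU; exact: nbhs_singleton (gnear x nU).
have cont (wi gi : R * R -> R) : (forall x, U x -> {for x, continuous wi}) -> continuous gi ->
    (forall x, ~ U x -> \forall y \near x, phi y = 0 /\ gi y = 0) -> continuous (fun x => wi x * phi x + w x * gi x).
  move=> cwi cgi out x; have [Ux|nU] := pselect (U x).
    apply: cvgD; apply: cvgM; [exact: cwi|exact: cphi|by case: (cw x Ux)|exact: cgi].
  have [e1 e2] := nbhs_singleton (out x nU); apply: cvg_near_cst; apply: filterS (out x nU) => y [-> ->].
  by rewrite e1 e2 !mulr0.
have near_F x : ~ U x -> \forall y \near x, w y * phi y = 0.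
  by move=> nU; apply: filterS (outU x nU) => y ->; rewrite mulr0.
apply: conj; rewrite /=.
  apply: (split_int w1 g1) => //; first by move=> x /zU[].
  apply: (@integral_partial1 (fun x => w x * phi x) _ A A0).
  - apply: (cont w1 g1 _ cg1); [by move=> x /cw[]|by move=> x nU; apply: filterS (gnear x nU) => y []].
  - move=> x; have [Ux|nU] := pselect (U x).
      have [e1 _] := dphi x; have [d1 _] := dw x Ux; apply: (der_eq (derM d1 e1)).
      by case: (x) => x1 x2.
    have [d1 _] := near_zero_lines (near_F x nU); apply: (der_eq d1).
    by have [-> -> _] := zU x nU; rewrite !mulr0 addr0.
  - by move=> x /offA[-> -> _]; rewrite !mulr0 addr0.
apply: (split_int w2 g2) => //; first by move=> x /zU[].
apply: (@integral_partial2 (fun x => w x * phi x) _ A A0).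
- apply: (cont w2 g2 _ cg2); [by move=> x /cw[]|by move=> x nU; apply: filterS (gnear x nU) => y []].
- move=> x; have [Ux|nU] := pselect (U x).
    have [_ e1] := dphi x; have [_ d1] := dw x Ux; apply: (der_eq (derM d1 e1)).
    by case: (x) => x1 x2.
  have [_ d1] := near_zero_lines (near_F x nU); apply: (der_eq d1).
  by have [-> _ ->] := zU x nU; rewrite !mulr0 addr0.
- by move=> x /offA[-> _ ->]; rewrite !mulr0 addr0.
Qed.
End integration_by_parts.

(** * Trial functions and their gradients *)

Section trial_functions.
Variable R : realType.
Notation mu := (@lebesgue_measure R).
Notation leb2 := (@leb2 R).
Notation C := (`[0%R, (2 * pi)%R]%classic : set R).

Definition nrm (x : R * R) : R := Num.sqrt (sqn x).

Lemma continuous_nrm : continuous nrm.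
Proof. by move=> x; apply: (continuous_comp (@continuous_sqn R x)); exact: sqrt_continuous. Qed.

Lemma nrm_gt0 x : (0 < nrm x) = (0 < sqn x). Proof. exact: sqrtr_gt0. Qed.

Lemma nrm_pol t s : 0 < s -> nrm (pol t s) = s.
Proof. by move=> s0; rewrite /nrm sqn_pol sqrtr_sqr gtr0_norm. Qed.

Lemma is_derive_nrm x : 0 < nrm x ->
  is_derive x.1 1 (fun s : R => nrm (s, x.2)) (x.1 * (nrm x)^-1) /\
  is_derive x.2 1 (fun s : R => nrm (x.1, s)) (x.2 * (nrm x)^-1).
Proof.
move=> n0; have := n0; rewrite nrm_gt0 => s0; have e : nrm (x.1, x.2) = nrm x by case: (x).
have nn : nrm x != 0 by rewrite gt_eqF.
have s1 : 0 < x.1 ^+ 2 + x.2 ^+ 2 by exact: s0.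
split.
  have d : is_derive x.1 1 (fun s : R => s ^+ 2 + x.2 ^+ 2) (2 * x.1 * 1 + 0) := derD (der2 (der_id x.1)) (der_cst _ _).
  have d' := @der_comp R Num.sqrt (fun s : R => s ^+ 2 + x.2 ^+ 2) x.1 _ _ (is_derive1_sqrt s1) d.
  apply: (@der_eq R (fun s : R => nrm (s, x.2)) x.1 _ _ d').
  by change (Num.sqrt (x.1 ^+ 2 + x.2 ^+ 2)) with (nrm x); rewrite invfM; field.
have d : is_derive x.2 1 (fun s : R => x.1 ^+ 2 + s ^+ 2) (0 + 2 * x.2 * 1) := derD (der_cst _ _) (der2 (der_id x.2)).
have d' := @der_comp R Num.sqrt (fun s : R => x.1 ^+ 2 + s ^+ 2) x.2 _ _ (is_derive1_sqrt s1) d.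
apply: (@der_eq R (fun s : R => nrm (x.1, s)) x.2 _ _ d').
by change (Num.sqrt (x.1 ^+ 2 + x.2 ^+ 2)) with (nrm x); rewrite invfM; field.
Qed.

Variables (h h1 : R -> R) (c0 s0 : R).
Hypothesis dh : forall s : R, 0 < s -> is_derive s 1 h (h1 s).
Hypothesis ch1 : forall s : R, 0 < s -> {for s, continuous h1}.
Hypothesis e1 : c0 ^+ 2 + s0 ^+ 2 = 1.

(** For a unit vector [(c0, s0)] at angle [theta0] this is [cos (t - theta0)], and [ang'] is its
    derivative. *)
Definition ang (t : R) : R := c0 * cos t + s0 * sin t.
Definition ang' (t : R) : R := s0 * cos t - c0 * sin t.
Definition xi (x : R * R) : R := c0 * x.1 + s0 * x.2.

(** The function [h (|x|) * (a + b * cos (theta - theta0))], with the cosine written as [xi x / |x|]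
    so that Cartesian partial derivatives can be taken without choosing an angle. *)
Definition trial (a b : R) (x : R * R) : R := h (nrm x) * (a + b * (xi x * (nrm x)^-1)).
Definition trial1 (a b : R) (x : R * R) : R := h1 (nrm x) * (x.1 * (nrm x)^-1) * (a + b * (xi x * (nrm x)^-1)) +
  h (nrm x) * (b * (c0 * (nrm x)^-1 + xi x * (- (x.1 * (nrm x)^-1) / nrm x ^+ 2))).
Definition trial2 (a b : R) (x : R * R) : R := h1 (nrm x) * (x.2 * (nrm x)^-1) * (a + b * (xi x * (nrm x)^-1)) +
  h (nrm x) * (b * (s0 * (nrm x)^-1 + xi x * (- (x.2 * (nrm x)^-1) / nrm x ^+ 2))).

Lemma trial_lin (a b : R) : trial a b = fun x => a * trial 1 0 x + b * trial 0 1 x.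
Proof. by apply/funext => x; rewrite /trial; ring. Qed.

Lemma xi_pol t s : xi (pol t s) = s * ang t.
Proof. by rewrite /xi /pol /ang /=; ring. Qed.

Lemma trial_pol (a b t s : R) : 0 < s -> trial a b (pol t s) = h s * (a + b * ang t).
Proof. by move=> s0'; rewrite /trial xi_pol nrm_pol// mulrAC divff ?mul1r// gt_eqF. Qed.

Lemma grad_trial_pol (a b t s : R) : 0 < s ->
  trial1 a b (pol t s) = h1 s * cos t * (a + b * ang t) - h s * (b * (sin t * ang' t)) / s /\
  trial2 a b (pol t s) = h1 s * sin t * (a + b * ang t) + h s * (b * (cos t * ang' t)) / s.
Proof.
move=> s0'; have sn : s != 0 by rewrite gt_eqF.
have c2 : cos t ^+ 2 = 1 - sin t ^+ 2 by rewrite -(cos2Dsin2 t) addrK.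
have s2 : sin t ^+ 2 = 1 - cos t ^+ 2 by rewrite -(cos2Dsin2 t) addrAC subrr add0r.
have eu : s * ang t * s^-1 = ang t by rewrite mulrAC divff ?mul1r.
rewrite /trial1 /trial2 xi_pol nrm_pol// eu /pol /=.
have -> : s * cos t * s^-1 = cos t by rewrite mulrAC divff ?mul1r.
have -> : s * sin t * s^-1 = sin t by rewrite mulrAC divff ?mul1r.
rewrite /ang /ang'; move: (cos t) (sin t) c2 s2 => c sn' c2 s2.
have k1 : c0 / s + s * (c0 * c + s0 * sn') * (- c / s ^+ 2) = - (sn' * (s0 * c - c0 * sn')) / s.
  have -> : s * (c0 * c + s0 * sn') * (- c / s ^+ 2) = - (c0 * c ^+ 2 + s0 * sn' * c) / s by field.
  by rewrite c2; field.
have k2 : s0 / s + s * (c0 * c + s0 * sn') * (- sn' / s ^+ 2) = (c * (s0 * c - c0 * sn')) / s.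
  have -> : s * (c0 * c + s0 * sn') * (- sn' / s ^+ 2) = - (c0 * c * sn' + s0 * sn' ^+ 2) / s by field.
  by rewrite s2; field.
by rewrite k1 k2; split; field.
Qed.

Lemma sqn_grad_trial_pol (a b t s : R) : 0 < s ->
  sqn (trial1 a b (pol t s), trial2 a b (pol t s)) =
  h1 s ^+ 2 * (a + b * ang t) ^+ 2 + h s ^+ 2 * (b * ang' t) ^+ 2 / s ^+ 2.
Proof.
move=> s0'; have sn : s != 0 by rewrite gt_eqF.
have [-> ->] := grad_trial_pol a b t s0'; rewrite /sqn /=; have := cos2Dsin2 t.
move: (cos t) (sin t) (ang t) (ang' t) => c d f f' cd.
transitivity ((h1 s ^+ 2 * (a + b * f) ^+ 2 + h s ^+ 2 * (b * f') ^+ 2 / s ^+ 2) * (c ^+ 2 + d ^+ 2)); first by field.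
by rewrite cd mulr1.
Qed.

Lemma radial_trial (a b t s : R) : 0 < s ->
  trial1 a b (pol t s) * cos t + trial2 a b (pol t s) * sin t = h1 s * (a + b * ang t).
Proof.
move=> s0'; have sn : s != 0 by rewrite gt_eqF.
have [-> ->] := grad_trial_pol a b t s0'; have := cos2Dsin2 t.
move: (cos t) (sin t) (ang t) (ang' t) => c d f f' cd.
transitivity (h1 s * (a + b * f) * (c ^+ 2 + d ^+ 2)); first by field.
by rewrite cd mulr1.
Qed.

Lemma is_derive_trial (a b : R) x : 0 < nrm x ->
  is_derive x.1 1 (fun s : R => trial a b (s, x.2)) (trial1 a b x) /\
  is_derive x.2 1 (fun s : R => trial a b (x.1, s)) (trial2 a b x).
Proof.
move=> n0; have [d1 d2] := is_derive_nrm n0; have nn : nrm x != 0 by rewrite gt_eqF.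
have e : (x.1, x.2) = x by case: (x).
have hx1 : is_derive x.1 1 (fun s : R => h (nrm (s, x.2))) (h1 (nrm x) * (x.1 * (nrm x)^-1)).
  by apply: (@der_comp _ h (fun s : R => nrm (s, x.2)) _ _ _ _ d1); rewrite /= e; exact: dh.
have hx2 : is_derive x.2 1 (fun s : R => h (nrm (x.1, s))) (h1 (nrm x) * (x.2 * (nrm x)^-1)).
  by apply: (@der_comp _ h (fun s : R => nrm (x.1, s)) _ _ _ _ d2); rewrite /= e; exact: dh.
have q1 : is_derive x.1 1 (fun s : R => (nrm (s, x.2))^-1) (- (x.1 * (nrm x)^-1) / nrm x ^+ 2).
  by have := @derV _ (fun s : R => nrm (s, x.2)) x.1 _ _ d1; rewrite /= e; apply.
have q2 : is_derive x.2 1 (fun s : R => (nrm (x.1, s))^-1) (- (x.2 * (nrm x)^-1) / nrm x ^+ 2).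
  by have := @derV _ (fun s : R => nrm (x.1, s)) x.2 _ _ d2; rewrite /= e; apply.
have y1 : is_derive x.1 1 (fun s : R => xi (s, x.2)) c0.
  by apply: (der_eq (derD (derZ c0 (der_id x.1)) (der_cst (s0 * x.2) x.1))); rewrite mulr1 addr0.
have y2 : is_derive x.2 1 (fun s : R => xi (x.1, s)) s0.
  by apply: (der_eq (derD (der_cst (c0 * x.1) x.2) (derZ s0 (der_id x.2)))); rewrite mulr1 add0r.
split.
  by apply: (der_eq (derM hx1 (derD (der_cst a _) (derZ b (derM y1 q1))))); rewrite /= e add0r.
by apply: (der_eq (derM hx2 (derD (der_cst a _) (derZ b (derM y2 q2))))); rewrite /= e add0r.
Qed.

Lemma continuous_trial (a b : R) x : 0 < nrm x ->
  [/\ {for x, continuous (trial a b)}, {for x, continuous (trial1 a b)} & {for x, continuous (trial2 a b)}].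
Proof.
move=> n0; have nn : nrm x != 0 by rewrite gt_eqF.
have cn : nrm @ x --> nrm x := continuous_nrm (x := x).
have ch : (fun y => h (nrm y)) @ x --> h (nrm x) by apply: (continuous_comp cn); exact: der_continuous (dh n0).
have ch1' : (fun y => h1 (nrm y)) @ x --> h1 (nrm x) by apply: (continuous_comp cn); exact: ch1.
have cq : (fun y => (nrm y)^-1) @ x --> (nrm x)^-1 by exact: cvgV.
have cf : (fun y : R * R => y.1) @ x --> x.1 by exact: cvg_fst.
have cs : (fun y : R * R => y.2) @ x --> x.2 by exact: cvg_snd.
have cxi : xi @ x --> xi x by apply: cvgD; apply: cvgMr.
have cu : (fun y => a + b * (xi y * (nrm y)^-1)) @ x --> a + b * (xi x * (nrm x)^-1).
  by apply: cvgD; [exact: cvg_cst|apply: cvgMr; exact: cvgM].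
have cn2 : (fun y => (nrm y ^+ 2)^-1) @ x --> (nrm x ^+ 2)^-1.
  by apply: cvgV; [rewrite sqrf_eq0|rewrite expr2; exact: cvgM].
split; [exact: cvgM| |].
  apply: cvgD; first by apply: cvgM => //; apply: cvgM => //; exact: cvgM.
  apply: cvgM => //; apply: cvgMr; apply: cvgD; first exact: cvgMr.
  by apply: cvgM => //; apply: cvgM => //; apply: cvgN; exact: cvgM.
apply: cvgD; first by apply: cvgM => //; apply: cvgM => //; exact: cvgM.
apply: cvgM => //; apply: cvgMr; apply: cvgD; first exact: cvgMr.
by apply: cvgM => //; apply: cvgM => //; apply: cvgN; exact: cvgM.
Qed.

Lemma is_derive_ang (t : R) : is_derive t 1 ang (ang' t).
Proof.
by apply: (der_eq (derD (derZ c0 (is_derive_cos t)) (derZ s0 (is_derive_sin t)))); rewrite /ang'; ring.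
Qed.

Lemma is_derive_ang' (t : R) : is_derive t 1 ang' (- ang t).
Proof.
by apply: (der_eq (derB (derZ s0 (is_derive_cos t)) (derZ c0 (is_derive_sin t)))); rewrite /ang; ring.
Qed.

Lemma continuous_ang : continuous ang. Proof. by move=> t; exact: der_continuous (is_derive_ang t). Qed.
Lemma continuous_ang' : continuous ang'. Proof. by move=> t; exact: der_continuous (is_derive_ang' t). Qed.

Lemma ang_periodic : ang (2 * pi) = ang 0 /\ ang' (2 * pi) = ang' 0.
Proof.
have p2 : 2 * pi = pi *+ 2 :> R by rewrite mulr_natl.
by rewrite /ang /ang' p2 cos2pi sin2pi cos0 sin0.
Qed.

Lemma ang_sqr t : ang t ^+ 2 + ang' t ^+ 2 = 1.
Proof.
rewrite /ang /ang'; have := cos2Dsin2 t; move: (cos t) (sin t) => c s cs.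
transitivity ((c0 ^+ 2 + s0 ^+ 2) * (c ^+ 2 + s ^+ 2)); first by ring.
by rewrite cs e1 mulr1.
Qed.

Lemma integral_ang_sqr (a b : R) :
  \int[mu]_(t in C) ((a + b * ang t) ^+ 2) = (2 * a ^+ 2 + b ^+ 2) * pi /\
  \int[mu]_(t in C) ((b * ang' t) ^+ 2) = b ^+ 2 * pi.
Proof.
have p0 : 0 <= 2 * pi :> R by rewrite ltW// twopi_gt0.
have [per per'] := ang_periodic.
have ca : continuous (fun t => (a + b * ang t) ^+ 2).
  by move=> t; exact: der_continuous (der2 (derD (der_cst a t) (derZ b (is_derive_ang t)))).
have cb : continuous (fun t => (b * ang' t) ^+ 2).
  by move=> t; exact: der_continuous (der2 (derZ b (is_derive_ang' t))).
split; apply: EFin_inj.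
  rewrite (Rintegral_EFin (continuous_subspaceT ca)).
  have d (t : R) : is_derive t 1 (fun t => (a ^+ 2 + b ^+ 2 / 2) * t - 2 * a * b * ang' t - b ^+ 2 / 2 * (ang t * ang' t)) ((a + b * ang t) ^+ 2).
    apply: (der_eq (derB (derB (derZ (a ^+ 2 + b ^+ 2 / 2) (der_id t)) (derZ (2 * a * b) (is_derive_ang' t)))
      (derZ (b ^+ 2 / 2) (derM (is_derive_ang t) (is_derive_ang' t))))).
    have := ang_sqr t; move: (ang t) (ang' t) => u v uv.
    have -> : v * v = 1 - u ^+ 2 by rewrite -uv; ring.
    by field.
  by rewrite (integral_is_derive p0 (fun t _ => d t) (continuous_subspaceT ca)) per per'; congr EFin; field.
rewrite (Rintegral_EFin (continuous_subspaceT cb)).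
have d (t : R) : is_derive t 1 (fun t => b ^+ 2 / 2 * (t + ang t * ang' t)) ((b * ang' t) ^+ 2).
  apply: (der_eq (derZ (b ^+ 2 / 2) (derD (der_id t) (derM (is_derive_ang t) (is_derive_ang' t))))).
  have := ang_sqr t; move: (ang t) (ang' t) => u v uv.
  have ev : v ^+ 2 = 1 - u ^+ 2 by rewrite -uv; ring.
  by rewrite -expr2 exprMn ev; field.
by rewrite (integral_is_derive p0 (fun t _ => d t) (continuous_subspaceT cb)) per per'; congr EFin; field.
Qed.
End trial_functions.

(** * Rayleigh quotients on the trial space *)

Section trial_bound.
Variable R : realType.
Notation mu := (@lebesgue_measure R).
Notation leb2 := (@leb2 R).
Notation C := (`[0%R, (2 * pi)%R]%classic : set R).
Variables (O : set (R * R)) (rho : R -> R) (r M P : R).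
Notation U := (exterior O).
Hypotheses (r0 : 0 < r) (P0 : 0 < P) (pU : polar_ext U rho) (crho : continuous rho).
Hypothesis rhoM : forall t, C t -> r <= rho t <= M.
Hypothesis Ur : forall x, U x -> r ^+ 2 <= sqn x.
Hypotheses (mbd : measurable (boundary O)) (gbd : forall t, C t -> boundary O (pol t (rho t))).
Hypothesis bge : forall f : R * R -> \bar R, (forall x, boundary O x -> (0 <= f x)%E) -> measurable_fun (boundary O) f ->
  (\int[mu]_(t in C) (f (pol t (rho t)) * (rho t)%:E) <= \int[@hausdorff1 R]_(x in boundary O) f x)%E.
Hypothesis ble : forall f : R * R -> \bar R, (forall x, boundary O x -> (0 <= f x)%E) -> measurable_fun (boundary O) f ->
  (\int[@hausdorff1 R]_(x in boundary O) f x <= \int[mu]_(t in C) (f (pol t (rho t)) * P%:E))%E.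
Variables (h h1 N1 N2 N3 : R -> R) (c0 s0 : R).
Hypothesis dh : forall s : R, 0 < s -> is_derive s 1 h (h1 s).
Hypothesis ch1 : forall s : R, 0 < s -> {for s, continuous h1}.
Hypothesis e1 : c0 ^+ 2 + s0 ^+ 2 = 1.
Hypothesis cN : forall s : R, 0 < s -> [/\ {for s, continuous N1}, {for s, continuous N2} & {for s, continuous N3}].
Hypothesis N2pos : forall s, 0 < s -> 0 < N2 s.
Hypothesis iN1 : forall s, r <= s -> (\int[mu]_(y in `[s, +oo[) (y * h1 y ^+ 2)%:E <= (N1 s)%:E)%E.
Hypothesis iN2 : forall s, r <= s -> (\int[mu]_(y in `[s, +oo[) (y * h y ^+ 2)%:E = (N2 s)%:E)%E.
Hypothesis iN3 : forall s, r <= s -> (\int[mu]_(y in `[s, +oo[) (h y ^+ 2 / y)%:E <= (N3 s)%:E)%E.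

Notation f a b := (fun t => a + b * ang c0 s0 t).
Notation f' b := (fun t => b * ang' c0 s0 t).
Notation W := (trial h c0 s0).
Notation W1 := (trial1 h h1 c0 s0).
Notation W2 := (trial2 h h1 c0 s0).

Let oU : open U. Proof. by rewrite /exterior openC; exact: closed_closure. Qed.
Let mU : measurable U. Proof. exact: open_measurable2. Qed.
Let mC : measurable (C : set (measurableTypeR R)). Proof. exact: measurable_itv. Qed.
Let rho0 t : C t -> 0 < rho t. Proof. by move=> /rhoM/andP[rt _]; exact: lt_le_trans rt. Qed.
Let nU x : U x -> 0 < nrm x.
Proof. by move=> /Ur rx; rewrite nrm_gt0; apply: lt_le_trans rx; rewrite exprn_gt0. Qed.
Let ch s : 0 < s -> {for s, continuous h}. Proof. by move=> s0'; exact: der_continuous (dh s0'). Qed.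

Let mray (g : R -> R) (a : R) : 0 < a -> (forall s, 0 < s -> {for s, continuous g}) ->
  measurable_fun (`[a, +oo[%classic : set (measurableTypeR R)) g.
Proof.
move=> a0 cg; apply: subspace_continuous_measurable_fun; first exact: measurable_itv.
by apply: continuous_in_subspaceT => s; rewrite inE /= in_itv /= andbT => /(lt_le_trans a0); exact: cg.
Qed.

Let cW a b x : U x -> [/\ {for x, continuous (W a b)}, {for x, continuous (W1 a b)} & {for x, continuous (W2 a b)}].
Proof. by move=> /nU; exact: continuous_trial. Qed.

Let mW a b : [/\ measurable_fun U (W a b), measurable_fun U (W1 a b) & measurable_fun U (W2 a b)].
Proof. by split; apply: open_continuous_measurable2 => // x /(cW a b)[]. Qed.

Let c_sh s : 0 < s -> {for s, continuous (fun y : R => y * h y ^+ 2)}.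
Proof. by move=> s0'; apply: cvgM; [exact: cvg_id|apply: cvgM; exact: ch]. Qed.
Let c_sh1 s : 0 < s -> {for s, continuous (fun y : R => y * h1 y ^+ 2)}.
Proof. by move=> s0'; apply: cvgM; [exact: cvg_id|apply: cvgM; exact: ch1]. Qed.
Let c_hs s : 0 < s -> {for s, continuous (fun y : R => h y ^+ 2 / y)}.
Proof. by move=> s0'; apply: cvgM; [apply: cvgM; exact: ch|apply: cvgV; [rewrite gt_eqF|exact: cvg_id]]. Qed.

Let ray_ge0 (a s : R) : 0 < a -> `[a, +oo[%classic s -> 0 < s.
Proof. by rewrite /= in_itv /= andbT; exact: lt_le_trans. Qed.

Lemma mass_trial a b : (nsq leb2 U (W a b) = \int[mu]_(t in C) (f a b t ^+ 2 * N2 (rho t))%:E)%E.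
Proof.
have [m0 _ _] := mW a b.
rewrite /nsq (@polar_ext_integral _ _ rho (fun x => (W a b x ^+ 2)%:E))//; last 2 first.
- exact: measurable_sq.
- by move=> x; rewrite lee_fin sqr_ge0.
apply: eq_integral => t /set_mem Ct; have [rt _] := andP (rhoM Ct).
rewrite EFinM -(iN2 rt) -ge0_integralZl_EFin ?sqr_ge0//.
- apply: eq_integral => s /set_mem /(ray_ge0 (rho0 Ct)) s0'.
  by rewrite (trial_pol h c0 s0 a b t s0') -!EFinM; congr EFin; rewrite exprMn; ring.
- by move=> s /(ray_ge0 (rho0 Ct)) s0'; rewrite lee_fin mulr_ge0 ?sqr_ge0// ltW.
- by apply/measurable_EFinP; exact: mray (rho0 Ct) c_sh.
Qed.

Lemma energy_trial a b : (\int[leb2]_(x in U) (sqn (W1 a b x, W2 a b x))%:E <=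
  \int[mu]_(t in C) (f a b t ^+ 2 * N1 (rho t) + f' b t ^+ 2 * N3 (rho t))%:E)%E.
Proof.
have [_ m1 m2] := mW a b.
rewrite (@polar_ext_integral _ _ rho (fun x => (sqn (W1 a b x, W2 a b x))%:E))//; last 2 first.
- by apply/measurable_EFinP; apply: measurable_funD; exact: measurable_funX.
- by move=> x; rewrite lee_fin addr_ge0// sqr_ge0.
apply: le_nonneg_integral => //.
- move=> t Ct; apply: integral_ge0 => s /(ray_ge0 (rho0 Ct)) s0'.
  by rewrite -EFinM lee_fin mulr_ge0// ?(ltW s0')// addr_ge0// sqr_ge0.
- move=> t Ct; have [rt _] := andP (rhoM Ct).
  have k1 : (0 <= (N1 (rho t))%:E)%E.
    apply: le_trans (iN1 rt); apply: integral_ge0 => s /(ray_ge0 (rho0 Ct)) s0'.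
    by rewrite lee_fin mulr_ge0 ?sqr_ge0// ltW.
  have k3 : (0 <= (N3 (rho t))%:E)%E.
    apply: le_trans (iN3 rt); apply: integral_ge0 => s /(ray_ge0 (rho0 Ct)) s0'.
    by rewrite lee_fin divr_ge0 ?sqr_ge0// ltW.
  by rewrite lee_fin; rewrite !lee_fin in k1 k3; apply: addr_ge0; apply: mulr_ge0 => //; exact: sqr_ge0.
move=> t Ct; have [rt _] := andP (rhoM Ct).
have g1 s : `[rho t, +oo[%classic s -> (0 <= (s * h1 s ^+ 2)%:E)%E.
  by move=> /(ray_ge0 (rho0 Ct)) s0'; rewrite lee_fin mulr_ge0 ?sqr_ge0// ltW.
have g3 s : `[rho t, +oo[%classic s -> (0 <= (h s ^+ 2 / s)%:E)%E.
  by move=> /(ray_ge0 (rho0 Ct)) s0'; rewrite lee_fin divr_ge0 ?sqr_ge0// ltW.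
have mm1 : measurable_fun (`[rho t, +oo[%classic : set (measurableTypeR R)) (fun s => (s * h1 s ^+ 2)%:E).
  by apply/measurable_EFinP; exact: mray (rho0 Ct) c_sh1.
have mm3 : measurable_fun (`[rho t, +oo[%classic : set (measurableTypeR R)) (fun s => (h s ^+ 2 / s)%:E).
  by apply/measurable_EFinP; exact: mray (rho0 Ct) c_hs.
have mr : measurable (`[rho t, +oo[%classic : set (measurableTypeR R)) by exact: measurable_itv.
have -> : (\int[mu]_(s in `[rho t, +oo[) ((sqn (W1 a b (pol t s), W2 a b (pol t s)))%:E * s%:E) =
    \int[mu]_(s in `[rho t, +oo[) ((f a b t ^+ 2)%:E * (s * h1 s ^+ 2)%:E + (f' b t ^+ 2)%:E * (h s ^+ 2 / s)%:E))%E.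
  apply: eq_integral => s /set_mem /(ray_ge0 (rho0 Ct)) s0'.
  rewrite (sqn_grad_trial_pol h h1 c0 s0 a b t s0') -!EFinM; congr EFin.
  by move: (ang c0 s0 t) (ang' c0 s0 t) => u v; field; rewrite gt_eqF.
rewrite ge0_integralD//.
- rewrite !ge0_integralZl_EFin ?sqr_ge0// EFinD !EFinM; apply: leeD; apply: lee_wpmul2l; rewrite ?lee_fin ?sqr_ge0//.
    exact: iN1.
  exact: iN3.
- by move=> s /g1 hs; apply: mule_ge0 => //; rewrite lee_fin sqr_ge0.
- by apply: measurable_funeM.
- by move=> s /g3 hs; apply: mule_ge0 => //; rewrite lee_fin sqr_ge0.
- by apply: measurable_funeM.
Qed.

Let cf a b : continuous (f a b).
Proof. by move=> t; apply: cvgD; [exact: cvg_cst|apply: cvgMr; exact: continuous_ang]. Qed.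
Let cf' b : continuous (f' b).
Proof. by move=> t; apply: cvgMr; exact: continuous_ang'. Qed.
Let crh (g : R -> R) : (forall s, 0 < s -> {for s, continuous g}) -> forall t, C t -> {for t, continuous (g \o rho)}.
Proof. by move=> cg t Ct; apply: continuous_comp; [exact: crho|exact: cg (rho0 Ct)]. Qed.
Let inC (g : R -> R) : (forall t, C t -> {for t, continuous g}) -> {within `[0, 2 * pi], continuous g}.
Proof. by move=> cg; apply: continuous_in_subspaceT => t /set_mem; exact: cg. Qed.

Let cmass a b : {within `[0, 2 * pi], continuous (fun t => f a b t ^+ 2 * N2 (rho t))}.
Proof.
apply: inC => t Ct; apply: cvgM; first by apply: cvgM; exact: cf.
by apply: (crh (g := N2)) => // s /cN[].
Qed.
Let cenergy a b : {within `[0, 2 * pi], continuous (fun t => f a b t ^+ 2 * N1 (rho t) + f' b t ^+ 2 * N3 (rho t))}.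
Proof.
apply: inC => t Ct; apply: cvgD; apply: cvgM.
- by apply: cvgM; exact: cf.
- by apply: (crh (g := N1)) => // s /cN[].
- by apply: cvgM; exact: cf'.
- by apply: (crh (g := N3)) => // s /cN[].
Qed.

Lemma L2_trial a b : [/\ L2 U (W a b), L2 U (W1 a b) & L2 U (W2 a b)].
Proof.
have [m0 m1 m2] := mW a b.
have fin : (\int[leb2]_(x in U) (sqn (W1 a b x, W2 a b x))%:E < +oo)%E.
  by apply: le_lt_trans (energy_trial a b) _; rewrite -(Rintegral_EFin (@cenergy a b)) ltry.
split; split=> //.
- by move: (mass_trial a b); rewrite /nsq => ->; rewrite -(Rintegral_EFin (@cmass a b)) ltry.
- apply: le_lt_trans fin; apply: le_nonneg_integral => //.
  + by move=> x _; rewrite lee_fin sqr_ge0.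
  + by move=> x _; rewrite lee_fin addr_ge0// sqr_ge0.
  + by move=> x _; rewrite lee_fin /sqn lerDl sqr_ge0.
- apply: le_lt_trans fin; apply: le_nonneg_integral => //.
  + by move=> x _; rewrite lee_fin sqr_ge0.
  + by move=> x _; rewrite lee_fin addr_ge0// sqr_ge0.
  + by move=> x _; rewrite lee_fin /sqn lerDr sqr_ge0.
Qed.

Lemma weak_grad_trial a b : weak_grad U (W a b) (fun x => (W1 a b x, W2 a b x)).
Proof.
have [L0 L1 L2'] := L2_trial a b; apply: classical_weak_grad => //.
- by move=> x /nU n0; exact: is_derive_trial.
- by move=> x; exact: cW.
Qed.

Lemma mass_trial_real a b : \int[leb2]_(x in U) (W a b x ^+ 2) = \int[mu]_(t in C) (f a b t ^+ 2 * N2 (rho t)).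
Proof.
have [L0 _ _] := L2_trial a b; apply: EFin_inj.
by rewrite (Rintegral_EFin (@cmass a b)) -mass_trial Rintegral_sq.
Qed.

(** A positive definite lower bound in [(a, b)]: it yields the linear independence of the two trial
    functions modulo almost everywhere equality. *)
Lemma mass_trial_ge : exists2 m : R, 0 < m &
  forall a b, m * ((2 * a ^+ 2 + b ^+ 2) * pi) <= \int[mu]_(t in C) (f a b t ^+ 2 * N2 (rho t)).
Proof.
have cn : {within `[0, 2 * pi], continuous (N2 \o rho)}.
  by apply: inC => t Ct; apply: (crh (g := N2)) => // s /cN[].
have [t0 t0C tmin] := EVT_min (ltW (twopi_gt0 R)) cn.
have Ct0 : C t0 by [].
exists (N2 (rho t0)); first exact: N2pos (rho0 Ct0).
move=> a b; have [<- _] := integral_ang_sqr e1 a b.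
have cq : {within `[0, 2 * pi], continuous (fun t => f a b t ^+ 2)}.
  by apply: continuous_subspaceT => t; apply: cvgM; exact: cf.
have I1 := continuous_integrable cq; have I2 := continuous_integrable (@cmass a b).
rewrite -(@RintegralZl _ (measurableTypeR R) _ mu C _ _ mC I1).
apply: (@le_Rintegral _ (measurableTypeR R) _ mu _ _ _ mC _ I2).
  by apply: continuous_integrable; apply: continuous_subspaceT => t; apply: cvgMr; apply: cvgM; exact: cf.
by move=> t Ct; rewrite mulrC ler_wpM2l ?sqr_ge0//; exact: tmin.
Qed.

Lemma two_dim_trial : two_dim_subspace U [set w | exists a b, w = W a b].
Proof.
have H1W a b : H1 U (W a b).
  by have [L0 _ _] := L2_trial a b; split=> //; eexists; exact: weak_grad_trial.
exists (W 1 0), (W 0 1); split => //.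
  move=> a b az; have [m m0 hm] := mass_trial_ge; have [[mw _] _ _] := L2_trial a b.
  have Fl := leb2_ae_filter R.
  have n0 : (\int[leb2]_(x in U) (W a b x ^+ 2)%:E = 0)%E.
    by apply: ae_zero_nsq => //; apply: filterS az => x hx Ux; rewrite trial_lin; exact: hx.
  have := hm a b; rewrite -mass_trial_real /Rintegral n0 /= => le0.
  have : (2 * a ^+ 2 + b ^+ 2) * pi <= 0 by rewrite -(pmulr_rle0 _ m0).
  rewrite pmulr_lle0 ?pi_gt0// => q.
  have a2 := sqr_ge0 a; have b2 := sqr_ge0 b.
  by split; apply/eqP; rewrite -sqrf_eq0 eq_le; apply/andP; split=> //; move: q a2 b2; move: (a ^+ 2) (b ^+ 2) => x y; lra.
apply/seteqP; split=> w [a [b ->]]; exists a, b; [exact: trial_lin|exact/esym/trial_lin].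
Qed.

Let gam t := pol t (rho t).
Let mgam : measurable_fun (C : set (measurableTypeR R)) (gam : R -> (R * R)%type).
Proof. by apply: measurable_curve; apply: measurable_funTS; exact: continuous_measurable_fun. Qed.

Let ctr a b : {within `[0, 2 * pi], continuous (fun t => (h (rho t) * f a b t) ^+ 2)}.
Proof. by apply: inC => t Ct; apply: cvgM; (apply: cvgM; [exact: (crh (g := h))|exact: cf]). Qed.
Let ctr_rho a b : {within `[0, 2 * pi], continuous (fun t => (h (rho t) * f a b t) ^+ 2 * rho t)}.
Proof.
by apply: inC => t Ct; apply: cvgM; [apply: cvgM; (apply: cvgM; [exact: (crh (g := h))|exact: cf])|exact: crho].
Qed.

(** The Rayleigh quotient admits any weak gradient of [v]; uniqueness almost everywhere lets the
    computed gradient be put in its place. *)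
Lemma ae_sqn_integral (g g' : R * R -> R * R) (v : R * R -> R) (u : R * R -> R * R) :
  weak_grad U v g -> weak_grad U v g' -> measurable_fun U (fun x => (u x).1) -> measurable_fun U (fun x => (u x).2) ->
  (\int[leb2]_(x in U) (sqn (u x - g x))%:E = \int[leb2]_(x in U) (sqn (u x - g' x))%:E)%E.
Proof.
move=> wg wg' mu1 mu2; have [a1 a2] := weak_grad_unique oU wg wg'; have Fl := leb2_ae_filter R.
have [[mg1 _] [mg2 _] _] := wg; have [[mg1' _] [mg2' _] _] := wg'.
apply: ae_eq_integral => //.
- by apply/measurable_EFinP; apply: measurable_funD; apply: measurable_funX; apply: measurable_funB.
- by apply/measurable_EFinP; apply: measurable_funD; apply: measurable_funX; apply: measurable_funB.
- apply: filterS2 a1 a2 => x /= z1 z2 Ux; congr (EFin (sqn (_ - _))).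
  by rewrite [g x]surjective_pairing [g' x]surjective_pairing; congr (_, _); apply/eqP; rewrite -subr_eq0; apply/eqP; [exact: z1|exact: z2].
Qed.

Lemma radial_sqr_le (p : R * R) (y1 y2 c d : R) : c ^+ 2 + d ^+ 2 = 1 ->
  (p.1 * c + p.2 * d - (y1 * c + y2 * d)) ^+ 2 <= sqn (p - (y1, y2)).
Proof.
case: p => x1 x2 cd; rewrite /sqn /=.
have -> : (x1 * c + x2 * d - (y1 * c + y2 * d)) ^+ 2 =
  ((x1 - y1) ^+ 2 + (x2 - y2) ^+ 2) * (c ^+ 2 + d ^+ 2) - ((x1 - y1) * d - (x2 - y2) * c) ^+ 2 by ring.
by rewrite cd mulr1 lerBlDr lerDl sqr_ge0.
Qed.

(** A trace comes only with some approximating sequence. Along the boundary curve that sequence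
    tends to the explicit values of the trial function, by [trace_inequality], and to [t], by [bge];
    so the two agree almost everywhere in the angle. *)
Lemma trace_trial a b t : is_trace O (W a b) t ->
  nsq mu (C : set (measurableTypeR R)) (fun s => t (gam s) - h (rho s) * f a b s) = 0%E /\
  measurable_fun (C : set (measurableTypeR R)) (fun s => t (gam s)).
Proof.
move=> [mt [g [phi [wg tphi vu vt]]]].
have mtg : measurable_fun (C : set (measurableTypeR R)) (fun s => t (gam s)).
  apply: (measurable_comp mbd _ mt mgam) => x [s Cs <-]; exact: gbd.
have mw : measurable_fun (C : set (measurableTypeR R)) (fun s => h (rho s) * f a b s).
  apply: subspace_continuous_measurable_fun => //; apply: inC => s Cs; apply: cvgM; [exact: (crh (g := h))|exact: cf].
have mphi n : measurable_fun (C : set (measurableTypeR R)) (fun s => phi n (gam s)).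
  have [sp _ _] := tphi n; have mp := continuous_measurable2 (sp 0%N); exact: (measurableT_comp mp mgam).
have [m0 m1 m2] := mW a b.
pose A n := (\int[leb2]_(x in U) ((phi n x - W a b x) ^+ 2 + sqn (grad (phi n) x - g x))%:E)%E.
pose B n := (\int[@hausdorff1 R]_(x in boundary O) ((phi n x - t x) ^+ 2)%:E)%E.
have vA : vanish A.
  apply/vanishP; last exact: vu.
  by move=> n; apply: integral_ge0 => x _; rewrite lee_fin addr_ge0 ?sqr_ge0// addr_ge0// sqr_ge0.
have hb n : (\int[mu]_(s in C) (((phi n (gam s) - t (gam s)) ^+ 2)%:E * (rho s)%:E) <= B n)%E.
  have [sp _ _] := tphi n.
  apply: (bge (f := fun x => ((phi n x - t x) ^+ 2)%:E)); first by move=> x _; rewrite lee_fin sqr_ge0.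
  apply/measurable_EFinP; apply: measurable_funX; apply: measurable_funB => //.
  by apply: measurable_funTS; exact: continuous_measurable2 (sp 0%N).
have vB : vanish B.
  apply/vanishP; last exact: vt.
  move=> n; apply: le_trans (hb n); apply: integral_ge0 => s Cs.
  by rewrite -EFinM lee_fin mulr_ge0 ?sqr_ge0// ltW// rho0.
have Aw n : (nsq mu (C : set (measurableTypeR R)) (fun s => phi n (gam s) - h (rho s) * f a b s)%R <= (2 / r)%:E * A n)%E.
  have [sp _ _] := tphi n; have cp : continuous (phi n) := sp 0%N; have [cg1 cg2] := grad_continuous sp.
  have mp : measurable_fun U (phi n) by apply: measurable_funTS; exact: continuous_measurable2.
  have mg1 : measurable_fun U (fun x => (grad (phi n) x).1) by apply: measurable_funTS; exact: continuous_measurable2 cg1.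
  have mg2 : measurable_fun U (fun x => (grad (phi n) x).2) by apply: measurable_funTS; exact: continuous_measurable2 cg2.
  pose F x := ((phi n x - W a b x) ^+ 2 + sqn (grad (phi n) x - (W1 a b x, W2 a b x)))%:E.
  have F0 x : (0 <= F x)%E by rewrite lee_fin addr_ge0 ?sqr_ge0// addr_ge0// sqr_ge0.
  have mq (gg : R * R -> R * R) : weak_grad U (W a b) gg -> measurable_fun U (fun x => (sqn (grad (phi n) x - gg x))%:E).
    by move=> [[mq1 _] [mq2 _] _]; apply/measurable_EFinP; apply: measurable_funD; apply: measurable_funX; [exact: (measurable_funB mg1 mq1)|exact: (measurable_funB mg2 mq2)].
  have msq : measurable_fun U (fun x => ((phi n x - W a b x) ^+ 2)%:E).
    by apply: measurable_sq; exact: measurable_funB.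
  have mF : measurable_fun U F.
    apply/measurable_EFinP; apply: measurable_funD; first by apply: measurable_funX; exact: measurable_funB.
    by have /measurable_EFinP := mq _ (weak_grad_trial a b).
  have -> : A n = (\int[leb2]_(x in U) F x)%E.
    have sq0 x : (0 <= ((phi n x - W a b x) ^+ 2)%:E)%E by rewrite lee_fin sqr_ge0.
    have sn0 (gg : R * R -> R * R) x : (0 <= (sqn (grad (phi n) x - gg x))%:E)%E by rewrite lee_fin addr_ge0// sqr_ge0.
    rewrite /A /F; under eq_integral do rewrite EFinD; under [in RHS]eq_integral do rewrite EFinD.
    rewrite (ge0_integralD leb2 mU (fun x _ => sq0 x) msq (fun x _ => sn0 g x) (mq _ wg)).
    rewrite (ge0_integralD leb2 mU (fun x _ => sq0 x) msq (fun x _ => sn0 _ x) (mq _ (weak_grad_trial a b))).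
    by congr (_ + _)%E; exact: (ae_sqn_integral wg (weak_grad_trial a b) mg1 mg2).
  apply: (@trace_inequality R U rho r F (fun s y => phi n (pol s y) - h y * f a b s)
    (fun s y => rad_der (phi n) s y - h1 y * f a b s) pU mU r0 _ mF F0).
  - by move=> s /rhoM/andP[].
  - move=> s y Cs sy; have y0 : 0 < y by exact: lt_le_trans (rho0 Cs) sy.
    apply: (der_eq (derB (is_derive_rad sp s y) (derM (dh y0) (der_cst (f a b s) y)))).
    by rewrite mulr0 addr0.
  - move=> s Cs; apply: continuous_in_subspaceT => y; rewrite inE /= in_itv /= => /andP[sy _].
    have y0 : 0 < y by exact: lt_le_trans (rho0 Cs) sy.
    apply: cvgB; first exact: ((continuous_sections (continuous_rad_der sp)).1 s).
    by apply: cvgM; [exact: ch1|exact: cvg_cst].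
  - move=> s y Cs sy; have y0 : 0 < y by exact: lt_le_trans (rho0 Cs) sy.
    rewrite lee_fin (trial_pol h c0 s0 a b s y0) lerD2l -(radial_trial h h1 c0 s0 a b s y0) /rad_der.
    exact: (radial_sqr_le (grad (phi n) (pol s y)) _ _ (cos2Dsin2 s)).
have Bt n : (nsq mu (C : set (measurableTypeR R)) (fun s => phi n (gam s) - t (gam s))%R <= (r^-1)%:E * B n)%E.
  have rr : 0 <= r^-1 by rewrite invr_ge0 ltW.
  apply: (@le_trans _ _ ((r^-1)%:E * \int[mu]_(s in C) (((phi n (gam s) - t (gam s)) ^+ 2)%:E * (rho s)%:E))%E); last first.
    by apply: lee_wpmul2l; [rewrite lee_fin|exact: hb].
  rewrite -ge0_integralZl_EFin//; last 2 first.
  - by move=> s Cs; rewrite -EFinM lee_fin mulr_ge0 ?sqr_ge0// ltW// rho0.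
  - apply: emeasurable_funM; apply/measurable_EFinP; first by apply: measurable_funX; apply: measurable_funB.
    by apply: measurable_funTS; exact: continuous_measurable_fun.
  apply: le_nonneg_integral => //.
  - by move=> s _; rewrite lee_fin sqr_ge0.
  - by move=> s Cs; rewrite -!EFinM lee_fin mulr_ge0// mulr_ge0 ?sqr_ge0// ltW// rho0.
  - move=> s Cs; rewrite -!EFinM lee_fin mulrCA ler_peMr ?sqr_ge0//.
    by rewrite mulrC ler_pdivlMr// mul1r; have /andP[] := rhoM Cs.
split=> //; apply/eqP; rewrite eq_le nsq_ge0 andbT; apply/lee_addgt0Pr => e e0; rewrite add0e.
have v : vanish (fun n => 2%:E * ((r^-1)%:E * B n) + 2%:E * ((2 / r)%:E * A n))%E.
  by apply: vanishD; apply: vanishZ => //; apply: vanishZ; rewrite ?divr_ge0 ?invr_ge0// ltW.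
have [n _ /(_ n (leqnn n)) hn] := v e e0.
apply: le_trans hn; apply: le_trans (leeD (lee_wpmul2l _ (Bt n)) (lee_wpmul2l _ (Aw n))); rewrite ?lee_fin//.
have m1' := measurable_funB mtg (mphi n); have m2' := measurable_funB (mphi n) mw.
rewrite (@nsqC R _ (measurableTypeR R) mu C (fun s => phi n (gam s)) (fun s => t (gam s))).
have -> : nsq mu (C : set (measurableTypeR R)) (fun s => t (gam s) - h (rho s) * f a b s)%R =
  nsq mu (C : set (measurableTypeR R)) (fun s => (t (gam s) - phi n (gam s)) + (phi n (gam s) - h (rho s) * f a b s))%R.
  by apply: eq_nsq => s _; rewrite addrA subrK.
exact: (nsqD mu mC m1' m2').
Qed.

(** The Hausdorff integral is bracketed rather than computed. The upper bound also shows it finite,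
    so that [fine] does not turn an infinite value into 0. *)
Lemma trace_trial_bounds a b t : is_trace O (W a b) t ->
  \int[mu]_(s in C) ((h (rho s) * f a b s) ^+ 2 * rho s) <=
  fine (\int[@hausdorff1 R]_(x in boundary O) (t x ^+ 2)%:E)%E <= P * \int[mu]_(s in C) ((h (rho s) * f a b s) ^+ 2).
Proof.
move=> tr; have [n0 mtg] := trace_trial tr; have [mt _] := tr.
have mw : measurable_fun (C : set (measurableTypeR R)) (fun s => h (rho s) * f a b s).
  apply: subspace_continuous_measurable_fun => //; apply: inC => s Cs; apply: cvgM; [exact: (crh (g := h))|exact: cf].
have md : measurable_fun (C : set (measurableTypeR R)) (fun s => t (gam s) - h (rho s) * f a b s) by exact: measurable_funB.
have Fl : Filter (almost_everywhere mu) by exact: ae_filter_ringOfSetsType.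
have ae : \forall s \ae mu, C s -> t (gam s) = h (rho s) * f a b s.
  have /(ae_eq_integral_abs mu mC (measurable_sq md)) hh : (\int[mu]_(x in C) `|((t (gam x) - h (rho x) * f a b x) ^+ 2)%:E| = 0)%E.
    by rewrite -n0; apply: eq_integral => s _; rewrite gee0_abs// lee_fin sqr_ge0.
  by apply: filterS hh => s /= hs Cs; have /eqP := hs Cs; rewrite eqe sqrf_eq0 subr_eq0 => /eqP.
have mrho : measurable_fun (C : set (measurableTypeR R)) rho by apply: measurable_funTS; exact: continuous_measurable_fun.
have eqI (k : R -> R) : measurable_fun (C : set (measurableTypeR R)) k ->
    (\int[mu]_(s in C) ((t (gam s) ^+ 2)%:E * (k s)%:E) = \int[mu]_(s in C) ((h (rho s) * f a b s) ^+ 2 * k s)%:E)%E.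
  move=> mk; apply: ae_eq_integral => //.
  - by apply: emeasurable_funM; apply/measurable_EFinP => //; exact: measurable_funX.
  - by apply/measurable_EFinP; apply: measurable_funM => //; exact: measurable_funX.
  - by apply: filterS ae => s hs Cs; rewrite -EFinM (hs Cs).
have msq : measurable_fun (boundary O) (fun x => (t x ^+ 2)%:E) by exact: measurable_sq.
have sq0 x : boundary O x -> (0 <= (t x ^+ 2)%:E)%E by rewrite lee_fin sqr_ge0.
have lo := bge sq0 msq; have up := ble sq0 msq.
rewrite (eqI rho mrho) -(Rintegral_EFin (@ctr_rho a b)) in lo.
have up' : (\int[@hausdorff1 R]_(x in boundary O) (t x ^+ 2)%:E <= (P * \int[mu]_(s in C) ((h (rho s) * f a b s) ^+ 2))%:E)%E.
  apply: le_trans up _; rewrite (eqI (fun=> P) (@measurable_cst _ _ (measurableTypeR R) _ C P)).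
  rewrite EFinM (Rintegral_EFin (@ctr a b)) -ge0_integralZl_EFin ?(ltW P0)//.
  - by rewrite le_eqVlt; apply/orP; left; apply/eqP; apply: eq_integral => s _; rewrite -EFinM mulrC.
  - by move=> s _; rewrite lee_fin sqr_ge0.
  - exact: measurable_sq.
move: lo up'; case: (integral _ _ _) => [v| |]; rewrite ?lee_fin ?leye_eq ?leeNy_eq//=.
by move=> -> ->.
Qed.

(** Reduces the eigenvalue bound to an inequality between integrals in the angle. Beyond radius [s],
    [N2] is the integral of [y * h^2], while [N1] and [N3] bound those of [y * h1^2] and [h^2 / y];
    [B] ranges over the values that the boundary integral may take. *)
Lemma trial_bound (alpha lam : R) :
  (forall a b B, \int[mu]_(s in C) ((h (rho s) * f a b s) ^+ 2 * rho s) <= B ->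
     B <= P * \int[mu]_(s in C) ((h (rho s) * f a b s) ^+ 2) ->
     \int[mu]_(t in C) (f a b t ^+ 2 * N1 (rho t) + f' b t ^+ 2 * N3 (rho t)) + alpha * B <=
       lam * \int[mu]_(t in C) (f a b t ^+ 2 * N2 (rho t))) ->
  (lambda2 O alpha <= lam%:E)%E.
Proof.
move=> H; apply: (@le_trans _ _ (rayleigh_sup O alpha [set w | exists a b, w = W a b])).
  by apply: ereal_inf_lbound; exists [set w | exists a b, w = W a b] => //; exact: two_dim_trial.
apply: ge_ereal_sup => _ [u [g [t [[a [b ->]] nz wg tr ->]]]]; rewrite lee_fin /rayleigh.
have [L0 L1 L2'] := L2_trial a b; have [m0 m1 m2] := mW a b.
have mp : 0 < \int[leb2]_(x in U) (W a b x ^+ 2).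
  rewrite lt_neqAle; apply/andP; split; last by apply: Rintegral_ge0 => x _; exact: sqr_ge0.
  apply/eqP => z; apply: nz; apply: nsq_ae_zero => //.
  by rewrite -Rintegral_sq// -z.
rewrite ler_pdivrMr// mass_trial_real.
have /andP[lo up] := trace_trial_bounds tr; apply: le_trans (H a b _ lo up); rewrite lerD2r.
rewrite -lee_fin (Rintegral_EFin (@cenergy a b)); apply: le_trans (energy_trial a b).
have z1 : measurable_fun U (fun _ : R * R => (0 : R)) by exact: measurable_cst.
have e0 := ae_sqn_integral (u := fun=> 0) wg (weak_grad_trial a b) z1 z1.
have e2 : (\int[leb2]_(x in U) (sqn (g x))%:E = \int[leb2]_(x in U) (sqn (W1 a b x, W2 a b x))%:E)%E.
  transitivity (\int[leb2]_(x in U) (sqn (0 - g x))%:E)%E; first by apply: eq_integral => x _; rewrite sub0r /sqn /= !sqrrN.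
  by rewrite e0; apply: eq_integral => x _; rewrite sub0r /sqn /= !sqrrN.
rewrite /Rintegral e2 fineK// ge0_fin_numE.
  by apply: le_lt_trans (energy_trial a b) _; rewrite -(Rintegral_EFin (@cenergy a b)) ltry.
by apply: integral_ge0 => x _; rewrite lee_fin addr_ge0// sqr_ge0.
Qed.
End trial_bound.

(** * Antiperiodic integrals, and radial integrals of the Bessel profile *)

Section profiles.
Variable R : realType.
Notation mu := (@lebesgue_measure R).
Notation C := (`[0%R, (2 * pi)%R]%classic : set R).

(** The two half-turns cancel. A constant [c] is added, and an absolute value taken, so that
    splitting and shifting can be done on nonnegative integrands. *)
Lemma antiperiodic_integral (g : R -> R) : continuous g -> (forall t : R, 0 <= t <= pi -> g (t + pi) = - g t) ->
  \int[mu]_(t in C) g t = 0.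
Proof.
move=> cg gpi; have p0 := pi_ge0 R; have p20 : 0 <= 2 * pi :> R by rewrite mulr_ge0.
have mC : measurable (C : set (measurableTypeR R)) by exact: measurable_itv.
have cn : {within `[0, 2 * pi], continuous (fun t => `|g t|)}.
  by apply: continuous_subspaceT => t; apply: (continuous_comp (cg t)); exact: norm_continuous.
have [t0 _ hc] := EVT_max p20 cn; set c := `|g t0| in hc.
have gc t : 0 <= t <= 2 * pi -> `|g t + c| = g t + c.
  by move=> Ct; rewrite ger0_norm//; have := hc t Ct; rewrite ler_norml => /andP[]; lra.
pose F t := (`|g t + c|)%:E.
have cF : continuous (fun t => `|g t + c|).
  move=> t; apply: (continuous_comp (f := fun t => g t + c)); last exact: norm_continuous.
  by apply: cvgD; [exact: cg|exact: cvg_cst].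
have mF : measurable_fun setT F by apply/measurable_EFinP; exact: continuous_measurable_fun.
have F0 t : (0 <= F t)%E by rewrite lee_fin.
have E1 : (\int[mu]_(t in C) F t = (c * (2 * pi))%:E)%E.
  have pp : 0 <= @pi R <= 2 * @pi R by apply/andP; split; lra.
  rewrite (integral_split pp F0 mF).
  have -> : `[pi, (2 * pi)]%classic = `[(0 + pi)%R, (pi + pi)%R]%classic :> set R by rewrite add0r mulr_natl mulr2n.
  rewrite -(integral_shift pi 0 pi F0 mF) -ge0_integralD//; last 2 first.
  - exact: measurable_funTS.
  - apply: measurable_funTS; apply: (measurableT_comp mF); apply: continuous_measurable_fun => t.
    by apply: cvgD; [exact: cvg_id|exact: cvg_cst].
  rewrite (eq_integral (cst (2 * c)%:E)); last first.
    move=> t; rewrite inE /= in_itv /= => /andP[t0' t1].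
    rewrite /F -EFinD gc; last by apply/andP; split; lra.
    rewrite gc; last by apply/andP; split; lra.
    by rewrite gpi ?t0'//; congr EFin; ring.
  have mp : mu `[0%R, pi]%classic = pi%:E by rewrite lebesgue_measure_itv /= lte_fin pi_gt0 -EFinB subr0.
  rewrite integral_cst//; transitivity ((2 * c)%:E * mu `[0%R, pi]%classic)%E => //.
  by rewrite mp -EFinM; congr EFin; ring.
have E2 : (\int[mu]_(t in C) F t = (\int[mu]_(t in C) (1 * g t + 0 * g t + c))%R%:E)%E.
  have cgc : continuous (fun t => 1 * g t + 0 * g t + c).
    by move=> t; apply: cvgD; [apply: cvgD; apply: cvgMr; exact: cg|exact: cvg_cst].
  rewrite (Rintegral_EFin (continuous_subspaceT cgc)); apply: eq_integral => t /set_mem /CP Ct.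
  by rewrite /F gc// mul1r mul0r addr0.
have := EFin_inj (etrans (esym E1) E2); rewrite Rintegral_lin// mul1r mul0r addr0 => e.
by apply: (@addIr _ (c * (2 * pi))); rewrite add0r -e.
Qed.

Lemma cvg_inv_bound_from (F : R -> R) (r K : R) : 0 < r -> 0 <= K -> (forall t, r <= t -> `|F t| <= K / t) -> F @ +oo --> (0 : R).
Proof.
move=> r0 K0 FK; pose G t := F (Num.max r t).
have cG : G @ +oo --> (0 : R).
  apply: (@cvg_inv_bound R G K K0) => t t0; have mr : r <= Num.max r t by rewrite le_max lexx.
  apply: le_trans (FK _ mr) _; apply: ler_wpM2l => //; rewrite lef_pV2 ?posrE ?(lt_le_trans r0 mr)//.
  by rewrite le_max lexx orbT.
apply: cvg_trans cG; apply: near_eq_cvg; near=> t.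
have rt : r <= t by near: t; apply: nbhs_pinfty_ge; exact: num_real.
by rewrite /G max_r.
Unshelve. all: by end_near.
Qed.

Lemma exp_decay_limits (g : R -> R) (k r c : R) : 0 < k -> 0 < r -> 0 <= c ->
  (forall s, r <= s -> `|g s| <= expR (- k * (s - r)) * c) ->
  [/\ g @ +oo --> (0 : R), (fun s => s * g s) @ +oo --> (0 : R) & (fun s => g s / s) @ +oo --> (0 : R)].
Proof.
move=> k0 r0 c0 hg; have ekr := expR_gt0 (k * r).
have E s : expR (- k * (s - r)) = expR (k * r) * expR (- (k * s)) by rewrite -expRD; congr expR; ring.
split.
- apply: (@cvg_inv_bound_from _ r (expR (k * r) * c / k)) => //.
    by apply: divr_ge0; [apply: mulr_ge0 => //; exact: ltW|exact: ltW].
  move=> s rs; have s0 := lt_le_trans r0 rs; apply: le_trans (hg s rs) _.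
  have := exp_inv_bound (mulr_gt0 k0 s0); rewrite E => hx.
  have -> : expR (k * r) * c / k / s = expR (k * r) * c * (k * s)^-1 by field; rewrite !gt_eqF.
  by rewrite mulrAC ler_wpM2l// mulr_ge0// ltW.
- apply: (@cvg_inv_bound_from _ r (expR (k * r) * c * 2 / k ^+ 2)) => //.
    by apply: divr_ge0; [apply: mulr_ge0 => //; apply: mulr_ge0 => //; exact: ltW|exact: sqr_ge0].
  move=> s rs; have s0 := lt_le_trans r0 rs; rewrite normrM (gtr0_norm s0).
  apply: le_trans (ler_wpM2l (ltW s0) (hg s rs)) _.
  have := exp_pow_bound 2 (mulr_gt0 k0 s0); rewrite E (_ : 2`!%:R = 2)// => hx.
  have -> : expR (k * r) * c * 2 / k ^+ 2 / s = expR (k * r) * c * (2 / (k ^+ 2 * s)) by field; rewrite !gt_eqF.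
  have -> : s * (expR (k * r) * expR (- (k * s)) * c) = expR (k * r) * c * (s * expR (- (k * s))) by ring.
  rewrite ler_wpM2l//; first by rewrite mulr_ge0// ltW.
  rewrite ler_pdivlMr ?mulr_gt0 ?exprn_gt0//.
  by apply: le_trans hx; rewrite exprMn; move: (expR (- (k * s))) => x; rewrite le_eqVlt; apply/orP; left; apply/eqP; ring.
- apply: (@cvg_inv_bound_from _ r c) => // s rs; have s0 := lt_le_trans r0 rs.
  rewrite normrM (gtr0_norm (_ : 0 < s^-1)) ?invr_gt0// ler_wpM2r ?invr_ge0 ?(ltW s0)//.
  apply: le_trans (hg s rs) _; rewrite ler_piMl// expR_le1 mulNr oppr_le0; apply: mulr_ge0; [exact: ltW|by rewrite subr_ge0].
Qed.

Lemma ray_integral (N g : R -> R) : (forall s : R, 0 < s -> is_derive s 1 N (- g s)) ->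
  (forall s : R, 0 < s -> {for s, continuous g}) -> (forall s, 0 < s -> 0 <= g s) -> N @ +oo --> (0 : R) ->
  forall s, 0 < s -> (\int[mu]_(y in `[s, +oo[) (g y)%:E = (N s)%:E)%E.
Proof.
move=> dN cg g0 Nl s s0.
have pos (y : R) : s <= y -> 0 < y by exact: lt_le_trans.
have d (y : R) : s <= y -> is_derive y 1 (fun y => - N y) (g y).
  by move=> sy; apply: (der_eq (derN (dN y (pos y sy)))); rewrite opprK.
have c : {within `[s, +oo[, continuous g}.
  by apply: continuous_in_subspaceT => y; rewrite inE /= in_itv /= andbT => /pos; exact: cg.
have l : (fun y => - N y) @ +oo --> (0 : R) by rewrite -oppr0; exact: cvgN.
by rewrite (ftc_infty d c (fun y sy => g0 y (pos y sy)) l) sub0r opprK.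
Qed.

Section zero_limits.
Implicit Types u v : R -> R.

Lemma cvg0D u v : u @ +oo --> (0 : R) -> v @ +oo --> (0 : R) -> (fun s => u s + v s) @ +oo --> (0 : R).
Proof. by move=> cu cv; rewrite -(addr0 (0 : R)); exact: (cvgD cu cv). Qed.

Lemma cvg0M u v : u @ +oo --> (0 : R) -> v @ +oo --> (0 : R) -> (fun s => u s * v s) @ +oo --> (0 : R).
Proof. by move=> cu cv; rewrite -(mulr0 (0 : R)); exact: (cvgM cu cv). Qed.

Lemma cvg0Z (c : R) u : u @ +oo --> (0 : R) -> (fun s => c * u s) @ +oo --> (0 : R).
Proof. by move=> cu; rewrite -(mulr0 c); exact: cvgMr. Qed.
End zero_limits.

Section bessel_profile.
Variables (k : R) (h h1 h2 : R -> R).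
Hypothesis k0 : 0 < k.
Hypothesis dh : forall s : R, 0 < s -> [/\ is_derive s 1 h (h1 s), is_derive s 1 h1 (h2 s), 0 < h s & h1 s < 0].
Hypothesis ode : forall s, 0 < s -> s * h2 s + h1 s = h s / s + k ^+ 2 * s * h s.
Hypothesis conv : forall s, 0 < s -> h1 s ^+ 2 <= h s * h2 s.
Hypothesis decay : forall a s, 0 < a -> a <= s ->
  h s <= expR (- k * (s - a)) * h a /\ - h1 s <= expR (- k * (s - a)) * - h1 a.

(** [bessel3], [bessel2] and [bessel1] are closed forms of the integrals over [[s, +oo[] of
    [h^2 / y], [y * h^2] and [y * h1^2]. For [h s = K_1 (k s)] one has
    [h1 s + h s / s = - k K_0 (k s)], so [bessel3] is half of [K_1^2 - K_0^2] at [k s]. The formula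
    for [bessel1] comes from multiplying the radial equation by [h] and integrating by parts. *)
Definition bessel3 (s : R) : R := (h s ^+ 2 - (h1 s + h s / s) ^+ 2 / k ^+ 2) / 2.
Definition bessel2 (s : R) : R := ((s * h1 s) ^+ 2 - h s ^+ 2 - k ^+ 2 * (s * h s) ^+ 2) / (2 * k ^+ 2).
Definition bessel1 (s : R) : R := - (s * h s * h1 s) - bessel3 s - k ^+ 2 * bessel2 s.

Let kn : k != 0. Proof. by rewrite gt_eqF. Qed.
Let ode2 s : 0 < s -> s ^+ 2 * h2 s = h s + k ^+ 2 * s ^+ 2 * h s - s * h1 s.
Proof.
move=> s0; have sn : s != 0 by rewrite gt_eqF.
have -> : s ^+ 2 * h2 s = s * (s * h2 s + h1 s) - s * h1 s by ring.
by rewrite ode//; field.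
Qed.

Lemma is_derive_bessel3 (s : R) : 0 < s -> is_derive s 1 bessel3 (- (h s ^+ 2 / s)).
Proof.
move=> s0; have [d0 d1 _ _] := dh s0; have sn : s != 0 by rewrite gt_eqF.
have dq := derM d0 (derV (f := fun s : R => s) sn (der_id s)).
apply: (der_eq (derM (derB (der2 d0) (derM (der2 (derD d1 dq)) (der_cst (k ^- 2) s))) (der_cst 2^-1 s))).
have e := ode2 s0; have -> : h2 s = (h s + k ^+ 2 * s ^+ 2 * h s - s * h1 s) / s ^+ 2 by rewrite -e; field.
by move: (h s) (h1 s) => x y; field; rewrite kn sn.
Qed.

Lemma is_derive_bessel2 (s : R) : 0 < s -> is_derive s 1 bessel2 (- (s * h s ^+ 2)).
Proof.
move=> s0; have [d0 d1 _ _] := dh s0; have sn : s != 0 by rewrite gt_eqF.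
apply: (der_eq (derM (derB (derB (der2 (derM (der_id s) d1)) (der2 d0)) (derZ (k ^+ 2) (der2 (derM (der_id s) d0)))) (der_cst (2 * k ^+ 2)^-1 s))).
have e := ode2 s0; have -> : h2 s = (h s + k ^+ 2 * s ^+ 2 * h s - s * h1 s) / s ^+ 2 by rewrite -e; field.
by move: (h s) (h1 s) => x y; field; rewrite kn sn.
Qed.

Lemma is_derive_bessel1 (s : R) : 0 < s -> is_derive s 1 bessel1 (- (s * h1 s ^+ 2)).
Proof.
move=> s0; have [d0 d1 _ _] := dh s0; have sn : s != 0 by rewrite gt_eqF.
apply: (der_eq (derB (derB (derN (derM (derM (der_id s) d0) d1)) (is_derive_bessel3 s0)) (derZ (k ^+ 2) (is_derive_bessel2 s0)))).
have e := ode2 s0; have -> : h2 s = (h s + k ^+ 2 * s ^+ 2 * h s - s * h1 s) / s ^+ 2 by rewrite -e; field.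
by move: (h s) (h1 s) => x y; field; rewrite sn.
Qed.

Lemma cvg_bessel : [/\ bessel1 @ +oo --> (0 : R), bessel2 @ +oo --> (0 : R) & bessel3 @ +oo --> (0 : R)].
Proof.
have [_ _ p1 q1] := dh (@ltr01 R).
have [a1 a2 a3] : [/\ h @ +oo --> (0 : R), (fun s => s * h s) @ +oo --> (0 : R) & (fun s => h s / s) @ +oo --> (0 : R)].
  apply: (@exp_decay_limits h k 1 (h 1)) => //; first exact: ltW.
  move=> s s1; have s0 := lt_le_trans ltr01 s1; have [_ _ ps _] := dh s0.
  by rewrite gtr0_norm//; have [] := decay ltr01 s1.
have [b1 b2 _] : [/\ h1 @ +oo --> (0 : R), (fun s => s * h1 s) @ +oo --> (0 : R) & (fun s => h1 s / s) @ +oo --> (0 : R)].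
  apply: (@exp_decay_limits h1 k 1 (- h1 1)) => //; first by rewrite oppr_ge0 ltW.
  move=> s s1; have s0 := lt_le_trans ltr01 s1; have [_ _ _ ps] := dh s0.
  by rewrite ltr0_norm//; have [] := decay ltr01 s1.
have c3 : bessel3 @ +oo --> (0 : R).
  have -> : bessel3 = fun s => 2^-1 * (h s * h s + - k ^- 2 * ((h1 s + h s / s) * (h1 s + h s / s))).
    by apply/funext => s; rewrite /bessel3 !expr2; move: (h s / s) => q; field.
  have b13 := cvg0D b1 a3.
  exact: (cvg0Z 2^-1 (cvg0D (cvg0M a1 a1) (cvg0Z (- k ^- 2) (cvg0M b13 b13)))).
have c2 : bessel2 @ +oo --> (0 : R).
  have -> : bessel2 = fun s => (2 * k ^+ 2)^-1 * ((s * h1 s) * (s * h1 s) + (-1 * (h s * h s) + - k ^+ 2 * ((s * h s) * (s * h s)))).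
    by apply/funext => s; rewrite /bessel2; field.
  exact: (cvg0Z _ (cvg0D (cvg0M b2 b2) (cvg0D (cvg0Z (-1) (cvg0M a1 a1)) (cvg0Z (- k ^+ 2) (cvg0M a2 a2))))).
split=> //.
have -> : bessel1 = fun s => -1 * ((s * h s) * h1 s) + (-1 * bessel3 s + - k ^+ 2 * bessel2 s).
  by apply/funext => s; rewrite /bessel1; ring.
exact: (cvg0D (cvg0Z (-1) (cvg0M a2 b1)) (cvg0D (cvg0Z (-1) c3) (cvg0Z (- k ^+ 2) c2))).
Qed.

Let ch s : 0 < s -> {for s, continuous h}. Proof. by move=> /dh[d _ _ _]; exact: der_continuous d. Qed.
Let ch1 s : 0 < s -> {for s, continuous h1}. Proof. by move=> /dh[_ d _ _]; exact: der_continuous d. Qed.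

Lemma bessel_integrals s : 0 < s -> [/\
  (\int[mu]_(y in `[s, +oo[) (y * h1 y ^+ 2)%:E = (bessel1 s)%:E)%E,
  (\int[mu]_(y in `[s, +oo[) (y * h y ^+ 2)%:E = (bessel2 s)%:E)%E &
  (\int[mu]_(y in `[s, +oo[) (h y ^+ 2 / y)%:E = (bessel3 s)%:E)%E].
Proof.
have [l1 l2 l3] := cvg_bessel; move=> s0; split.
- apply: (ray_integral is_derive_bessel1 _ _ l1 s0) => y y0; last by rewrite mulr_ge0 ?sqr_ge0// ltW.
  by apply: cvgM; [exact: cvg_id|apply: cvgM; exact: ch1].
- apply: (ray_integral is_derive_bessel2 _ _ l2 s0) => y y0; last by rewrite mulr_ge0 ?sqr_ge0// ltW.
  by apply: cvgM; [exact: cvg_id|apply: cvgM; exact: ch].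
- apply: (ray_integral is_derive_bessel3 _ _ l3 s0) => y y0; last by rewrite divr_ge0 ?sqr_ge0// ltW.
  by apply: cvgM; [apply: cvgM; exact: ch|apply: cvgV; [rewrite gt_eqF|exact: cvg_id]].
Qed.

Lemma bessel3_ge0 s : 0 < s -> 0 <= bessel3 s.
Proof.
move=> s0; have [_ _ e] := bessel_integrals s0; rewrite -lee_fin -e; apply: integral_ge0 => y.
rewrite /= in_itv /= andbT => /(lt_le_trans s0) y0; by rewrite lee_fin divr_ge0 ?sqr_ge0// ltW.
Qed.

Lemma bessel2_gt0 s : 0 < s -> 0 < bessel2 s.
Proof.
move=> s0; have s1 : s < s + 1 by rewrite ltrDl.
have s10 := lt_trans s0 s1.
have ge0 : 0 <= bessel2 (s + 1).
  have [_ e _] := bessel_integrals s10; rewrite -lee_fin -e; apply: integral_ge0 => y.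
  rewrite /= in_itv /= andbT => /(lt_le_trans s10) y0; by rewrite lee_fin mulr_ge0 ?sqr_ge0// ltW.
have [||c] := @MVT R bessel2 (fun y => - (y * h y ^+ 2)) s (s + 1) s1.
- by move=> y; rewrite in_itv /= => /andP[/(lt_trans s0) y0 _]; exact: is_derive_bessel2.
- apply: der_within => y; rewrite /= in_itv /= => /andP[/(lt_le_trans s0) y0 _].
  by eexists; exact: is_derive_bessel2.
- rewrite in_itv /= => /andP[/(lt_trans s0) c0 _]; have [_ _ hc _] := dh c0.
  have : 0 < c * h c ^+ 2 by rewrite mulr_gt0// exprn_gt0.
  by rewrite addrAC subrr add0r mulr1; move: (c * _) => x; lra.
Qed.

Lemma log_derivative_ndecr r s : 0 < r -> r <= s -> h1 r / h r <= h1 s / h s.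
Proof.
move=> r0 rs; rewrite -subr_ge0; have [->|ne] := eqVneq r s; first by rewrite subrr.
have lt : r < s by rewrite lt_neqAle ne.
pose w y := h1 y / h y; pose w' y := (h2 y * h y - h1 y ^+ 2) / h y ^+ 2.
have dw (y : R) : 0 < y -> is_derive y 1 w (w' y).
  move=> y0; have [d0 d1 hy _] := dh y0; have hn : h y != 0 by rewrite gt_eqF.
  by apply: (der_eq (derM d1 (derV hn d0))); rewrite /w'; field.
have [||c] := @MVT R w w' r s lt.
- by move=> y; rewrite in_itv /= => /andP[/(lt_trans r0) y0 _]; exact: dw.
- by apply: der_within => y; rewrite /= in_itv /= => /andP[/(lt_le_trans r0) y0 _]; eexists; exact: dw.
rewrite in_itv /= => /andP[/(lt_trans r0) c0 _]; rewrite /w => ->; have [_ _ hc _] := dh c0.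
by rewrite mulr_ge0 ?subr_ge0// divr_ge0 ?sqr_ge0// subr_ge0 mulrC conv.
Qed.
End bessel_profile.
End profiles.

(** * Upper bounds for the eigenvalue outside the domain *)

Section upper_bounds.
Variable R : realType.
Notation mu := (@lebesgue_measure R).
Notation leb2 := (@leb2 R).
Notation C := (`[0%R, (2 * pi)%R]%classic : set R).
Variables (O : set (R * R)) (rho : R -> R) (r M P : R).
Notation U := (exterior O).
Hypotheses (r0 : 0 < r) (P0 : 0 < P) (pU : polar_ext U rho) (crho : continuous rho).
Hypothesis rhoM : forall t, C t -> r <= rho t <= M.
Hypothesis Ur : forall x, U x -> r ^+ 2 <= sqn x.
Hypotheses (mbd : measurable (boundary O)) (gbd : forall t, C t -> boundary O (pol t (rho t))).
Hypothesis bge : forall f : R * R -> \bar R, (forall x, boundary O x -> (0 <= f x)%E) -> measurable_fun (boundary O) f ->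
  (\int[mu]_(t in C) (f (pol t (rho t)) * (rho t)%:E) <= \int[@hausdorff1 R]_(x in boundary O) f x)%E.
Hypothesis ble : forall f : R * R -> \bar R, (forall x, boundary O x -> (0 <= f x)%E) -> measurable_fun (boundary O) f ->
  (\int[@hausdorff1 R]_(x in boundary O) f x <= \int[mu]_(t in C) (f (pol t (rho t)) * P%:E))%E.
Hypothesis rho_ge : forall t, r <= rho t.

Let mC : measurable (C : set (measurableTypeR R)). Proof. exact: measurable_itv. Qed.
Let rho0 t : 0 < rho t. Proof. exact: lt_le_trans (rho_ge t). Qed.
Let crh (g : R -> R) : (forall s, 0 < s -> {for s, continuous g}) -> continuous (fun t => g (rho t)).
Proof. by move=> cg t; have cgt := cg _ (rho0 t); exact: (@continuous_comp _ _ _ rho g t (@crho t) cgt). Qed.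
Let lin (f u : R -> R) (a b : R) : continuous f -> continuous u ->
  \int[mu]_(t in C) (a * f t + b * u t) = a * \int[mu]_(t in C) f t + b * \int[mu]_(t in C) u t.
Proof.
move=> cf cu; have := @Rintegral_lin R f u a b 0 cf cu; rewrite mul0r addr0 => <-.
by congr fine; apply: eq_integral => t _; rewrite addr0.
Qed.
Let le_int (f u : R -> R) : continuous f -> continuous u -> (forall t, C t -> f t <= u t) ->
  \int[mu]_(t in C) f t <= \int[mu]_(t in C) u t.
Proof.
move=> cf cu fu; apply: (@le_Rintegral _ (measurableTypeR R) _ mu _ _ _ mC) => //.
  by apply: continuous_integrable; exact: continuous_subspaceT.
by apply: continuous_integrable; exact: continuous_subspaceT.
Qed.
Let csq (f : R -> R) : continuous f -> continuous (fun t => f t ^+ 2).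
Proof. by move=> cf t; apply: cvgM; exact: cf. Qed.
Let cmul (f u : R -> R) : continuous f -> continuous u -> continuous (fun t => f t * u t).
Proof. by move=> cf cu t; apply: cvgM; [exact: cf|exact: cu]. Qed.
Let cadd (f u : R -> R) (a b : R) : continuous f -> continuous u -> continuous (fun t => a * f t + b * u t).
Proof. by move=> cf cu t; apply: cvgD; apply: cvgMr; [exact: cf|exact: cu]. Qed.

(** The radial equation turns the energy on a ray into a boundary term, a multiple of the mass, and
    the integral [D] of [h^2 / y]. Once the boundary term is absorbed, the shape of the domain is
    felt, apart from the mass, only through angular integrals of [D]. *)
Lemma bessel_upper_bound (k alpha : R) (h h1 h2 : R -> R) : 0 < k ->
  (forall t, 0 <= t <= pi -> rho (t + pi) = rho t) ->
  (forall s : R, 0 < s -> [/\ is_derive s 1 h (h1 s), is_derive s 1 h1 (h2 s), 0 < h s & h1 s < 0]) ->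
  (forall s, 0 < s -> s * h2 s + h1 s = h s / s + k ^+ 2 * s * h s) ->
  (forall s, 0 < s -> h1 s ^+ 2 <= h s * h2 s) ->
  (forall a s, 0 < a -> a <= s ->
    h s <= expR (- k * (s - a)) * h a /\ - h1 s <= expR (- k * (s - a)) * - h1 a) ->
  alpha <= h1 r / h r -> (lambda2 O alpha <= (- k ^+ 2)%:E)%E.
Proof.
move=> k0 sym dh ode conv decay al.
pose N1 := bessel1 k h h1; pose N2 := bessel2 k h h1; pose N3 := bessel3 k h h1.
have dN1 (s : R) : 0 < s -> is_derive s 1 N1 (- (s * h1 s ^+ 2)) by move=> s0; exact: (is_derive_bessel1 k0 dh ode s0).
have dN2 (s : R) : 0 < s -> is_derive s 1 N2 (- (s * h s ^+ 2)) by move=> s0; exact: (is_derive_bessel2 k0 dh ode s0).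
have dN3 (s : R) : 0 < s -> is_derive s 1 N3 (- (h s ^+ 2 / s)) by move=> s0; exact: (is_derive_bessel3 k0 dh ode s0).
have cN1 s : 0 < s -> {for s, continuous N1} by move=> s0; exact: der_continuous (dN1 s s0).
have cN2 s : 0 < s -> {for s, continuous N2} by move=> s0; exact: der_continuous (dN2 s s0).
have cN3 s : 0 < s -> {for s, continuous N3} by move=> s0; exact: der_continuous (dN3 s s0).
have dh0 (s : R) : 0 < s -> is_derive s 1 h (h1 s) by move=> /dh[].
have ch s : 0 < s -> {for s, continuous h} by move=> s0; exact: der_continuous (dh0 s s0).
have ch1 s : 0 < s -> {for s, continuous h1} by move=> /dh[_ d _ _]; exact: der_continuous d.
have ints s : r <= s -> [/\ (\int[mu]_(y in `[s, +oo[) (y * h1 y ^+ 2)%:E = (N1 s)%:E)%E,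
    (\int[mu]_(y in `[s, +oo[) (y * h y ^+ 2)%:E = (N2 s)%:E)%E & (\int[mu]_(y in `[s, +oo[) (h y ^+ 2 / y)%:E = (N3 s)%:E)%E].
  by move=> /(lt_le_trans r0) s0; exact: (bessel_integrals k0 dh ode decay s0).
pose D t := N3 (rho t); have cD : continuous D by exact: crh.
have D0 t : 0 <= D t by exact: (bessel3_ge0 k0 dh ode decay (rho0 t)).
have Dpi t : 0 <= t <= pi -> D (t + pi) = D t by move=> tp; rewrite /D sym.
pose J := \int[mu]_(t in C) ((cos t ^+ 2 - sin t ^+ 2) * D t).
have ccos : continuous (@cos R) by exact: continuous_cos.
have csin : continuous (@sin R) by exact: continuous_sin.
(* The two orientations give the integrals [J] and [- J], so one of them is not positive. *)
have [c0 [s0 [e1 neg]]] : exists c0 s0 : R, c0 ^+ 2 + s0 ^+ 2 = 1 /\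
    \int[mu]_(t in C) ((ang' c0 s0 t ^+ 2 - ang c0 s0 t ^+ 2) * D t) <= 0.
  have [Jn|Jp] := leP J 0.
    exists 0, 1; split; first by ring.
    rewrite (_ : \int[mu]_(t in C) _ = J)//; congr fine; apply: eq_integral => t _.
    by rewrite /ang /ang'; congr EFin; ring.
  exists 1, 0; split; first by ring.
  have -> : \int[mu]_(t in C) ((ang' 1 0 t ^+ 2 - ang 1 0 t ^+ 2) * D t) =
      \int[mu]_(t in C) (- 1 * ((cos t ^+ 2 - sin t ^+ 2) * D t) + 0 * D t).
    by congr fine; apply: eq_integral => t _; rewrite /ang /ang'; congr EFin; ring.
  rewrite lin//; last first.
    by apply: cmul => // t; apply: cvgB; apply: cvgM; first [exact: ccos|exact: csin].
  by rewrite -/J mul0r addr0 mulN1r oppr_le0 ltW.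
have ca := @continuous_ang R c0 s0; have ca' := @continuous_ang' R c0 s0.
have cross : \int[mu]_(t in C) (ang c0 s0 t * D t) = 0.
  apply: antiperiodic_integral; first exact: cmul.
  by move=> t tp; rewrite Dpi// /ang cosDpi sinDpi; ring.
apply: (trial_bound r0 P0 pU crho rhoM Ur mbd gbd bge ble dh0 ch1 e1 (N1 := N1) (N2 := N2) (N3 := N3)).
- by move=> s s0'; split; [exact: cN1|exact: cN2|exact: cN3].
- by move=> s s0'; exact: (bessel2_gt0 k0 dh ode decay s0').
- by move=> s /ints[-> _ _].
- by move=> s /ints[_ -> _].
- by move=> s /ints[_ _ ->].
move=> a b B lo up.
pose f t := a + b * ang c0 s0 t; pose f' t := b * ang' c0 s0 t.
have cf : continuous f by move=> t; apply: cvgD; [exact: cvg_cst|apply: cvgMr; exact: ca].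
have cf' : continuous f' by move=> t; apply: cvgMr; exact: ca'.
pose T t := (h (rho t) * f t) ^+ 2 * rho t.
have cT : continuous T by apply: cmul => //; apply: csq; apply: cmul => //; exact: crh.
have chn : continuous (fun t => f t ^+ 2 * N1 (rho t)) by apply: cmul; [exact: csq|exact: crh].
have chm : continuous (fun t => f t ^+ 2 * N2 (rho t)) by apply: cmul; [exact: csq|exact: crh].
have chd : continuous (fun t => f' t ^+ 2 * N3 (rho t)) by apply: cmul; [exact: csq|exact: crh].
have h10 : h1 r / h r < 0 by have [_ _ hp hn] := dh r r0; rewrite pmulr_llt0// invr_gt0.
have a0 : alpha < 0 by exact: le_lt_trans h10.
pose E t := f t ^+ 2 * N1 (rho t) + f' t ^+ 2 * N3 (rho t).
have cE : continuous E by move=> t; apply: cvgD; [exact: chn|exact: chd].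
(* By the definition of [bessel1], energy plus boundary term is at most
   [(f'^2 - f^2) * D - k^2 * f^2 * N2]. Expanding [f'^2 - f^2] in [a] and [b], the terms in [b^2]
   and [a * b] go to [V], the rest to [W]. *)
pose V t := b ^+ 2 * ((ang' c0 s0 t ^+ 2 - ang c0 s0 t ^+ 2) * D t) + (- (2 * a * b)) * (ang c0 s0 t * D t).
pose W t := a ^+ 2 * D t + k ^+ 2 * (f t ^+ 2 * N2 (rho t)).
have ce : continuous (fun t => (ang' c0 s0 t ^+ 2 - ang c0 s0 t ^+ 2) * D t).
  by apply: cmul => // t; apply: cvgB; apply: csq.
have caD : continuous (fun t => ang c0 s0 t * D t) by exact: cmul.
have cV : continuous V by exact: cadd.
have cW : continuous W by exact: cadd.
have key : \int[mu]_(t in C) (1 * E t + alpha * T t) <= \int[mu]_(t in C) (1 * V t + (-1) * W t).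
  apply: le_int => [||t _]; [exact: cadd|exact: cadd|].
  have [_ _ hp hn] := dh _ (rho0 t); have sn : rho t != 0 by rewrite gt_eqF.
  have w : alpha <= h1 (rho t) / h (rho t).
    exact: le_trans al (log_derivative_ndecr dh conv r0 (rho_ge t)).
  have w2 : alpha * h (rho t) ^+ 2 <= h (rho t) * h1 (rho t).
    have := ler_wpM2r (ltW hp) w; rewrite divfK ?gt_eqF// => w'.
    by have := ler_wpM2l (ltW hp) w'; rewrite mulrCA -expr2.
  have w3 : alpha * h (rho t) ^+ 2 * (f t ^+ 2 * rho t) <= h (rho t) * h1 (rho t) * (f t ^+ 2 * rho t).
    by apply: ler_wpM2r w2; rewrite mulr_ge0 ?sqr_ge0// ltW.
  rewrite /E /T /V /W /f /f' /N1 /bessel1 -/N2 -/N3 /D; move: w3; rewrite /f.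
  move: (N2 (rho t)) (N3 (rho t)) (ang c0 s0 t) (ang' c0 s0 t) (h (rho t)) (h1 (rho t)) (rho t) => n2 n3 u u' x x1 s w3.
  rewrite -subr_ge0; move: w3; rewrite -subr_ge0; congr (0 <= _).
  ring.
move: key; rewrite !lin// cross mulr0 addr0 !mul1r => key.
have i2 : 0 <= \int[mu]_(t in C) D t by apply: Rintegral_ge0 => t _; exact: D0.
have i1 : b ^+ 2 * \int[mu]_(t in C) ((ang' c0 s0 t ^+ 2 - ang c0 s0 t ^+ 2) * D t) <= 0.
  by apply: mulr_ge0_le0 => //; exact: sqr_ge0.
have i3 : 0 <= a ^+ 2 * \int[mu]_(t in C) D t by apply: mulr_ge0 => //; exact: sqr_ge0.
(* As [alpha < 0], it is the lower bound on the boundary integral that is inserted. *)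
have i4 : alpha * B <= alpha * \int[mu]_(t in C) T t by rewrite ler_nM2l.
rewrite mulNr; move: key i1 i3 i4; rewrite /E /f /f'.
move: (b ^+ 2 * _) (a ^+ 2 * _) (alpha * B) (alpha * _) (k ^+ 2 * _) => x y z w v key *; lra.
Qed.

(** For [h s = exp (- k s)] with small [k], the mass is of order at least [k^-2], while the boundary
    term and the energy in excess of [k^2] times the mass are of order at most [1 / k]. This handles
    the subspaces whose Rayleigh bound on the disk side is nonnegative. *)
Lemma lambda2_le0 (alpha : R) : (lambda2 O alpha <= 0)%E.
Proof.
apply/lee_addgt0Pr => eps eps0; rewrite add0e.
pose c := expR (- 2) : R; have c0 : 0 < c by exact: expR_gt0.
pose q := (2 * r)^-1 + `|alpha| * P.
have q0 : 0 < q by rewrite ltr_pwDl// ?invr_gt0 ?mulr_gt0// mulr_ge0// ltW.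
have M0 : 0 < M.
  have C0 : C 0 by apply/CP; rewrite lexx ltW// twopi_gt0.
  by have /andP[x y] := rhoM C0; exact: lt_le_trans r0 (le_trans x y).
(* The bound [k * M <= 1] keeps [E (rho t)] above [c = exp (- 2)]; [k <= 1] and [k <= eps / 2] give
   [k^2 <= eps / 2]; the last bound makes [q / k] at most [eps / 2] times the lower bound
   [c / (4 * k^2)] of the mass. *)
pose k := Num.min (Num.min 1 M^-1) (Num.min (eps / 2) (eps * c / 8 / q)).
have k0 : 0 < k by rewrite !lt_min ltr01 invr_gt0 M0 !divr_gt0// mulr_gt0.
have k1 : k <= 1 by rewrite !ge_min lexx.
have kM : k * M <= 1 by rewrite -ler_pdivlMr// mul1r !ge_min lexx orbT.
have ke : k <= eps / 2 by rewrite !ge_min lexx !orbT.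
have kq : k * q <= eps * c / 8 by rewrite -ler_pdivlMr// !ge_min lexx !orbT.
have kn : k != 0 by rewrite gt_eqF.
pose E (s : R) := expR (- (2 * k) * s); pose h (s : R) := expR (- k * s); pose h1 (s : R) := - k * expR (- k * s).
have hE s : h s ^+ 2 = E s by rewrite /h /E expr2 -expRD; congr expR; ring.
have dlin (x s : R) : is_derive s 1 (fun s => x * s) x by apply: (der_eq (derZ x (der_id s))); rewrite mulr1.
have dE (s : R) : is_derive s 1 E (- (2 * k) * E s) := der_exp (dlin _ s).
have dh (s : R) : is_derive s 1 h (h1 s) := der_exp (dlin _ s).
have dh1 (s : R) : is_derive s 1 h1 (- k * h1 s) := derZ (- k) (dh s).
pose N2 (s : R) := E s * (s / (2 * k) + (4 * k ^+ 2)^-1).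
have dN2 (s : R) : is_derive s 1 N2 (- (s * h s ^+ 2)).
  apply: (der_eq (derM (dE s) (derD (derM (der_id s) (der_cst (2 * k)^-1 s)) (der_cst (4 * k ^+ 2)^-1 s)))).
  by rewrite hE; field.
pose N0 (s : R) := E s / (2 * k).
have dN0 (s : R) : is_derive s 1 N0 (- (h s ^+ 2)).
  by apply: (der_eq (derM (dE s) (der_cst (2 * k)^-1 s))); rewrite hE; field.
have [lE lsE _] : [/\ E @ +oo --> (0 : R), (fun s => s * E s) @ +oo --> (0 : R) & (fun s => E s / s) @ +oo --> (0 : R)].
  apply: (@exp_decay_limits R E (2 * k) 1 (expR (- (2 * k)))) => //; first exact: mulr_gt0.
  by move=> s _; rewrite ger0_norm ?expR_ge0// -expRD le_eqVlt; apply/orP; left; apply/eqP; congr expR; ring.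
have lN2 : N2 @ +oo --> (0 : R).
  have -> : N2 = fun s => (2 * k)^-1 * (s * E s) + (4 * k ^+ 2)^-1 * E s by apply/funext => s; rewrite /N2; ring.
  exact: (cvg0D (cvg0Z _ lsE) (cvg0Z _ lE)).
have lN0 : N0 @ +oo --> (0 : R).
  have -> : N0 = fun s => (2 * k)^-1 * E s by apply/funext => s; rewrite /N0 mulrC.
  exact: (cvg0Z _ lE).
have ch : continuous h by move=> s; exact: der_continuous (dh s).
have csh s : {for s, continuous (fun y : R => y * h y ^+ 2)}.
  by apply: cvgM; [exact: cvg_id|apply: cvgM; exact: ch].
have csq0 s : {for s, continuous (fun y : R => h y ^+ 2)} by apply: cvgM; exact: ch.
have iN2 s : 0 < s -> (\int[mu]_(y in `[s, +oo[) (y * h y ^+ 2)%:E = (N2 s)%:E)%E.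
  apply: (ray_integral (fun s _ => dN2 s) (fun s _ => csh s) _ lN2) => y y0; by rewrite mulr_ge0 ?sqr_ge0// ltW.
have iN0 s : 0 < s -> (\int[mu]_(y in `[s, +oo[) (h y ^+ 2)%:E = (N0 s)%:E)%E.
  by apply: (ray_integral (fun s _ => dN0 s) (fun s _ => csq0 s) _ lN0) => y y0; rewrite sqr_ge0.
have ray0 (s y : R) : 0 < s -> `[s, +oo[%classic y -> 0 < y by rewrite /= in_itv /= andbT; exact: lt_le_trans.
have mray (s : R) : measurable (`[s, +oo[%classic : set (measurableTypeR R)) by exact: measurable_itv.
have e1 : (1 : R) ^+ 2 + 0 ^+ 2 = 1 by ring.
apply: (trial_bound r0 P0 pU crho rhoM Ur mbd gbd bge ble (fun s _ => dh s) (fun s _ => der_continuous (dh1 s)) e1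
  (N1 := fun s => k ^+ 2 * N2 s) (N2 := N2) (N3 := fun s => r^-1 * N0 s)).
- move=> s _; have c2 := der_continuous (dN2 s); have c00 := der_continuous (dN0 s).
  by split=> //; apply: cvgMr.
- by move=> s s0; rewrite /N2 mulr_gt0 ?expR_gt0// addr_gt0 ?divr_gt0 ?invr_gt0 ?mulr_gt0// exprn_gt0.
- move=> s rs; have s0 := lt_le_trans r0 rs; rewrite EFinM -iN2// -ge0_integralZl_EFin ?sqr_ge0//.
  + rewrite le_eqVlt; apply/orP; left; apply/eqP; apply: eq_integral => y _.
    by rewrite -EFinM /h1 exprMn sqrrN; congr EFin; rewrite /h; ring.
  + by move=> y /(ray0 s y s0) y0; rewrite lee_fin mulr_ge0 ?sqr_ge0// ltW.
  + by apply/measurable_EFinP; apply: measurable_funTS; apply: continuous_measurable_fun => y; exact: csh.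
- by move=> s rs; apply: iN2; exact: lt_le_trans rs.
- move=> s rs; have s0 := lt_le_trans r0 rs; rewrite EFinM -iN0// -ge0_integralZl_EFin ?invr_ge0 ?(ltW r0)//.
  + apply: le_nonneg_integral => //.
    * by move=> y /(ray0 s y s0) y0; rewrite lee_fin divr_ge0 ?sqr_ge0// ltW.
    * by move=> y _; rewrite -EFinM lee_fin mulr_ge0 ?sqr_ge0// invr_ge0 ltW.
    * move=> y; rewrite /= in_itv /= andbT => sy; rewrite -EFinM lee_fin mulrC ler_wpM2r ?sqr_ge0//.
      have ry := le_trans rs sy.
      by rewrite lef_pV2 ?posrE// (lt_le_trans r0).
  + by move=> y _; rewrite lee_fin sqr_ge0.
  + by apply/measurable_EFinP; apply: measurable_funTS; apply: continuous_measurable_fun => y; exact: csq0.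
move=> a b B lo up.
pose f t := a + b * ang 1 0 t; pose f' t := b * ang' 1 0 t.
have cf : continuous f by move=> t; apply: cvgD; [exact: cvg_cst|apply: cvgMr; exact: continuous_ang].
have cf' : continuous f' by move=> t; apply: cvgMr; exact: continuous_ang'.
have cN2r : continuous (fun t => N2 (rho t)) by apply: crh => s _; exact: der_continuous (dN2 s).
have cN0r : continuous (fun t => N0 (rho t)) by apply: crh => s _; exact: der_continuous (dN0 s).
have chr : continuous (fun t => h (rho t)) by apply: crh => s _; exact: ch.
have cmass : continuous (fun t => f t ^+ 2 * N2 (rho t)) by apply: cmul => //; exact: csq.
have [If If'] := integral_ang_sqr e1 a b.
set I := \int[mu]_(t in C) (f t ^+ 2) in If; set I' := \int[mu]_(t in C) (f' t ^+ 2) in If'.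
have II : I' <= I.
  rewrite If If'; apply: ler_wpM2r; first exact: pi_ge0.
  by rewrite lerDr mulr_ge0// sqr_ge0.
have I0 : 0 <= I by apply: Rintegral_ge0 => t _; exact: sqr_ge0.
have h_le1 t : h (rho t) <= 1 by rewrite /h expR_le1 mulNr oppr_le0 mulr_ge0// ltW.
have E_le1 t : E (rho t) <= 1 by rewrite -hE expr_le1// expR_ge0.
have up1 : B <= P * I.
  apply: le_trans up _; apply: ler_wpM2l; first exact: ltW.
  apply: le_int => [||t _]; [by apply: csq; exact: cmul|exact: csq|].
  by rewrite exprMn ler_piMl ?sqr_ge0// hE.
have B0 : 0 <= B.
  apply: le_trans lo; apply: Rintegral_ge0 => t _; apply: mulr_ge0; [exact: sqr_ge0|exact: ltW].
have aB : alpha * B <= `|alpha| * P * I.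
  apply: (@le_trans _ _ (`|alpha| * B)); first by rewrite ler_wpM2r// ler_norm.
  by rewrite -mulrA ler_wpM2l.
set m := \int[mu]_(t in C) (f t ^+ 2 * N2 (rho t)).
have m_ge : c / (4 * k ^+ 2) * I <= m.
  have -> : c / (4 * k ^+ 2) * I = \int[mu]_(t in C) (c / (4 * k ^+ 2) * f t ^+ 2 + 0 * f t).
    by rewrite lin//; [rewrite mul0r addr0|exact: csq].
  apply: le_int => [||t Ct]; [by apply: cadd => //; exact: csq|exact: cmass|].
  rewrite mul0r addr0 mulrC; apply: ler_wpM2l; first exact: sqr_ge0.
  apply: ler_pM; [exact: ltW|by rewrite invr_ge0 mulr_ge0// sqr_ge0| |].
    rewrite /E ler_expR mulNr lerN2 -mulrA; have /andP[_ tM] := rhoM Ct.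
    have : k * rho t <= k * M by rewrite ler_wpM2l// ltW.
    by move: kM; move: (k * M) (k * rho t) => *; lra.
  by rewrite lerDr divr_ge0 ?mulr_ge0// ltW.
have e_le : \int[mu]_(t in C) (f t ^+ 2 * (k ^+ 2 * N2 (rho t)) + f' t ^+ 2 * (r^-1 * N0 (rho t))) <=
    k ^+ 2 * m + (2 * k * r)^-1 * I.
  apply: (@le_trans _ _ (\int[mu]_(t in C) (k ^+ 2 * (f t ^+ 2 * N2 (rho t)) + (2 * k * r)^-1 * f' t ^+ 2))).
    apply: le_int => [||t _].
    - move=> t; apply: cvgD; apply: cvgM; [exact: csq|apply: cvgMr; exact: cN2r|exact: csq|apply: cvgMr; exact: cN0r].
    - by apply: cadd => //; exact: csq.
    - rewrite [X in X + _](_ : _ = k ^+ 2 * (f t ^+ 2 * N2 (rho t))); last by ring.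
      rewrite lerD2l mulrC ler_wpM2r ?sqr_ge0//.
      rewrite (_ : (2 * k * r)^-1 = r^-1 * (1 / (2 * k))); last by field; rewrite kn gt_eqF.
      by rewrite ler_wpM2l ?invr_ge0 ?(ltW r0)// /N0 ler_wpM2r// invr_ge0 mulr_ge0// ltW.
  rewrite lin//; last exact: csq.
  by rewrite lerD2l ler_wpM2l// invr_ge0 !mulr_ge0// ltW.
apply: le_trans (lerD e_le aB) _; rewrite -addrA -mulrDl -lerBrDl -mulrBl.
have q2 : (2 * k * r)^-1 + `|alpha| * P <= q / k.
  have -> : q / k = (2 * r)^-1 / k + `|alpha| * P / k by exact: mulrDl.
  apply: lerD.
    by rewrite le_eqVlt; apply/orP; left; apply/eqP; field; rewrite kn gt_eqF.
  by rewrite ler_peMr// ?invf_ge1// mulr_ge0// ltW.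
have ek : eps / 2 <= eps - k ^+ 2.
  have : k ^+ 2 <= eps / 2 by apply: le_trans ke; rewrite expr2 ler_piMl// ltW.
  by move: (k ^+ 2) => x; lra.
apply: (@le_trans _ _ (q / k * I)); first exact: ler_wpM2r.
apply: (@le_trans _ _ (eps / 2 * (c / (4 * k ^+ 2) * I))).
  rewrite mulrA; apply: ler_wpM2r => //.
  have -> : eps / 2 * (c / (4 * k ^+ 2)) = (eps * c / 8) / k ^+ 2 by field.
  rewrite ler_pdivlMr ?exprn_gt0//; apply: le_trans kq.
  by rewrite le_eqVlt; apply/orP; left; apply/eqP; field.
apply: ler_pM => //; first by rewrite divr_ge0// ltW.
by rewrite mulr_ge0// divr_ge0 ?mulr_ge0 ?sqr_ge0// ltW.
Qed.
End upper_bounds.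

(** * Traces on the circle and the lower bound in H1 *)

Section circle_traces.
Variable R : realType.
Notation mu := (@lebesgue_measure R).
Notation leb2 := (@leb2 R).
Notation C := (`[0%R, (2 * pi)%R]%classic : set (measurableTypeR R)).
Variable r : R.
Hypothesis r0 : 0 < r.
Notation U := (disk_ext r).
Implicit Types (u v t : R * R -> R) (g : R * R -> R * R).

Let oU : open U. Proof. exact: open_disk_ext. Qed.
Let mU : measurable U. Proof. by apply: open_measurable2. Qed.
Let mC : measurable C. Proof. exact: measurable_itv. Qed.

(** A single sequence converges to [u], to its gradient and to the trace. Carrying it along lets
    traces be combined linearly and the lower bound pass to the limit, without invoking uniqueness
    of traces. *)
Definition approximates u g t (phi : nat -> R * R -> R) : Prop :=
  [/\ forall n, test_fun setT (phi n),
      measurable_fun setT t /\ vanish (fun n => nsq mu C (fun s => phi n (pol s r) - t (pol s r))),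
      vanish (fun n => nsq leb2 U (fun x => phi n x - u x)),
      vanish (fun n => nsq leb2 U (fun x => (grad (phi n) x).1 - (g x).1)) &
      vanish (fun n => nsq leb2 U (fun x => (grad (phi n) x).2 - (g x).2))].

Lemma h1_norm_split phi u g : test_fun setT phi -> L2 U u -> weak_grad U u g ->
  (\int[leb2]_(x in U) ((phi x - u x) ^+ 2 + sqn (grad phi x - g x))%:E =
   nsq leb2 U (fun x => phi x - u x)%R + (nsq leb2 U (fun x => (grad phi x).1 - (g x).1)%R +
   nsq leb2 U (fun x => (grad phi x).2 - (g x).2)%R))%E.
Proof.
move=> tphi [mu' _] [[m1 _] [m2 _] _]; have [t1 t2] := test_fun_grad tphi.
have [mp _] := test_fun_L2S oU tphi; have [mp1 _] := test_fun_L2S oU t1; have [mp2 _] := test_fun_L2S oU t2.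
have q0 := measurable_sq (measurable_funB mp mu'); have q1 := measurable_sq (measurable_funB mp1 m1).
have q2 := measurable_sq (measurable_funB mp2 m2).
rewrite /nsq -(ge0_integralD leb2 mU _ q1 _ q2); [|by move=> x _; rewrite lee_fin sqr_ge0|by move=> x _; rewrite lee_fin sqr_ge0].
rewrite -(ge0_integralD leb2 mU _ q0 _ (emeasurable_funD q1 q2)); last 2 first.
- by move=> x _; rewrite lee_fin sqr_ge0.
- by move=> x _; apply: adde_ge0; rewrite lee_fin sqr_ge0.
by apply: eq_integral => x _; rewrite EFinD.
Qed.

Lemma approximates_exists u g : L2 U u -> weak_grad U u g ->
  exists t phi, approximates u g t phi.
Proof.
move=> Lu wg; have [phi [tphi v0 v1 v2]] := H1_disk_density r0 Lu wg.
exists (circle_trace r u g), phi; split=> //; split; first exact: (measurable_circle_trace Lu wg).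
have rr : 0 <= 2 / r by rewrite divr_ge0// ltW.
apply: (vanish_le (v := fun n => ((2 / r)%:E * (nsq leb2 U (fun x => phi n x - u x)%R +
  (nsq leb2 U (fun x => (grad (phi n) x).1 - (g x).1)%R + nsq leb2 U (fun x => (grad (phi n) x).2 - (g x).2)%R)))%E)).
  apply: nearW => n; rewrite -(h1_norm_split (tphi n) Lu wg); have [sp _ _] := tphi n.
  exact: (circle_trace_le r0 Lu wg sp).
by apply: vanishZ => //; apply: vanishD => //; apply: vanishD.
Qed.

Lemma smooth_lin (a b : R) phi psi : smooth phi -> smooth psi -> smooth (fun x => a * phi x + b * psi x).
Proof.
move=> sp sq k; apply: CkD; apply: CkM; [exact: Ck_cst|exact: sp|exact: Ck_cst|exact: sq].
Qed.

Lemma test_fun_lin (a b : R) phi psi : test_fun setT phi -> test_fun setT psi ->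
  test_fun setT (fun x => a * phi x + b * psi x).
Proof.
move=> tp tq; have [M M0 hp] := test_fun_supp tp; have [N N0 hq] := test_fun_supp tq.
have [sp _ _] := tp; have [sq _ _] := tq.
apply: (@test_fun_box R setT _ (0, 0) (Num.max M N)) => //; first exact: smooth_lin.
have sub (K : R) x : K <= Num.max M N -> ~ box (0, 0) (Num.max M N) x -> ~ box (0, 0) K x.
  by move=> KM nb [h1 h2]; apply: nb; split; [exact: le_trans h1 KM|exact: le_trans h2 KM].
move=> x nb; rewrite hp ?hq ?mulr0 ?addr0//.
  by apply: sub nb; rewrite le_max lexx orbT.
by apply: sub nb; rewrite le_max lexx.
Qed.

Lemma grad_lin (a b : R) phi psi x : smooth phi -> smooth psi ->
  grad (fun x => a * phi x + b * psi x) x =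
  (a * (grad phi x).1 + b * (grad psi x).1, a * (grad phi x).2 + b * (grad psi x).2).
Proof.
move=> sp sq; have [dp _ _] := Ck_elim (sp 1%N); have [dq _ _] := Ck_elim (sq 1%N).
have d : has_grad (fun x => a * phi x + b * psi x) (fun x => a * (grad phi x).1 + b * (grad psi x).1)
    (fun x => a * (grad phi x).2 + b * (grad psi x).2).
  move=> y; have [p1 p2] := dp y; have [q1 q2] := dq y.
  exact: (conj (derD (derZ a p1) (derZ b q1)) (derD (derZ a p2) (derZ b q2))).
by have [_ ->] := has_gradP d.
Qed.

Lemma vanish_lin d (T : measurableType d) (m : {measure set T -> \bar R}) (D : set T) (f f' : nat -> T -> R) (k k' : T -> R) (a b : R) :
  measurable D -> (forall n, measurable_fun D (f n)) -> (forall n, measurable_fun D (f' n)) ->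
  measurable_fun D k -> measurable_fun D k' ->
  vanish (fun n => nsq m D (fun x => f n x - k x)) -> vanish (fun n => nsq m D (fun x => f' n x - k' x)) ->
  vanish (fun n => nsq m D (fun x => (a * f n x + b * f' n x) - (a * k x + b * k' x))).
Proof.
move=> mD mf mf' mk mk' v v'.
apply: (vanish_le (v := fun n => ((2 * a ^+ 2)%:E * nsq m D (fun x => f n x - k x)%R + (2 * b ^+ 2)%:E * nsq m D (fun x => f' n x - k' x)%R)%E)).
  apply: nearW => n; apply: nsq_lin2 => //.
  - by rewrite mulr_ge0// sqr_ge0.
  - by rewrite mulr_ge0// sqr_ge0.
  - exact: measurable_funB.
  - exact: measurable_funB.
  - by apply: measurable_funB; apply: measurable_funD; exact: measurable_funM.
  - move=> x _; rewrite (_ : _ - _ = a * (f n x - k x) + b * (f' n x - k' x)); last by ring.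
    move: (f n x - k x) (f' n x - k' x) => y z; rewrite -subr_ge0.
    by have -> : 2 * a ^+ 2 * y ^+ 2 + 2 * b ^+ 2 * z ^+ 2 - (a * y + b * z) ^+ 2 = (a * y - b * z) ^+ 2; [ring|exact: sqr_ge0].
by apply: vanishD; apply: vanishZ => //; rewrite mulr_ge0// sqr_ge0.
Qed.

Let mcirc (t : R * R -> R) : measurable_fun setT t -> measurable_fun C (fun s => t (pol s r)).
Proof.
move=> mt; apply: measurable_funTS; apply: (measurableT_comp mt).
exact: (measurableT_comp (@measurable_pol R) (measurable_pair2 r)).
Qed.

Lemma approximates_lin u v g g' t t' phi psi (a b : R) : L2 U u -> L2 U v -> weak_grad U u g -> weak_grad U v g' ->
  approximates u g t phi -> approximates v g' t' psi ->
  approximates (fun x => a * u x + b * v x) (fun x => (a * (g x).1 + b * (g' x).1, a * (g x).2 + b * (g' x).2))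
    (fun x => a * t x + b * t' x) (fun n x => a * phi n x + b * psi n x).
Proof.
move=> [mu' _] [mv _] [[g1 _] [g2 _] _] [[g1' _] [g2' _] _] [tp [mt vt] v0 v1 v2] [tq [mt' vt'] w0 w1 w2].
have sp n : smooth (phi n) by case: (tp n).
have sq n : smooth (psi n) by case: (tq n).
have L n := test_fun_L2S oU (tp n); have L' n := test_fun_L2S oU (tq n).
have L1 n := test_fun_L2S oU (test_fun_grad (tp n)).1; have L2' n := test_fun_L2S oU (test_fun_grad (tp n)).2.
have K1 n := test_fun_L2S oU (test_fun_grad (tq n)).1; have K2 n := test_fun_L2S oU (test_fun_grad (tq n)).2.
split.
- by move=> n; exact: test_fun_lin.
- split; first by apply: measurable_funD; exact: measurable_funM.
  have mphi n : measurable_fun C (fun s => phi n (pol s r)) by apply: mcirc; exact: continuous_measurable2 (sp n 0%N).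
  have mpsi n : measurable_fun C (fun s => psi n (pol s r)) by apply: mcirc; exact: continuous_measurable2 (sq n 0%N).
  exact: (vanish_lin a b mC mphi mpsi (mcirc mt) (mcirc mt') vt vt').
- by apply: vanish_lin => // n; [case: (L n)|case: (L' n)].
- have h1 n : measurable_fun U (fun x => (grad (phi n) x).1) by case: (L1 n).
  have h2 n : measurable_fun U (fun x => (grad (psi n) x).1) by case: (K1 n).
  have V := vanish_lin (m := leb2) a b mU h1 h2 g1 g1' v1 w1.
  move=> e e0; apply: filterS (V e e0) => n; apply: le_trans; rewrite le_eqVlt; apply/orP; left; apply/eqP.
  by apply: eq_nsq => x _; rewrite grad_lin.
- have h1 n : measurable_fun U (fun x => (grad (phi n) x).2) by case: (L2' n).
  have h2 n : measurable_fun U (fun x => (grad (psi n) x).2) by case: (K2 n).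
  have V := vanish_lin (m := leb2) a b mU h1 h2 g2 g2' v2 w2.
  move=> e e0; apply: filterS (V e e0) => n; apply: le_trans; rewrite le_eqVlt; apply/orP; left; apply/eqP.
  by apply: eq_nsq => x _; rewrite grad_lin.
Qed.

Lemma sqi_circle phi : continuous phi -> sqi mu C (fun s => phi (pol s r)).
Proof.
move=> cp; have cs : continuous (fun s => phi (pol s r)) := (continuous_sections (continuous_polar cp)).2 r.
split; first by apply: measurable_funTS; exact: continuous_measurable_fun.
have c2 : {within `[0, 2 * pi], continuous (fun s => phi (pol s r) ^+ 2)}.
  by apply: continuous_subspaceT => s; apply: cvgM; exact: cs.
by rewrite /nsq -(Rintegral_EFin c2) ltry.
Qed.

Lemma approximates_sqi u g t phi : approximates u g t phi -> sqi mu C (fun s => t (pol s r)).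
Proof.
move=> [tp [mt vt] _ _ _]; have [n _ /(_ n (leqnn n)) hn] := vt 1 ltr01.
have sn : sqi mu C (fun s => phi n (pol s r)) by apply: sqi_circle; have [sp _ _] := tp n; exact: sp 0%N.
have sd : sqi mu C (fun s => phi n (pol s r) - t (pol s r)).
  by split; [apply: measurable_funB; [case: sn|exact: mcirc]|exact: le_lt_trans hn (ltry _)].
have [mz lz] := sqiB mC sn sd; split; first exact: mcirc.
apply: le_lt_trans lz; rewrite le_eqVlt; apply/orP; left; apply/eqP.
by apply: eq_nsq => s _; rewrite subKr.
Qed.

Lemma circle_integrable (f : R -> R) : sqi mu C f -> mu.-integrable C (EFin \o f).
Proof.
move=> Lf; have L1 : sqi mu C (fun=> 1) by apply: (@sqi_circle (fun=> 1)) => x; exact: cvg_cst.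
by have := sqi_integrableM mC Lf L1; apply: eq_integrable => // x _; rewrite /= mulr1.
Qed.

Lemma integral_sqr_le (f : R -> R) : sqi mu C f -> (\int[mu]_(s in C) f s) ^+ 2 <= 2 * pi * \int[mu]_(s in C) (f s ^+ 2).
Proof.
move=> Lf; have p2 := twopi_gt0 R; set I := \int[mu]_(s in C) f s.
have i1 := circle_integrable Lf.
have L1 : sqi mu C (fun=> 1) by apply: (@sqi_circle (fun=> 1)) => x; exact: cvg_cst.
have i2 := sqi_integrable Lf.
pose c := I / (2 * pi).
have Lc : sqi mu C (fun s => f s - c * 1) by apply: sqiB => //; exact: sqiZ.
have muC : fine (mu C) = 2 * pi.
  by rewrite lebesgue_measure_itv /= lte_fin p2 -EFinB subr0.
have E : \int[mu]_(s in C) ((f s - c * 1) ^+ 2) = \int[mu]_(s in C) (f s ^+ 2) - 2 * c * I + c ^+ 2 * (2 * pi).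
  have ic (x : R) : mu.-integrable C (EFin \o (fun=> x)).
    by apply: continuous_integrable; apply: continuous_subspaceT => y; exact: cvg_cst.
  have ick : mu.-integrable C (EFin \o (fun s => - (2 * c) * f s)).
    have := integrableZl mC (- (2 * c)) i1; apply: eq_integrable => // x _; by rewrite /= EFinM.
  transitivity (\int[mu]_(s in C) (f s ^+ 2 + (- (2 * c) * f s + c ^+ 2))).
    by congr fine; apply: eq_integral => s _; congr EFin; ring.
  have icc : mu.-integrable C (EFin \o (fun s => - (2 * c) * f s + c ^+ 2)).
    by have := integrableD mC ick (ic (c ^+ 2)); apply: eq_integrable.
  rewrite (@RintegralD _ (measurableTypeR R) _ mu C _ _ mC i2 icc) (@RintegralD _ (measurableTypeR R) _ mu C _ _ mC ick (ic _)).
  rewrite (@RintegralZl _ (measurableTypeR R) _ mu C _ (- (2 * c)) mC i1) -/I.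
  rewrite (_ : \int[mu]_(s in C) c ^+ 2 = c ^+ 2 * (2 * pi)); first by ring.
  by rewrite Rintegral_cst// muC.
have : 0 <= \int[mu]_(s in C) ((f s - c * 1) ^+ 2) by apply: Rintegral_ge0 => s _; exact: sqr_ge0.
rewrite E => h; rewrite mulrC -ler_pdivrMr//.
have -> : I ^+ 2 / (2 * pi) = 2 * c * I - c ^+ 2 * (2 * pi).
  have pn : pi != 0 :> R by rewrite gt_eqF// pi_gt0.
  by rewrite /c; move: pi pn => y yn; field.
by move: h; move: (c ^+ 2 * _) (2 * c * I) => x y; lra.
Qed.

(** On a circle the upper comparison holds with [K = 0], so convergence in the angle gives
    convergence against the Hausdorff measure. *)
Lemma is_trace_disk u g t phi : L2 U u -> weak_grad U u g -> approximates u g t phi -> is_trace (disk r) u t.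
Proof.
move=> Lu wg [tp [mt vt] v0 v1 v2].
have mB : measurable (boundary (disk r)).
  by apply: measurableD; [apply: closed_measurable2; exact: closed_closure|apply: open_measurable2; exact: open_interior].
split; first exact: measurable_funTS.
rewrite exterior_disk//; exists g, phi; split=> //.
  apply/vanishP; first by move=> n; apply: integral_ge0 => x _; rewrite lee_fin addr_ge0 ?sqr_ge0// addr_ge0// sqr_ge0.
  under eq_fun do rewrite (h1_norm_split (tp _) Lu wg).
  by apply: vanishD => //; exact: vanishD.
have rho_ge (s : R) : `[0, 2 * pi]%classic s -> r <= r by [].
have lip s s' : `[0, 2 * pi]%classic s -> `[0, 2 * pi]%classic s' -> `|(fun=> r) s - (fun=> r) s'| <= 0 * `|s - s'|.
  by move=> _ _; rewrite subrr normr0 mul0r.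
have mr : measurable_fun C (fun _ : R => r) by exact: measurable_cst.
have bE := boundary_disk r0.
have f0 n x : boundary (disk r) x -> (0 <= ((phi n x - t x) ^+ 2)%:E)%E by rewrite lee_fin sqr_ge0.
have mphi n : measurable_fun setT (phi n) by have [sp _ _] := tp n; exact: continuous_measurable2 (sp 0%N).
have mf n : measurable_fun (boundary (disk r)) (fun x => ((phi n x - t x) ^+ 2)%:E).
  by apply: measurable_funTS; apply/measurable_EFinP; apply: measurable_funX; exact: measurable_funB.
have CA s : `[0, 2 * pi]%classic s -> boundary (disk r) (pol s r) by move=> Cs; rewrite bE; exists s.
apply/vanishP.
  move=> n; apply: le_trans (@curve_integral_le R (fun=> r) r r 0 r0 (lexx 0) rho_ge (fun s _ => lexx r) lip mr _ _ mB CA (f0 n) (mf n)).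
  by apply: integral_ge0 => s _; rewrite -EFinM lee_fin mulr_ge0 ?sqr_ge0// ltW.
apply: (vanish_le (v := fun n => (r%:E * nsq mu C (fun s => phi n (pol s r) - t (pol s r))%R)%E)).
  apply: nearW => n; apply: le_trans (@curve_integral_ge R (fun=> r) r r 0 r0 (lexx 0) rho_ge (fun s _ => lexx r) lip mr erefl _ _ mB bE (f0 n) (mf n)) _.
  rewrite -ge0_integralZl_EFin ?(ltW r0)//.
  - by rewrite le_eqVlt; apply/orP; left; apply/eqP; apply: eq_integral => s _; rewrite add0r muleC.
  - by move=> s _; rewrite lee_fin sqr_ge0.
  - by apply: measurable_sq; apply: measurable_funB; exact: mcirc.
by apply: vanishZ => //; exact: ltW.
Qed.

(** The comparison with the angle makes the Hausdorff integral finite, so [fine] keeps its value;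
    the upper bound is the direction that a negative coupling constant calls for. *)
Lemma disk_trace_le t : measurable_fun setT t -> sqi mu C (fun s => t (pol s r)) ->
  0 <= fine (\int[@hausdorff1 R]_(x in boundary (disk r)) (t x ^+ 2)%:E)%E <= r * \int[mu]_(s in C) (t (pol s r) ^+ 2).
Proof.
move=> mt Lt.
have mB : measurable (boundary (disk r)).
  by apply: measurableD; [apply: closed_measurable2; exact: closed_closure|apply: open_measurable2; exact: open_interior].
have rho_ge (s : R) : `[0, 2 * pi]%classic s -> r <= r by [].
have lip s s' : `[0, 2 * pi]%classic s -> `[0, 2 * pi]%classic s' -> `|(fun=> r) s - (fun=> r) s'| <= 0 * `|s - s'|.
  by move=> _ _; rewrite subrr normr0 mul0r.
have mr : measurable_fun C (fun _ : R => r) by exact: measurable_cst.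
have bE := boundary_disk r0.
have f0 x : boundary (disk r) x -> (0 <= (t x ^+ 2)%:E)%E by rewrite lee_fin sqr_ge0.
have mf : measurable_fun (boundary (disk r)) (fun x => (t x ^+ 2)%:E).
  by apply: measurable_funTS; exact: measurable_sq.
have CA s : `[0, 2 * pi]%classic s -> boundary (disk r) (pol s r) by move=> Cs; rewrite bE; exists s.
have lo := @curve_integral_le R (fun=> r) r r 0 r0 (lexx 0) rho_ge (fun s _ => lexx r) lip mr _ _ mB CA f0 mf.
have up := @curve_integral_ge R (fun=> r) r r 0 r0 (lexx 0) rho_ge (fun s _ => lexx r) lip mr erefl _ _ mB bE f0 mf.
have lo' : (0 <= \int[@hausdorff1 R]_(x in boundary (disk r)) (t x ^+ 2)%:E)%E.
  by apply: le_trans lo; apply: integral_ge0 => s _; rewrite -EFinM lee_fin mulr_ge0 ?sqr_ge0// ltW.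
have up' : (\int[@hausdorff1 R]_(x in boundary (disk r)) (t x ^+ 2)%:E <= (r * \int[mu]_(s in C) (t (pol s r) ^+ 2))%:E)%E.
  apply: le_trans up _; rewrite EFinM Rintegral_sq// /nsq -ge0_integralZl_EFin ?(ltW r0)//.
  - by rewrite le_eqVlt; apply/orP; left; apply/eqP; apply: eq_integral => s _; rewrite add0r muleC.
  - by move=> s _; rewrite lee_fin sqr_ge0.
  - by apply: measurable_sq; case: Lt.
move: lo' up'; case: (integral _ _ _) => [v| |]; rewrite ?lee_fin ?leye_eq ?leeNy_eq//=.
by move=> -> ->.
Qed.

Lemma integral_sum3 (f0 f1 f2 : R * R -> R) (c : R) : 0 <= c -> L2 U f0 -> L2 U f1 -> L2 U f2 ->
  (\int[leb2]_(x in U) (f1 x ^+ 2 + f2 x ^+ 2 + c * f0 x ^+ 2)%:E =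
   (fine (nsq leb2 U f1) + (fine (nsq leb2 U f2) + c * fine (nsq leb2 U f0)))%:E)%E.
Proof.
move=> c0 K0 K1 K2; have [m0 _] := K0; have [m1 _] := K1; have [m2 _] := K2.
have q0 := measurable_sq m0; have q1 := measurable_sq m1; have q2 := measurable_sq m2.
rewrite !EFinD EFinM (fineK (@nsq_fin R _ _ leb2 U _ K0)) (fineK (@nsq_fin R _ _ leb2 U _ K1)) (fineK (@nsq_fin R _ _ leb2 U _ K2)).
have q0' : measurable_fun U (fun x => (c%:E * (f0 x ^+ 2)%:E)%E) by exact: measurable_funeM.
rewrite /nsq -(ge0_integralZl_EFin leb2 mU _ q0 c0); last by move=> x _; rewrite lee_fin sqr_ge0.
rewrite -(ge0_integralD leb2 mU _ q2 _ q0'); last 2 first.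
- by move=> x _; rewrite lee_fin sqr_ge0.
- by move=> x _; rewrite -EFinM lee_fin mulr_ge0 ?sqr_ge0.
rewrite -(ge0_integralD leb2 mU _ q1 _ (emeasurable_funD q2 q0')); last 2 first.
- by move=> x _; rewrite lee_fin sqr_ge0.
- by move=> x _; rewrite -EFinM -EFinD lee_fin; apply: addr_ge0; [|apply: mulr_ge0 => //]; exact: sqr_ge0.
by apply: eq_integral => x _; rewrite -addrA !EFinD EFinM.
Qed.

Lemma lower_trace u g t phi (k : R) (h h1 h2 : R -> R) : L2 U u -> weak_grad U u g -> approximates u g t phi ->
  (forall s : R, 0 < s -> [/\ is_derive s 1 h (h1 s), is_derive s 1 h1 (h2 s), 0 < h s & h1 s < 0]) ->
  (forall s, 0 < s -> s * h2 s + h1 s = h s / s + k ^+ 2 * s * h s) ->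
  \int[mu]_(s in C) t (pol s r) = 0 ->
  - (r * (h1 r / h r)) * \int[mu]_(s in C) (t (pol s r) ^+ 2) <=
  \int[leb2]_(x in U) sqn (g x) + k ^+ 2 * \int[leb2]_(x in U) (u x ^+ 2).
Proof.
move=> Lu wg ap dh ode t0; have Lt := approximates_sqi ap; have [tp [mt vt] v0 v1 v2] := ap.
have [L1 L2' _] := wg.
(* The logarithmic derivative turns the second-order radial equation into the Riccati equation, with
   equality in the hypothesis of [lower_test]. *)
pose Q s := s * (h1 s / h s); pose Q' s := k ^+ 2 * s + s^-1 - Q s ^+ 2 / s.
have dQ (s : R) : 0 < s -> is_derive s 1 Q (Q' s).
  move=> s0; have [d0 d1 hp _] := dh s s0; have hn : h s != 0 by rewrite gt_eqF.
  have sn : s != 0 by rewrite gt_eqF.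
  apply: (der_eq (derM (der_id s) (derM d1 (derV hn d0)))); rewrite /Q' /Q.
  have -> : h2 s = (h s / s + k ^+ 2 * s * h s - h1 s) / s by rewrite -ode//; field.
  by field; rewrite sn hn.
have pos s : r <= s -> 0 < s by exact: lt_le_trans.
have cQ' b : {within `[r, b], continuous Q'}.
  apply: continuous_in_subspaceT => s; rewrite inE /= in_itv /= => /andP[/pos s0 _].
  have sn : s != 0 by rewrite gt_eqF.
  have cQ : Q @ s --> Q s := der_continuous (dQ s s0).
  apply: cvgB; first by apply: cvgD; [apply: cvgMr; exact: cvg_id|apply: cvgV => //; exact: cvg_id].
  by apply: cvgM; [exact: cvgM|apply: cvgV => //; exact: cvg_id].
have Qr : Q r <= 0.
  have [_ _ hp hn] := dh r r0; have w : h1 r / h r < 0 by rewrite pmulr_llt0 ?invr_gt0.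
  by apply: mulr_ge0_le0; exact: ltW.
pose a n := fine (nsq mu C (fun s => phi n (pol s r))).
pose d n := fine (nsq mu C (fun s => phi n (pol s r) - t (pol s r))).
pose e0 n := fine (nsq leb2 U (phi n)); pose e1 n := fine (nsq leb2 U (fun x => (grad (phi n) x).1)).
pose e2 n := fine (nsq leb2 U (fun x => (grad (phi n) x).2)).
have sp n : smooth (phi n) by case: (tp n).
have Lc n : sqi mu C (fun s => phi n (pol s r)) by apply: sqi_circle; exact: sp n 0%N.
have Ld n : sqi mu C (fun s => phi n (pol s r) - t (pol s r)) by apply: sqiB.
have K0 n := test_fun_L2S oU (tp n).
have K1 n := test_fun_L2S oU (test_fun_grad (tp n)).1; have K2 n := test_fun_L2S oU (test_fun_grad (tp n)).2.
(* The trace has zero mean, so the mean of [phi n] on the circle is that of [phi n - t], whose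
   square is at most [2 * pi * d n] and vanishes in the limit. *)
have ineq n : - Q r * (4 * pi * a n - 2 * (2 * pi * d n)) <= 4 * pi * (e1 n + (e2 n + k ^+ 2 * e0 n)).
  have ric s : r <= s -> Q' s + Q s ^+ 2 / s <= k ^+ 2 * s + s^-1 by move=> _; rewrite /Q' subrK.
  have lt := lower_test (tp n) r0 (fun s rs => dQ s (pos s rs)) cQ' ric Qr.
  have split3 : (\int[leb2]_(x in U) (sqn (grad (phi n) x) + k ^+ 2 * phi n x ^+ 2)%:E = (e1 n + (e2 n + k ^+ 2 * e0 n))%:E)%E.
    exact: (integral_sum3 (sqr_ge0 k) (K0 n) (K1 n) (K2 n)).
  move: lt; rewrite split3 -EFinM lee_fin; apply: le_trans; apply: ler_wpM2l; first by rewrite oppr_ge0.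
  have -> : spread (fun s => phi n (pol s r)) = 4 * pi * a n - 2 * (\int[mu]_(s in C) phi n (pol s r)) ^+ 2 by [].
  have -> : \int[mu]_(s in C) phi n (pol s r) = \int[mu]_(s in C) (phi n (pol s r) - t (pol s r)).
    by rewrite (@RintegralB _ (measurableTypeR R) _ mu C _ _ mC (circle_integrable (Lc n)) (circle_integrable Lt)) t0 subr0.
  have := integral_sqr_le (Ld n).
  have -> : \int[mu]_(s in C) ((phi n (pol s r) - t (pol s r)) ^+ 2) = d n by [].
  by rewrite lerD2l lerN2 ler_pM2l.
have ca : a @ \oo --> \int[mu]_(s in C) (t (pol s r) ^+ 2).
  rewrite (_ : \int[mu]_(s in C) _ = fine (nsq mu C (fun s => t (pol s r))))//.
  by apply: nsq_cvg => // n; case: (Lc n).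
have cd : d @ \oo --> (0 : R).
  have z0 : nsq mu C (fun=> 0) = 0%E by rewrite /nsq; apply: integral0_eq => s _; rewrite expr0n.
  have Lz : sqi mu C (fun=> 0) by split; [exact: measurable_cst|rewrite z0 ltry].
  have vd : vanish (fun n => nsq mu C (fun s => (phi n (pol s r) - t (pol s r)) - 0)).
    move=> e e0'; apply: filterS (vt e e0') => n; apply: le_trans; rewrite le_eqVlt; apply/orP; left; apply/eqP.
    by apply: eq_nsq => s _; rewrite subr0.
  have := @nsq_cvg R _ _ mu C mC _ _ (fun n => proj1 (Ld n)) Lz vd; by rewrite z0.
have c0 : e0 @ \oo --> \int[leb2]_(x in U) (u x ^+ 2) by apply: nsq_cvg => // n; case: (K0 n).
have c1 : e1 @ \oo --> \int[leb2]_(x in U) ((g x).1 ^+ 2) by apply: (@nsq_cvg R _ _ leb2 U mU _ _ _ L1 v1) => n; case: (K1 n).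
have c2 : e2 @ \oo --> \int[leb2]_(x in U) ((g x).2 ^+ 2) by apply: (@nsq_cvg R _ _ leb2 U mU _ _ _ L2' v2) => n; case: (K2 n).
have lhs : (fun n => - Q r * (4 * pi * a n - 2 * (2 * pi * d n))) @ \oo -->
    - Q r * (4 * pi * \int[mu]_(s in C) (t (pol s r) ^+ 2) - 2 * (2 * pi * 0)).
  apply: cvgMr; apply: cvgB; first exact: cvgMr.
  by apply: cvgMr; exact: cvgMr.
have rhs : (fun n => 4 * pi * (e1 n + (e2 n + k ^+ 2 * e0 n))) @ \oo -->
    4 * pi * (\int[leb2]_(x in U) ((g x).1 ^+ 2) + (\int[leb2]_(x in U) ((g x).2 ^+ 2) + k ^+ 2 * \int[leb2]_(x in U) (u x ^+ 2))).
  by apply: cvgMr; apply: cvgD => //; apply: cvgD => //; exact: cvgMr.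
have le : \forall n \near \oo, - Q r * (4 * pi * a n - 2 * (2 * pi * d n)) <= 4 * pi * (e1 n + (e2 n + k ^+ 2 * e0 n)).
  by apply: nearW; exact: ineq.
have := @ler_cvg_to _ _ eventually_filter R _ _ _ _ lhs rhs le; rewrite !mulr0 subr0.
have -> : \int[leb2]_(x in U) sqn (g x) = \int[leb2]_(x in U) ((g x).1 ^+ 2) + \int[leb2]_(x in U) ((g x).2 ^+ 2).
  by rewrite -(@RintegralD _ _ _ leb2 U _ _ mU (@sqi_integrable R _ _ leb2 U _ L1) (@sqi_integrable R _ _ leb2 U _ L2')).
have P0 : 0 < 4 * pi :> R by rewrite mulr_gt0// pi_gt0.
by rewrite mulrCA ler_pM2l// addrA.
Qed.
End circle_traces.

(** * Comparison of the two exteriors *)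

Section comparison.
Variable R : realType.
Notation mu := (@lebesgue_measure R).
Notation leb2 := (@leb2 R).
Notation C := (`[0%R, (2 * pi)%R]%classic : set R).

(** The profile is returned together with its bounds because the disk estimate has to be applied to
    the same [h]: the threshold [h1 r / h r] is what the two sides share. *)
Lemma star_upper_bounds (O : set (R * R)) (r : R) : bounded_domain O -> strictly_star_shaped O ->
  centrally_symmetric O -> 0 < r -> disk r `<=` O ->
  (forall alpha, lambda2 O alpha <= 0)%E /\
  forall k : R, 0 < k -> exists h h1 h2 : R -> R, [/\
    forall s : R, 0 < s -> [/\ is_derive s 1 h (h1 s), is_derive s 1 h1 (h2 s), 0 < h s & h1 s < 0],
    forall s, 0 < s -> s * h2 s + h1 s = h s / s + k ^+ 2 * s * h s,
    - h1 r <= (r^-1 + k) * h r &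
    forall alpha, alpha <= h1 r / h r -> (lambda2 O alpha <= (- k ^+ 2)%:E)%E].
Proof.
move=> dom star sym r0 rO.
have [rho [M [K [[K0 crho] rhoM lip [pU /(_ sym) hsym] [bd per]]]]] := strictly_star_shapedP dom star r0 rO.
(* The maximum of rho and r: the upper bounds ask for a radius bounded below on the whole line. *)
pose sig t := (rho t + r + `|rho t - r|) / 2.
have sE t : C t -> sig t = rho t.
  move=> /rhoM/andP[h _]; rewrite /sig ger0_norm ?subr_ge0//; move: (rho t) h => x h; lra.
have csig : continuous sig.
  move=> t; apply: cvgMl; apply: cvgD; first by apply: cvgD; [exact: (@crho t)|exact: cvg_cst].
  by apply: cvg_norm; apply: cvgB; [exact: (@crho t)|exact: cvg_cst].
have sge t : r <= sig t.
  by have := ler_norm (r - rho t); rewrite /sig distrC; move: (rho t) `|_| => x y; lra.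
have pS : polar_ext (exterior O) sig.
  have [p1 p2] := pU; split=> [t|t s] tC; rewrite sE; try exact/CP; first exact: p1.
  exact: p2.
have sM t : C t -> r <= sig t <= M by move=> Ct; rewrite sE//; exact: rhoM.
have sge' t : C t -> r <= sig t by [].
have sle t : C t -> sig t <= M by move=> /sM/andP[].
have slip s t : C s -> C t -> `|sig s - sig t| <= K * `|s - t| by move=> Cs Ct; rewrite !sE//; exact: lip.
have sper : sig 0 = sig (2 * pi) by rewrite /sig per.
have ms : measurable_fun (C : set (measurableTypeR R)) sig.
  by apply: measurable_funTS; exact: continuous_measurable_fun.
have bdS : boundary O = [set pol t (sig t) | t in C].
  by rewrite bd; apply: eq_imagel => t Ct; rewrite sE.
have mbd : measurable (boundary O).
  by apply: measurableD; [apply: closed_measurable2; exact: closed_closure|apply: open_measurable2; exact: open_interior].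
have gbd t : C t -> boundary O (pol t (sig t)) by move=> Ct; rewrite bdS; exists t.
have M0 : 0 < M.
  have C0 : C 0 by apply/CP; rewrite lexx ltW// twopi_gt0.
  by have /andP[x y] := sM _ C0; exact: lt_le_trans r0 (le_trans x y).
have P0 : 0 < K + M by rewrite ltr_wpDl.
have bge f f0 mf := @curve_integral_le R sig r M K r0 K0 sge' sle slip ms (boundary O) f mbd gbd f0 mf.
have ble f f0 mf := @curve_integral_ge R sig r M K r0 K0 sge' sle slip ms sper (boundary O) f mbd bdS f0 mf.
have Ur x : exterior O x -> r ^+ 2 <= sqn x by exact: (star_exterior_ge rO).
have ssym t : 0 <= t <= pi -> sig (t + pi) = sig t by move=> ht; rewrite /sig hsym.
split; first exact: (lambda2_le0 r0 P0 pS csig sM Ur mbd gbd bge ble sge).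
move=> k k0; have [h [h1 [h2 [dh ode conv low decay]]]] := radial_profile k0.
exists h, h1, h2; split=> //; first exact: low.
move=> alpha.
exact: (bessel_upper_bound r0 P0 pS csig sM Ur mbd gbd bge ble sge k0 ssym dh ode conv decay).
Qed.

(* A combination of the basis whose trace has zero mean: it is orthogonal to the radial modes. *)
Lemma disk_subspace_bound (r alpha : R) (L : set (R * R -> R)) : 0 < r ->
  two_dim_subspace (exterior (disk r)) L ->
  exists2 q : R, (q%:E <= rayleigh_sup (disk r) alpha L)%E &
  forall (k : R) (h h1 h2 : R -> R), 0 < k -> q = - k ^+ 2 ->
    (forall s : R, 0 < s -> [/\ is_derive s 1 h (h1 s), is_derive s 1 h1 (h2 s), 0 < h s & h1 s < 0]) ->
    (forall s, 0 < s -> s * h2 s + h1 s = h s / s + k ^+ 2 * s * h s) ->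
    alpha <= h1 r / h r.
Proof.
move=> r0; rewrite exterior_disk// => -[u [v [[Lu [gu wu]] [Lv [gv wv]] indep LE]]].
pose Cm : set (measurableTypeR R) := C.
have mC : measurable Cm by exact: measurable_itv.
have oU : open (disk_ext r) := @open_disk_ext R r; have mU := open_measurable2 oU.
have [tu [pu au]] := approximates_exists r0 Lu wu; have [tv [pv av]] := approximates_exists r0 Lv wv.
have iu := circle_integrable r (approximates_sqi au); have iv := circle_integrable r (approximates_sqi av).
pose Iu := \int[mu]_(s in Cm) tu (pol s r); pose Iv := \int[mu]_(s in Cm) tv (pol s r).
have [a [b [ab nz]]] : exists a b : R, a * Iu + b * Iv = 0 /\ ~ (a = 0 /\ b = 0).
  have [z|nz] := eqVneq Iu 0.
    by exists 1, 0; split; [rewrite z mulr0 mul0r addr0|case=> /eqP; rewrite oner_eq0].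
  by exists Iv, (- Iu); split; [ring|case=> _ /eqP; rewrite oppr_eq0 (negbTE nz)].
have ap := approximates_lin a b Lu Lv wu wv au av; have wg := weak_grad_lin a b oU Lu Lv wu wv.
set w := (fun x => a * u x + b * v x) in ap wg; set g := (fun x => (_, _)) in ap wg.
set t := (fun x => a * tu x + b * tv x) in ap; set phi := (fun n x => _) in ap.
have Lw : L2 (disk_ext r) w by apply: (@sqiD R _ _ leb2 _ mU); exact: (@sqiZ R _ _ leb2 _ mU).
have t0 : \int[mu]_(s in Cm) t (pol s r) = 0.
  have ia := integrableZl mC a iu; have ib := integrableZl mC b iv.
  have := @RintegralD _ (measurableTypeR R) _ mu Cm (fun s => a * tu (pol s r)) (fun s => b * tv (pol s r)) mC ia ib.
  rewrite (@RintegralZl _ (measurableTypeR R) _ mu Cm _ a mC iu) (@RintegralZl _ (measurableTypeR R) _ mu Cm _ b mC iv).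
  by rewrite -/Iu -/Iv ab.
have nzw : ~ ae_zero (disk_ext r) w by move=> z; apply: nz; exact: indep a b z.
exists (rayleigh (disk r) alpha w g t).
  apply: ereal_sup_ubound; exists w, g, t; rewrite exterior_disk//; split=> //.
    by rewrite LE; exists a, b.
  exact: (is_trace_disk r0 Lw wg ap).
move=> k h h1 h2 k0 + dh ode; rewrite /rayleigh exterior_disk//.
have Lt := approximates_sqi ap; have [_ [mt _] _ _ _] := ap.
have lo := lower_trace r0 Lw wg ap dh ode t0; have := disk_trace_le r0 mt Lt.
have [_ _ hp hn] := dh r r0; have x0 : h1 r / h r < 0 by rewrite pmulr_llt0 ?invr_gt0.
have T0 : 0 <= \int[mu]_(s in Cm) (t (pol s r) ^+ 2) by apply: Rintegral_ge0 => s _; exact: sqr_ge0.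
have G0 : 0 <= \int[leb2]_(x in disk_ext r) sqn (g x) by apply: Rintegral_ge0 => s _; rewrite addr_ge0// sqr_ge0.
have m0 : 0 < \int[leb2]_(x in disk_ext r) (w x ^+ 2).
  rewrite lt_neqAle eq_sym; apply/andP; split; last by apply: Rintegral_ge0 => s _; exact: sqr_ge0.
  apply/eqP => z; apply: nzw; apply: nsq_ae_zero => //; first by case: Lw.
  by rewrite -(@Rintegral_sq R _ _ leb2 _ _ Lw) z.
move: lo T0 G0 m0 x0; move: (Rintegral leb2 _ _) (Rintegral leb2 _ _) (Rintegral mu _ _) (fine _) (h1 r / h r) => m G T B x.
move=> lo T0 G0 m0 x0 /andP[B0 BT] E.
have {}E : G + alpha * B = - k ^+ 2 * m by rewrite -E mulfVK// gt_eqF.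
have km : 0 < k ^+ 2 * m by rewrite mulr_gt0// exprn_gt0.
(* A negative quotient forces [alpha < 0] and [B > 0]; only then does [B <= r * T] turn into a lower
   bound for [alpha * B]. *)
have aB : alpha * B < 0 by move: E km; rewrite mulNr; move: (k ^+ 2 * m) (alpha * B) => *; lra.
have Bp : 0 < B by rewrite lt_neqAle B0 andbT eq_sym; apply/eqP => z; move: aB; rewrite z mulr0 ltxx.
have a0 : alpha < 0 by rewrite -(pmulr_llt0 _ Bp).
have rT : 0 < r * T by exact: lt_le_trans BT.
have h3 : alpha * (r * T) <= alpha * B by rewrite ler_wnM2l// ltW.
rewrite -(ler_pM2r rT); apply: le_trans h3 _.
have -> : x * (r * T) = r * x * T by ring.
move: lo E; rewrite !mulNr.
by move: (k ^+ 2 * m) (alpha * B) (r * x * T) => *; lra.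
Qed.
End comparison.

Theorem theorem1p4 (R : realType) (Omega : set (R * R)) (r : R)
    (hdom : bounded_domain Omega) (hsmooth : smooth_boundary Omega)
    (hstar : strictly_star_shaped Omega) (hsym : centrally_symmetric Omega)
    (hr : 0 < r) (hincl : disk r `<=` Omega) :
  (forall alpha : R, (lambda2 Omega alpha <= lambda2 (disk r) alpha)%E) /\
  ((- r^-1)%:E <= alpha_star Omega)%E.
Proof.
have [le0 bound] := star_upper_bounds hdom hstar hsym hr hincl; split=> [alpha|].
  apply: le_ereal_inf_tmp => _ [L L2d <-].
  have [q qL qk] := disk_subspace_bound alpha hr L2d; apply: le_trans qL.
  (* A nonnegative quotient is settled by [le0]; a negative one determines the rate [k = sqrt (- q)]
     of the profile for this subspace. *)
  have [q0|q0] := leP 0 q; first by apply: le_trans (le0 alpha) _; rewrite lee_fin.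
  have k0 : 0 < Num.sqrt (- q) by rewrite sqrtr_gt0 oppr_gt0.
  have qE : q = - Num.sqrt (- q) ^+ 2 by rewrite sqr_sqrtr ?opprK// oppr_ge0 ltW.
  have [h [h1 [h2 [dh ode _ ub]]]] := bound _ k0.
  by rewrite [X in X%:E]qE; apply: ub; exact: qk k0 qE dh ode.
apply/lee_addgt0Pr => e e0; have [h [h1 [h2 [dh ode low ub]]]] := bound e e0.
have [_ _ hp _] := dh r hr.
(* With [k = e], the bound on the logarithmic derivative reads [- 1 / r - e <= h1 r / h r], so this
   coupling constant meets the threshold. *)
have l : (lambda2 Omega (- r^-1 - e) < 0)%E.
  apply: (@le_lt_trans _ _ (- e ^+ 2)%:E); last by rewrite lte_fin oppr_lt0 exprn_gt0.
  apply: ub; rewrite ler_pdivlMr// -opprD mulNr.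
  by move: low; move: ((r^-1 + e) * h r) (h1 r) => *; lra.
have : ((- r^-1 - e)%:E <= alpha_star Omega)%E by apply: ereal_sup_ubound; exists (- r^-1 - e).
by rewrite EFinB leeBlDr.
Qed.
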